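(* Let $\Omega\subset\mathbb{R}^2$ be a bounded polygonal Lipschitz domain with a shape regular, quasi-uniform family of triangulations $\{\mathcal{T}_h\}$ such that any $T\in\mathcal{T}_h$ has at most one edge in $\partial\Omega$. Let $\Pi_h=\Pi_h^b(I-R_h)+R_h: L^2(\Omega;\mathbb{R}^2)\to V_h$ be the operator defined in the context, where $V_h$ and $Q_h$ are the Taylor–Hood velocity and pressure spaces. Then: (i) there is a constant $C$, independent of $\epsilon\in(0,1]$ and of $h$, such that \[ \|\Pi_h v\|_{L^2\cap\epsilon H^1}\le C\,\|v\|_{L^2\cap\epsilon H^1}\qquad\text{for all } v\in H_0^1(\Omega;\mathbb{R}^2),\ \epsilon\in(0,1]; \] equivalently, $\Pi_h$ is bounded, uniformly with respect to $h$, both as an operator on $L^2(\Omega;\mathbb{R}^2)$ and as an operator on $H^1_0(\Omega;\mathbb{R}^2)$; (ii) $\langle\operatorname{div}\Pi_h v,q\rangle=\langle\operatorname{div}v,q\rangle$ for all $v\in H^1_0(\Omega;\mathbb{R}^2)$ and $q\in Q_h$.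
   Context: Norms and inner product: $\langle\cdot,\cdot\rangle$ is the $L^2$ inner product and $\|v\|_{L^2\cap\epsilon H^1}^2=\|v\|_{L^2(\Omega)}^2+\epsilon^2\|v\|_{H^1(\Omega)}^2$. Meshes: $\{\mathcal{T}_h\}$ is a family of conforming simplicial triangulations of $\Omega$ indexed by $h=\max_{T\in\mathcal{T}_h}h_T$, $h_T=\operatorname{diam}T$. Shape regular: there is $\gamma_0>0$ with $h_T^2\le\gamma_0|T|$ for all $T\in\mathcal{T}_h$ and all $h$. Quasi-uniform: there is $\gamma_1>0$ with $h_T\ge\gamma_1h$ for all $T\in\mathcal{T}_h$ and all $h$. $\Delta_1^i(\mathcal{T}_h)$ and $\Delta_1^\partial(\mathcal{T}_h)$ are the sets of interior edges and of boundary edges. $\mathcal{T}_h^\partial$ is the set of triangles in $\mathcal{T}_h$ having an edge in $\Delta_1^\partial(\mathcal{T}_h)$. Spaces: $V_h\subset H_0^1(\Omega;\mathbb{R}^2)$ is the space of continuous piecewise quadratic vector fields vanishing on $\partial\Omega$; $Q_h\subset L_0^2(\Omega)$ is the space of continuous piecewise linear functions with mean value zero; $V_h^1\subset H_0^1(\Omega;\mathbb{R}^2)$ is the space of continuous piecewise linear vector fields vanishing on $\partial\Omega$. For an interior edge $e$ with endpoints $x_i,x_j$, let $\psi_e=6\lambda_i\lambda_j(x_j-x_i)$ (determined up to sign), where $\lambda_k$ is the continuous piecewise linear function with $\lambda_k(x_l)=\delta_{kl}$ at all vertices $x_l$. Let $V_h^b=\operatorname{span}\{\psi_e: e\in\Delta_1^i(\mathcal{T}_h)\}\subset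 V_h$. $Z_h$ is the lowest order Nedelec edge space: all $z$ such that on each $T\in\mathcal{T}_h$ both $z$ and $z(x)\cdot x$ are linear (affine), and the tangential component of $z$ is continuous across each edge. Finally, $Z_h^0=\{z\in Z_h:\int_{\partial T}z\cdot t\,ds=0,\ T\in\mathcal{T}_h^\partial\}$, with $t$ a unit tangent along $\partial T$; equivalently, $z$ is constant on each $T\in\mathcal{T}_h^\partial$. Operators: $\Pi_h^b:L^2(\Omega;\mathbb{R}^2)\to V_h^b$ is defined by $\langle\Pi_h^bu,z\rangle=\langle u,z\rangle$ for all $z\in Z_h^0$ (this determines $\Pi_h^b u$ uniquely under the stated mesh assumptions). $R_h:L^2(\Omega;\mathbb{R}^2)\to V_h^1$ is the Clément interpolation operator onto continuous piecewise linear vector fields vanishing on $\partial\Omega$; it is linear and local, and it satisfies, for every $T\in\mathcal{T}_h$ and $0\le j\le k\le1$, \[ \|(I-R_h)v\|_{H^j(T)}\le c\,h_{\Omega_T}^{k-j}\|v\|_{H^k(\Omega_T)}, \] for $v\in L^2(\Omega;\mathbb{R}^2)$ if $k=0$ and $v\in H_0^1(\Omega;\mathbb{R}^2)$ if $k=1$, with $c$ independent of $h$ and $v$. Here $\Omega_T$ is the union of all $T'\in\mathcal{T}_h$ with $T\cap T'\ne\emptyset$, and $h_{\Omega_T}=\max\{h_{T'}: T'\in\mathcal{T}_h, T'\subset\Omega_T\}$. *)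

(* Defs.v *)
From HB Require Import structures.
From mathcomp Require Import all_boot all_order all_algebra.
From mathcomp Require Import finmap.
From mathcomp Require Import all_classical all_reals all_analysis.

Set Implicit Arguments.
Unset Strict Implicit.
Unset Printing Implicit Defensive.

Import Order.TTheory GRing.Theory Num.Theory.
Import numFieldNormedType.Exports.

Local Open Scope classical_set_scope.
Local Open Scope ring_scope.

Notation plane R := (R * R)%type.

Section Plane.
Variable R : realType.
Implicit Types (D Omega : set (plane R)) (f g : plane R -> R).
Implicit Types (v w : plane R -> plane R) (x y : plane R).

Definition leb2 := (@lebesgue_measure R \x @lebesgue_measure R)%E.

(* The library norm of R * R is the max norm, hence the Euclidean structure
   is spelled out. *)
Definition dot x y : R := x.1 * y.1 + x.2 * y.2.
Definition eucl_dist x y : R := Num.sqrt (dot (x - y) (x - y)).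

Definition ex : plane R := (1, 0).
Definition ey : plane R := (0, 1).

Definition bdry D : set (plane R) := closure D `\` D°.

(** * L2 and Sobolev spaces

   Elements are Borel representatives; only the values on the domain matter.
   All the domains below differ from their interior by a null set. *)

Definition L2 D f : Prop := f \_ D \in Lfun leb2 2%:E.
Definition L2norm D f : R := fine ('N[leb2]_2%:E[EFin \o (f \_ D)]).

Definition L2v D v : Prop := L2 D (fst \o v) /\ L2 D (snd \o v).
Definition L2normv D v : R :=
  Num.sqrt (L2norm D (fst \o v) ^+ 2 + L2norm D (snd \o v) ^+ 2).

Definition inner D f g : R := \int[leb2]_(x in D) (f x * g x).
Definition innerv D v w : R := \int[leb2]_(x in D) dot (v x) (w x).

(* Every iterated directional derivative is (Frechet) differentiable. *)
Definition smooth f : Prop :=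
  forall (s : seq (plane R)) x,
    differentiable (foldr (fun e (g : plane R -> R) y => 'D_e g y) f s) x.

Definition test_function D f : Prop :=
  smooth f /\
  exists K : set (plane R),
    [/\ compact K, K `<=` D & forall x, ~ K x -> f x = 0].

Definition weak_deriv D e f g : Prop :=
  forall phi, test_function D phi ->
    inner D f (fun x => 'D_e phi x) = - inner D g phi.

Definition H1 D f : Prop :=
  [/\ L2 D f,
      exists2 g, L2 D g & weak_deriv D ex f g &
      exists2 g, L2 D g & weak_deriv D ey f g].

(* A representative of the weak derivative; 0 if there is none in L2. *)
Definition wD D e f : plane R -> R :=
  xget (cst 0) [set g | L2 D g /\ weak_deriv D e f g].

Definition H1norm D f : R :=
  Num.sqrt (L2norm D f ^+ 2 + L2norm D (wD D ex f) ^+ 2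
                            + L2norm D (wD D ey f) ^+ 2).

Definition H1_0 D f : Prop :=
  H1 D f /\
  forall eps : R, 0 < eps ->
    exists2 phi, test_function D phi & H1norm D (f - phi) < eps.

Definition H1normv D v : R :=
  Num.sqrt (H1norm D (fst \o v) ^+ 2 + H1norm D (snd \o v) ^+ 2).
Definition H1_0v D v : Prop := H1_0 D (fst \o v) /\ H1_0 D (snd \o v).

Definition wdiv D v : plane R -> R :=
  fun x => wD D ex (fst \o v) x + wD D ey (snd \o v) x.

(* The norm of L2 /\ eps H1. *)
Definition L2epsH1norm D (eps : R) v : R :=
  Num.sqrt (L2normv D v ^+ 2 + eps ^+ 2 * H1normv D v ^+ 2).

(* H^k(D; R^2) norm; only k = 0 and k = 1 are meaningful. *)
Definition Hnormv (k : nat) D v : R :=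
  if k is 0%N then L2normv D v else H1normv D v.

(** * Domains *)

(* Up to a rotation, the domain is locally a strict Lipschitz epigraph. *)
Definition lipschitz_boundary Omega : Prop :=
  forall p, bdry Omega p ->
    exists (c s L : R) (gamma : R -> R),
      [/\ c ^+ 2 + s ^+ 2 = 1, L.-lipschitz gamma &
          \forall x \near p,
            Omega x <-> gamma (c * x.1 + s * x.2) < - s * x.1 + c * x.2].

(* Convex hull of a finite set of points. *)
Definition hull (S : {fset plane R}) : set (plane R) :=
  [set x | exists w : plane R -> R,
     [/\ forall p, p \in S -> 0 <= w p,
         \sum_(p <- S) w p = 1 & x = \sum_(p <- S) w p *: p]].

Definition polygonal Omega : Prop :=
  exists s : seq (plane R * plane R),
    bdry Omega = \bigcup_(e in [set` s]) hull [fset e.1; e.2]%fset.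

Definition polygonal_lipschitz_domain Omega : Prop :=
  [/\ [/\ open Omega, connected Omega & Omega !=set0],
      bounded_set Omega, polygonal Omega & lipschitz_boundary Omega].

(** * Triangulations

   A triangle is its set of vertices, a triangulation is a finite set of
   triangles. *)

Notation cell := {fset plane R}.
Notation mesh := {fset {fset plane R}}.
Implicit Types (T : cell) (Th : mesh).

Definition triangulation Omega Th : Prop :=
  [/\ forall T, T \in Th -> #|` T| = 3%N /\ (hull T)° !=set0,
      forall T T', T \in Th -> T' \in Th ->
        hull T `&` hull T' = hull (T `&` T')%fset &
      \bigcup_(T in [set` Th]) hull T = closure Omega].

Definition diam T : R := sup [set eucl_dist x y | x in hull T & y in hull T].
Definition area T : R := fine (leb2 (hull T)).
Definition mesh_size Th : R := \big[Num.max/0]_(T <- Th) diam T.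

Definition is_vertex Th x : Prop := exists2 T, T \in Th & x \in T.
Definition is_edge Th (e : cell) : Prop :=
  #|` e| = 2%N /\ exists2 T, T \in Th & (e `<=` T)%fset.
Definition bdry_edge Omega Th (e : cell) : Prop :=
  is_edge Th e /\ hull e `<=` bdry Omega.
Definition int_edge Omega Th (e : cell) : Prop :=
  is_edge Th e /\ ~ (hull e `<=` bdry Omega).
Definition bdry_cell Omega Th T : Prop :=
  T \in Th /\ exists2 e, bdry_edge Omega Th e & (e `<=` T)%fset.

Definition macro Th T : set (plane R) :=
  \bigcup_(T' in [set T' | T' \in Th /\ hull T `&` hull T' !=set0]) hull T'.
Definition macro_size Th T : R :=
  \big[Num.max/0]_(T' <- Th | `[< hull T' `<=` macro Th T >]) diam T'.

(* The family is indexed by the set H of its mesh sizes. *)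
Definition mesh_family Omega (H : set R) (Th : R -> mesh) : Prop :=
  forall h, H h -> triangulation Omega (Th h) /\ mesh_size (Th h) = h.

Definition shape_regular (H : set R) (Th : R -> mesh) : Prop :=
  exists2 gamma0 : R, 0 < gamma0 &
    forall h T, H h -> T \in Th h -> diam T ^+ 2 <= gamma0 * area T.

Definition quasi_uniform (H : set R) (Th : R -> mesh) : Prop :=
  exists2 gamma1 : R, 0 < gamma1 &
    forall h T, H h -> T \in Th h -> gamma1 * h <= diam T.

Definition at_most_one_bdry_edge Omega Th : Prop :=
  forall T (e e' : cell), T \in Th ->
    bdry_edge Omega Th e -> (e `<=` T)%fset ->
    bdry_edge Omega Th e' -> (e' `<=` T)%fset -> e = e'.

(** * Finite element spaces *)

Definition poly_on (k : nat) D f : Prop :=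
  exists c : nat -> nat -> R, forall x, D x ->
    f x = \sum_(i < k.+1) \sum_(j < k.+1 | (i + j <= k)%N)
            c i j * x.1 ^+ i * x.2 ^+ j.

Definition Lagrange (k : nat) Omega Th f : Prop :=
  {within closure Omega, continuous f} /\
  forall T, T \in Th -> poly_on k (hull T) f.

Definition Lagrange0v (k : nat) Omega Th v : Prop :=
  [/\ Lagrange k Omega Th (fst \o v), Lagrange k Omega Th (snd \o v) &
      forall x, bdry Omega x -> v x = 0].

Definition Vh := Lagrange0v 2.
Definition Vh1 := Lagrange0v 1.

Definition Qh Omega Th f : Prop :=
  Lagrange 1 Omega Th f /\ \int[leb2]_(x in Omega) f x = 0.

Definition hat Omega Th (a : plane R) : plane R -> R :=
  xget (cst 0) [set f | Lagrange 1 Omega Th f /\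
                        forall b, is_vertex Th b -> f b = (a == b)%:R].

Definition psi Omega Th (a b : plane R) : plane R -> plane R :=
  fun x => (6%:R * hat Omega Th a x * hat Omega Th b x) *: (b - a).

Definition fspan (S : set (plane R -> plane R)) : set (plane R -> plane R) :=
  [set v | exists (n : nat) (c : 'I_n -> R) (s : 'I_n -> plane R -> plane R),
     (forall i, S (s i)) /\ v = \sum_i c i *: s i].

Definition Vhb Omega Th : set (plane R -> plane R) :=
  fspan [set v | exists a b,
    int_edge Omega Th [fset a; b]%fset /\ v = psi Omega Th a b].

(* zT T is the trace on the closed triangle T of the field z, which is only
   single-valued inside the triangles. *)
Definition nedelec Omega Th (zT : cell -> plane R -> plane R) z : Prop :=
  [/\ L2v Omega z,
      forall T, T \in Th -> forall x, (hull T)° x -> z x = zT T x,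
      forall T, T \in Th ->
        [/\ poly_on 1 (hull T) (fst \o zT T),
            poly_on 1 (hull T) (snd \o zT T) &
            poly_on 1 (hull T) (fun x => dot (zT T x) x)] &
      forall T T' a b, T \in Th -> T' \in Th ->
        ([fset a; b] `<=` T `&` T')%fset ->
        forall x, hull [fset a; b]%fset x ->
          dot (zT T x) (b - a) = dot (zT T' x) (b - a)].

(* Integral of the tangential component along the oriented segment [a, b]. *)
Definition line_integral (v : plane R -> plane R) (a b : plane R) : R :=
  \int[@lebesgue_measure R]_(t in `[0, 1]) dot (v (a + t *: (b - a))) (b - a).

Definition Zh0 Omega Th z : Prop :=
  exists2 zT, nedelec Omega Th zT z &
    forall a b c, bdry_cell Omega Th [fset a; b; c]%fset ->
      let v := zT [fset a; b; c]%fset in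
      line_integral v a b + line_integral v b c + line_integral v c a = 0.

(** * Operators *)

Definition Pib Omega Th v : plane R -> plane R :=
  xget (cst 0) [set w | Vhb Omega Th w /\
    forall z, Zh0 Omega Th z -> innerv Omega w z = innerv Omega v z].

(* The Clement operator enters only through these standard properties; it acts
   on representatives, and locality makes it independent of their choice. *)
Definition clement Omega (H : set R) (Th : R -> mesh)
    (Rh : R -> (plane R -> plane R) -> plane R -> plane R) : Prop :=
  [/\ forall h v, H h -> L2v Omega v -> Vh1 Omega (Th h) (Rh h v),
      forall h a v w, H h -> L2v Omega v -> L2v Omega w ->
        forall x, closure Omega x ->
          Rh h (a *: v + w) x = a *: Rh h v x + Rh h w x,
      forall h T v w, H h -> T \in Th h -> L2v Omega v -> L2v Omega w ->
        {ae leb2, forall x, macro (Th h) T x -> v x = w x} ->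
        forall x, hull T x -> Rh h v x = Rh h w x &
      exists c : R, forall h T (j k : nat) v, H h -> T \in Th h ->
        (j <= k <= 1)%N ->
        (if k is 0%N then L2v Omega v else H1_0v Omega v) ->
        Hnormv j (hull T)° (v - Rh h v)
          <= c * macro_size (Th h) T ^+ (k - j) * Hnormv k (macro (Th h) T)° v].

Definition Pi_h Omega Th
    (Rh : (plane R -> plane R) -> plane R -> plane R) v : plane R -> plane R :=
  Pib Omega Th (v - Rh v) + Rh v.

End Plane.

(* Main.v *)
Require Import Defs.
From HB Require Import structures.
From mathcomp Require Import all_boot all_order all_algebra.
From mathcomp Require Import finmap.
From mathcomp Require Import all_classical all_reals all_analysis.
From mathcomp Require Import measurable_realfun.
From mathcomp Require Import ring lra.

Set Implicit Arguments.
Unset Strict Implicit.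
Unset Printing Implicit Defensive.

Import Order.TTheory GRing.Theory Num.Theory.
Import numFieldNormedType.Exports.

Local Open Scope classical_set_scope.
Local Open Scope ring_scope.

(* A field of Z_h^0 is determined by its tangential components, and a field of
   V_h^b by its coefficients on the psi_e; both are antisymmetric functions C of
   the oriented edges that vanish on boundary edges. If w and z come from the
   same C, explicit moments of barycentric coordinates bound the integral of w.z
   over a cell T from below by |T| / 5 times the sum of the C(e)^2 over the edges
   of T. This coercivity makes the equations for Pi_h^b uniquely solvable, and
   with scaled inverse estimates it gives |Pi_h^b u| <= c |u| and
   |grad Pi_h^b u| <= (c / h) |u|. Taking u = v - R_h v and summing the Clement
   estimates over the macroelements, whose overlap is bounded by comparing areas
   in a box of side 4 h, gives the stability of Pi_h. For q in Q_h the gradient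
   of q is constant on cells with continuous tangential components, so it lies
   in Z_h^0, and <div f, q> = - <f, grad q> for f in H^1_0 yields the commutation
   with the divergence. Conformity of the discrete spaces rests on one fact: a
   Lipschitz function that vanishes outside the domain is an H^1 limit of smooth
   quasi-interpolants of its soft thresholds, which have compact support. *)

(** * Lebesgue measure and integrals on the plane *)

(** Two powers of h cancel: the gradient of Pi_h^b u costs 1 / h, while u = v - R_h v gains h when v
    is in H^1. Both mesh conditions enter through one number [ka], with ka h^2 <= |T| and diam T <=
    h on every cell. A boundary cell keeps two interior edges, just enough to determine a constant
    field; with two boundary edges the coefficients on interior edges would no longer determine
    Z_h^0. Weak derivatives, hat functions and Pi_h^b are given by choice. A weak derivative is
    pinned down almost everywhere by the fundamental lemma of the calculus of variations. The
    estimates for Pi_h^b are derived from its defining equations alone, so every solution obeys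
    them, and a solution exists because each vector in the cokernel of the system yields the zero
    field. The analytic obstacle is H^1_0, a closure of functions all of whose iterated derivatives
    exist: approximants must be smooth, compactly supported in the domain and explicit enough to
    differentiate. Thresholding provides the support, sums of tensor-product bumps the smoothness.
    Norms are kept squared, since squares add up over cells. *)

Section ImageMeasure.
Context d d' (T1 : measurableType d) (T2 : measurableType d') (R : realType).
Variables (m : {measure set T1 -> \bar R}) (f : T1 -> T2).
Hypothesis mf : measurable_fun setT f.

(** The pushforward with its measure structure, the form in which the uniqueness theorems for
    Lebesgue and product measures apply. *)
Definition image_measure : {measure set T2 -> \bar R} :=
  measure_function_pushforward__canonical__measure_function_Measure m mf.

Lemma image_measureE A : image_measure A = m (f @^-1` A).
Proof. by []. Qed.
End ImageMeasure.

Notation planeM R := (measurableTypeR R * measurableTypeR R)%type.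

Section PlaneMeasure.
Variable R : realType.
Implicit Types (A D : set (plane R)) (f g : plane R -> R).

Definition mu2 : {measure set (planeM R) -> \bar R} :=
  (@lebesgue_measure R \x @lebesgue_measure R)%E.

Definition pmeas (A : set (plane R)) : Prop := measurable (A : set (planeM R)).
Definition measf (D : set (plane R)) (f : plane R -> R) : Prop :=
  measurable_fun (D : set (planeM R)) (f : (planeM R) -> R).
Definition pnull (A : set (plane R)) : Prop := mu2.-negligible (A : set (planeM R)).
Definition pintg (D : set (plane R)) (f : plane R -> R) : Prop :=
  mu2.-integrable D (EFin \o f : (planeM R) -> \bar R).
Definition I2 (D : set (plane R)) (f : plane R -> R) : R :=
  \int[mu2]_(x in D) f x.

Lemma pmeasI A B : pmeas A -> pmeas B -> pmeas (A `&` B).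
Proof. exact: measurableI. Qed.
Lemma pmeasU A B : pmeas A -> pmeas B -> pmeas (A `|` B).
Proof. exact: measurableU. Qed.
Lemma pmeasD A B : pmeas A -> pmeas B -> pmeas (A `\` B).
Proof. exact: measurableD. Qed.
Lemma pmeasC A : pmeas A -> pmeas (~` A).
Proof. exact: measurableC. Qed.
Lemma pmeasT : pmeas setT.
Proof. exact: measurableT. Qed.

Lemma pmeas_box (A B : set R) : measurable A -> measurable B -> pmeas (A `*` B).
Proof. by move=> mA mB; apply: measurableX. Qed.

(** The sigma-algebra is the product one, so an open set has to be written as a countable union of
    boxes with rational centres and radii. *)
Lemma pmeas_open A : open A -> pmeas A.
Proof.
move=> oA.
pose U (t : rat * rat * rat) : set (plane R) :=
  let B := ball (ratr t.1.1 : R) (ratr t.2 : R) `*` ball (ratr t.1.2 : R) (ratr t.2) in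
  if `[< B `<=` A >] then B else set0.
have -> : A = \bigcup_(t in setT) U t.
  apply/seteqP; split => [[x y] Axy|z [t _]]; last first.
    by rewrite /U; case: ifPn => // /asboolP; exact.
  have /nbhs_ballP[e /= e0 be] : nbhs (x, y) A by apply: open_nbhs_nbhs; split.
  have [r] := rat_in_itvoo (divr_gt0 e0 (ltr0Sn R 1)).
  rewrite in_itv/= => /andP[r0 re].
  have xr : x < x + ratr r by rewrite ltrDl.
  have yr : y < y + ratr r by rewrite ltrDl.
  have [p] := rat_in_itvoo xr; rewrite in_itv/= => /andP[p0 pe].
  have [q] := rat_in_itvoo yr; rewrite in_itv/= => /andP[q0 qe].
  exists (p, q, r); first by [].
  rewrite /U/=; case: ifPn => [_|/asboolP]; last first.
    case=> -[x' y'] [/= bx by'].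
    apply: be; split => /=; move: bx by'; rewrite /ball /= ltr_norml => /andP[? ?].
      by move=> _; rewrite ltr_norml; apply/andP; split; lra.
    by rewrite !ltr_norml => /andP[? ?]; apply/andP; split; lra.
  by split; rewrite /ball/= ltr_norml; apply/andP; split; lra.
apply: countable_bigcupT_measurable; first exact: countableP.
move=> t; rewrite /U; case: ifPn => _; last exact: measurable0.
by apply: pmeas_box; rewrite ball_itv; exact: measurable_itv.
Qed.

Lemma pmeas_closed A : closed A -> pmeas A.
Proof. by move=> cA; rewrite -(setCK A); apply: pmeasC; apply: pmeas_open; rewrite openC. Qed.

Lemma measf_cont f : continuous f -> measf setT f.
Proof.
move=> cf; apply: (measurability _ (RGenOpens.measurableE R)).
move=> _ [_ [a [b ->] <-]]; rewrite setTI; apply: pmeas_open.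
by apply: open_comp; [move=> x _; exact: cf|exact: interval_open].
Qed.

End PlaneMeasure.

(** * Affine changes of variables *)

Section AffineChange.
Variable R : realType.
Implicit Types (A D : set (plane R)) (f g : plane R -> R).

(** The pushforward rescaled by |a| has the right value on half-open intervals, so it is Lebesgue
    measure by uniqueness. For a < 0 the preimage of []u, v]] is closed at its left end instead. *)
Lemma leb_affine (a b : R) (A : set (measurableTypeR R)) : a != 0 -> measurable A ->
  lebesgue_measure ((fun x => a * x + b) @^-1` A) = (`|a|^-1%:E * lebesgue_measure A)%E.
Proof.
move=> a0 mA.
have mF : measurable_fun setT (fun x : measurableTypeR R => (a * x + b : measurableTypeR R)).
  by apply: continuous_measurable_fun => x; apply: cvgD; [exact: mulrl_continuous | exact: cvg_cst].
have na0 : 0 < `|a| by rewrite normr_gt0.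
pose m' := mscale (NngNum (ltW na0)) (image_measure (@lebesgue_measure R) mF).
have m'E B : m' B = (`|a|%:E * lebesgue_measure ((fun x => (a * x + b)%R) @^-1` B))%E by [].
have h : forall B, measurable B -> lebesgue_measure B = m' B.
  apply: lebesgue_measure_unique => _ [[u v] _ <-].
  suff : lebesgue_measure `]u, v]%classic =
    (`|a|%:E * lebesgue_measure ((fun x => (a * x + b)%R) @^-1` `]u, v]%classic))%E by [].
  rewrite lebesgue_measure_itv [LHS]/= lte_fin.
  have [agt|alt] : 0 < a \/ a < 0 by move: a0; rewrite neq_lt => /orP[]; [right|left].
    rewrite (_ : _ @^-1` _ = `](u - b) / a, (v - b) / a]%classic); last first.
      apply/seteqP; split => x /=; rewrite !in_itv/= ltr_pdivrMr// ler_pdivlMr// [x * a]mulrC;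
       by rewrite ltrBlDr lerBrDr.
    rewrite lebesgue_measure_itv /= lte_fin ltr_pM2r ?invr_gt0// ltrD2r gtr0_norm//.
    case: ifP => _; last by rewrite mule0.
    by rewrite -!EFinB -EFinM; congr EFin; field.
  rewrite (_ : _ @^-1` _ = `[(v - b) / a, (u - b) / a[%classic); last first.
    apply/seteqP; split => x /=; rewrite !in_itv/= ltr_ndivlMr// ler_ndivrMr// [x * a]mulrC ltrBlDr lerBrDr;
      by rewrite andbC.
  rewrite lebesgue_measure_itv /= lte_fin ltr_nM2r ?invr_lt0// ltrD2r ltr0_norm//.
  case: ifP => _; last by rewrite mule0.
  by rewrite -!EFinB -EFinM; congr EFin; field; rewrite lt_eqF.
by rewrite [lebesgue_measure A]h// m'E muleA -EFinM mulVf ?gt_eqF// mul1e.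
Qed.

Lemma measf_affine (p q t : R) : measf setT (fun x => p * x.1 + q * x.2 + t).
Proof.
apply: measf_cont => x; apply: cvgD; last exact: cvg_cst.
apply: cvgD; apply: cvgM; try exact: cvg_cst; [exact: cvg_fst|exact: cvg_snd].
Qed.

Definition affm (p q r s t1 t2 : R) (x : plane R) : plane R :=
  (p * x.1 + q * x.2 + t1, r * x.1 + s * x.2 + t2).

Lemma measurable_affm p q r s t1 t2 :
  measurable_fun setT (affm p q r s t1 t2 : planeM R -> planeM R).
Proof. by apply: measurable_fun_pair; exact: measf_affine. Qed.

(** Both measures agree on rectangles, where the swap only exchanges the factors. *)
Lemma mu2_swap A : pmeas A -> mu2 R (affm 0 1 1 0 0 0 @^-1` A) = mu2 R A.
Proof.
move=> mA; rewrite -(image_measureE _ (measurable_affm 0 1 1 0 0 0)).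
apply/esym; apply: product_measure_unique => // B C mB mC.
rewrite image_measureE (_ : _ @^-1` _ = C `*` B); last first.
  by apply/seteqP; split => -[x y]; rewrite /affm /=;
    rewrite !mul0r !mul1r !add0r !addr0 => -[].
by rewrite [LHS]product_measure1E// muleC.
Qed.

(** The product measure integrates the measures of vertical sections, and each section of the
    preimage is an affine preimage on the line. *)
Lemma mu2_shear (al k t : R) A : al != 0 -> pmeas A ->
  mu2 R (affm 1 0 k al 0 t @^-1` A) = (`|al|^-1%:E * mu2 R A)%E.
Proof.
move=> al0 mA.
rewrite /mu2 /= /product_measure1 -ge0_integralZl//; last exact: measurable_fun_xsection.
apply: eq_integral => x _ /=.
rewrite -(@leb_affine al (k * x + t)) //; last exact: measurable_xsection.
congr lebesgue_measure; apply/seteqP.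
have e y : (1 * x + 0 * y + 0, k * x + al * y + t) = (x, al * y + (k * x + t)).
  by congr pair; ring.
by split => y /=; rewrite /xsection /= !inE /affm /= e.
Qed.

Lemma pmeas_preimage p q r s t1 t2 A : pmeas A -> pmeas (affm p q r s t1 t2 @^-1` A).
Proof. by move=> mA; rewrite -[_ @^-1` _]setTI; exact: measurable_affm. Qed.

Lemma affm_comp p q r s t1 t2 p' q' r' s' t1' t2' :
  affm p q r s t1 t2 \o affm p' q' r' s' t1' t2' =
  affm (p * p' + q * r') (p * q' + q * s') (r * p' + s * r') (r * q' + s * s')
       (p * t1' + q * t2' + t1) (r * t1' + s * t2' + t2).
Proof. by apply/funext => x; rewrite /affm /=; congr pair; ring. Qed.

Let scaling p q r s t1 t2 (d : R) := forall A, pmeas A ->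
  mu2 R (affm p q r s t1 t2 @^-1` A) = (d%:E * mu2 R A)%E.

Let scaling_comp p q r s t1 t2 p' q' r' s' t1' t2' d d' :
  scaling p q r s t1 t2 d -> scaling p' q' r' s' t1' t2' d' ->
  scaling (p * p' + q * r') (p * q' + q * s') (r * p' + s * r') (r * q' + s * s')
       (p * t1' + q * t2' + t1) (r * t1' + s * t2' + t2) (d' * d).
Proof.
move=> h h' A mA; rewrite -affm_comp comp_preimage h'; last exact: pmeas_preimage.
by rewrite h// muleA.
Qed.

(** Gaussian elimination with pivot p: the map factors into swap, shear, swap and shear. *)
Let scaling_p p q r s t1 t2 : p != 0 -> p * s - q * r != 0 ->
  scaling p q r s t1 t2 `|p * s - q * r|^-1.
Proof.
move=> p0 d0.
have sw : scaling 0 1 1 0 0 0 1 by move=> A mA; rewrite mu2_swap// mul1e.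
have sh1 : scaling 1 0 q p 0 t1 `|p|^-1 by move=> A mA; exact: mu2_shear.
have al0 : (p * s - q * r) / p != 0 by rewrite mulf_neq0// invr_neq0.
have sh2 : scaling 1 0 (r / p) ((p * s - q * r) / p) 0 (t2 - r / p * t1)
   `|(p * s - q * r) / p|^-1 by move=> A mA; exact: mu2_shear.
have := scaling_comp sh2 (scaling_comp sw (scaling_comp sh1 sw)).
have -> : 1 * `|p|^-1 * 1 * `|(p * s - q * r) / p|^-1 = `|p * s - q * r|^-1.
  by rewrite normrM normfV; field; rewrite ?normr_eq0 p0 d0.
rewrite !(mul0r, mul1r, mulr0, mulr1, addr0, add0r).
have -> : r / p * q + (p * s - q * r) / p = s by field.
have -> : r / p * p = r by field.
by have -> : r / p * t1 + (t2 - r / p * t1) = t2 by ring.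
Qed.

Lemma mu2_affm p q r s t1 t2 A : p * s - q * r != 0 -> pmeas A ->
  mu2 R (affm p q r s t1 t2 @^-1` A) = (`|p * s - q * r|^-1%:E * mu2 R A)%E.
Proof.
move=> d0 mA; have [p0|p0] := eqVneq p 0; last exact: scaling_p.
have q0 : q != 0 by apply: contra_neq d0 => ->; rewrite p0; ring.
(* For p = 0 the map is written as one with pivot p + q preceded by a shear of determinant one. *)
have sh : scaling 1 0 (- 1) 1 0 0 1.
  by move=> B mB; rewrite mu2_shear ?oner_neq0// normr1 invr1.
have pq0 : p + q != 0 by rewrite p0 add0r.
have d1 : (p + q) * s - q * (r + s) != 0.
  by have -> : (p + q) * s - q * (r + s) = p * s - q * r by ring.
have := scaling_comp (scaling_p t1 t2 pq0 d1) sh mA.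
have -> : (p + q) * s - q * (r + s) = p * s - q * r by ring.
rewrite !(mul0r, mul1r, mulr0, mulr1, addr0, add0r, mulrN1, addrK).
by [].
Qed.

Section change_of_variables.
Variables p q r s t1 t2 : R.
Hypothesis d0 : p * s - q * r != 0.
Let F := affm p q r s t1 t2.
Let mF := measurable_affm p q r s t1 t2.
Let d : R := `|p * s - q * r|.

Lemma ge0_integral_affm (D : set (planeM R)) (f : planeM R -> \bar R) : pmeas D ->
  measurable_fun setT f -> (forall x, (0 <= f x)%E) ->
  (\int[mu2 R]_(x in F @^-1` D) f (F x) = d^-1%:E * \int[mu2 R]_(x in D) f x)%E.
Proof.
move=> mD mf f0.
rewrite -(@ge0_integral_pushforward _ _ _ _ R (F : planeM R -> planeM R) mF (mu2 R) D f)//; last first.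
  exact: measurable_funTS.
have dn : 0 <= d^-1 by rewrite invr_ge0 normr_ge0.
rewrite (eq_measure_integral (mscale (NngNum dn) (mu2 R))); last first.
  by move=> A mA _; exact: mu2_affm.
rewrite ge0_integral_mscale; [by []|by []|exact: measurable_funTS|by []].
Qed.

Lemma pintg_affm D f : pmeas D -> measf setT f -> pintg D f ->
  pintg (F @^-1` D) (f \o F).
Proof.
move=> mD mf /integrableP[_ fi]; apply/integrableP; split.
  apply/measurable_EFinP; apply: measurable_funTS.
  exact: (measurableT_comp mf mF).
rewrite (ge0_integral_affm (f := fun x => (`|f x|)%:E))//; last first.
  by apply/measurable_EFinP; exact: measurableT_comp.
by apply: lte_mul_pinfty => //; rewrite lee_fin invr_ge0 normr_ge0.
Qed.

(** The formula is available for nonnegative functions; a signed integral is split into its two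
    parts. *)
Lemma I2_affm D f : pmeas D -> measf setT f -> pintg D f ->
  I2 (F @^-1` D) (f \o F) = d^-1 * I2 D f.
Proof.
move=> mD mf fi.
have mEf : measurable_fun setT (EFin \o f : planeM R -> \bar R) by exact/measurable_EFinP.
have Ep := ge0_integral_affm mD (measurable_funepos mEf) (fun x => funepos_ge0 _ x).
have En := ge0_integral_affm mD (measurable_funeneg mEf) (fun x => funeneg_ge0 _ x).
have E : (\int[mu2 R]_(x in F @^-1` D) (EFin \o (f \o F)) x =
  d^-1%:E * \int[mu2 R]_(x in D) (EFin \o f)^\+ x -
  d^-1%:E * \int[mu2 R]_(x in D) (EFin \o f)^\- x)%E.
  rewrite integralE; congr (_ - _)%E.
    by refine (eq_trans _ Ep); apply: eq_integral => x _; rewrite -[EFin \o (f \o F)]/((EFin \o f) \o F) funepos_comp.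
  by refine (eq_trans _ En); apply: eq_integral => x _; rewrite -[EFin \o (f \o F)]/((EFin \o f) \o F) funeneg_comp.
rewrite /I2 /Rintegral [X in fine X]E [in RHS]integralE.
have := integrable_pos_fin_num mD fi; have := integrable_neg_fin_num mD fi.
move=> /fineK <- /fineK <-.
by rewrite -!EFinM -!EFinB/= mulrBr.
Qed.

End change_of_variables.

End AffineChange.

(** * Integrable functions *)

Section PlaneIntegral.
Variable R : realType.
Implicit Types (A D : set (plane R)) (f g : plane R -> R).

Lemma measfS D E f : pmeas E -> D `<=` E -> measf E f -> measf D f.
Proof. by move=> mE DE; apply: measurable_funS. Qed.
Lemma measfT D f : measf setT f -> measf D f.
Proof. by apply: measurable_funS => //; exact: measurableT. Qed.
Lemma measf_cst D c : measf D (fun=> c).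
Proof. exact: measurable_cst. Qed.
Lemma measf_fst D : measf D (fun x => x.1).
Proof. by apply: measfT; apply: measf_cont => x; exact: cvg_fst. Qed.
Lemma measf_snd D : measf D (fun x => x.2).
Proof. by apply: measfT; apply: measf_cont => x; exact: cvg_snd. Qed.
Lemma measfD D f g : measf D f -> measf D g -> measf D (fun x => f x + g x).
Proof. exact: measurable_funD. Qed.
Lemma measfM D f g : measf D f -> measf D g -> measf D (fun x => f x * g x).
Proof. exact: measurable_funM. Qed.
Lemma measfB D f g : measf D f -> measf D g -> measf D (fun x => f x - g x).
Proof. exact: measurable_funB. Qed.
Lemma measfN D f : measf D f -> measf D (fun x => - f x).
Proof.
by move=> mf; have := measfB (measf_cst 0) mf; under eq_fun do rewrite sub0r.
Qed.
Lemma measfZ D c f : measf D f -> measf D (fun x => c * f x).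
Proof. by move=> mf; apply: measfM => //; exact: measf_cst. Qed.
Lemma measfX D f n : measf D f -> measf D (fun x => f x ^+ n).
Proof. exact: measurable_funX. Qed.
Lemma measf_sum I (s : seq I) (Q : pred I) D (f : I -> plane R -> R) :
  (forall i, Q i -> measf D (f i)) -> measf D (fun x => \sum_(i <- s | Q i) f i x).
Proof.
move=> mf; elim: s => [|i s ih].
  by under eq_fun do rewrite big_nil; exact: measf_cst.
under eq_fun do rewrite big_cons.
case: (boolP (Q i)) => Qi //; apply: measfD => //; exact: mf.
Qed.
Lemma measf_eq D f g : (forall x, D x -> f x = g x) -> measf D f -> measf D g.
Proof. by move=> fg; apply: eq_measurable_fun => x /[!inE]; exact: fg. Qed.
Lemma measfU D E f : pmeas D -> pmeas E -> measf D f -> measf E f -> measf (D `|` E) f.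
Proof. by move=> mD mE mf mg; apply/measurable_funU. Qed.
Lemma measf_restrict D f : pmeas D -> measf D f -> measf setT (f \_ D).
Proof. by move=> mD mf; apply/(measurable_restrictT _ mD). Qed.
Lemma measf_restrictP D f : pmeas D -> measf setT (f \_ D) <-> measf D f.
Proof. by move=> mD; apply: iff_sym; exact: (measurable_restrictT _ mD). Qed.
Lemma measf_affm p q r s t1 t2 f : measf setT f -> measf setT (f \o affm p q r s t1 t2).
Proof. by move=> mf; exact: (measurableT_comp mf (measurable_affm p q r s t1 t2)). Qed.

Lemma pintg_measf D f : pintg D f -> measf D f.
Proof. by move=> /measurable_int /measurable_EFinP. Qed.
Lemma pintgD D f g : pmeas D -> pintg D f -> pintg D g -> pintg D (fun x => f x + g x).
Proof. by move=> mD fi gi; have := integrableD mD fi gi. Qed.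
Lemma pintgZ D c f : pmeas D -> pintg D f -> pintg D (fun x => c * f x).
Proof. by move=> mD fi; have := integrableZl mD c fi. Qed.
Lemma pintgN D f : pmeas D -> pintg D f -> pintg D (fun x => - f x).
Proof. by move=> mD fi; have := integrableN fi. Qed.
Lemma pintgB D f g : pmeas D -> pintg D f -> pintg D g -> pintg D (fun x => f x - g x).
Proof. by move=> mD fi gi; apply: pintgD => //; exact: pintgN. Qed.
Lemma pintg_eq D f g : pmeas D -> (forall x, D x -> f x = g x) -> pintg D f -> pintg D g.
Proof.
by move=> mD fg; apply: eq_integrable => // x /[!inE] Dx /=; rewrite fg.
Qed.
Lemma pintg0 D : pmeas D -> pintg D (fun=> 0).
Proof. by move=> mD; have := integrable0 (mu2 R) D; apply: eq_integrable => // x _ /=. Qed.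
Lemma pintg_sum D I (s : seq I) (Q : pred I) (f : I -> plane R -> R) : pmeas D ->
  (forall i, Q i -> pintg D (f i)) -> pintg D (fun x => \sum_(i <- s | Q i) f i x).
Proof.
move=> mD mf; elim: s => [|i s ih].
  by under eq_fun do rewrite big_nil; exact: pintg0.
under eq_fun do rewrite big_cons.
case: (boolP (Q i)) => Qi //; apply: pintgD => //; exact: mf.
Qed.
Lemma pintg_le D f g : pmeas D -> measf D f -> (forall x, D x -> `|f x| <= g x) ->
  pintg D g -> pintg D f.
Proof.
move=> mD mf fg; apply: le_integrable => //; first exact/measurable_EFinP.
move=> x Dx /=; rewrite lee_fin (le_trans (fg x Dx))//; exact: ler_norm.
Qed.
Lemma pintgS D E f : pmeas D -> pmeas E -> D `<=` E -> pintg E f -> pintg D f.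
Proof. by move=> mD mE; exact: (integrableS mE mD). Qed.

Lemma pintg_bounded D f (c : R) : pmeas D -> (mu2 R D < +oo)%E -> measf D f ->
  (forall x, D x -> `|f x| <= c) -> pintg D f.
Proof.
move=> mD Doo mf fc; apply: (@pintg_le _ _ (fun=> c)) => //.
apply/integrableP; split; first exact: measurable_cst.
rewrite (eq_integral (cst `|c|%:E)) // integral_cst //.
by apply: lte_mul_pinfty => //; rewrite lee_fin normr_ge0.
Qed.

Lemma I2D D f g : pmeas D -> pintg D f -> pintg D g ->
  I2 D (fun x => f x + g x) = I2 D f + I2 D g.
Proof. by move=> mD fi gi; rewrite /I2 RintegralD. Qed.
Lemma I2Z D c f : pmeas D -> pintg D f -> I2 D (fun x => c * f x) = c * I2 D f.
Proof. by move=> mD fi; rewrite /I2 RintegralZl. Qed.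
Lemma I2N D f : pmeas D -> pintg D f -> I2 D (fun x => - f x) = - I2 D f.
Proof.
move=> mD fi; rewrite -mulN1r -I2Z//; congr I2; by apply/funext => x; rewrite mulN1r.
Qed.
Lemma I2B D f g : pmeas D -> pintg D f -> pintg D g ->
  I2 D (fun x => f x - g x) = I2 D f - I2 D g.
Proof. by move=> mD fi gi; rewrite /I2 RintegralB. Qed.
Lemma I20 D : I2 D (fun=> 0) = 0.
Proof. by rewrite /I2 /Rintegral integral0_eq. Qed.
Lemma I2_sum D I (s : seq I) (Q : pred I) (f : I -> plane R -> R) : pmeas D ->
  (forall i, Q i -> pintg D (f i)) ->
  I2 D (fun x => \sum_(i <- s | Q i) f i x) = \sum_(i <- s | Q i) I2 D (f i).
Proof.
move=> mD mf; elim: s => [|i s ih].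
  by under eq_fun do rewrite big_nil; rewrite I20 big_nil.
under eq_fun do rewrite big_cons.
rewrite big_cons; case: (boolP (Q i)) => Qi //.
by rewrite I2D// ?ih//; [exact: mf|exact: pintg_sum].
Qed.
Lemma I2_eq D f g : (forall x, D x -> f x = g x) -> I2 D f = I2 D g.
Proof. by move=> fg; apply: eq_Rintegral => x /[!inE]; exact: fg. Qed.
Lemma I2_ge0 D f : (forall x, D x -> 0 <= f x) -> 0 <= I2 D f.
Proof. by move=> f0; rewrite /I2; apply: Rintegral_ge0. Qed.
Lemma I2_le D f g : pmeas D -> pintg D f -> pintg D g -> (forall x, D x -> f x <= g x) ->
  I2 D f <= I2 D g.
Proof. by move=> mD fi gi fg; rewrite /I2; apply: le_Rintegral. Qed.
Lemma I2_cst D c : pmeas D -> I2 D (fun=> c) = c * fine (mu2 R D).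
Proof. by move=> mD; rewrite /I2 Rintegral_cst. Qed.
Lemma I2_norm D f : pmeas D -> pintg D f -> `|I2 D f| <= I2 D (fun x => `|f x|).
Proof. by move=> mD fi; rewrite /I2; apply: le_normr_Rintegral. Qed.
Lemma I2_mkcond D f : I2 D f = I2 setT (f \_ D).
Proof. by rewrite /I2 Rintegral_mkcond. Qed.
Lemma pintg_mkcond D f : pmeas D -> pintg D f <-> pintg setT (f \_ D).
Proof.
move=> mD; rewrite /pintg -restrict_EFin; exact: integrable_mkcond.
Qed.

Definition pae D (Q : plane R -> Prop) := {ae mu2 R, forall x, D x -> Q x}.

Lemma pnull0 : pnull (set0 : set (plane R)).
Proof. by exists set0; split. Qed.

Let aeF : Filter (almost_everywhere (mu2 R)).
Proof. exact: ae_filter_ringOfSetsType. Qed.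

Lemma pae_pnull D (Q : plane R -> Prop) (N : set (plane R)) : pnull N ->
  (forall x, D x -> ~ N x -> Q x) -> pae D Q.
Proof.
move=> [A [mA A0 NA]] h; exists A; split => // x /= nx; apply: NA.
by apply: contrapT => Nx; apply: nx => Dx; exact: h.
Qed.
Lemma pae_and D Q1 Q2 : pae D Q1 -> pae D Q2 -> pae D (fun x => Q1 x /\ Q2 x).
Proof. by rewrite /pae; apply: (@filterS2 _ _ aeF) => x h1 h2 Dx; split; [exact: h1|exact: h2]. Qed.
Lemma pae_imp D Q1 Q2 : (forall x, D x -> Q1 x -> Q2 x) -> pae D Q1 -> pae D Q2.
Proof. by rewrite /pae => h; apply: (@filterS _ _ aeF) => x h1 Dx; apply: h => //; exact: h1. Qed.
Lemma paeS D E Q : D `<=` E -> pae E Q -> pae D Q.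
Proof. by rewrite /pae => DE; apply: (@filterS _ _ aeF) => x h /DE. Qed.
Lemma pae_all D (Q : plane R -> Prop) : (forall x, D x -> Q x) -> pae D Q.
Proof. by move=> h; apply: (pae_pnull pnull0) => x Dx _; exact: h. Qed.

Lemma pnullU A B : pnull A -> pnull B -> pnull (A `|` B).
Proof.
move=> [A' [mA A0 AA]] [B' [mB B0 BB]]; exists (A' `|` B'); split.
- exact: pmeasU.
- exact: null_set_setU.
- exact: setUSS.
Qed.
Lemma pnullS A B : A `<=` B -> pnull B -> pnull A.
Proof. by move=> AB [C [mC C0 BC]]; exists C; split=> //; exact: subset_trans AB BC. Qed.
Lemma pnullP A : pmeas A -> mu2 R A = 0%E -> pnull A.
Proof. by move=> mA A0; exists A; split. Qed.
Lemma pnull_mu A : pmeas A -> pnull A -> mu2 R A = 0%E.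
Proof. by move=> mA nA; apply/negligibleP. Qed.
Lemma bigcup_seq_cons (I : eqType) (i : I) (s : seq I) (F : I -> set (plane R)) :
  \bigcup_(j in [set` i :: s]) F j = F i `|` \bigcup_(j in [set` s]) F j.
Proof.
apply/seteqP; split => x.
  by move=> [j /=]; rewrite in_cons => /orP[/eqP->|js] Fx; [left|right; exists j].
move=> [Fx|[j js Fx]]; first by exists i => //=; rewrite mem_head.
by exists j => //=; rewrite in_cons; apply/orP; right.
Qed.
Lemma pnull_bigcup_seq (I : eqType) (s : seq I) (F : I -> set (plane R)) :
  (forall i, i \in s -> pnull (F i)) -> pnull (\bigcup_(i in [set` s]) F i).
Proof.
elim: s => [|i s ih] h.
  have -> : \bigcup_(i in [set` [::]]) F i = set0 by rewrite -subset0 => x [j]. exact: pnull0.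
rewrite bigcup_seq_cons; apply: pnullU; first by apply: h; rewrite mem_head.
by apply: ih => j js; apply: h; rewrite in_cons js orbT.
Qed.
Lemma pmeas_bigcup_seq (I : eqType) (s : seq I) (F : I -> set (plane R)) :
  (forall i, i \in s -> pmeas (F i)) -> pmeas (\bigcup_(i in [set` s]) F i).
Proof.
elim: s => [|i s ih] h.
  have -> : \bigcup_(i in [set` [::]]) F i = set0 by rewrite -subset0 => x [j]. exact: measurable0.
rewrite bigcup_seq_cons; apply: pmeasU; first by apply: h; rewrite mem_head.
by apply: ih => j js; apply: h; rewrite in_cons js orbT.
Qed.

Lemma I2_ae D f g : pmeas D -> measf D f -> measf D g -> pae D (fun x => f x = g x) ->
  I2 D f = I2 D g.
Proof.
move=> mD mf mg h; rewrite /I2 /Rintegral; congr fine.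
apply: ae_eq_integral => //; [exact/measurable_EFinP|exact/measurable_EFinP|].
by apply: (@filterS _ _ aeF) h => x h1 Dx /=; rewrite h1.
Qed.

Lemma I2_ae0 D f : pmeas D -> measf D f -> (forall x, D x -> 0 <= f x) -> pintg D f ->
  I2 D f = 0 -> pae D (fun x => f x = 0).
Proof.
move=> mD mf f0 fi If0.
have : (\int[mu2 R]_(x in D) `|(EFin \o f) x|)%E = 0%E.
  transitivity (\int[mu2 R]_(x in D) (EFin \o f) x)%E.
    by apply: eq_integral => x /[!inE] Dx /=; rewrite ger0_norm// f0.
  by rewrite -[LHS]fineK ?[fine _]If0//; exact: integrable_fin_num.
have mEf : measurable_fun D (EFin \o f : planeM R -> \bar R) by exact/measurable_EFinP.
move=> h0; have := (ae_eq_integral_abs (mu2 R) mD mEf).1 h0.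
rewrite /ae_eq /pae; apply: (@filterS _ _ aeF) => x h1 Dx.
by have /= := h1 Dx => -[].
Qed.

Lemma I2_dct D (f_ : nat -> plane R -> R) f g : pmeas D ->
  (forall n, measf D (f_ n)) -> measf D f ->
  pae D (fun x => f_ ^~ x @ \oo --> f x) -> pintg D g ->
  (forall n x, D x -> `|f_ n x| <= g x) ->
  (fun n => I2 D (f_ n)) @ \oo --> I2 D f.
Proof.
move=> mD mf_ mf h gi fg.
have [] := @dominated_convergence _ _ _ (mu2 R) D mD (fun n => EFin \o f_ n) (EFin \o f)
  (EFin \o g).
- by move=> n; apply/measurable_EFinP; exact: mf_.
- exact/measurable_EFinP.
- by apply: (@filterS _ _ aeF) h => x h1 Dx; apply/cvg_EFin; [exact: nearW|exact: h1].
- exact: gi.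
- by apply: (@filterE _ _ aeF) => x n Dx /=; rewrite lee_fin fg.
move=> fi _ h1; rewrite -[X in _ --> X](fineK (integrable_fin_num mD fi)) in h1.
exact: fine_cvg h1.
Qed.

Lemma I2_setU D E f : pmeas D -> pmeas E -> pnull (D `&` E) -> pintg (D `|` E) f ->
  I2 (D `|` E) f = I2 D f + I2 E f.
Proof.
move=> mD mE DE fi.
have mED := pmeasD mE mD.
have U : D `|` (E `\` D) = D `|` E.
  by apply/seteqP; split => x [Dx|]; [left| case; right|left|have [] := pselect (D x); [left|right]].
rewrite -[in LHS]U /I2 Rintegral_setU//; last 2 first.
- by rewrite U.
- by apply/disj_set2P; rewrite -subset0 => x [Dx []].
congr (_ + _).
have mf : measf E f by apply: measfS (pintg_measf fi) => //; exact: pmeasU.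
rewrite -/(I2 _ _) -/(I2 _ _) I2_mkcond [RHS]I2_mkcond; apply: I2_ae.
- exact: pmeasT.
- apply: measf_restrict => //; apply: measfS mf => //.
- exact: measf_restrict.
apply: (@pae_pnull _ _ _ DE) => x _ nx; rewrite !patchE.
case: ifPn => [/set_mem[Ex _]|/negP nED]; first by rewrite mem_set.
case: ifPn => // /set_mem Ex; exfalso; apply: nED; apply/mem_set; split => // Dx.
exact: nx.
Qed.

Lemma I2_pnull D f : pmeas D -> measf D f -> pnull D -> I2 D f = 0.
Proof.
move=> mD mf nD; rewrite /I2 /Rintegral null_set_integral//; last exact: pnull_mu.
exact/measurable_EFinP.
Qed.

End PlaneIntegral.

(** * Square integrable functions *)

Section L2.
Variable R : realType.
Implicit Types (A D : set (plane R)) (f g : plane R -> R).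

Let restrict_sq D f : (fun x => (f \_ D) x ^+ 2) = (fun x => f x ^+ 2) \_ D.
Proof.
by apply/funext => x; rewrite !patchE; case: ifPn => // _; rewrite expr0n.
Qed.

Let Lint D f : (\int[mu2 R]_x `|(EFin \o (f \_ D)) x| `^ 2)%E =
  (\int[mu2 R]_(x in D) (f x ^+ 2)%:E)%E.
Proof.
rewrite [RHS]integral_mkcond; apply: eq_integral => x _ /=.
rewrite !patchE; case: ifPn => _ /=.
  by rewrite powR_mulrn ?normr_ge0// real_normK ?num_real.
by rewrite normr0 powR0.
Qed.

(** Membership in the library space is unfolded here once; later proofs work with measurability and
    integrability of the square. *)
Lemma L2P D f : pmeas D -> L2 D f <-> measf D f /\ pintg D (fun x => f x ^+ 2).
Proof.
move=> mD; split.
  rewrite /L2 => h; have mf : measf D f.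
    by apply/measf_restrictP => //; move: h; rewrite inE => /andP[/[!inE]].
  split => //; apply/pintg_mkcond => //; rewrite -restrict_sq.
  exact: (Lfun2_integrable_sqr h).
move=> [mf /integrableP[_ fi]].
rewrite /L2 inE; apply/andP; split; rewrite inE /=; first exact: measf_restrict.
rewrite /finite_norm unlock Lint; apply: poweR_lty.
apply: le_lt_trans fi; apply: ge0_le_integral => //.
- by move=> x _; rewrite lee_fin sqr_ge0.
- by apply/measurable_EFinP; exact: measfX.
- by apply: measurableT_comp => //; apply/measurable_EFinP; exact: measfX.
- by move=> x _ /=; rewrite lee_fin ler_norm.
Qed.

Lemma L2norm_sq D f : pmeas D -> L2 D f -> L2norm D f ^+ 2 = I2 D (fun x => f x ^+ 2).
Proof.
move=> mD /(L2P _ mD)[mf fi].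
have E : (\int[mu2 R]_(x in D) (f x ^+ 2)%:E)%E = (I2 D (fun x => f x ^+ 2))%:E.
  by rewrite /I2 /Rintegral fineK//; exact: integrable_fin_num.
rewrite /L2norm unlock Lint E.
have I0 : 0 <= I2 D (fun x => f x ^+ 2) by apply: I2_ge0 => x _; exact: sqr_ge0.
by rewrite /= -powR_mulrn ?powR_ge0// -powRrM mulVf ?powRr1// pnatr_eq0.
Qed.

Lemma L2norm_ge0 D f : 0 <= L2norm D f.
Proof. by apply: fine_ge0; exact: Lnorm_ge0. Qed.

Lemma L2_measf D f : pmeas D -> L2 D f -> measf D f.
Proof. by move=> mD /(L2P _ mD)[]. Qed.
Lemma L2_pintg_sq D f : pmeas D -> L2 D f -> pintg D (fun x => f x ^+ 2).
Proof. by move=> mD /(L2P _ mD)[]. Qed.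

Lemma sqrD_le (a b : R) : (a + b) ^+ 2 <= 2 * a ^+ 2 + 2 * b ^+ 2.
Proof. by have := sqr_ge0 (a - b); rewrite sqrrB sqrrD; lra. Qed.

Lemma L2D D f g : pmeas D -> L2 D f -> L2 D g -> L2 D (fun x => f x + g x).
Proof.
move=> mD Lf Lg; have [mf fi] := (L2P f mD).1 Lf; have [mg gi] := (L2P g mD).1 Lg.
apply/L2P => //; split; first exact: measfD.
apply: (pintg_le (g := fun x => 2 * f x ^+ 2 + 2 * g x ^+ 2)) => //.
- by apply: measfX; exact: measfD.
- by move=> x _; rewrite ger0_norm ?sqr_ge0// sqrD_le.
- by apply: pintgD => //; exact: pintgZ.
Qed.
Lemma L2Z D c f : pmeas D -> L2 D f -> L2 D (fun x => c * f x).
Proof.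
move=> mD /(L2P _ mD)[mf fi]; apply/L2P => //; split; first exact: measfZ.
by under eq_fun do rewrite exprMn; exact: pintgZ.
Qed.
Lemma L2N D f : pmeas D -> L2 D f -> L2 D (fun x => - f x).
Proof. by move=> mD /(L2Z (-1) mD); under eq_fun do rewrite mulN1r. Qed.
Lemma L2B D f g : pmeas D -> L2 D f -> L2 D g -> L2 D (fun x => f x - g x).
Proof. by move=> mD Lf Lg; apply: L2D => //; exact: L2N. Qed.
Lemma L20 D : pmeas D -> L2 D (fun=> 0).
Proof.
move=> mD; apply/L2P => //; split; first exact: measf_cst.
by under eq_fun do rewrite expr0n; exact: pintg0.
Qed.
Lemma L2_sum D I (s : seq I) (Q : pred I) (f : I -> plane R -> R) : pmeas D ->
  (forall i, Q i -> L2 D (f i)) -> L2 D (fun x => \sum_(i <- s | Q i) f i x).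
Proof.
move=> mD mf; elim: s => [|i s ih].
  by under eq_fun do rewrite big_nil; exact: L20.
under eq_fun do rewrite big_cons.
case: (boolP (Q i)) => Qi //; apply: L2D => //; exact: mf.
Qed.
Lemma L2_eq D f g : pmeas D -> (forall x, D x -> f x = g x) -> L2 D f -> L2 D g.
Proof.
move=> mD fg /(L2P _ mD)[mf fi]; apply/L2P => //; split; first exact: measf_eq mf.
by apply: pintg_eq fi => // x Dx; rewrite fg.
Qed.
Lemma L2S D E f : pmeas D -> pmeas E -> D `<=` E -> L2 E f -> L2 D f.
Proof.
move=> mD mE DE /(L2P _ mE)[mf fi]; apply/L2P => //; split; first exact: measfS mf.
exact: pintgS fi.
Qed.
Lemma L2_bounded D f (c : R) : pmeas D -> (mu2 R D < +oo)%E -> measf D f ->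
  (forall x, D x -> `|f x| <= c) -> L2 D f.
Proof.
move=> mD Doo mf fc; apply/L2P => //; split => //.
apply: (@pintg_bounded _ _ _ (c ^+ 2)) => //; first exact: measfX.
move=> x Dx; rewrite normrX; apply: lerXn2r; rewrite ?nnegrE ?normr_ge0 ?fc//.
by apply: le_trans (fc x Dx).
Qed.
Lemma L2_pintgM D f g : pmeas D -> L2 D f -> L2 D g -> pintg D (fun x => f x * g x).
Proof.
move=> mD /(L2P _ mD)[mf fi] /(L2P _ mD)[mg gi].
apply: (@pintg_le _ _ _ (fun x => f x ^+ 2 + g x ^+ 2)) => //.
- exact: measfM.
- move=> x _; rewrite ler_norml; have := sqr_ge0 (f x - g x); have := sqr_ge0 (f x + g x).
  have := sqr_ge0 (f x); have := sqr_ge0 (g x).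
  by rewrite sqrrB sqrrD => *; apply/andP; split; lra.
- exact: pintgD.
Qed.

Lemma pintg_norm D f : pmeas D -> pintg D f -> pintg D (fun x => `|f x|).
Proof. by move=> mD fi; have := integrable_norm fi. Qed.

(* Young's inequality replaces the Cauchy-Schwarz inequality throughout. *)
Lemma inner_young D f g (t : R) : 0 < t -> pmeas D -> L2 D f -> L2 D g ->
  `|I2 D (fun x => f x * g x)| <=
    t / 2 * L2norm D f ^+ 2 + (2 * t)^-1 * L2norm D g ^+ 2.
Proof.
move=> t0 mD Lf Lg; rewrite !L2norm_sq//.
have fi := L2_pintg_sq mD Lf; have gi := L2_pintg_sq mD Lg.
have fgi := L2_pintgM mD Lf Lg.
rewrite -!I2Z// -I2D//; [|exact: pintgZ|exact: pintgZ].
apply: le_trans (I2_norm mD fgi) _; apply: I2_le => //.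
- exact: pintg_norm.
- by apply: pintgD => //; exact: pintgZ.
move=> x _; rewrite normrM.
have e : t / 2 * f x ^+ 2 + (2 * t)^-1 * g x ^+ 2 - `|f x| * `|g x| =
  (2 * t)^-1 * (t * `|f x| - `|g x|) ^+ 2.
  rewrite -(real_normK (num_real (f x))) -(real_normK (num_real (g x))).
  by field; rewrite gt_eqF.
by rewrite -subr_ge0 e mulr_ge0 ?sqr_ge0// invr_ge0 mulr_ge0// ltW.
Qed.

Lemma L2norm_sqD D f g : pmeas D -> L2 D f -> L2 D g ->
  L2norm D (fun x => f x + g x) ^+ 2 <= 2 * L2norm D f ^+ 2 + 2 * L2norm D g ^+ 2.
Proof.
move=> mD Lf Lg; rewrite !L2norm_sq//; last exact: L2D.
have fi := L2_pintg_sq mD Lf; have gi := L2_pintg_sq mD Lg.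
rewrite -!I2Z// -I2D//; [|exact: pintgZ|exact: pintgZ].
apply: I2_le => //; [|by apply: pintgD => //; exact: pintgZ|by move=> x _; exact: sqrD_le].
by apply: L2_pintg_sq => //; exact: L2D.
Qed.

Lemma L2norm_ae D f g : pmeas D -> L2 D f -> L2 D g -> pae D (fun x => f x = g x) ->
  L2norm D f = L2norm D g.
Proof.
move=> mD Lf Lg fg; apply/eqP; rewrite -(@eqrXn2 _ 2)// ?L2norm_ge0//; apply/eqP.
rewrite !L2norm_sq//; apply: I2_ae => //.
- by apply: measfX; exact: L2_measf.
- by apply: measfX; exact: L2_measf.
- by apply: pae_imp fg => x _ ->.
Qed.

End L2.

(** * Smooth bumps on the line *)

Section Smooth1.
Variable R : realType.
Implicit Types f g : R -> R.

(* The functions x |-> P(1/x) exp(-1/x) for x > 0, extended by 0: a class closed under differentiation. *)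
Definition flat (p : {poly R}) (x : R) : R :=
  if 0 < x then p.[x^-1] * expR (- x^-1) else 0.

(** A class given by its syntax: each rule of differentiation stays inside it, so one induction
    yields derivatives of every order. *)
Inductive sm : (R -> R) -> Prop :=
| sm_cst c : sm (fun=> c)
| sm_id : sm (fun x => x)
| sm_flat p : sm (flat p)
| sm_add f g : sm f -> sm g -> sm (fun x => f x + g x)
| sm_mul f g : sm f -> sm g -> sm (fun x => f x * g x)
| sm_aff f a b : sm f -> sm (fun x => f (a * x + b))
| sm_inv f : (forall x, f x != 0) -> sm f -> sm (fun x => (f x)^-1).

(** A single term of the exponential series at 1 / h bounds exp (1 / h) from below. *)
Lemma expRN_le (n : nat) (h : R) : 0 < h -> expR (- h^-1) <= n`!%:R * h ^+ n.
Proof.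
move=> h0; case: n => [|n].
  by rewrite expr0 mulr1 fact0 -expR0 ler_expR oppr_le0 invr_ge0 ltW.
have hi0 : 0 < h^-1 by rewrite invr_gt0.
have := expR_ge1Dxn n (ltW hi0) => e1.
have f0 : 0 < (n.+1)`!%:R :> R by rewrite ltr0n fact_gt0.
rewrite expRN -[leRHS]invrK lef_pV2 ?posrE ?expR_gt0//; last first.
  by rewrite invr_gt0 mulr_gt0// exprn_gt0.
rewrite invfM -exprVn mulrC; apply: le_trans e1; lra.
Qed.

(** By induction on the polynomial; the factor 1 / h of each degree is absorbed by using the
    induction hypothesis at k + 1. *)
Lemma flat_bound p (k : nat) : exists C, forall h, 0 < h -> `|flat p h| <= C * h ^+ k.
Proof.
elim/poly_ind: p k => [|p c ih] k.
  exists 0 => h h0; rewrite /flat h0 horner0 !mul0r normr0//.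
have [C hC] := ih k.+1; exists (C + `|c| * k`!%:R) => h h0.
have -> : flat (p * 'X + c%:P) h = h^-1 * flat p h + c * expR (- h^-1).
  by rewrite /flat h0 hornerD hornerM hornerX hornerC; ring.
apply: le_trans (ler_normD _ _) _; rewrite mulrDl; apply: lerD.
  rewrite normrM gtr0_norm ?invr_gt0//.
  apply: le_trans (ler_wpM2l _ (hC h h0)) _; first by rewrite invr_ge0 ltW.
  by rewrite exprS mulrCA mulKf// gt_eqF.
rewrite normrM -mulrA ler_wpM2l// ger0_norm ?expR_ge0//; exact: expRN_le.
Qed.

Lemma is_derive_conv f g (x a b : R) : is_derive x 1 f a -> f = g -> a = b -> is_derive x 1 g b.
Proof. by move=> h <- <-. Qed.

(** The bound of order two makes the difference quotient at 0 of order h. *)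
Lemma is_derive_flat0 p : is_derive (0 : R) 1 (flat p) 0.
Proof.
have [C hC] := flat_bound p 2.
have hC' h : `|flat p h| <= `|C| * h ^+ 2.
  have [h0|h0] := ltP 0 h.
    by apply: le_trans (hC h h0) _; rewrite ler_wpM2r ?sqr_ge0// ler_norm.
  by rewrite /flat ltNge h0 /= normr0 mulr_ge0// sqr_ge0.
have f0 : flat p 0 = 0 by rewrite /flat ltxx.
have cv : (fun h => h^-1 *: ((flat p \o shift 0) (h *: 1) - flat p 0)) @ 0^' --> (0 : R).
  apply/cvgrPdist_le => e e0; near=> h.
  have hn0 : h != 0 by near: h; exact: nbhs_dnbhs_neq.
  have hn1 : 0 < `|h| by rewrite normr_gt0.
  have he : `|h| <= e / (`|C| + 1).
    near: h; apply: dnbhs0_le; rewrite divr_gt0// ltr_pwDr//.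
  rewrite sub0r normrN f0 subr0 /= addr0 /GRing.scale /= mulr1 normrM normfV.
  apply: le_trans (ler_wpM2l _ (hC' h)) _; first by rewrite invr_ge0.
  rewrite -(real_normK (num_real h)) expr2 mulrCA mulKf ?gt_eqF//.
  apply: le_trans (ler_wpM2l _ he) _ => //.
  rewrite mulrA ler_pdivrMr ?ltr_pwDr// mulrC ler_wpM2l ?(ltW e0)// lerDl//.
apply: DeriveDef; first by apply/cvg_ex; exists 0.
exact: cvg_lim cv.
Unshelve. all: by end_near. Qed.

(** Differentiating P(1 / x) exp (-1 / x) brings out a factor 1 / x^2 and replaces P by P - P'. *)
Lemma is_derive_flat p (x : R) : is_derive x 1 (flat p) (flat ('X^2 * (p - p^`())) x).
Proof.
have [x0|x0|->] := ltgtP x 0.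
- rewrite {2}/flat ltNge (ltW x0) /=.
  apply: (near_eq_is_derive (f := cst 0)).
  by near=> y; rewrite /flat ltNge (ltW _)//; near: y; exact: lt_nbhsl.
- rewrite {2}/flat x0.
  have xn0 : x != 0 by rewrite gt_eqF.
  have dV : is_derive x 1 (fun y : R => y^-1) (- x ^- 2 *: (1 : R)) by exact: is_deriveV.
  have dp := is_derive1_comp (is_derive_poly p x^-1) dV.
  have dE : is_derive x 1 (fun y : R => expR (- y^-1)) (expR (- x^-1) * - (- x ^- 2 *: (1 : R))).
    by apply: (is_derive1_comp (f := expR) (g := fun y => - y^-1)); exact: is_deriveN.
  have D : is_derive x 1 (fun y : R => p.[y^-1] * expR (- y^-1))
      (('X^2 * (p - p^`())).[x^-1] * expR (- x^-1)).
    have /is_derive_conv := is_deriveM dp dE; apply => //.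
    by rewrite !hornerE /GRing.scale /= /GRing.scale /=; field.
  apply: near_eq_is_derive D.
  by near=> y; rewrite /flat ifT//; near: y; exact: lt_nbhsr.
- by rewrite {2}/flat ltxx; exact: is_derive_flat0.
Unshelve. all: by end_near. Qed.

Lemma sm_derive f : sm f -> exists2 f', sm f' & forall x : R, is_derive x 1 f (f' x).
Proof.
elim=> {f} [c||p|f g fS [f' f'S hf] gS [g' g'S hg]|f g fS [f' f'S hf] gS [g' g'S hg]
  |f a b fS [f' f'S hf]|f f0 fS [f' f'S hf]].
- by exists (fun=> 0); [exact: sm_cst|move=> x; exact: is_derive_cst].
- by exists (fun=> 1); [exact: sm_cst|move=> x; exact: is_derive_id].
- by exists (flat ('X^2 * (p - p^`()))); [exact: sm_flat|move=> x; exact: is_derive_flat].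
- by exists (fun x => f' x + g' x); [exact: sm_add|move=> x; exact: is_deriveD].
- exists (fun x => f x * g' x + g x * f' x).
    by apply: sm_add; exact: sm_mul.
  by move=> x; exact: (is_deriveM (hf x) (hg x)).
- exists (fun x => f' (a * x + b) * a).
    by apply: sm_mul; [exact: sm_aff|exact: sm_cst].
  move=> x; apply: (is_derive1_comp (f := f) (g := fun x => a * x + b)) => //.
  have := is_deriveD (is_deriveM (is_derive_cst a x 1) (is_derive_id x 1)) (is_derive_cst b x 1).
  by move/is_derive_conv; apply => //; rewrite /GRing.scale /=; ring.
- exists (fun x => - 1 * ((f x)^-1 * (f x)^-1) * f' x).
    apply: sm_mul => //; apply: sm_mul; first exact: sm_cst.
    by apply: sm_mul; exact: sm_inv.
  move=> x; have /is_derive_conv := is_deriveV (f0 x) (hf x); apply => //.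
  by rewrite /GRing.scale /= mulN1r expr2 invfM.
Qed.

Lemma sm_continuous f : sm f -> continuous f.
Proof.
move=> /sm_derive[f' _ hf] x; apply: differentiable_continuous.
by apply/derivable1_diffP; have [] := hf x.
Qed.

Lemma sm_eq f g : f = g -> sm f -> sm g. Proof. by move=> ->. Qed.

(** The usual smooth transition f(x) / (f(x) + f(1 - x)), with 1 - x spelled so as to match
    [sm_aff]. *)
Definition step (x : R) : R := flat 1 x * (flat 1 x + flat 1 (-1 * x + 1))^-1.

Lemma flat1_ge0 x : 0 <= flat 1 x.
Proof. by rewrite /flat; case: ifP => // _; rewrite hornerC mul1r expR_ge0. Qed.
Lemma flat1_gt0 x : 0 < x -> 0 < flat 1 x.
Proof. by move=> x0; rewrite /flat x0 hornerC mul1r expR_gt0. Qed.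
Lemma flat_le0 p x : x <= 0 -> flat p x = 0.
Proof. by move=> x0; rewrite /flat ltNge x0. Qed.

Lemma step_den x : 0 < flat 1 x + flat 1 (-1 * x + 1).
Proof.
have [x0|x0] := ltP 0 x; first by rewrite ltr_pwDl ?flat1_gt0 ?flat1_ge0.
by rewrite ltr_pwDr ?flat1_ge0 ?flat1_gt0//; lra.
Qed.

Lemma sm_step : sm step.
Proof.
apply: sm_mul; first exact: sm_flat.
apply: sm_inv; first by move=> x; rewrite gt_eqF// step_den.
by apply: sm_add; [exact: sm_flat|apply: sm_aff; exact: sm_flat].
Qed.
Lemma step_le0 x : x <= 0 -> step x = 0.
Proof. by move=> x0; rewrite /step flat_le0// mul0r. Qed.
Lemma step_ge1 x : 1 <= x -> step x = 1.
Proof.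
move=> x1; rewrite /step [flat 1 (_ + _)]flat_le0 ?addr0 ?divff ?gt_eqF ?flat1_gt0//; lra.
Qed.
Lemma step_ge0 x : 0 <= step x.
Proof. by rewrite /step mulr_ge0 ?flat1_ge0// invr_ge0 ltW// step_den. Qed.
Lemma step_le1 x : step x <= 1.
Proof. by rewrite /step ler_pdivrMr ?step_den// mul1r lerDl flat1_ge0. Qed.

(** Zero for x <= 0 and equal to x for x >= 1: second differences annihilate both pieces. *)
Definition ramp (x : R) : R := x * step x.
Lemma sm_ramp : sm ramp. Proof. by apply: sm_mul; [exact: sm_id|exact: sm_step]. Qed.

(* Second difference: for a ramp, a bump whose integer translates reproduce affine functions. *)
Definition diff2 (r : R -> R) (x : R) : R := r (x + 1) - 2 * r x + r (x - 1).

Lemma sm_diff2 r : sm r -> sm (diff2 r).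
Proof.
move=> rS; apply: (@sm_eq (fun x => r (1 * x + 1) + (-2) * r x + r (1 * x + (-1)))).
  by apply/funext => x; rewrite /diff2 !mul1r; ring.
apply: sm_add; last exact: sm_aff.
by apply: sm_add; [exact: sm_aff|apply: sm_mul => //; exact: sm_cst].
Qed.

(** The sum telescopes to first differences at the two ends; the weighted sum that follows does so
    after a summation by parts. *)
Lemma sum_diff2 r (n : nat) (y : R) : \sum_(k < n) diff2 r (y - k%:R) =
  (r (y + 1) - r y) - (r (y - n%:R + 1) - r (y - n%:R)).
Proof.
elim: n => [|n ih]; first by rewrite big_ord0 subr0 subrr.
rewrite big_ord_recr /= ih /diff2 -[n.+1%:R]natr1.
have -> : y - (n%:R + 1) + 1 = y - n%:R by ring.
have -> : y - (n%:R + 1) = y - n%:R - 1 by ring.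
ring.
Qed.

Lemma sum_idx_diff2 r (n : nat) (y : R) : \sum_(k < n) k%:R * diff2 r (y - k%:R) =
  r y - r (y - n%:R + 1) - (n%:R - 1) * (r (y - n%:R + 1) - r (y - n%:R)).
Proof.
elim: n => [|n ih]; first by rewrite big_ord0 subr0; ring.
rewrite big_ord_recr /= ih /diff2 -[n.+1%:R]natr1.
have -> : y - (n%:R + 1) + 1 = y - n%:R by ring.
have -> : y - (n%:R + 1) = y - n%:R - 1 by ring.
ring.
Qed.

(** At most four integers lie in [y - 2, y + 1], so at most four translates of the support [-1, 2]
    reach y. *)
Lemma sum_translates (B : R -> R) (M : R) (n : nat) (y : R) :
  (forall x, `|B x| <= M) -> (forall x, x < -1 \/ 2 < x -> B x = 0) ->
  \sum_(k < n) `|B (y - k%:R)| <= 4 * M.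
Proof.
move=> BM B0; have M0 : 0 <= M by apply: le_trans (BM 0).
have sh m z : \sum_(k < m.+1) `|B (z - k%:R)| = `|B z| + \sum_(k < m) `|B (z - 1 - k%:R)|.
  rewrite big_ord_recl subr0; congr (_ + _); apply: eq_bigr => k _.
  by rewrite lift0 -natr1; congr `|B _|; ring.
(* Below j - 1 only the first j translates can be nonzero. *)
have low (j m : nat) z : z < j%:R - 1 -> \sum_(k < m) `|B (z - k%:R)| <= j%:R * M.
  elim: j m z => [|j ih] m z zj.
    rewrite mul0r big1// => k _; rewrite B0 ?normr0//; left.
    by have := ler0n R k; lra.
  case: m => [|m]; first by rewrite big_ord0 mulr_ge0.
  rewrite sh -natr1 mulrDl mul1r addrC lerD//; apply: ih.
  by move: zj; rewrite -natr1; lra.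
elim: n y => [|n ih] y; first by rewrite big_ord0 mulr_ge0.
have [y2|y2] := ltP 2 y; last by apply: low; lra.
by rewrite sh B0 ?normr0 ?add0r//; right.
Qed.

(** The range conditions on y put y and y + 1 where the ramp is the identity, and y - n and y - n +
    1 where it vanishes; the telescoped sums then give a partition of unity that reproduces the
    identity, and the derivatives of both facts. *)
Lemma bump_exists : exists B B' : R -> R, exists M : R,
  [/\ sm B, forall x : R, is_derive x 1 B (B' x),
      (forall x, `|B x| <= M) /\ (forall x, `|B' x| <= M),
      forall x, x < -1 \/ 2 < x -> B x = 0 /\ B' x = 0 &
      forall (n : nat) y, 1 < y -> y - n%:R + 1 < 0 ->
        [/\ \sum_(k < n) B (y - k%:R) = 1, \sum_(k < n) k%:R * B (y - k%:R) = y,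
            \sum_(k < n) B' (y - k%:R) = 0 & \sum_(k < n) k%:R * B' (y - k%:R) = 1]].
Proof.
have [r' r'S dr] := sm_derive sm_ramp.
have r1 x : 1 <= x -> ramp x = x by move=> x1; rewrite /ramp step_ge1// mulr1.
have r0 x : x <= 0 -> ramp x = 0 by move=> x1; rewrite /ramp step_le0// mulr0.
have r'1 x : 1 < x -> r' x = 1.
  move=> x1; have /(@derive_val _ _ _ _ _ _ _) <- := dr x.
  rewrite (@near_eq_derive _ _ _ _ id); first exact: derive_id.
  by near=> y; rewrite r1// ltW//; near: y; exact: lt_nbhsr.
have r'0 x : x < 0 -> r' x = 0.
  move=> x1; have /(@derive_val _ _ _ _ _ _ _) <- := dr x.
  rewrite (@near_eq_derive _ _ _ _ (fun=> 0)); first exact: derive_cst.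
  by near=> y; rewrite r0// ltW//; near: y; exact: lt_nbhsl.
have supp (r : R -> R) (a b : R) : (forall x, 1 < x -> r x = a + b * x) -> (forall x, x < 0 -> r x = 0) ->
    forall x, x < -1 \/ 2 < x -> diff2 r x = 0.
  move=> ra rb x [h|h]; rewrite /diff2.
    by rewrite !rb; lra.
  by rewrite !ra; [ring|lra|lra|lra].
have s1 : forall x, x < -1 \/ 2 < x -> diff2 ramp x = 0.
  apply: (supp _ 0 1) => x hx; first by rewrite r1 ?ltW//; ring.
  by rewrite r0// ltW.
have s2 : forall x, x < -1 \/ 2 < x -> diff2 r' x = 0.
  by apply: (supp _ 1 0) => x hx; [rewrite r'1//; ring|rewrite r'0].
have bd f : sm f -> (forall x, x < -1 \/ 2 < x -> f x = 0) -> exists M, forall x, `|f x| <= M.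
  move=> fS f0.
  have c12 : (-1 : R) <= 2 by lra.
  have cf : {within `[(-1 : R), 2], continuous (fun x => `|f x|)}.
    apply: continuous_subspaceT => x; apply: continuous_comp; first exact: sm_continuous.
    exact: norm_continuous.
  have [c cI hc] := EVT_max c12 cf; exists `|f c| => x.
  have [x1|x1] := ltP x (-1); first by rewrite f0 ?normr0//; left.
  have [x2|x2] := ltP 2 x; first by rewrite f0 ?normr0//; right.
  by apply: hc; rewrite in_itv /= x1.
have [M1 hM1] := bd _ (sm_diff2 sm_ramp) s1.
have [M2 hM2] := bd _ (sm_diff2 r'S) s2.
exists (diff2 ramp), (diff2 r'), (Num.max M1 M2); split.
- exact: sm_diff2 sm_ramp.
- move=> x.
  have sh (a : R) : is_derive x 1 (fun x => ramp (x + a)) (r' (x + a)).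
    rewrite -[r' _]mulr1; apply: (is_derive1_comp (f := ramp) (g := fun x => x + a)).
    have := is_deriveD (is_derive_id x (1 : R)) (is_derive_cst a x 1).
    by move/is_derive_conv; apply => //; rewrite addr0.
  have := is_deriveD (is_deriveB (sh 1) (is_deriveM (is_derive_cst (2 : R) x (1 : R)) (dr x))) (sh (-1)).
  by move/is_derive_conv; apply => //; rewrite /diff2 /GRing.scale /=; ring.
- by split => x; rewrite le_max ?hM1// hM2 orbT.
- by move=> x hx; rewrite s1// s2.
- move=> n y y1 yn.
  have e1 : ramp (y + 1) = y + 1 by rewrite r1//; lra.
  have e2 : ramp y = y by rewrite r1//; lra.
  have e3 : ramp (y - n%:R + 1) = 0 by rewrite r0//; lra.
  have e4 : ramp (y - n%:R) = 0 by rewrite r0//; lra.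
  have f1 : r' (y + 1) = 1 by rewrite r'1//; lra.
  have f2 : r' y = 1 by rewrite r'1//; lra.
  have f3 : r' (y - n%:R + 1) = 0 by rewrite r'0//; lra.
  have f4 : r' (y - n%:R) = 0 by rewrite r'0//; lra.
  split.
  + by rewrite sum_diff2 e1 e2 e3 e4; ring.
  + by rewrite sum_idx_diff2 e2 e3 e4; ring.
  + by rewrite sum_diff2 f1 f2 f3 f4; ring.
  + by rewrite sum_idx_diff2 f2 f3 f4; ring.
Unshelve. all: by end_near. Qed.

End Smooth1.

(** * Gradients of Lipschitz functions *)

Section Gradient.
Variable R : realType.
Implicit Types (D : set (plane R)) (f g : plane R -> R) (x y v : plane R).

(** The Frechet gradient as a relation, so that it can be asserted at almost every point of a
    function that is merely Lipschitz. *)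
Definition grad f x (a b : R) : Prop := forall e : R, 0 < e -> \forall y \near x,
  `|f y - f x - (a * (y.1 - x.1) + b * (y.2 - x.2))| <= e * `|y - x|.

Definition lip (L : R) f : Prop := forall x y, `|f x - f y| <= L * `|x - y|.

Lemma norm_fst v : `|v.1| <= `|v|. Proof. by rewrite prod_normE le_max lexx. Qed.
Lemma norm_snd v : `|v.2| <= `|v|. Proof. by rewrite prod_normE le_max lexx orbT. Qed.
Lemma norm_ltP v (e : R) : `|v| < e <-> `|v.1| < e /\ `|v.2| < e.
Proof. by rewrite prod_normE gt_max; split => [/andP[]|[-> ->]]. Qed.
Lemma norm_leP v (e : R) : `|v| <= e <-> `|v.1| <= e /\ `|v.2| <= e.
Proof. by rewrite prod_normE ge_max; split => [/andP[]|[-> ->]]. Qed.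

Lemma near_normP x (Q : plane R -> Prop) :
  (\forall y \near x, Q y) <-> exists2 d : R, 0 < d & forall y, `|y - x| < d -> Q y.
Proof.
split.
  move=> /nbhs_ballP[d /= d0 h]; exists d => // y yd; apply: h.
  by rewrite prod_norm_ball /ball_ /= distrC.
move=> [d d0 h]; apply/nbhs_ballP; exists d => //= y.
by rewrite prod_norm_ball /ball_ /= distrC => /h.
Qed.

Lemma plane_basis v : v = v.1 *: ex R + v.2 *: ey R.
Proof.
case: v => a b; rewrite /ex /ey; congr pair => /=; rewrite /GRing.scale /=.
  by rewrite mulr1 mulr0 addr0.
by rewrite mulr1 mulr0 add0r.
Qed.

Lemma deriveE2 f x v : differentiable f x ->
  'D_v f x = v.1 * 'D_(ex R) f x + v.2 * 'D_(ey R) f x.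
Proof.
by move=> df; rewrite !deriveE// {1}(plane_basis v) linearD !linearZ.
Qed.

Lemma grad_diff f x : differentiable f x -> grad f x ('D_(ex R) f x) ('D_(ey R) f x).
Proof.
move=> df e e0.
have /diff_locallyx fE := df.
have [k kE] : exists k : {o_ (nbhs (0 : plane R)) (id : plane R -> plane R)},
    forall h, f (h + x) = f x + 'd f x h + k h by eexists; exact: fE.
have := littleoP k e0.
move=> /nbhs_ballP[d /= d0 h]; apply/near_normP; exists d => // y yd.
have := h (y - x); rewrite prod_norm_ball /ball_ /= sub0r normrN => /(_ yd).
have := kE (y - x); rewrite subrK -(deriveE (y - x) df) deriveE2//= => -> le1.
by rewrite (_ : _ - _ = k (y - x))//=; ring.
Qed.

(** Continuous induction: the supremum of the times at which the bound holds satisfies it by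
    continuity, and if it were below 1 a later time would satisfy it too. *)
Lemma lip_chain (g : R -> R) (L : R) : continuous g ->
  (forall t, 0 <= t < 1 -> exists2 t', t < t' <= 1 & `|g t' - g t| <= L * (t' - t)) ->
  `|g 1 - g 0| <= L.
Proof.
move=> cg h.
pose S := [set t : R | 0 <= t <= 1 /\ `|g t - g 0| <= L * t].
have S0 : S 0 by split; rewrite ?lexx ?ler01// subrr normr0 mulr0.
have hS : has_sup S.
  by split; [exists 0|exists 1 => t [/andP[]]].
set s := sup S.
have s01 : 0 <= s <= 1.
  apply/andP; split; first exact: (ub_le_sup hS.2 S0).
  by apply: ge_sup; [exists 0|move=> t [/andP[]]].
have Ss : S s.
  split => //; rewrite leNgt; apply/negP => lt1.
  have cG : continuous (fun t => `|g t - g 0| - L * t).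
    move=> t; apply: cvgB.
      by apply: cvg_norm; apply: cvgB; [exact: cg|exact: cvg_cst].
    by apply: cvgM; [exact: cvg_cst|exact: cvg_id].
  have : \forall t \near s, 0 < `|g t - g 0| - L * t.
    by apply: (cvgr_gt _ (cG s)); rewrite subr_gt0.
  move=> /nbhs_ballP[d /= d0 hd].
  have [t St st] := sup_adherent d0 hS.
  have ts : t <= s by exact: (ub_le_sup hS.2 St).
  have st' : s - t < d by rewrite -/s in st; lra.
  have := hd t; rewrite /ball /= ger0_norm ?subr_ge0// => /(_ st').
  by rewrite subr_gt0 ltNge; case: St => _ ->.
have [s1|s1] := ltP s 1; last first.
  have -> : 1 = s by apply/eqP; rewrite eq_le s1; case/andP: s01.
  case: Ss => _; case/andP: s01 => s0 sle; have -> : s = 1 by apply/eqP; rewrite eq_le sle s1.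
  by rewrite mulr1.
have [|t' /andP[st' t'1] ht] := h s; first by case/andP: s01 => ->.
have : t' <= s.
  apply: (ub_le_sup hS.2); split.
    by rewrite t'1 andbT; case/andP: s01 => s0 _; apply: le_trans (ltW st').
  have -> : g t' - g 0 = (g t' - g s) + (g s - g 0) by ring.
  apply: le_trans (ler_normD _ _) _; case: Ss => _ h2; lra.
by rewrite leNgt st'.
Qed.

Lemma continuous_segment f x y : continuous f -> continuous (fun t : R => f (x + t *: (y - x))).
Proof.
move=> cf t; apply: (continuous_comp (f := fun t : R => x + t *: (y - x))); last exact: cf.
apply: cvgD; first exact: cvg_cst.
by apply: cvgZr_tmp; exact: cvg_id.
Qed.

(** Control on a short initial piece of each ray is enough: [lip_chain] moves along the segment
    between two points in one direction. *)
Lemma lip_local f (L : R) : 0 <= L -> continuous f ->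
  (forall x y, exists2 d : R, 0 < d & forall t, 0 < t < d ->
     `|f (x + t *: y) - f x| <= L * `|t *: y|) -> lip L f.
Proof.
move=> L0 cf h x y.
have := @lip_chain (fun t : R => f (y + t *: (x - y))) (L * `|x - y|)
  (continuous_segment (x := y) (y := x) cf).
rewrite scale1r scale0r addr0 subrKC; apply=> t /andP[t0 t1].
have [d d0 hd] := h (y + t *: (x - y)) (x - y).
pose s := Num.min (d / 2) (1 - t).
have s0 : 0 < s by rewrite lt_min divr_gt0//= subr_gt0.
have sd : s < d by rewrite gt_min; apply/orP; left; lra.
have s1 : s <= 1 - t by rewrite ge_min lexx orbT.
exists (t + s); first by apply/andP; split; lra.
have := hd s; rewrite s0 sd => /(_ isT).
have -> : y + t *: (x - y) + s *: (x - y) = y + (t + s) *: (x - y) by rewrite scalerDl addrA.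
rewrite normrZ gtr0_norm// => le1; apply: le_trans le1 _.
have -> : t + s - t = s by ring.
by rewrite mulrA mulrAC.
Qed.

(** In the max norm the two partial derivatives contribute 2 M; the unit is the remainder for e =
    1. *)
Lemma grad_lip f (M : R) (a b : plane R -> R) : continuous f ->
  (forall x, grad f x (a x) (b x)) -> (forall x, `|a x| <= M /\ `|b x| <= M) ->
  lip (2 * M + 1) f.
Proof.
move=> cf gf hM; have M0 : 0 <= M by apply: le_trans (proj1 (hM 0)).
apply: lip_local => //; first by lra.
move=> x y; have /near_normP[d d0 hd] := gf x 1 ltr01.
have [->|y0] := eqVneq y 0.
  by exists 1 => // t _; rewrite scaler0 addr0 subrr !normr0 mulr0.
have ny : 0 < `|y| by rewrite normr_gt0.
exists (d / `|y|); first exact: divr_gt0.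
move=> t /andP[t0 td]; have := hd (x + t *: y).
have -> : x + t *: y - x = t *: y by rewrite addrAC subrr add0r.
rewrite normrZ gtr0_norm// -ltr_pdivlMr// => /(_ td) le1.
set z := t *: y; have zE : `|z| = t * `|y| by rewrite normrZ gtr0_norm.
have e1 : (x + z).1 - x.1 = z.1 by rewrite /=; ring.
have e2 : (x + z).2 - x.2 = z.2 by rewrite /=; ring.
rewrite -/z e1 e2 mul1r -zE in le1; rewrite -zE.
have -> : f (x + z) - f x = (f (x + z) - f x - (a x * z.1 + b x * z.2)) + a x * z.1 + b x * z.2 by ring.
apply: le_trans (ler_normD _ _) _; apply: le_trans (lerD (ler_normD _ _) (lexx _)) _.
have [h1 h2] := hM x.
have l1 : `|a x * z.1| <= M * `|z| by rewrite normrM ler_pM// norm_fst.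
have l2 : `|b x * z.2| <= M * `|z| by rewrite normrM ler_pM// norm_snd.
lra.
Qed.

Lemma lip_cont f L : lip L f -> continuous f.
Proof.
move=> lf x; apply/cvgrPdist_le => e e0; apply/near_normP.
exists (e / (`|L| + 1)); first by rewrite divr_gt0// ltr_pwDr.
move=> y yd; rewrite distrC; apply: le_trans (lf _ _) _.
move: yd; rewrite ltr_pdivlMr ?ltr_pwDr// => yd.
apply: le_trans (ltW yd); rewrite mulrC ler_wpM2l//.
by apply: le_trans (ler_norm L) _; rewrite lerDl.
Qed.

(** Sums of products of one-variable functions of [sm]: closed under directional derivatives and
    rich enough for tensor-product quasi-interpolants. *)
Inductive sm2 : (plane R -> R) -> Prop :=
| sm2_tens al be : sm al -> sm be -> sm2 (fun x => al x.1 * be x.2)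
| sm2_add f g : sm2 f -> sm2 g -> sm2 (fun x => f x + g x).

Lemma sm2_Z c f : sm2 f -> sm2 (fun x => c * f x).
Proof.
elim=> {f} [al be sa sb|f g _ ih1 _ ih2].
  have -> : (fun x : plane R => c * (al x.1 * be x.2)) =
    (fun x => (fun t => (fun=> c) t * al t) x.1 * be x.2).
    by apply/funext => x; rewrite mulrA.
  by apply: (sm2_tens (al := fun t => c * al t)) => //; apply: (sm_mul (f := fun=> c)) => //; exact: sm_cst.
under eq_fun do rewrite mulrDr.
exact: sm2_add.
Qed.

Lemma sm2_sum I (s : seq I) (F : I -> plane R -> R) : (forall i, sm2 (F i)) ->
  sm2 (fun x => \sum_(i <- s) F i x).
Proof.
move=> hF; elim: s => [|i s ih].
  under eq_fun do rewrite big_nil.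
  have := sm2_tens (sm_cst 0) (sm_cst (0 : R)); by under eq_fun do rewrite mulr0.
by under eq_fun do rewrite big_cons; exact: sm2_add.
Qed.

Lemma diff_fst_comp (al : R -> R) (a : R) x : is_derive x.1 1 al a ->
  differentiable (al \o fst) x /\ forall v, 'D_v (al \o fst) x = v.1 * a.
Proof.
move=> [da ea].
have cfst : continuous (fst : plane R -> R) by move=> y; exact: cvg_fst.
have dfst : differentiable (fst : plane R -> R) x by exact: linear_differentiable.
have dal : differentiable al x.1 by exact/derivable1_diffP.
have dc : differentiable (al \o fst) x by exact: differentiable_comp.
split => // v; rewrite deriveE// diff_comp//= diff_lin// diff1E//.
by rewrite derive1E ea.
Qed.

Lemma diff_snd_comp (al : R -> R) (a : R) x : is_derive x.2 1 al a ->
  differentiable (al \o snd) x /\ forall v, 'D_v (al \o snd) x = v.2 * a.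
Proof.
move=> [da ea].
have cfst : continuous (snd : plane R -> R) by move=> y; exact: cvg_snd.
have dfst : differentiable (snd : plane R -> R) x by exact: linear_differentiable.
have dal : differentiable al x.2 by exact/derivable1_diffP.
have dc : differentiable (al \o snd) x by exact: differentiable_comp.
split => // v; rewrite deriveE// diff_comp//= diff_lin// diff1E//.
by rewrite derive1E ea.
Qed.

Lemma diff_tens (al be : R -> R) (a b : R) x : is_derive x.1 1 al a -> is_derive x.2 1 be b ->
  differentiable (fun y : plane R => al y.1 * be y.2) x /\
  forall v, 'D_v (fun y : plane R => al y.1 * be y.2) x = v.1 * (a * be x.2) + v.2 * (al x.1 * b).
Proof.
move=> /diff_fst_comp[d1 e1] /diff_snd_comp[d2 e2].
have d : differentiable ((al \o fst) * (be \o snd)) x by exact: differentiableM.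
split => // v.
have -> : 'D_v (fun y : plane R => al y.1 * be y.2) x = 'D_v ((al \o fst) * (be \o snd)) x by [].
rewrite deriveM; [|exact: diff_derivable|exact: diff_derivable].
by rewrite e1 e2 /GRing.scale /=; ring.
Qed.

Lemma sm2_diff f : sm2 f -> exists f1 f2, [/\ sm2 f1, sm2 f2,
  forall x, differentiable f x & forall x v, 'D_v f x = v.1 * f1 x + v.2 * f2 x].
Proof.
elim=> {f} [al be sa sb|f g _ [f1 [f2 [s1 s2 df ef]]] _ [g1 [g2 [t1 t2 dg eg]]]].
  have [al' sa' da] := sm_derive sa; have [be' sb' db] := sm_derive sb.
  exists (fun x => al' x.1 * be x.2), (fun x => al x.1 * be' x.2); split.
  - exact: sm2_tens.
  - exact: sm2_tens.
  - by move=> x; have [] := diff_tens (da x.1) (db x.2).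
  - by move=> x v; have [_ ->] := diff_tens (da x.1) (db x.2).
exists (fun x => f1 x + g1 x), (fun x => f2 x + g2 x); split.
- exact: sm2_add.
- exact: sm2_add.
- by move=> x; exact: differentiableD.
- move=> x v; have -> : 'D_v (fun x => f x + g x) x = 'D_v (f + g) x by [].
  rewrite deriveD; [|exact: diff_derivable|exact: diff_derivable].
  by rewrite ef eg; ring.
Qed.

Lemma sm2_smooth f : sm2 f -> smooth f.
Proof.
move=> sf s x.
suff h : sm2 (foldr (fun e (g : plane R -> R) y => 'D_e g y) f s).
  by have [f1 [f2 [_ _ + _]]] := sm2_diff h.
elim: s => //= v s ih.
have [f1 [f2 [s1 s2 _ e]]] := sm2_diff ih.
have -> : (fun y => 'D_v (foldr (fun e (g : plane R -> R) y => 'D_e g y) f s) y) =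
   (fun y => v.1 * f1 y + v.2 * f2 y) by apply/funext => y; rewrite e.
by apply: sm2_add; exact: sm2_Z.
Qed.

Lemma smooth_diff f x : smooth f -> differentiable f x.
Proof. by move=> /(_ [::] x). Qed.

Lemma smooth_cont f : smooth f -> continuous f.
Proof. by move=> sf x; apply: differentiable_continuous; exact: smooth_diff. Qed.

Lemma smooth_D f v : smooth f -> smooth (fun x => 'D_v f x).
Proof. by move=> sf s x; have := sf (rcons s v) x; rewrite foldr_rcons. Qed.

Lemma smooth_add f g : smooth f -> smooth g -> smooth (f + g).
Proof.
move=> sf sg s.
suff h : foldr (fun e (g : plane R -> R) y => 'D_e g y) (f + g) s =
  foldr (fun e (g : plane R -> R) y => 'D_e g y) f s + foldr (fun e (g : plane R -> R) y => 'D_e g y) g s.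
  by move=> x; rewrite h; apply: differentiableD; [exact: sf|exact: sg].
elim: s => //= v s ->; apply/funext => y.
by rewrite deriveD//; apply: diff_derivable; [exact: sf|exact: sg].
Qed.

Lemma smooth_scale c f : smooth f -> smooth (c *: f).
Proof.
move=> sf s.
suff h : foldr (fun e (g : plane R -> R) y => 'D_e g y) (c *: f) s =
  c *: foldr (fun e (g : plane R -> R) y => 'D_e g y) f s.
  by move=> x; rewrite h; apply: differentiableZ; exact: sf.
elim: s => //= v s ->; apply/funext => y.
by rewrite deriveZ//; apply: diff_derivable; exact: sf.
Qed.

End Gradient.

(** * Difference quotients and weak derivatives *)

Section WeakDerivative.
Variable R : realType.
Implicit Types (D : set (plane R)) (f g : plane R -> R) (x y v c : plane R).

Definition pbox c (r : R) : set (plane R) := [set x | `|x - c| <= r].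
Definition obox (a b a' b' : R) : set (plane R) := `]a, b[%classic `*` `]a', b'[%classic.

Lemma pboxE c r : pbox c r = `[c.1 - r, c.1 + r]%classic `*` `[c.2 - r, c.2 + r]%classic.
Proof.
apply/seteqP; split => x; rewrite /pbox /=.
  by move=> /norm_leP[/=]; rewrite !ler_norml !in_itv /= => /andP[? ?] /andP[? ?];
    split; apply/andP; split; lra.
move=> [/=]; rewrite !in_itv /= => /andP[? ?] /andP[? ?]; apply/norm_leP => /=.
by rewrite !ler_norml; split; apply/andP; split; lra.
Qed.

Lemma pmeas_pbox c r : pmeas (pbox c r).
Proof. by rewrite pboxE; apply: pmeas_box; exact: measurable_itv. Qed.

Lemma pmeas_obox a b a' b' : pmeas (obox a b a' b').
Proof. by apply: pmeas_box; exact: measurable_itv. Qed.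

Lemma mu2_pbox c r : 0 <= r -> mu2 R (pbox c r) = (4 * r ^+ 2)%:E.
Proof.
move=> r0; rewrite pboxE.
transitivity (lebesgue_measure `[(c.1 - r)%R, (c.1 + r)%R]%classic *
  lebesgue_measure `[(c.2 - r)%R, (c.2 + r)%R]%classic)%E.
  by apply: product_measure1E; exact: measurable_itv.
rewrite !lebesgue_measure_itv /= !lte_fin.
have [->|r1] := eqVneq r 0.
  by rewrite !subr0 !addr0 !ltxx mule0 expr0n mulr0.
have rp : 0 < r by rewrite lt_neqAle eq_sym r1.
rewrite !ifT; [|lra|lra].
by rewrite -!EFinB -EFinM; congr EFin; ring.
Qed.

Lemma mu2_pbox_lty c r : (mu2 R (pbox c r) < +oo)%E.
Proof.
have [r0|r0] := leP 0 r; first by rewrite mu2_pbox// ltry.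
suff -> : pbox c r = set0 by rewrite measure0.
by rewrite -subset0 => x /= h; have := le_lt_trans h r0; rewrite normr_lt0.
Qed.

Lemma mu2_lty D c r : pmeas D -> D `<=` pbox c r -> (mu2 R D < +oo)%E.
Proof.
move=> mD Dr; apply: le_lt_trans (mu2_pbox_lty c r).
by apply: le_measure => //; rewrite inE; [exact: mD|exact: pmeas_pbox].
Qed.

Lemma L2_pintg D f : pmeas D -> (mu2 R D < +oo)%E -> L2 D f -> pintg D f.
Proof.
move=> mD Doo Lf.
have L1 : L2 D (fun=> 1) by apply: (L2_bounded (c := 1)) => // [|x _]; [exact: measf_cst|rewrite normr1].
by have := L2_pintgM mD Lf L1; under eq_fun do rewrite mulr1.
Qed.

Lemma compact_pbox c r : compact (pbox c r).
Proof. by rewrite pboxE; apply: compact_setX; exact: segment_compact. Qed.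

Lemma compact_bounded_closed (K : set (plane R)) c r : closed K -> K `<=` pbox c r -> compact K.
Proof. by move=> cK Kr; exact: (subclosed_compact cK (@compact_pbox c r) Kr). Qed.

Lemma compact_pbox_sub (K : set (plane R)) : compact K -> exists2 M : R, 0 <= M & K `<=` pbox 0 M.
Proof.
move=> /compact_bounded[M [_ hM]]; exists (`|M| + 1).
  by rewrite addr_ge0.
move=> x Kx; rewrite /pbox /= subr0; apply: hM => //.
by apply: le_lt_trans (ler_norm M) _; rewrite ltrDl.
Qed.

Lemma bounded_pbox D : bounded_set D -> exists2 M : R, 0 <= M & D `<=` pbox 0 M.
Proof.
move=> [M [_ hM]]; exists (`|M| + 1); first by rewrite addr_ge0.
move=> x Kx; rewrite /pbox /= subr0; apply: hM => //.
by apply: le_lt_trans (ler_norm M) _; rewrite ltrDl.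
Qed.

Lemma lip_measf f L : lip L f -> measf setT f.
Proof. by move=> lf; apply: measf_cont; exact: lip_cont lf. Qed.

Lemma pintg_supp f (M C : R) : measf setT f -> (forall x, `|f x| <= C) ->
  (forall x, M < `|x| -> f x = 0) -> pintg setT f.
Proof.
move=> mf fC f0; have -> : f = f \_ (pbox 0 M).
  apply/funext => x; rewrite patchE; case: ifPn => // /negP h.
  by rewrite f0// ltNge; apply/negP => h2; apply: h; rewrite inE /pbox /= subr0.
apply: (pintg_mkcond _ (@pmeas_pbox 0 M)).1.
apply: (@pintg_bounded _ _ _ C) => //; [exact: pmeas_pbox|exact: mu2_pbox_lty|exact: measfT].
Qed.

(** Comparison with the point (M + 1, 0), where f vanishes and which is at most 2 M + 1 away from
    any point of norm at most M. *)
Lemma lip_supp_bound f (L M : R) : 0 <= L -> 0 <= M -> lip L f ->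
  (forall x, M < `|x| -> f x = 0) -> forall x, `|f x| <= L * (2 * M + 1).
Proof.
move=> L0 M0 lf f0 x.
have [xM|xM] := ltP M `|x|; first by rewrite f0// normr0 mulr_ge0//; lra.
have z0 : f ((M + 1, 0) : plane R) = 0.
  by rewrite f0// prod_normE /= normr0 ger0_norm; rewrite ?lt_max; [apply/orP; left; lra|lra].
have := lf x (M + 1, 0); rewrite z0 subr0 => h; apply: le_trans h _.
apply: ler_wpM2l => //; apply: le_trans (ler_normB _ _) _.
have -> : `|(M + 1, 0) : plane R| = M + 1.
  by rewrite prod_normE /= normr0 ger0_norm ?max_l//; lra.
lra.
Qed.

Lemma I2_shift f v : measf setT f -> pintg setT f -> I2 setT (fun x => f (x + v)) = I2 setT f.
Proof.
move=> mf fi; have d0 : (1 : R) * 1 - 0 * 0 != 0 by rewrite mulr1 mulr0 subr0 oner_neq0.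
have := I2_affm v.1 v.2 d0 (@pmeasT R) mf fi.
rewrite preimage_setT mulr1 mulr0 subr0 normr1 invr1 mul1r => <-.
congr I2; apply/funext => x /=; congr f; rewrite /affm.
by apply/eqP; rewrite eqE /=; apply/andP; split; apply/eqP => /=; ring.
Qed.

Lemma pintg_shift f v : measf setT f -> pintg setT f -> pintg setT (fun x => f (x + v)).
Proof.
move=> mf fi; have d0 : (1 : R) * 1 - 0 * 0 != 0 by rewrite mulr1 mulr0 subr0 oner_neq0.
have := pintg_affm v.1 v.2 d0 (@pmeasT R) mf fi.
rewrite preimage_setT; congr pintg; apply/funext => x /=; congr f; rewrite /affm.
by apply/eqP; rewrite eqE /=; apply/andP; split; apply/eqP => /=; ring.
Qed.

Lemma measf_shift f v : measf setT f -> measf setT (fun x => f (x + v)).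
Proof.
move=> mf; have := measf_affm 1 0 0 1 v.1 v.2 mf; congr measf.
apply/funext => x /=; congr f; rewrite /affm.
by apply/eqP; rewrite eqE /=; apply/andP; split; apply/eqP => /=; ring.
Qed.

(* Difference quotients integrate to zero by translation invariance, and are dominated. *)
Lemma int_deriv0 f g (L M : R) v : lip L f -> (forall x, M < `|x| -> f x = 0) -> measf setT g ->
  pae setT (fun x => (fun n => n.+1%:R * (f (x + n.+1%:R^-1 *: v) - f x)) @ \oo --> g x) ->
  I2 setT g = 0.
Proof.
move=> lf f0 mg h.
pose L' : R := `|L|; pose M' : R := `|M|.
have L'0 : 0 <= L' by exact: normr_ge0.
have lf' : lip L' f by move=> x y; apply: le_trans (lf x y) _; rewrite ler_wpM2r// ler_norm.
have f0' x : M' < `|x| -> f x = 0 by move=> h1; apply: f0; apply: le_lt_trans h1; exact: ler_norm.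
have mf := lip_measf lf.
have fi : pintg setT f.
  apply: (pintg_supp (M := M') (C := L' * (2 * M' + 1))) => //.
  by apply: lip_supp_bound => //; exact: normr_ge0.
pose q n x := n.+1%:R * (f (x + n.+1%:R^-1 *: v) - f x).
have mq n : measf setT (q n) by apply: measfZ; apply: measfB => //; exact: measf_shift.
have q0 n : I2 setT (q n) = 0.
  rewrite /q I2Z; [|exact: pmeasT|by apply: pintgB => //; [exact: pmeasT|exact: pintg_shift]].
  rewrite I2B; [|exact: pmeasT|exact: pintg_shift|by []].
  by rewrite I2_shift// subrr mulr0.
(* The increments 1 / (n + 1) are at most one, so all quotients vanish outside this enlarged
   square. *)
pose G x := (if `|x| <= M' + `|v| then L' * `|v| else 0).
have qG n x : `|q n x| <= G x.
  have n0 : 0 < (n.+1%:R : R) by rewrite ltr0n.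
  rewrite /G; case: ifPn => hx.
    rewrite /q normrM gtr0_norm//.
    apply: le_trans (ler_wpM2l (ltW n0) (lf' _ _)) _.
    by rewrite addrAC subrr add0r normrZ gtr0_norm ?invr_gt0// mulrCA mulVKf ?gt_eqF.
  rewrite -ltNge in hx.
  rewrite /q !f0' ?subrr ?mulr0 ?normr0//.
    by apply: le_lt_trans hx; rewrite lerDl.
  have : `|x| <= `|x + n.+1%:R^-1 *: v| + `|v|.
    have -> : x = (x + n.+1%:R^-1 *: v) - n.+1%:R^-1 *: v by rewrite addrK.
    apply: le_trans (ler_normB _ _) _; rewrite addrK lerD//.
    by rewrite normrZ gtr0_norm ?invr_gt0// ler_piMl// invf_le1// ler1n.
  lra.
have mG : pintg setT G.
  apply: (pintg_supp (M := M' + `|v|) (C := L' * `|v|)).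
  - have -> : G = (fun=> L' * `|v|) \_ (pbox 0 (M' + `|v|)).
      apply/funext => x; rewrite patchE /G; case: ifPn => hx.
        by rewrite mem_set//= /pbox /= subr0.
      rewrite ifN//; apply/negP; rewrite inE /pbox /= subr0 => h2.
      by rewrite h2 in hx.
    by apply: measf_restrict; [exact: pmeas_pbox|exact: measf_cst].
  - move=> x; rewrite /G; case: ifP => _; first by rewrite ger0_norm// mulr_ge0.
    by rewrite normr0 mulr_ge0.
  - by move=> x hx; rewrite /G leNgt hx.
have := I2_dct (@pmeasT R) mq mg h mG (fun n x _ => qG n x).
have -> : (fun n => I2 setT (q n)) = (fun=> 0) by apply/funext => n; rewrite q0.
by move=> /(cvg_unique (@Rhausdorff R)); apply; exact: cvg_cst.
Qed.

Lemma grad_dq f x (a b : R) v : grad f x a b ->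
  (fun n => n.+1%:R * (f (x + n.+1%:R^-1 *: v) - f x)) @ \oo --> a * v.1 + b * v.2.
Proof.
move=> gf; apply/cvgrPdist_le => e e0.
have ev : 0 < e / (`|v| + 1) by rewrite divr_gt0// ltr_pwDr.
have /near_normP[d d0 hd] := gf _ ev.
have dv : 0 < d / (`|v| + 1) by rewrite divr_gt0// ltr_pwDr.
near=> n.
have n0 : 0 < (n.+1%:R : R) by rewrite ltr0n.
have nd : n.+1%:R^-1 < d / (`|v| + 1).
  by near: n; exact: (near_infty_natSinv_lt (PosNum dv)).
move: nd n0; move: (n.+1%:R : R) => N nd n0.
set y := x + N^-1 *: v.
have yx : y - x = N^-1 *: v by rewrite /y addrAC subrr add0r.
have := hd y; rewrite yx normrZ gtr0_norm ?invr_gt0//.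
have lt1 : N^-1 * `|v| < d.
  apply: le_lt_trans (_ : N^-1 * (`|v| + 1) < _).
    by rewrite ler_wpM2l ?invr_ge0 ?(ltW n0)// lerDl.
  by rewrite -ltr_pdivlMr// ltr_pwDr.
move=> /(_ lt1).
have e1 : y.1 - x.1 = N^-1 * v.1 by rewrite /y /=; rewrite /GRing.scale /=; ring.
have e2 : y.2 - x.2 = N^-1 * v.2 by rewrite /y /=; rewrite /GRing.scale /=; ring.
rewrite e1 e2 => le1; rewrite distrC.
have -> : N * (f y - f x) - (a * v.1 + b * v.2) =
  N * (f y - f x - (a * (N^-1 * v.1) + b * (N^-1 * v.2))).
  by field; rewrite gt_eqF.
rewrite normrM gtr0_norm//; apply: le_trans (ler_wpM2l (ltW n0) le1) _.
rewrite [leLHS](_ : _ = e / (`|v| + 1) * `|v|); last by field; rewrite !gt_eqF ?ltr_pwDr.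
by rewrite mulrAC ler_pdivrMr ?ltr_pwDr// ler_wpM2l ?(ltW e0)// lerDl.
Unshelve. all: by end_near. Qed.

Lemma grad_near f g x a b : (\forall y \near x, f y = g y) -> grad f x a b -> grad g x a b.
Proof.
move=> fg gf e e0; have fgx : f x = g x by exact: nbhs_singleton fg.
by apply: filterS2 fg (gf e e0) => y <-; rewrite -fgx.
Qed.

Lemma grad_cst (k : R) x : grad (fun=> k) x 0 0.
Proof.
move=> e e0; apply/near_normP; exists 1 => // y _.
by rewrite subrr !mul0r addr0 subr0 normr0 mulr_ge0//; exact: ltW.
Qed.

Lemma grad_bd f x a b : grad f x a b ->
  \forall y \near x, `|f y - f x| <= (`|a| + `|b| + 1) * `|y - x|.
Proof.
move=> /(_ 1 ltr01); apply: filterS => y h.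
have -> : f y - f x = (f y - f x - (a * (y.1 - x.1) + b * (y.2 - x.2))) + a * (y.1 - x.1) + b * (y.2 - x.2) by ring.
apply: le_trans (ler_normD _ _) _; apply: le_trans (lerD (ler_normD _ _) (lexx _)) _.
have l1 : `|a * (y.1 - x.1)| <= `|a| * `|y - x| by rewrite normrM ler_wpM2l// (norm_fst (y - x)).
have l2 : `|b * (y.2 - x.2)| <= `|b| * `|y - x| by rewrite normrM ler_wpM2l// (norm_snd (y - x)).
rewrite mul1r in h; rewrite !mulrDl mul1r; lra.
Qed.

Lemma grad_mul f g x a b a' b' : grad f x a b -> grad g x a' b' ->
  grad (fun y => f y * g y) x (f x * a' + g x * a) (f x * b' + g x * b).
Proof.
move=> gf gg e e0.
pose C := `|a| + `|b| + 1; pose C' := `|a'| + `|b'| + 1.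
have C0 : 0 < C by rewrite /C ltr_pwDr// addr_ge0.
have C'0 : 0 < C' by rewrite /C' ltr_pwDr// addr_ge0.
pose k := `|f x| + `|g x| + 1.
have k0 : 0 < k by rewrite /k ltr_pwDr// addr_ge0.
have e3 : 0 < e / (3 * k) by rewrite divr_gt0// mulr_gt0.
have d3 : 0 < e / (3 * (C * C')) by rewrite divr_gt0// !mulr_gt0.
near=> y.
have h1 : `|f y - f x - (a * (y.1 - x.1) + b * (y.2 - x.2))| <= e / (3 * k) * `|y - x|.
  by near: y; exact: gf.
have h2 : `|g y - g x - (a' * (y.1 - x.1) + b' * (y.2 - x.2))| <= e / (3 * k) * `|y - x|.
  by near: y; exact: gg.
have h3 : `|f y - f x| <= C * `|y - x| by near: y; exact: grad_bd.
have h4 : `|g y - g x| <= C' * `|y - x| by near: y; exact: grad_bd.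
have h5 : `|y - x| <= e / (3 * (C * C')).
  by near: y; apply/near_normP; exists (e / (3 * (C * C'))) => // z /ltW.
set r := _ - _.
have -> : r = f x * (g y - g x - (a' * (y.1 - x.1) + b' * (y.2 - x.2))) +
  g x * (f y - f x - (a * (y.1 - x.1) + b * (y.2 - x.2))) + (f y - f x) * (g y - g x).
  by rewrite /r; ring.
apply: le_trans (ler_normD _ _) _; apply: le_trans (lerD (ler_normD _ _) (lexx _)) _.
rewrite !normrM.
set N := `|y - x| in h1 h2 h3 h4 h5 *; have N0 : 0 <= N by exact: normr_ge0.
have b3 : `|f y - f x| * `|g y - g x| <= e / 3 * N.
  apply: le_trans (ler_pM (normr_ge0 _) (normr_ge0 _) h3 h4) _.
  have -> : C * N * (C' * N) = (C * C') * N * N by ring.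
  rewrite ler_wpM2r//; apply: le_trans (ler_wpM2l (mulr_ge0 (ltW C0) (ltW C'0)) h5) _.
  by rewrite le_eqVlt; apply/orP; left; apply/eqP; field; rewrite ?gt_eqF.
have b1 : `|f x| * `|g y - g x - (a' * (y.1 - x.1) + b' * (y.2 - x.2))| <= `|f x| * (e / (3 * k) * N).
  exact: ler_wpM2l.
have b2 : `|g x| * `|f y - f x - (a * (y.1 - x.1) + b * (y.2 - x.2))| <= `|g x| * (e / (3 * k) * N).
  exact: ler_wpM2l.
have b4 : (`|f x| + `|g x|) * (e / (3 * k) * N) <= e / 3 * N.
  rewrite mulrA ler_wpM2r//.
  rewrite (_ : e / 3 = k * (e / (3 * k))); last by field; rewrite gt_eqF.
  by rewrite ler_wpM2r ?(ltW e3)// lerDl.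
rewrite mulrDl in b4.
have -> : e * N = e / 3 * N + e / 3 * N + e / 3 * N by field.
have : 0 <= e / 3 * N by rewrite mulr_ge0// divr_ge0// ltW.
lra.
Unshelve. all: by end_near. Qed.

End WeakDerivative.

(** * Uniqueness of weak derivatives *)

Section TestFunctions.
Variable R : realType.
Implicit Types (D : set (plane R)) (f g phi psi : plane R -> R) (x y v c : plane R).

Lemma innerE D f g : inner D f g = I2 D (fun x => f x * g x).
Proof. by []. Qed.

Lemma pae_setT D (Q : plane R -> Prop) : pae D Q -> pae setT (fun x => D x -> Q x).
Proof.
by move=> [N [a b h]]; exists N; split => // x /= nx; apply: h => /= h; apply: nx => _.
Qed.

Lemma cvg_cst0_eq (l : R) : (fun _ : nat => (0 : R)) @ \oo --> l -> l = 0.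
Proof. by move=> /(cvg_unique (@Rhausdorff R)); apply; exact: cvg_cst. Qed.

Lemma compact_closed_plane (K : set (plane R)) : compact K -> closed K.
Proof. by apply: compact_closed; exact: norm_hausdorff. Qed.

Lemma test_smooth D phi : test_function D phi -> smooth phi. Proof. by case. Qed.

Lemma near_compl (K : set (plane R)) x : compact K -> ~ K x -> \forall y \near x, ~ K y.
Proof.
move=> cK nK; apply: open_nbhs_nbhs; split => //.
by have := compact_closed_plane cK; rewrite -openC.
Qed.

Lemma test_D_supp D phi : test_function D phi -> exists K, [/\ compact K, K `<=` D,
  forall x, ~ K x -> phi x = 0 & forall x v, ~ K x -> 'D_v phi x = 0].
Proof.
move=> [sp [K [cK KD hK]]]; exists K; split => // x v nK.
have : \forall y \near x, phi y = (cst 0 : plane R -> R) y.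
  by apply: filterS (near_compl cK nK) => y; exact: hK.
by move=> /near_eq_derive ->; rewrite derive_cst.
Qed.

Lemma bounded_supp f (K : set (plane R)) : continuous f -> compact K -> (forall x, ~ K x -> f x = 0) ->
  exists2 C : R, 0 <= C & forall x, `|f x| <= C.
Proof.
move=> cf cK f0; have [M M0 KM] := compact_pbox_sub cK.
have ne : pbox (0 : plane R) M !=set0 by exists 0; rewrite /pbox /= subrr normr0.
have cF : {within pbox (0 : plane R) M, continuous (fun x => `|f x|)}.
  by apply: continuous_subspaceT => x; apply: continuous_comp; [exact: cf|exact: norm_continuous].
have [c cI hc] := compact_EVT_max ne (@compact_pbox _ 0 M) cF.
exists `|f c| => // x; have [Kx|nK] := pselect (K x); last by rewrite f0// normr0.
by apply: hc; rewrite inE; exact: KM.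
Qed.

Lemma smooth_D_cont f v : smooth f -> continuous (fun x => 'D_v f x).
Proof. by move=> sf; apply: smooth_cont; exact: smooth_D. Qed.

Lemma test_bounds D phi : test_function D phi -> exists C : R, [/\ 0 <= C,
  forall x, `|phi x| <= C, forall x, `|'D_(ex R) phi x| <= C, forall x, `|'D_(ey R) phi x| <= C &
  forall x, C < `|x| -> phi x = 0 ].
Proof.
move=> tp; have sp := test_smooth tp.
have [K [cK KD h1 h2]] := test_D_supp tp.
have [C1 C10 H1] := bounded_supp (smooth_cont sp) cK h1.
have [C2 C20 H2] := bounded_supp (smooth_D_cont (v := ex R) sp) cK (fun x => @h2 x (ex R)).
have [C3 C30 H3] := bounded_supp (smooth_D_cont (v := ey R) sp) cK (fun x => @h2 x (ey R)).
have [M M0 KM] := compact_pbox_sub cK.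
exists (C1 + C2 + C3 + M); split.
- by rewrite !addr_ge0.
- by move=> x; apply: le_trans (H1 x) _; lra.
- by move=> x; apply: le_trans (H2 x) _; lra.
- by move=> x; apply: le_trans (H3 x) _; lra.
- move=> x hx; apply: h1 => /KM; rewrite /pbox /= subr0 => hM.
  by have := lt_le_trans hx hM; lra.
Qed.

Lemma test_grad D phi x : test_function D phi ->
  grad phi x ('D_(ex R) phi x) ('D_(ey R) phi x).
Proof. by move=> tp; apply: grad_diff; apply: smooth_diff; exact: test_smooth tp. Qed.

Lemma test_lip D phi : test_function D phi -> exists2 L : R, 0 <= L & lip L phi.
Proof.
move=> tp; have [C [C0 h1 h2 h3 h4]] := test_bounds tp.
exists (2 * C + 1); first lra.
apply: (grad_lip (a := fun x => 'D_(ex R) phi x) (b := fun x => 'D_(ey R) phi x)).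
- exact: smooth_cont (test_smooth tp).
- by move=> x; exact: test_grad tp.
- by [].
Qed.

Lemma lip_mul f g (L L' C C' : R) : lip L f -> lip L' g ->
  (forall x, `|f x| <= C) -> (forall x, `|g x| <= C') -> lip (C * L' + C' * L) (fun x => f x * g x).
Proof.
move=> lf lg fC gC x y.
have -> : f x * g x - f y * g y = f x * (g x - g y) + g y * (f x - f y) by ring.
apply: le_trans (ler_normD _ _) _; rewrite !normrM mulrDl -!mulrA.
by apply: lerD; apply: ler_pM.
Qed.

Lemma I2_supp D h : (forall x, ~ D x -> h x = 0) -> I2 D h = I2 setT h.
Proof.
move=> h0; rewrite I2_mkcond; congr I2; apply/funext => x; rewrite patchE.
by case: ifPn => // /negP nD; rewrite h0// => Dx; apply: nD; rewrite inE.
Qed.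

(** The product of f and phi is Lipschitz with bounded support, so its directional derivative has
    integral zero; the product rule splits it almost everywhere on D, and outside D its gradient is
    zero. *)
Lemma by_parts D f phi (L M : R) (g1 g2 : plane R -> R) v : pmeas D ->
  lip L (fun x => f x * phi x) -> (forall x, M < `|x| -> phi x = 0) ->
  (forall x, ~ D x -> phi x = 0 /\ 'D_v phi x = 0) ->
  measf D f -> measf D g1 -> measf D g2 -> smooth phi ->
  pintg D (fun x => f x * 'D_v phi x) -> pintg D (fun x => (v.1 * g1 x + v.2 * g2 x) * phi x) ->
  pae D (fun x => grad f x (g1 x) (g2 x)) -> pae (~` D) (fun x => grad (fun x => f x * phi x) x 0 0) ->
  inner D f (fun x => 'D_v phi x) = - inner D (fun x => v.1 * g1 x + v.2 * g2 x) phi.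
Proof.
move=> mD lF s0 s1 mf m1 m2 sp i1 i2 hD hC.
pose G x := f x * 'D_v phi x + (v.1 * g1 x + v.2 * g2 x) * phi x.
have iG : pintg D G by exact: pintgD.
have mG : measf setT (G \_ D) by apply: measf_restrict => //; exact: pintg_measf.
apply/eqP; rewrite -subr_eq0 opprK !innerE -I2D//; apply/eqP.
rewrite I2_mkcond; apply: (int_deriv0 lF (M := M) (v := v)) => //.
  by move=> x hx; rewrite s0// mulr0.
have h1 : pae setT (fun x => D x -> grad f x (g1 x) (g2 x)) by exact: pae_setT.
have h2 : pae setT (fun x => ~ D x -> grad (fun x => f x * phi x) x 0 0) by exact: pae_setT.
apply: pae_imp (pae_and h1 h2) => x _ [H1 H2].
rewrite patchE; case: ifPn => [/set_mem Dx|/negP nD].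
  have gp := grad_diff (smooth_diff x sp).
  have E : f x * 'D_v phi x + (v.1 * g1 x + v.2 * g2 x) * phi x =
    (f x * 'D_(ex R) phi x + phi x * g1 x) * v.1 + (f x * 'D_(ey R) phi x + phi x * g2 x) * v.2.
    rewrite (deriveE2 v (smooth_diff x sp)).
    by move: ('D_(ex R) phi x) ('D_(ey R) phi x) => d1 d2; ring.
  have H := grad_dq (v := v) (grad_mul (H1 Dx) gp).
  rewrite E; exact H.
have nDx : ~ D x by move=> Dx; apply: nD; rewrite inE.
have := grad_dq (v := v) (H2 nDx).
by rewrite !mul0r addr0.
Qed.

Lemma test_measf D phi : test_function D phi -> measf setT phi.
Proof. by move=> tp; apply: measf_cont; apply: smooth_cont; exact: test_smooth tp. Qed.

Lemma test_D_measf D phi v : test_function D phi -> measf setT (fun x => 'D_v phi x).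
Proof. by move=> tp; apply: measf_cont; apply: smooth_D_cont; exact: test_smooth tp. Qed.

Lemma test_D_bounds D phi v : test_function D phi -> exists C : R, [/\ 0 <= C,
  forall x, `|'D_v phi x| <= C & forall x, C < `|x| -> 'D_v phi x = 0 ].
Proof.
move=> tp; have [K [cK KD h1 h2]] := test_D_supp tp.
have [C C0 H] := bounded_supp (smooth_D_cont (v := v) (test_smooth tp)) cK (fun x => @h2 x v).
have [M M0 KM] := compact_pbox_sub cK.
exists (C + M); split; first by rewrite addr_ge0.
  by move=> x; apply: le_trans (H x) _; lra.
move=> x hx; apply: h2 => /KM; rewrite /pbox /= subr0 => hM.
by have := lt_le_trans hx hM; lra.
Qed.

Lemma supp_L2 D f (C M : R) : pmeas D -> measf setT f -> (forall x, `|f x| <= C) ->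
  (forall x, M < `|x| -> f x = 0) -> L2 D f.
Proof.
move=> mD mf fC f0; apply/L2P => //; split; first exact: measfT.
apply: (pintgS mD (@pmeasT R)) => //.
apply: (pintg_supp (M := M) (C := C ^+ 2)).
- exact: measfX.
- by move=> x; rewrite normrX lerXn2r// nnegrE// (le_trans _ (fC x)).
- by move=> x /f0 ->; rewrite expr0n.
Qed.

Lemma test_L2 D E phi : pmeas E -> test_function D phi -> L2 E phi.
Proof.
move=> mE tp; have [C [C0 h1 h2 h3 h4]] := test_bounds tp.
by apply: supp_L2 h1 h4 => //; exact: test_measf tp.
Qed.
Lemma test_D_L2 D E phi v : pmeas E -> test_function D phi -> L2 E (fun x => 'D_v phi x).
Proof.
move=> mE tp; have [C [C0 h1 h2]] := test_D_bounds v tp.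
by apply: supp_L2 h1 h2 => //; exact: test_D_measf tp.
Qed.

Lemma test_weak D phi v : open D -> test_function D phi -> weak_deriv D v phi (fun x => 'D_v phi x).
Proof.
move=> oD tp psi tq.
have mD := pmeas_open oD.
have [C [C0 h1 h2 h3 h4]] := test_bounds tp; have [C' [C'0 h1' h2' h3' h4']] := test_bounds tq.
have [L L0 lp] := test_lip tp; have [L' L'0 lq] := test_lip tq.
have [K [cK KD k1 k2]] := test_D_supp tq.
have -> : (fun x => 'D_v phi x) = (fun x => v.1 * 'D_(ex R) phi x + v.2 * 'D_(ey R) phi x).
  by apply/funext => x; rewrite (deriveE2 _ (smooth_diff x (test_smooth tp))).
apply: (by_parts mD (lip_mul lp lq h1 h1') h4').
- by move=> x nD; split; [apply: k1|apply: k2] => /KD.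
- by apply: measfT; exact: test_measf tp.
- by apply: measfT; exact: test_D_measf tp.
- by apply: measfT; exact: test_D_measf tp.
- exact: test_smooth tq.
- by apply: L2_pintgM => //; [exact: test_L2 tp|exact: test_D_L2 tq].
- apply: L2_pintgM => //; last exact: test_L2 tq.
  by apply: L2D => //; apply: L2Z => //; exact: test_D_L2 tp.
- by apply: pae_all => x _; exact: test_grad tp.
- apply: pae_all => x nD; apply: (grad_near (f := fun=> 0)); last exact: grad_cst.
  have nK : ~ K x by move=> /KD.
  by apply: filterS (near_compl cK nK) => y /k1 ->; rewrite mulr0.
Qed.

(** * Fundamental lemma of the calculus of variations *)

Section Fundamental.
Variables (D : set (plane R)) (g : plane R -> R).
Hypotheses (oD : open D) (Lg : L2 D g) (g0 : forall phi, test_function D phi -> inner D g phi = 0).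
Let mD := pmeas_open oD.

Definition cbox (a b a' b' : R) : set (plane R) := `[a, b]%classic `*` `[a', b']%classic.
Lemma pmeas_cbox a b a' b' : pmeas (cbox a b a' b').
Proof. by apply: pmeas_box; exact: measurable_itv. Qed.
Lemma compact_cbox a b a' b' : compact (cbox a b a' b').
Proof. by apply: compact_setX; exact: segment_compact. Qed.

Lemma pintg_cbox a b a' b' : cbox a b a' b' `<=` D -> pintg (cbox a b a' b') g.
Proof.
move=> cD; have [M _ hM] := compact_pbox_sub (@compact_cbox a b a' b').
have mC := @pmeas_cbox a b a' b'.
apply: L2_pintg => //; last exact: L2S Lg.
by apply: mu2_lty hM.
Qed.

(** A smooth approximation from below of the indicator of ]a, b[, with transitions of width 1 / (n +
    1) at both ends. *)
Definition bump1 (n : nat) (a b t : R) : R := step (n.+1%:R * t + - (n.+1%:R * a)) * step (- n.+1%:R * t + n.+1%:R * b).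

Lemma bump1_01 n a b t : 0 <= bump1 n a b t <= 1.
Proof. by rewrite /bump1 mulr_ge0 ?step_ge0//= mulr_ile1 ?step_ge0 ?step_le1. Qed.

Lemma bump1_out n a b t : t <= a \/ b <= t -> bump1 n a b t = 0.
Proof.
have n0 : 0 < (n.+1%:R : R) by rewrite ltr0n.
move=> [h|h]; rewrite /bump1.
  by rewrite step_le0 ?mul0r// subr_le0 ler_pM2l.
by rewrite [step (- _ * _ + _)]step_le0 ?mulr0// mulNr addrC subr_le0 ler_pM2l.
Qed.

Lemma bump1_in a b t : a < t < b -> \forall n \near \oo, bump1 n a b t = 1.
Proof.
move=> /andP[at_ tb].
have d1 : 0 < t - a by rewrite subr_gt0.
have d2 : 0 < b - t by rewrite subr_gt0.
near=> n.
have n0 : 0 < (n.+1%:R : R) by rewrite ltr0n.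
have nd1 : n.+1%:R^-1 < t - a by near: n; exact: (near_infty_natSinv_lt (PosNum d1)).
have nd2 : n.+1%:R^-1 < b - t by near: n; exact: (near_infty_natSinv_lt (PosNum d2)).
rewrite /bump1; move: nd1 nd2 n0; move: (n.+1%:R : R) => N nd1 nd2 n0.
have e1 : 1 <= N * (t - a) by rewrite -ler_pdivrMl ?mulr1 ?ltW.
have e2 : 1 <= N * (b - t) by rewrite -ler_pdivrMl ?mulr1 ?ltW.
by rewrite !step_ge1 ?mulr1//; lra.
Unshelve. all: by end_near. Qed.

Lemma sm_bump1 n a b : sm (bump1 n a b).
Proof. by apply: sm_mul; apply: sm_aff; exact: sm_step. Qed.

(** Products of two cutoffs are test functions that converge to the indicator of the open box, and
    |g| on the closed box dominates. *)
Lemma fund_box a b a' b' : cbox a b a' b' `<=` D -> I2 (obox a b a' b') g = 0.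
Proof.
move=> cD; have mC := @pmeas_cbox a b a' b'.
pose eta n (x : plane R) := bump1 n a b x.1 * bump1 n a' b' x.2.
have eta0 n x : ~ obox a b a' b' x -> eta n x = 0.
  move=> /= nO; rewrite /eta.
  have [h|h] := pselect (x.1 <= a \/ b <= x.1); first by rewrite bump1_out// mul0r.
  have [h'|h'] := pselect (x.2 <= a' \/ b' <= x.2); first by rewrite [bump1 n a' b' _]bump1_out// mulr0.
  exfalso; apply: nO; rewrite /obox; split => /=; rewrite in_itv /=.
    by apply/andP; split; rewrite ltNge; apply/negP => ?; apply: h; [left|right].
  by apply/andP; split; rewrite ltNge; apply/negP => ?; apply: h'; [left|right].
have OC : obox a b a' b' `<=` cbox a b a' b'.
  by move=> x [/=]; rewrite !in_itv /= => /andP[? ?] /andP[? ?]; split; rewrite /= in_itv /= !ltW.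
have te n : test_function D (eta n).
  split; first by apply: sm2_smooth; apply: sm2_tens; exact: sm_bump1.
  exists (cbox a b a' b'); split => //; first exact: compact_cbox.
  by move=> x nC; apply: eta0 => /OC.
have meta n : measf setT (eta n) by exact: test_measf (te n).
have ig := pintg_cbox cD.
have mg := pintg_measf ig.
pose h x := g x * \1_(obox a b a' b') x.
have h1 x : h x = (g \_ (obox a b a' b')) x.
  by rewrite /h patchE indicE; case: ifPn => _; rewrite ?mulr1 ?mulr0.
have hC : I2 (cbox a b a' b') h = I2 (obox a b a' b') g.
  rewrite I2_mkcond (I2_mkcond (obox _ _ _ _)); congr I2; apply/funext => x.
  rewrite patchE; case: ifPn => [_|/negP nC]; first by rewrite h1.
  rewrite patchE ifN//; apply/negP => h2; apply: nC; rewrite inE; apply: OC.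
  by rewrite inE in h2.
rewrite -hC.
have := @I2_dct _ (cbox a b a' b') (fun n x => g x * eta n x) h (fun x => `|g x|) mC.
have -> : (fun n => I2 (cbox a b a' b') (fun x => g x * eta n x)) = (fun=> 0).
  apply/funext => n; rewrite -(g0 (te n)) innerE I2_mkcond (I2_mkcond D).
  congr I2; apply/funext => x; rewrite !patchE.
  case: ifPn => [/set_mem Cx|/negP nC]; first by rewrite mem_set//; exact: cD.
  by case: ifP => // _; rewrite eta0 ?mulr0// => /OC Cx; apply: nC; rewrite inE.
move=> H; apply: cvg_cst0_eq; apply: H.
- by move=> n; apply: measfM => //; exact: measfT.
- apply: (measf_eq (f := g \_ (obox a b a' b'))); first by move=> x _; rewrite h1.
  apply: measfT; apply: measf_restrict; first exact: pmeas_obox.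
  exact: measfS mg.
- apply: pae_all => x _.
  have [Ox|nO] := pselect (obox a b a' b' x).
    apply: cvg_near_cst; case: (Ox) => /=; rewrite !in_itv /= => /bump1_in e1 /bump1_in e2.
    apply: filterS2 e1 e2 => n e1 e2; apply/eqP.
    by rewrite /eta /h e1 e2 indicE mem_set// mulr1.
  apply: cvg_near_cst; apply: nearW => n; apply/eqP.
  by rewrite eta0// /h indicE memNset.
- exact: pintg_norm.
- move=> n x _; rewrite normrM ler_piMr// ger0_norm; last first.
    by rewrite /eta mulr_ge0//; [have /andP[] := bump1_01 n a b x.1|have /andP[] := bump1_01 n a' b' x.2].
  have /andP[p1 p2] := bump1_01 n a b x.1; have /andP[p3 p4] := bump1_01 n a' b' x.2.
  exact: mulr_ile1.
Qed.

(* Dynkin's pi-lambda theorem for A |-> \int_(h A) g. *)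
Lemma dynkin_int (T : Type) (G : set (set T)) (h : set T -> set (plane R)) (U : set (plane R)) :
  pmeas U -> pintg U g -> setI_closed G ->
  h setT = U -> (forall A B, h (A `\` B) = h A `\` h B) ->
  (forall A : (set T)^nat, h (\bigcup_n A n) = \bigcup_n h (A n)) ->
  (forall A B, A `<=` B -> h A `<=` h B) ->
  (forall A, G A -> pmeas (h A)) -> I2 U g = 0 ->
  (forall A, G A -> I2 (h A) g = 0) ->
  forall A, <<s G >> A -> pmeas (h A) /\ I2 (h A) g = 0.
Proof.
move=> mU iU GI hT hD hU hS mG I0 IG.
pose E := [set A : set T | pmeas (h A) /\ I2 (h A) g = 0].
have hsub A : h A `<=` U by rewrite -hT; apply: hS.
suff : <<s G >> `<=` E by move=> h1 A /h1.
have GE : G `<=` E by move=> A GA; split; [exact: mG|exact: IG].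
suff lE : lambda_system setT E by exact: lambda_system_subset.
split => //.
- by rewrite /E /= hT.
- move=> A B BA [mA IA] [mB IB]; rewrite /E /= hD.
  have mAB := pmeasD mA mB; split => //.
  have iA : pintg (h A) g by exact: pintgS (hsub A) iU.
  have e : (h A `\` h B) `|` h B = h A.
    by apply/seteqP; split => x; [move=> [[]|/(hS _ _ BA)]|move=> hx; have [] := pselect (h B x); [right|left]].
  have dj : pnull ((h A `\` h B) `&` h B).
    by rewrite (_ : _ `&` _ = set0); [exact: pnull0|rewrite -subset0 => x [[]]].
  have := @I2_setU _ _ _ g mAB mB dj; rewrite e IA IB addr0 => /(_ iA) <-.
  by [].
- move=> A ndA EA; rewrite /E /= hU; split.
    by apply: bigcup_measurable => n _; have [] := EA n.
  have mA n : pmeas (h (A n)) by have [] := EA n.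
  have mbig : pmeas (\bigcup_n h (A n)) by apply: bigcup_measurable => n _; exact: mA.
  rewrite I2_mkcond.
  have mgU := pintg_measf iU.
  have := @I2_dct _ U (fun n => g \_ (h (A n))) (g \_ (\bigcup_n h (A n))) (fun x => `|g x|) mU.
  have E1 B : pmeas B -> B `<=` U -> I2 U (g \_ B) = I2 B g.
    move=> mB BU; rewrite I2_supp ?(I2_mkcond B)// => x nU; rewrite patchE ifN//.
    by apply/negP; rewrite inE => /BU.
  have -> : (fun n => I2 U (g \_ (h (A n)))) = (fun=> 0).
    by apply/funext => n; rewrite E1//; have [] := EA n.
  rewrite E1//; last by move=> x [n _] /hsub.
  rewrite -I2_mkcond => H; apply: cvg_cst0_eq; apply: H.
  + by move=> n; apply: measfT; apply: measf_restrict => //; exact: measfS mgU.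
  + by apply: measfT; apply: measf_restrict => //; apply: measfS mgU => // x [n _] /hsub.
  + apply: pae_all => x _; apply: cvg_near_cst.
    have [[n _ hn]|nb] := pselect ((\bigcup_n h (A n)) x).
      exists n => // m /= nm; apply/eqP; rewrite !patchE !mem_set//; first by exists n.
      by apply: hS hn; apply/subsetPset; exact: ndA.
    apply: nearW => n; apply/eqP; rewrite !patchE !memNset//.
    by move=> hn; apply: nb; exists n.
  + exact: pintg_norm.
  + by move=> n x _; rewrite patchE; case: ifP => // _; rewrite normr0.
Qed.

Lemma setI_closed_itvoo : setI_closed (@RGenOpens.G R).
Proof.
move=> _ _ [a [b ->]] [c [d ->]]; exists (Num.max a c), (Num.min b d).
apply/seteqP; split => x /=; rewrite !in_itv /= gt_max lt_min.
  by move=> [/andP[-> ->] /andP[-> ->]].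
by move=> /andP[/andP[-> ->] /andP[-> ->]].
Qed.

(** Three applications of the pi-lambda argument: measurable sets replace intervals in the first
    factor, then in the second, and then measurable rectangles generate all measurable sets of the
    plane. *)
Lemma fund_open_box a b a' b' (X : set (plane R)) : cbox a b a' b' `<=` D -> pmeas X ->
  I2 (X `&` obox a b a' b') g = 0.
Proof.
move=> cD mX; set U := obox a b a' b'.
have mU : pmeas U by exact: pmeas_obox.
have OC : U `<=` cbox a b a' b'.
  by move=> x [/=]; rewrite !in_itv /= => /andP[? ?] /andP[? ?]; split; rewrite /= in_itv /= !ltW.
have iU : pintg U g by apply: pintgS (pintg_cbox cD) => //; exact: pmeas_cbox.
have IU : I2 U g = 0 by exact: fund_box.
have sub1 (c d c' d' : R) : cbox (Num.max a c) (Num.min b d) (Num.max a' c') (Num.min b' d') `<=` D.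
  move=> x [/=]; rewrite !in_itv /= !ge_max !le_min => /andP[/andP[? ?] /andP[? ?]] /andP[/andP[? ?] /andP[? ?]].
  by apply: cD; split; rewrite /= in_itv /=; apply/andP.
have obI (c d c' d' : R) : (`]c, d[%classic `*` `]c', d'[%classic) `&` U =
   obox (Num.max a c) (Num.min b d) (Num.max a' c') (Num.min b' d').
  apply/seteqP; split => x; rewrite /U /obox /=; rewrite !in_itv /= !gt_max !lt_min.
    by move=> [[/andP[-> ->] /andP[-> ->]] [/andP[-> ->] /andP[-> ->]]].
  by move=> [/andP[/andP[-> ->] /andP[-> ->]] /andP[/andP[-> ->] /andP[-> ->]]].
have s1 (A : set R) (c' d' : R) : measurable A -> pmeas ((A `*` `]c', d'[%classic) `&` U) /\
    I2 ((A `*` `]c', d'[%classic) `&` U) g = 0.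
  move=> mA.
  have mU' : pmeas (([set: R] `*` `]c', d'[%classic) `&` U).
    by apply: pmeasI => //; apply: pmeas_box => //; exact: measurable_itv.
  apply: (@dynkin_int R (@RGenOpens.G R) (fun A => (A `*` `]c', d'[%classic) `&` U)
    (([set: R] `*` `]c', d'[%classic) `&` U) mU') => //.
  - by apply: pintgS iU => // x [].
  - exact: setI_closed_itvoo.
  - by move=> B C; apply/seteqP; split=> x /=; tauto.
  - move=> B; apply/seteqP; split=> x /=.
      by move=> [[[n _ Bn] hx] Ux]; exists n.
    by move=> [n _ [[Bn hx] Ux]]; split => //; split => //; exists n.
  - by move=> B C BC x [[/BC ? ?] ?].
  - by move=> _ [c [d ->]]; rewrite obI; exact: pmeas_obox.
  - have -> : ([set: R] `*` `]c', d'[%classic) `&` U = (`]a, b[%classic `*` `]c', d'[%classic) `&` U.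
      by apply/seteqP; split=> x; rewrite /U /obox /=; tauto.
    by rewrite obI; apply: fund_box.
  - by move=> _ [c [d ->]]; rewrite obI; apply: fund_box.
  - have : (@RGenOpens.G R).-sigma.-measurable A by rewrite -RGenOpens.measurableE.
    by [].
have s2 (A B : set R) : measurable A -> measurable B -> pmeas ((A `*` B) `&` U) /\ I2 ((A `*` B) `&` U) g = 0.
  move=> mA mB.
  have mU' : pmeas ((A `*` [set: R]) `&` U) by apply: pmeasI => //; exact: pmeas_box.
  apply: (@dynkin_int R (@RGenOpens.G R) (fun B => (A `*` B) `&` U) ((A `*` [set: R]) `&` U) mU') => //.
  - by apply: pintgS iU => // x [].
  - exact: setI_closed_itvoo.
  - by move=> C C'; apply/seteqP; split=> x /=; tauto.
  - move=> C; apply/seteqP; split=> x /=.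
      by move=> [[hx [n _ Bn]] Ux]; exists n.
    by move=> [n _ [[hx Bn] Ux]]; split => //; split => //; exists n.
  - by move=> C C' CC x [[? /CC ?] ?].
  - by move=> _ [c [d ->]]; have [] := s1 A c d mA.
  - have -> : (A `*` [set: R]) `&` U = (A `*` `]a', b'[%classic) `&` U.
      by apply/seteqP; split=> x; rewrite /U /obox /=; tauto.
    by have [] := s1 A a' b' mA.
  - by move=> _ [c [d ->]]; have [] := s1 A c d mA.
  - have : (@RGenOpens.G R).-sigma.-measurable B by rewrite -RGenOpens.measurableE.
    by [].
pose G3 : set (set (plane R)) := [set C | exists2 A : set R, measurable A & exists2 B : set R, measurable B & A `*` B = C].
suff : pmeas (X `&` U) /\ I2 (X `&` U) g = 0 by case.
apply: (@dynkin_int (plane R) G3 (fun C => C `&` U) U) => //.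
- move=> _ _ [A mA [B mB <-]] [A' mA' [B' mB' <-]].
  exists (A `&` A'); first exact: measurableI.
  by exists (B `&` B'); [exact: measurableI|rewrite setXI].
- by rewrite setTI.
- by move=> C C'; apply/seteqP; split=> x /=; tauto.
- by move=> C; rewrite setI_bigcupl.
- by move=> C C' CC x [/CC].
- by move=> _ [A mA [B mB <-]]; have [] := s2 A B mA mB.
- by move=> _ [A mA [B mB <-]]; have [] := s2 A B mA mB.
- by move: mX; rewrite /pmeas measurable_prod_measurableType.
Qed.

(** The integral vanishes over the parts of the box where g is positive and where it is negative, so
    both parts are null. *)
Lemma fund_ae_box a b a' b' : cbox a b a' b' `<=` D -> pae (obox a b a' b') (fun x => g x = 0).
Proof.
move=> cD; set U := obox a b a' b'.
have mU : pmeas U by exact: pmeas_obox.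
have OC : U `<=` cbox a b a' b'.
  by move=> x [/=]; rewrite !in_itv /= => /andP[? ?] /andP[? ?]; split; rewrite /= in_itv /= !ltW.
have iU : pintg U g by apply: pintgS (pintg_cbox cD) => //; exact: pmeas_cbox.
have mg := pintg_measf iU.
have mP : pmeas (U `&` g @^-1` `]0, +oo[%classic) by apply: mg => //; exact: measurable_itv.
have mN : pmeas (U `&` g @^-1` `]-oo, 0[%classic) by apply: mg => //; exact: measurable_itv.
have hP : pae (U `&` g @^-1` `]0, +oo[%classic) (fun x => g x = 0).
  apply: I2_ae0 => //.
  - by apply: measfS mg => // x [].
  - by move=> x [_ /=]; rewrite in_itv /= andbT => /ltW.
  - by apply: pintgS iU => // x [].
  - by have := fund_open_box cD mP; rewrite setIC setIA setIid.
have hN : pae (U `&` g @^-1` `]-oo, 0[%classic) (fun x => - g x = 0).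
  apply: I2_ae0 => //.
  - by apply: measfN; apply: measfS mg => // x [].
  - by move=> x [_ /=]; rewrite in_itv /= oppr_ge0 => /ltW.
  - by apply: pintgN => //; apply: pintgS iU => // x [].
  - rewrite I2N//; last by apply: pintgS iU => // x [].
    by have := fund_open_box cD mN; rewrite setIC setIA setIid => ->; rewrite oppr0.
have h1 : pae setT (fun x => (U `&` g @^-1` `]0, +oo[%classic) x -> g x = 0) by exact: pae_setT.
have h2 : pae setT (fun x => (U `&` g @^-1` `]-oo, 0[%classic) x -> - g x = 0) by exact: pae_setT.
apply: pae_imp (pae_and (paeS (@subsetT _ U) h1) (paeS (@subsetT _ U) h2)) => x Ux [H1 H2].
have [h|h|//] := ltgtP (g x) 0.
  by apply/eqP; rewrite -oppr_eq0; apply/eqP; apply: H2; split => //=; rewrite in_itv.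
by apply: H1; split => //=; rewrite in_itv /= andbT.
Qed.

Lemma fund_lemma : pae D (fun x => g x = 0).
Proof.
(* The exceptional sets of the countably many rational boxes; an index that codes no box, or a box
   whose closure leaves D, contributes the empty set. *)
pose F (n : nat) : set (plane R) := match (choice.unpickle n : option (rat * rat * rat)) with
  | Some t => let B := obox (ratr t.1.1 - ratr t.2) (ratr t.1.1 + ratr t.2) (ratr t.1.2 - ratr t.2) (ratr t.1.2 + ratr t.2) in
     if `[< cbox (ratr t.1.1 - ratr t.2) (ratr t.1.1 + ratr t.2) (ratr t.1.2 - ratr t.2) (ratr t.1.2 + ratr t.2) `<=` D >]
     then [set x | B x /\ g x <> 0] else set0
  | None => set0 end.
have nF n : pnull (F n).
  rewrite /F; case: choice.unpickle => [t|]; last exact: pnull0.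
  case: ifPn => [/asboolP/fund_ae_box|_]; last exact: pnull0.
  move=> [N [mN N0 h]]; exists N; split => // x [Bx gx]; apply: h => /= h.
  exact: gx (h Bx).
have nU : pnull (\bigcup_n F n) by apply: negligible_bigcup => n; exact: nF.
apply: (pae_pnull nU) => x Dx nx; apply: contrapT => gx; apply: nx.
have /near_normP[e e0 be] : nbhs x D by apply: open_nbhs_nbhs; split.
have [r] := rat_in_itvoo (divr_gt0 e0 (ltr0Sn R 2)).
rewrite in_itv/= => /andP[r0 re].
have xr : x.1 < x.1 + ratr r by rewrite ltrDl.
have yr : x.2 < x.2 + ratr r by rewrite ltrDl.
have [p] := rat_in_itvoo xr; rewrite in_itv/= => /andP[p0 pe].
have [q] := rat_in_itvoo yr; rewrite in_itv/= => /andP[q0 qe].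
exists (choice.pickle (p, q, r)); first by [].
rewrite /F choice.pickleK /=; case: ifPn => [_|/asboolP]; last first.
  case=> y [/=]; rewrite !in_itv /= => /andP[? ?] /andP[? ?].
  by apply: be; apply/norm_ltP => /=; rewrite !ltr_norml; split; apply/andP; split; lra.
by split => //; split => /=; rewrite in_itv /=; apply/andP; split; lra.
Qed.

End Fundamental.

Lemma weak_deriv_unique D v f g g' : open D -> L2 D g -> L2 D g' ->
  weak_deriv D v f g -> weak_deriv D v f g' -> pae D (fun x => g x = g' x).
Proof.
move=> oD Lg Lg' wg wg'; have mD := pmeas_open oD.
have : pae D (fun x => g x - g' x = 0).
  apply: fund_lemma => //; first exact: L2B.
  move=> phi tp; rewrite innerE.
  have Lp := test_L2 mD tp.
  rewrite (I2_eq (g := fun x => g x * phi x - g' x * phi x)); last by move=> x _; rewrite mulrBl.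
  rewrite I2B//; [|exact: L2_pintgM|exact: L2_pintgM].
  by have := wg _ tp; rewrite (wg' _ tp) !innerE => /oppr_inj ->; rewrite subrr.
by apply: pae_imp => x _ /eqP; rewrite subr_eq0 => /eqP.
Qed.

(** [wD] is an arbitrary choice; uniqueness identifies it almost everywhere with whichever weak
    derivative is at hand. *)
Lemma wD_spec D v f g : open D -> L2 D g -> weak_deriv D v f g ->
  [/\ L2 D (wD D v f), weak_deriv D v f (wD D v f) & pae D (fun x => wD D v f x = g x)].
Proof.
move=> oD Lg wg.
have [h1 h2] : [set g | L2 D g /\ weak_deriv D v f g] (wD D v f).
  by rewrite /wD; case: xgetP => [y -> []//|/(_ g)]; case; split.
split; [exact: h1|exact: h2|exact: (weak_deriv_unique oD h1 Lg h2 wg)].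
Qed.

Lemma H1_wD D f : open D -> H1 D f -> [/\ L2 D f, L2 D (wD D (ex R) f), L2 D (wD D (ey R) f),
  weak_deriv D (ex R) f (wD D (ex R) f) & weak_deriv D (ey R) f (wD D (ey R) f)].
Proof.
move=> oD [Lf [g Lg wg] [g' Lg' wg']].
by have [? ? _] := wD_spec oD Lg wg; have [? ? _] := wD_spec oD Lg' wg'.
Qed.

Lemma H1norm_sq D f g1 g2 : open D -> L2 D f -> L2 D g1 -> L2 D g2 ->
  weak_deriv D (ex R) f g1 -> weak_deriv D (ey R) f g2 ->
  H1norm D f ^+ 2 = L2norm D f ^+ 2 + L2norm D g1 ^+ 2 + L2norm D g2 ^+ 2.
Proof.
move=> oD Lf L1 L2' w1 w2; have mD := pmeas_open oD.
have [a1 _ c1] := wD_spec oD L1 w1; have [a2 _ c2] := wD_spec oD L2' w2.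
rewrite /H1norm sqr_sqrtr ?addr_ge0 ?sqr_ge0//.
by congr (_ + _ ^+ 2 + _ ^+ 2); [exact: (L2norm_ae mD a1 L1 c1)|exact: (L2norm_ae mD a2 L2' c2)].
Qed.

Lemma weak_derivD D v f g f' g' : pmeas D -> L2 D f -> L2 D g -> L2 D f' -> L2 D g' ->
  weak_deriv D v f f' -> weak_deriv D v g g' ->
  weak_deriv D v (fun x => f x + g x) (fun x => f' x + g' x).
Proof.
move=> mD Lf Lg Lf' Lg' wf wg phi tp.
have Lp := test_L2 mD tp; have Ldp := test_D_L2 v mD tp.
have := wf _ tp; have := wg _ tp; rewrite !innerE => e2 e1.
rewrite (I2_eq (g := fun x => f x * 'D_v phi x + g x * 'D_v phi x)); last by move=> x _; rewrite mulrDl.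
rewrite [in RHS](I2_eq (g := fun x => f' x * phi x + g' x * phi x)); last by move=> x _; rewrite mulrDl.
by rewrite !I2D//; [rewrite e1 e2 opprD|exact: L2_pintgM..].
Qed.

Lemma weak_derivZ D v (c : R) f f' : pmeas D -> L2 D f -> L2 D f' ->
  weak_deriv D v f f' -> weak_deriv D v (fun x => c * f x) (fun x => c * f' x).
Proof.
move=> mD Lf Lf' wf phi tp.
have Lp := test_L2 mD tp; have Ldp := test_D_L2 v mD tp.
have := wf _ tp; rewrite !innerE => e1.
rewrite (I2_eq (g := fun x => c * (f x * 'D_v phi x))); last by move=> x _; rewrite mulrA.
rewrite [in RHS](I2_eq (g := fun x => c * (f' x * phi x))); last by move=> x _; rewrite mulrA.
by rewrite !I2Z//; [rewrite e1 mulrN|exact: L2_pintgM..].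
Qed.

Lemma weak_derivS D E v f f' : pmeas D -> pmeas E -> D `<=` E ->
  weak_deriv E v f f' -> weak_deriv D v f f'.
Proof.
move=> mD mE DE wf phi tp.
have te : test_function E phi.
  by case: tp => sp [K [cK KD h]]; split => //; exists K; split => //; exact: subset_trans KD DE.
have [K [cK KD h1 h2]] := test_D_supp tp.
have := wf _ te; rewrite !innerE => e.
have sub h : (forall x, ~ K x -> h x = 0) -> I2 D h = I2 E h.
  move=> h0; rewrite !I2_supp//; first by move=> x nE; apply: h0 => /KD /DE.
  by move=> x nD; apply: h0 => /KD.
rewrite (sub (fun x => f x * 'D_v phi x)); last by move=> x nK; rewrite h2 ?mulr0.
by rewrite (sub (fun x => f' x * phi x))// => x nK; rewrite h1 ?mulr0.
Qed.

End TestFunctions.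

(** * Lipschitz functions and H1_0 *)

Section QuasiInterpolation.
Variable R : realType.
Implicit Types (x y v : plane R) (G : plane R -> R) (s : R) (N n : nat).

(** Quasi-interpolant on a grid of width s. The shift by N lets natural indices reach negative
    nodes, and b1 and b2 are separate so that partial derivatives have the same form. *)
Definition QI (b1 b2 : R -> R) G s N n x : R :=
  \sum_(i < n) \sum_(j < n) G (s * (i%:R - N%:R), s * (j%:R - N%:R)) *
     (b1 (s^-1 * x.1 + N%:R - i%:R) * b2 (s^-1 * x.2 + N%:R - j%:R)).

Lemma QI_sub b1 b2 G A s N n x :
  QI b1 b2 G s N n x - QI b1 b2 A s N n x = QI b1 b2 (fun y => G y - A y) s N n x.
Proof.
rewrite /QI -sumrB; apply: eq_bigr => i _; rewrite -sumrB; apply: eq_bigr => j _.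
by rewrite mulrBl.
Qed.

(** Only nodes within 2 s of x contribute, and each one-dimensional sum of translates is at most 4
    M. *)
Lemma QI_est (b1 b2 : R -> R) (M eta : R) E s N n x : 0 < s -> 0 <= eta ->
  (forall t, `|b1 t| <= M) -> (forall t, `|b2 t| <= M) ->
  (forall t, t < -1 \/ 2 < t -> b1 t = 0) -> (forall t, t < -1 \/ 2 < t -> b2 t = 0) ->
  (forall y, `|y - x| <= 2 * s -> `|E y| <= eta) ->
  `|QI b1 b2 E s N n x| <= eta * ((4 * M) * (4 * M)).
Proof.
move=> s0 eta0 h1 h2 z1 z2 hE.
have M0 : 0 <= M by apply: le_trans (h1 0).
set u := s^-1 * x.1 + N%:R; set w := s^-1 * x.2 + N%:R.
have h i j : `|E (s * (i%:R - N%:R), s * (j%:R - N%:R)) * (b1 (u - i%:R) * b2 (w - j%:R))| <=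
    eta * (`|b1 (u - i%:R)| * `|b2 (w - j%:R)|) :> R.
  rewrite !normrM.
  have [c1|c1] := pselect (u - i%:R < -1 \/ 2 < u - i%:R).
    by rewrite z1// normr0 mul0r !mulr0.
  have [c2|c2] := pselect (w - j%:R < -1 \/ 2 < w - j%:R).
    by rewrite z2// normr0 !mulr0.
  rewrite ler_wpM2r ?mulr_ge0//; apply: hE; apply/norm_leP => /=.
  have k (t : R) (m : nat) : ~ (s^-1 * t + N%:R - m%:R < -1 \/ 2 < s^-1 * t + N%:R - m%:R) ->
      `|s * (m%:R - N%:R) - t| <= 2 * s.
    move=> nc; have l1 : -1 <= s^-1 * t + N%:R - m%:R by rewrite leNgt; apply/negP => ?; apply: nc; left.
    have l2 : s^-1 * t + N%:R - m%:R <= 2 by rewrite leNgt; apply/negP => ?; apply: nc; right.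
    have -> : s * (m%:R - N%:R) - t = - (s * (s^-1 * t + N%:R - m%:R)) by field; rewrite gt_eqF.
    rewrite normrN normrM gtr0_norm// mulrC ler_pM2r// ler_norml; apply/andP; split; lra.
  by split; exact: k.
rewrite /QI.
apply: (@le_trans _ _ (\sum_(i < n) \sum_(j < n) eta * (`|b1 (u - i%:R)| * `|b2 (w - j%:R)|))).
  apply: le_trans (ler_norm_sum _ _ _) _; apply: ler_sum => i _.
  by apply: le_trans (ler_norm_sum _ _ _) _; apply: ler_sum => j _; exact: h.
have -> : \sum_(i < n) \sum_(j < n) eta * (`|b1 (u - i%:R)| * `|b2 (w - j%:R)|) =
  eta * ((\sum_(i < n) `|b1 (u - i%:R)|) * (\sum_(j < n) `|b2 (w - j%:R)|)).
  rewrite big_distrlr /= mulr_sumr; apply: eq_bigr => i _.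
  by rewrite mulr_sumr.
rewrite ler_wpM2l// ler_pM ?sumr_ge0//; exact: sum_translates.
Qed.

(** The zeroth and first moments of the translates are left as parameters: they are 1 and the
    rescaled coordinate for the bump, 0 and 1 for its derivative. *)
Lemma QI_affine (b1 b2 : R -> R) (c a b al0 al1 be0 be1 : R) s N n x :
  \sum_(k < n) b1 (s^-1 * x.1 + N%:R - k%:R) = al0 ->
  \sum_(k < n) k%:R * b1 (s^-1 * x.1 + N%:R - k%:R) = al1 ->
  \sum_(k < n) b2 (s^-1 * x.2 + N%:R - k%:R) = be0 ->
  \sum_(k < n) k%:R * b2 (s^-1 * x.2 + N%:R - k%:R) = be1 ->
  QI b1 b2 (fun y => c + a * (y.1 - x.1) + b * (y.2 - x.2)) s N n x =
    ((c - a * (s * N%:R + x.1)) * al0 + a * s * al1) * be0 +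
    al0 * (- (b * (s * N%:R + x.2)) * be0 + b * s * be1).
Proof.
move=> <- <- <- <-; rewrite /QI /=.
set u := s^-1 * x.1 + N%:R; set w := s^-1 * x.2 + N%:R.
set P1 := c - _; set P2 := - (b * _).
have -> : P1 * (\sum_(k < n) b1 (u - k%:R)) + a * s * (\sum_(k < n) k%:R * b1 (u - k%:R)) =
    \sum_(k < n) (P1 + a * s * k%:R) * b1 (u - k%:R).
  by rewrite !mulr_sumr -big_split /=; apply: eq_bigr => k _; ring.
have -> : P2 * (\sum_(k < n) b2 (w - k%:R)) + b * s * (\sum_(k < n) k%:R * b2 (w - k%:R)) =
    \sum_(k < n) (P2 + b * s * k%:R) * b2 (w - k%:R).
  by rewrite !mulr_sumr -big_split /=; apply: eq_bigr => k _; ring.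
rewrite !big_distrlr /= -big_split /=.
apply: eq_bigr => i _; rewrite -big_split /=; apply: eq_bigr => j _.
by rewrite /P1 /P2; ring.
Qed.

Lemma diff_sum I (r : seq I) (F : I -> plane R -> R) (a b : I -> R) x :
  (forall i, differentiable (F i) x /\ forall v, 'D_v (F i) x = v.1 * a i + v.2 * b i) ->
  differentiable (fun y => \sum_(i <- r) F i y) x /\
  forall v, 'D_v (fun y => \sum_(i <- r) F i y) x = v.1 * (\sum_(i <- r) a i) + v.2 * (\sum_(i <- r) b i).
Proof.
move=> h; elim: r => [|i r [ihd ihe]].
  under eq_fun do rewrite big_nil; rewrite !big_nil; split; first exact: differentiable_cst.
  by move=> v; rewrite derive_cst !mulr0 addr0.
have [hd he] := h i.
have e : (fun y => \sum_(j <- i :: r) F j y) = F i + (fun y => \sum_(j <- r) F j y).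
  by apply/funext => y; rewrite big_cons.
rewrite e !big_cons; split; first exact: differentiableD.
move=> v; rewrite deriveD; [|exact: diff_derivable|exact: diff_derivable].
by rewrite he ihe; ring.
Qed.

Variables (B B' : R -> R) (M : R).
Hypotheses (sB : sm B) (dB : forall x : R, is_derive x 1 B (B' x))
  (BM : forall t, `|B t| <= M) (BM' : forall t, `|B' t| <= M)
  (B0 : forall t, t < -1 \/ 2 < t -> B t = 0) (B0' : forall t, t < -1 \/ 2 < t -> B' t = 0)
  (Bsum : forall (n : nat) (y : R), 1 < y -> y - n%:R + 1 < 0 ->
        [/\ \sum_(k < n) B (y - k%:R) = 1, \sum_(k < n) k%:R * B (y - k%:R) = y,
            \sum_(k < n) B' (y - k%:R) = 0 & \sum_(k < n) k%:R * B' (y - k%:R) = 1]).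

Lemma QI_sm2 G s N n : sm2 (QI B B G s N n).
Proof.
apply: sm2_sum => i; apply: sm2_sum => j; apply: sm2_Z.
apply: (sm2_tens (al := fun t => B (s^-1 * t + N%:R - i%:R)) (be := fun t => B (s^-1 * t + N%:R - j%:R))).
  by apply: (@sm_eq _ (fun t => B (s^-1 * t + (N%:R - i%:R)))); [apply/funext => t; rewrite addrA|exact: sm_aff].
by apply: (@sm_eq _ (fun t => B (s^-1 * t + (N%:R - j%:R)))); [apply/funext => t; rewrite addrA|exact: sm_aff].
Qed.

(** A partial derivative replaces B by its derivative in one variable and costs 1 / s. *)
Lemma QI_D G s N n x v : 'D_v (QI B B G s N n) x =
  v.1 * (s^-1 * QI B' B G s N n x) + v.2 * (s^-1 * QI B B' G s N n x).
Proof.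
have dt (t : R) (m : nat) : is_derive t 1 (fun t => B (s^-1 * t + N%:R - m%:R)) (s^-1 * B' (s^-1 * t + N%:R - m%:R)).
  have := is_deriveD (is_deriveM (is_derive_cst s^-1 t (1 : R)) (is_derive_id t (1 : R)))
     (is_derive_cst (N%:R - m%:R : R) t (1 : R)).
  move=> /is_derive_conv => /(_ (fun t => s^-1 * t + N%:R - m%:R) s^-1) h.
  rewrite mulrC; apply: (is_derive1_comp (f := B) (g := fun t => s^-1 * t + N%:R - m%:R)) => //.
  apply: h; first by apply/funext => z; rewrite -addrA.
  by rewrite /GRing.scale /=; ring.
have h1 i j : differentiable (fun y : plane R => G (s * (i%:R - N%:R), s * (j%:R - N%:R)) *
     (B (s^-1 * y.1 + N%:R - i%:R) * B (s^-1 * y.2 + N%:R - j%:R))) x /\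
   forall v, 'D_v (fun y : plane R => G (s * (i%:R - N%:R), s * (j%:R - N%:R)) *
     (B (s^-1 * y.1 + N%:R - i%:R) * B (s^-1 * y.2 + N%:R - j%:R))) x =
    v.1 * (s^-1 * (G (s * (i%:R - N%:R), s * (j%:R - N%:R)) * (B' (s^-1 * x.1 + N%:R - i%:R) * B (s^-1 * x.2 + N%:R - j%:R)))) +
    v.2 * (s^-1 * (G (s * (i%:R - N%:R), s * (j%:R - N%:R)) * (B (s^-1 * x.1 + N%:R - i%:R) * B' (s^-1 * x.2 + N%:R - j%:R)))).
  have [d e] := diff_tens (dt x.1 i) (dt x.2 j).
  split; first by apply: (differentiableM _ d); exact: differentiable_cst.
  move=> w; have dw : derivable (fun y : plane R => B (s^-1 * y.1 + N%:R - i%:R) * B (s^-1 * y.2 + N%:R - j%:R)) x w by exact: diff_derivable.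
  apply: (etrans (deriveZ (G (s * (i%:R - N%:R), s * (j%:R - N%:R))) dw)).
  by rewrite e /GRing.scale /=; ring.
have h2 (i : 'I_n) := diff_sum (index_enum 'I_n) (fun j : 'I_n => h1 i j).
have [_ ->] := diff_sum (index_enum 'I_n) h2.
rewrite /QI !mulr_sumr; congr (_ + _); apply: eq_bigr => i _; congr (_ * _).
  by rewrite mulr_sumr.
by rewrite mulr_sumr.
Qed.

(** Affine functions are reproduced together with their gradients, so only the deviation of G from
    an affine function on the stencil counts. *)
Lemma QI_approx G s N n x (c a b eta : R) : 0 < s -> 0 <= eta ->
  1 < s^-1 * x.1 + N%:R -> s^-1 * x.1 + N%:R - n%:R + 1 < 0 ->
  1 < s^-1 * x.2 + N%:R -> s^-1 * x.2 + N%:R - n%:R + 1 < 0 ->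
  (forall y, `|y - x| <= 2 * s -> `|G y - (c + a * (y.1 - x.1) + b * (y.2 - x.2))| <= eta) ->
  [/\ `|QI B B G s N n x - c| <= eta * (16 * M ^+ 2),
      `|s^-1 * QI B' B G s N n x - a| <= s^-1 * (eta * (16 * M ^+ 2)) &
      `|s^-1 * QI B B' G s N n x - b| <= s^-1 * (eta * (16 * M ^+ 2))].
Proof.
move=> s0 eta0 u1 un w1 wn hG.
have [a1 a2 a3 a4] := Bsum u1 un; have [b1 b2 b3 b4] := Bsum w1 wn.
have e16 : (4 * M) * (4 * M) = 16 * M ^+ 2 by ring.
have si : 0 < s^-1 by rewrite invr_gt0.
have f1 := QI_affine c a b a1 a2 b1 b2.
have f2 := QI_affine c a b a3 a4 b1 b2.
have f3 := QI_affine c a b a1 a2 b3 b4.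
have sn : s != 0 by rewrite gt_eqF.
split.
- have := QI_est N n s0 eta0 BM BM B0 B0 hG; rewrite -QI_sub f1 e16.
  by congr (`|_ - _| <= _); field.
- have := QI_est N n s0 eta0 BM' BM B0' B0 hG; rewrite -QI_sub f2 e16 => h.
  have -> : s^-1 * QI B' B G s N n x - a = s^-1 * (QI B' B G s N n x - (((c - a * (s * N%:R + x.1)) * 0 + a * s * 1) * 1 +
    0 * (- (b * (s * N%:R + x.2)) * 1 + b * s * (s^-1 * x.2 + N%:R)))) by field.
  by rewrite normrM gtr0_norm// ler_pM2l.
- have := QI_est N n s0 eta0 BM BM' B0 B0' hG; rewrite -QI_sub f3 e16 => h.
  have -> : s^-1 * QI B B' G s N n x - b = s^-1 * (QI B B' G s N n x - (((c - a * (s * N%:R + x.1)) * 1 + a * s * (s^-1 * x.1 + N%:R)) * 0 +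
    1 * (- (b * (s * N%:R + x.2)) * 0 + b * s * 1))) by field.
  by rewrite normrM gtr0_norm// ler_pM2l.
Qed.

(** Soft thresholding: it is nonexpansive and kills small values, which turns zero boundary values
    into compact support. *)
Definition sth (d t : R) : R := if d < t then t - d else if t < - d then t + d else 0.

Lemma sth_near d t : 0 <= d -> `|sth d t - t| <= d.
Proof.
move=> d0; rewrite /sth; case: ltP => h1; first by rewrite addrAC subrr sub0r normrN ger0_norm.
case: ltP => h2; first by rewrite addrAC subrr add0r ger0_norm.
by rewrite sub0r normrN ler_norml h2 h1.
Qed.
Lemma sth_lip d t t' : 0 <= d -> `|sth d t - sth d t'| <= `|t - t'|.
Proof.
move=> d0; rewrite /sth; case: (ltP d t) => h1; case: (ltP d t') => h2;
  try case: (ltP t (- d)) => h3; try case: (ltP t' (- d)) => h4;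
  rewrite ler_norml; case: (ltP 0 (t - t')) => h5;
  rewrite ?(gtr0_norm h5) ?(ler0_norm h5); apply/andP; split; lra.
Qed.
Lemma sth_small d t : `|t| <= d -> sth d t = 0.
Proof. by rewrite ler_norml => /andP[h1 h2]; rewrite /sth ltNge h2 /= ltNge h1. Qed.
Lemma sth_le d t : 0 <= d -> `|sth d t| <= `|t|.
Proof. by move=> d0; have := sth_lip t 0 d0; rewrite [sth d 0]sth_small ?normr0// !subr0. Qed.

End QuasiInterpolation.

(** * Approximation of Lipschitz functions by test functions *)

Section LipschitzH10.
Variable R : realType.
Variables (Om : set (plane R)) (f g1 g2 : plane R -> R) (L C rho : R).
Hypotheses (oO : open Om) (bO : Om `<=` pbox 0 rho) (L0 : 0 <= L) (lf : lip L f) (rho0 : 0 <= rho)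
  (f0 : forall x, ~ Om x -> f x = 0) (m1 : measf Om g1) (m2 : measf Om g2)
  (b1 : forall x, Om x -> `|g1 x| <= C) (b2 : forall x, Om x -> `|g2 x| <= C)
  (gf : pae Om (fun x => grad f x (g1 x) (g2 x) /\ (f x = 0 -> g1 x = 0 /\ g2 x = 0))).

Let mO := pmeas_open oO.
Let Ooo : (mu2 R Om < +oo)%E. Proof. exact: mu2_lty bO. Qed.

(** Where f is nonzero the threshold eventually shifts it by a constant and leaves its gradient
    alone; where f is zero the limit gradient must be zero, which is the second half of [gf]. *)
Lemma lip_H10_approx : exists phi : nat -> plane R -> R, exists K : R,
  [/\ forall n, test_function Om (phi n),
      forall n x, Om x -> [/\ `|phi n x - f x| <= K, `|'D_(ex R) (phi n) x| <= K & `|'D_(ey R) (phi n) x| <= K],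
      forall x, Om x -> phi ^~ x @ \oo --> f x &
      pae Om (fun x => (fun n => 'D_(ex R) (phi n) x) @ \oo --> g1 x /\
                       (fun n => 'D_(ey R) (phi n) x) @ \oo --> g2 x)].
Proof.
have [B [B' [M [sB dB [BM BM'] BB0 Bsum]]]] := bump_exists R.
have B0 t (h : t < -1 \/ 2 < t) : B t = 0 by have [] := BB0 t h.
have B0' t (h : t < -1 \/ 2 < t) : B' t = 0 by have [] := BB0 t h.
pose s (n : nat) : R := n.+1%:R^-1.
(* Half the threshold exceeds the variation 2 L s of f over a stencil, so the quasi-interpolant
   vanishes wherever |f| is below [d n / 2]. *)
pose d n : R := 4 * (L + 1) * s n.
(* In units of s the domain has radius at most rho (n + 1); the extra 3 secures the range conditions
   of the bump sums. *)
pose N n : nat := Num.bound (rho * n.+1%:R + 3).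
pose G n (y : plane R) := sth (d n) (f y).
pose phi n := QI B B (G n) (s n) (N n) (N n + N n)%N.
have s0 n : 0 < s n by rewrite /s invr_gt0 ltr0n.
have s1 n : s n <= 1 by rewrite /s invf_le1// ler1n.
have d0 n : 0 <= d n by rewrite /d mulr_ge0 ?(ltW (s0 n))// mulr_ge0// addr_ge0.
have N0 n : rho * n.+1%:R + 3 < (N n)%:R.
  by apply: archi_boundP; rewrite addr_ge0// mulr_ge0.
have reg n (t : R) : `|t| <= rho -> 1 < (s n)^-1 * t + (N n)%:R /\
   (s n)^-1 * t + (N n)%:R - (N n + N n)%:R + 1 < 0.
  move=> ht; have := N0 n; rewrite /s invrK natrD.
  have n0 : 0 < (n.+1%:R : R) by rewrite ltr0n.
  have : `|n.+1%:R * t| <= rho * n.+1%:R by rewrite normrM gtr0_norm// mulrC ler_pM2r.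
  by rewrite ler_norml => /andP[? ?] ?; split; lra.
have Gl n x y : `|y - x| <= 2 * s n -> `|G n y - f x| <= d n + L * (2 * s n).
  move=> h; have -> : G n y - f x = (G n y - f y) + (f y - f x) by ring.
  apply: le_trans (ler_normD _ _) _; apply: lerD; first exact: sth_near.
  by apply: le_trans (lf _ _) _; rewrite ler_wpM2l.
have approx n x := @QI_approx R B B' M BM BM' B0 B0' Bsum (G n) (s n) (N n) (N n + N n)%N x.
have Q0 n x : Om x -> `|phi n x - f x| <= (d n + L * (2 * s n)) * (16 * M ^+ 2).
  move=> Ox; have := bO Ox; rewrite /pbox /= subr0 => /norm_leP[h1 h2].
  have [r1 r2] := reg n _ h1; have [r3 r4] := reg n _ h2.
  have [] // := approx n x (f x) 0 0 (d n + L * (2 * s n)) (s0 n) _ r1 r2 r3 r4.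
    by rewrite addr_ge0// mulr_ge0// mulr_ge0// ltW.
  by move=> y hy; rewrite !mul0r !addr0; exact: Gl.
have Q1 n x : Om x -> `|(s n)^-1 * QI B' B (G n) (s n) (N n) (N n + N n)%N x| <= 2 * L * (16 * M ^+ 2) /\
   `|(s n)^-1 * QI B B' (G n) (s n) (N n) (N n + N n)%N x| <= 2 * L * (16 * M ^+ 2).
  move=> Ox; have := bO Ox; rewrite /pbox /= subr0 => /norm_leP[h1 h2].
  have [r1 r2] := reg n _ h1; have [r3 r4] := reg n _ h2.
  have e : 2 * L * (16 * M ^+ 2) = (s n)^-1 * (L * (2 * s n) * (16 * M ^+ 2)).
    by have := gt_eqF (s0 n); move: (s n) => t ht; field; rewrite ht.
  rewrite e.
  (* Comparison with the constant [G n x] rather than [f x]: the error is then a variation of G, of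
     order s, and division by s leaves a bound. *)
  have [||_] := approx n x (G n x) 0 0 (L * (2 * s n)) (s0 n) _ r1 r2 r3 r4.
  - by rewrite mulr_ge0// mulr_ge0// ltW.
  - move=> y hy; rewrite !mul0r !addr0.
    apply: le_trans (sth_lip _ _ (d0 n)) _; apply: le_trans (lf _ _) _.
    by rewrite ler_wpM2l.
  - by rewrite !subr0.
have De n x : 'D_(ex R) (phi n) x = (s n)^-1 * QI B' B (G n) (s n) (N n) (N n + N n)%N x.
  by rewrite (QI_D dB) /ex /= mul1r mul0r addr0.
have De' n x : 'D_(ey R) (phi n) x = (s n)^-1 * QI B B' (G n) (s n) (N n) (N n + N n)%N x.
  by rewrite (QI_D dB) /ey /= mul1r mul0r add0r.
pose K := (4 * (L + 1) + L * 2) * (16 * M ^+ 2) + 2 * L * (16 * M ^+ 2).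
have M2 : 0 <= 16 * M ^+ 2 by rewrite mulr_ge0// sqr_ge0.
have Lp1 : 0 < L + 1 by rewrite ltr_wpDl.
have L4 : 0 <= 4 * (L + 1) + L * 2 by rewrite addr_ge0 ?mulr_ge0 ?(ltW Lp1).
have dp n : 0 < d n by rewrite /d mulr_gt0// mulr_gt0.
have K1 : 2 * L * (16 * M ^+ 2) <= K.
  by rewrite /K lerDr mulr_ge0.
exists phi, K; split.
- move=> n; split; first by apply: sm2_smooth; exact: QI_sm2.
  exists [set x | d n / 2 <= `|f x|]; split.
  + apply: (@compact_bounded_closed _ _ 0 rho).
      apply: (@closed_comp _ _ (fun x => `|f x|) [set t | d n / 2 <= t]); last exact: closed_ge.
      move=> x _; apply: continuous_comp; [exact: (lip_cont lf)|exact: norm_continuous].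
    move=> x /= hx; apply: bO; apply: contrapT => nO; move: hx; rewrite f0// normr0.
    by rewrite leNgt => /negP; apply; rewrite divr_gt0.
  + move=> x /= hx; apply: contrapT => nO; move: hx; rewrite f0// normr0.
    by rewrite leNgt => /negP; apply; rewrite divr_gt0.
  + move=> x /= /negP; rewrite -ltNge => hx.
    have := @QI_est R B B M 0 (G n) (s n) (N n) (N n + N n)%N x (s0 n) (lexx _) BM BM B0 B0.
    rewrite mul0r => /(_ _) h; apply/eqP; rewrite -normr_le0; apply: h => y hy.
    rewrite /G sth_small ?normr0//.
    have -> : f y = f x + (f y - f x) by ring.
    apply: le_trans (ler_normD _ _) _.
    have l1 : `|f y - f x| <= L * (2 * s n) by apply: le_trans (lf _ _) _; rewrite ler_wpM2l.
    have l2 : L * (2 * s n) <= d n / 2.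
      have -> : d n / 2 = L * (2 * s n) + 2 * s n by rewrite /d; field.
      by rewrite lerDl mulr_ge0// ltW.
    lra.
- move=> n x Ox; have [h1 h2] := Q1 n x Ox; split; last 2 first.
  + by rewrite De; apply: le_trans h1 K1.
  + by rewrite De'; apply: le_trans h2 K1.
  + apply: le_trans (Q0 n x Ox) _; rewrite /K.
    apply: (@le_trans _ _ ((4 * (L + 1) + L * 2) * (16 * M ^+ 2))).
      rewrite ler_wpM2r// /d.
      have -> : 4 * (L + 1) * s n + L * (2 * s n) = (4 * (L + 1) + L * 2) * s n by ring.
      by rewrite ler_piMr.
    by rewrite lerDl mulr_ge0// mulr_ge0.
- move=> x Ox; apply/cvgrPdist_le => e e0.
  pose c := (4 * (L + 1) + L * 2) * (16 * M ^+ 2) + 1.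
  have c0 : 0 < c by rewrite /c ltr_pwDr// mulr_ge0.
  have ec : 0 < e / c by rewrite divr_gt0.
  near=> n.
  have sn : s n < e / c by near: n; exact: (near_infty_natSinv_lt (PosNum ec)).
  rewrite distrC; apply: le_trans (Q0 n x Ox) _.
  have -> : (d n + L * (2 * s n)) * (16 * M ^+ 2) = (c - 1) * s n by rewrite /d /c; ring.
  apply: (@le_trans _ _ (c * s n)); first by rewrite ler_wpM2r ?(ltW (s0 n))//; lra.
  by rewrite -ler_pdivlMl// mulrC ltW.
- apply: pae_imp gf => x Ox [gx zx].
  suff h : forall e, 0 < e -> \forall n \near \oo,
      `|(s n)^-1 * QI B' B (G n) (s n) (N n) (N n + N n)%N x - g1 x| <= e /\
      `|(s n)^-1 * QI B B' (G n) (s n) (N n) (N n + N n)%N x - g2 x| <= e.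
    split; apply/cvgrPdist_le => e /h; apply: filterS => n [h1 h2].
      by rewrite De distrC.
    by rewrite De' distrC.
  move=> e e0.
  pose c := 32 * M ^+ 2 + 1.
  have c0 : 0 < c by rewrite /c ltr_pwDr// mulr_ge0// sqr_ge0.
  have ec : 0 < e / c by rewrite divr_gt0.
  have /near_normP[r r0 hr] := gx _ ec.
  have r20 : 0 < r / 2 by rewrite divr_gt0.
  have := bO Ox; rewrite /pbox /= subr0 => /norm_leP[h1 h2].
  have main n k0 : s n < r / 2 ->
      (forall y, `|y - x| <= 2 * s n -> `|G n y - (k0 + g1 x * (y.1 - x.1) + g2 x * (y.2 - x.2))| <= e / c * `|y - x|) ->
      `|(s n)^-1 * QI B' B (G n) (s n) (N n) (N n + N n)%N x - g1 x| <= e /\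
      `|(s n)^-1 * QI B B' (G n) (s n) (N n) (N n + N n)%N x - g2 x| <= e.
    move=> sr hG.
    have [r1 r2] := reg n _ h1; have [r3 r4] := reg n _ h2.
    have en : (s n)^-1 * (e / c * (2 * s n) * (16 * M ^+ 2)) <= e.
      have -> : (s n)^-1 * (e / c * (2 * s n) * (16 * M ^+ 2)) = e / c * (c - 1).
        by have := gt_eqF (s0 n); move: (s n) => t ht; rewrite /c; field; rewrite ht gt_eqF.
      by rewrite mulrAC ler_pdivrMr// ler_wpM2l ?(ltW e0)//; lra.
    have [||_ a1 a2] := approx n x k0 (g1 x) (g2 x) (e / c * (2 * s n)) (s0 n) _ r1 r2 r3 r4.
    - by rewrite mulr_ge0 ?(ltW ec)// mulr_ge0// ltW.
    - move=> y hy; apply: le_trans (hG y hy) _.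
      by rewrite ler_wpM2l ?(ltW ec).
    - by split; [exact: le_trans a1 en|exact: le_trans a2 en].
  have [fx|fx] := eqVneq (f x) 0.
    have [z1 z2] := zx fx.
    near=> n.
    have sr : s n < r / 2 by near: n; exact: (near_infty_natSinv_lt (PosNum r20)).
    (* At a zero of f the gradient is zero, so f is of smaller order than the distance, and
       thresholding only shrinks it. *)
    apply: (main n 0 sr) => y hy; rewrite z1 z2 !mul0r !addr0 subr0.
    apply: le_trans (sth_le _ (d0 n)) _.
    have := hr y; rewrite fx z1 z2 !mul0r !addr0 !subr0; apply.
    by apply: le_lt_trans hy _; lra.
  have fp : 0 < `|f x| by rewrite normr_gt0.
  pose q := 4 * (L + 1) + 2 * L.
  have q0 : 0 < q by rewrite /q ltr_wpDr ?mulr_ge0// mulr_gt0.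
  have fq : 0 < `|f x| / q by rewrite divr_gt0.
  near=> n.
  have sr : s n < r / 2 by near: n; exact: (near_infty_natSinv_lt (PosNum r20)).
  have sf : s n < `|f x| / q by near: n; exact: (near_infty_natSinv_lt (PosNum fq)).
  have dl : d n + L * (2 * s n) < `|f x|.
    have -> : d n + L * (2 * s n) = q * s n by rewrite /d /q; ring.
    by rewrite -ltr_pdivlMl// mulrC.
  (* On the whole stencil f keeps its sign and exceeds the threshold, so G is f minus a constant. *)
  apply: (main n (f x - Num.sg (f x) * d n) sr) => y hy.
  have l1 : `|f y - f x| <= L * (2 * s n) by apply: le_trans (lf _ _) _; rewrite ler_wpM2l.
  have yr : `|y - x| < r by apply: le_lt_trans hy _; lra.
  have e1 : G n y = f y - Num.sg (f x) * d n.
    rewrite /G /sth; move: l1; rewrite ler_norml => /andP[l1 l2].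
    have [fp'|fn'|f0'] := ltgtP 0 (f x).
    - rewrite gtr0_sg// mul1r ifT//; move: dl; rewrite gtr0_norm//; lra.
    - rewrite ltr0_sg// mulN1r opprK; move: dl; rewrite ltr0_norm// => dl.
      have dn := d0 n; rewrite ifF; last by apply/negbTE; rewrite -leNgt; lra.
      by rewrite ifT//; lra.
    - by move: fx; rewrite -f0' eqxx.
  rewrite e1; apply: le_trans (hr y yr).
  set t := Num.sg (f x) * d n.
  by have -> : f y - t - (f x - t + g1 x * (y.1 - x.1) + g2 x * (y.2 - x.2)) =
    f y - f x - (g1 x * (y.1 - x.1) + g2 x * (y.2 - x.2)) by ring.
Unshelve. all: by end_near. Qed.

(** The approximants satisfy the integration by parts, and dominated convergence passes to the limit
    on both sides. *)
Lemma lip_weak : L2 Om f /\ [/\ L2 Om g1, L2 Om g2, weak_deriv Om (ex R) f g1 & weak_deriv Om (ey R) f g2].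
Proof.
have [phi [K [tp hb cv cg]]] := lip_H10_approx.
have fb := lip_supp_bound L0 rho0 lf.
have fs x : rho < `|x| -> f x = 0.
  move=> hx; apply: f0 => /bO; rewrite /pbox /= subr0 => h.
  by have := lt_le_trans hx h; rewrite ltxx.
have mf := lip_measf lf.
have Lf : L2 Om f.
  by apply: (L2_bounded (c := L * (2 * rho + 1))) => //; [exact: measfT|move=> x _; exact: fb].
have Lg1 : L2 Om g1 by exact: L2_bounded b1.
have Lg2 : L2 Om g2 by exact: L2_bounded b2.
split => //.
have key v (g : plane R -> R) : measf Om g ->
   (forall n x, Om x -> `|'D_v (phi n) x| <= K) ->
   pae Om (fun x => (fun n => 'D_v (phi n) x) @ \oo --> g x) -> weak_deriv Om v f g.
  move=> mg hK hv psi tq.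
  have [Cp [Cp0 p1 p2 p3 p4]] := test_bounds tq.
  have [Cd [Cd0 q1 q2]] := test_D_bounds v tq.
  have Lq := test_L2 mO tq; have Ldq := test_D_L2 v mO tq.
  have c1 : (fun n => inner Om (phi n) (fun x => 'D_v psi x)) @ \oo --> inner Om f (fun x => 'D_v psi x).
    apply: (@I2_dct _ Om (fun n x => phi n x * 'D_v psi x) (fun x => f x * 'D_v psi x)
      (fun=> (K + L * (2 * rho + 1)) * Cd) mO).
    - by move=> n; apply: measfM; apply: measfT; [exact: test_measf (tp n)|exact: test_D_measf tq].
    - by apply: measfM; apply: measfT => //; exact: test_D_measf tq.
    - by apply: pae_all => x Ox; apply: cvgM; [exact: cv|exact: cvg_cst].
    - apply: (pintg_bounded (c := `|(K + L * (2 * rho + 1)) * Cd|)) => //; exact: measf_cst.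
    - move=> n x Ox; rewrite normrM; apply: ler_pM => //.
      have -> : phi n x = (phi n x - f x) + f x by ring.
      apply: le_trans (ler_normD _ _) _; apply: lerD; last exact: fb.
      by have [] := hb n x Ox.
  have c2 : (fun n => inner Om (fun x => 'D_v (phi n) x) psi) @ \oo --> inner Om g psi.
    apply: (@I2_dct _ Om (fun n x => 'D_v (phi n) x * psi x) (fun x => g x * psi x)
      (fun=> K * Cp) mO).
    - by move=> n; apply: measfM; apply: measfT; [exact: test_D_measf (tp n)|exact: test_measf tq].
    - by apply: measfM => //; apply: measfT => //; exact: test_measf tq.
    - by apply: pae_imp hv => x Ox hx; apply: cvgM; [exact: hx|exact: cvg_cst].
    - apply: (pintg_bounded (c := `|K * Cp|)) => //; exact: measf_cst.
    - by move=> n x Ox; rewrite normrM; apply: ler_pM => //; exact: hK.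
  have e : (fun n => inner Om (phi n) (fun x => 'D_v psi x)) = (fun n => - inner Om (fun x => 'D_v (phi n) x) psi).
    by apply/funext => n; rewrite (test_weak v oO (tp n) tq).
  rewrite e in c1.
  by apply: (cvg_unique (@Rhausdorff R) c1); exact: cvgN.
split => //.
- apply: key => //; first by move=> n x Ox; have [] := hb n x Ox.
  by apply: pae_imp cg => x _ [].
- apply: key => //; first by move=> n x Ox; have [] := hb n x Ox.
  by apply: pae_imp cg => x _ [].
Qed.

Theorem lip_H10 : H1_0 Om f.
Proof.
have [Lf [L1 L2' w1 w2]] := lip_weak.
split; first by split => //; [exists g1|exists g2].
move=> eps e0.
have [phi [K [tp hb cv cg]]] := lip_H10_approx.
have K0 : 0 <= `|K| by [].
have nrm n : H1norm Om (f - phi n) ^+ 2 = I2 Om (fun x => (f x - phi n x) ^+ 2) +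
    I2 Om (fun x => (g1 x - 'D_(ex R) (phi n) x) ^+ 2) + I2 Om (fun x => (g2 x - 'D_(ey R) (phi n) x) ^+ 2).
  have Lp := test_L2 mO (tp n).
  have Lpx := test_D_L2 (ex R) mO (tp n); have Lpy := test_D_L2 (ey R) mO (tp n).
  have wx := test_weak (ex R) oO (tp n); have wy := test_weak (ey R) oO (tp n).
  have sb v gg : L2 Om gg -> L2 Om (fun x => 'D_v (phi n) x) -> weak_deriv Om v f gg -> weak_deriv Om v (phi n) (fun x => 'D_v (phi n) x) ->
      weak_deriv Om v (f - phi n) (fun x => gg x - 'D_v (phi n) x).
    move=> Lgg Lpp wgg wpp.
    have := weak_derivD mO Lf (L2Z (-1) mO Lp) Lgg (L2Z (-1) mO Lpp) wgg (weak_derivZ (-1) mO Lp Lpp wpp).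
    have -> : (fun x => f x + -1 * phi n x) = f - phi n by apply/funext => x; rewrite mulN1r.
    by have -> : (fun x => gg x + -1 * 'D_v (phi n) x) = (fun x => gg x - 'D_v (phi n) x) by apply/funext => x; rewrite mulN1r.
  rewrite (H1norm_sq oO (L2B mO Lf Lp) (L2B mO L1 Lpx) (L2B mO L2' Lpy) (sb _ _ L1 Lpx w1 wx) (sb _ _ L2' Lpy w2 wy)).
  congr (_ + _ + _); [exact: (L2norm_sq mO (L2B mO Lf Lp))|exact: (L2norm_sq mO (L2B mO L1 Lpx))|exact: (L2norm_sq mO (L2B mO L2' Lpy))].
have cnv (u : plane R -> R) (un : nat -> plane R -> R) (c : R) : measf Om u -> (forall n, measf Om (un n)) ->
    (forall n x, Om x -> `|u x - un n x| <= c) -> pae Om (fun x => un ^~ x @ \oo --> u x) ->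
    (fun n => I2 Om (fun x => (u x - un n x) ^+ 2)) @ \oo --> (0 : R).
  move=> mu mun hc hu; rewrite -(I20 Om).
  apply: (@I2_dct _ Om (fun n x => (u x - un n x) ^+ 2) (fun=> 0) (fun=> c ^+ 2) mO).
  - by move=> n; apply: measfX; exact: measfB.
  - exact: measf_cst.
  - apply: pae_imp hu => x _ hx; under eq_fun do rewrite expr2; rewrite -(mulr0 (0 : R)).
    have h0 : (fun n => u x - un n x) @ \oo --> (0 : R) by rewrite -(subrr (u x)); apply: cvgB => //; exact: cvg_cst.
    exact: cvgM.
  - by apply: (pintg_bounded (c := `|c ^+ 2|)) => //; exact: measf_cst.
  - by move=> n x Ox; rewrite normrX lerXn2r ?nnegrE// ?hc// (le_trans _ (hc n x Ox)).
have mf := lip_measf lf.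
have c0 := cnv f phi K (measfT mf) (fun n => measfT (test_measf (tp n))).
have c1 := cnv g1 (fun n x => 'D_(ex R) (phi n) x) (C + K) m1 (fun n => measfT (test_D_measf (ex R) (tp n))).
have c2 := cnv g2 (fun n x => 'D_(ey R) (phi n) x) (C + K) m2 (fun n => measfT (test_D_measf (ey R) (tp n))).
have {}c0 := c0 (fun n x Ox => ltac:(by rewrite distrC; have [] := hb n x Ox)) (pae_all cv).
have {}c1 : (fun n => I2 Om (fun x => (g1 x - 'D_(ex R) (phi n) x) ^+ 2)) @ \oo --> (0 : R).
  apply: c1; last by apply: pae_imp cg => x _ [].
  by move=> n x Ox; apply: le_trans (ler_normB _ _) _; apply: lerD; [exact: b1|have [] := hb n x Ox].
have {}c2 : (fun n => I2 Om (fun x => (g2 x - 'D_(ey R) (phi n) x) ^+ 2)) @ \oo --> (0 : R).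
  apply: c2; last by apply: pae_imp cg => x _ [].
  by move=> n x Ox; apply: le_trans (ler_normB _ _) _; apply: lerD; [exact: b2|have [] := hb n x Ox].
have cc := cvgD (cvgD c0 c1) c2; rewrite !addr0 in cc.
have e2 : 0 < eps ^+ 2 by rewrite exprn_gt0.
have fo : Filter (\oo : set_system nat) by exact: eventually_filter.
have /cvgr0Pnorm_lt/(_ _ e2)[n _ hn] := cc fo fo.
exists (phi n); first exact: tp.
have := hn n (leqnn n) => /= h.
rewrite -(@ltr_pXn2r _ 2)// ?nnegrE ?sqrtr_ge0// ?(ltW e0)//.
by rewrite nrm; apply: le_lt_trans h; exact: ler_norm.
Qed.

End LipschitzH10.

(** * Barycentric coordinates *)

Section Triangle.
Variable R : realType.
Implicit Types (a b c p x y u v : plane R) (f g : plane R -> R) (T e : {fset plane R}).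

Definition cross u v : R := u.1 * v.2 - u.2 * v.1.

Lemma fstD u v : (u + v).1 = u.1 + v.1. Proof. by []. Qed.
Lemma sndD u v : (u + v).2 = u.2 + v.2. Proof. by []. Qed.
Lemma fstN u : (- u).1 = - u.1. Proof. by []. Qed.
Lemma sndN u : (- u).2 = - u.2. Proof. by []. Qed.
Lemma fstZ (t : R) u : (t *: u).1 = t * u.1. Proof. by []. Qed.
Lemma sndZ (t : R) u : (t *: u).2 = t * u.2. Proof. by []. Qed.
Definition planeE := (fstD, sndD, fstN, sndN, fstZ, sndZ).

Definition aff f : Prop := exists al be ga : R, forall x, f x = al * x.1 + be * x.2 + ga.

Lemma aff_comb f I (s : seq I) (w : I -> R) (p : I -> plane R) : aff f ->
  \sum_(i <- s) w i = 1 -> f (\sum_(i <- s) w i *: p i) = \sum_(i <- s) w i * f (p i).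
Proof.
move=> [al [be [ga fE]]] w1; rewrite fE.
have e1 : (\sum_(i <- s) w i *: p i).1 = \sum_(i <- s) w i * (p i).1.
  elim: s {w1} => [|i s ih]; first by rewrite !big_nil.
  by rewrite !big_cons -ih.
have e2 : (\sum_(i <- s) w i *: p i).2 = \sum_(i <- s) w i * (p i).2.
  elim: s {w1 e1} => [|i s ih]; first by rewrite !big_nil.
  by rewrite !big_cons -ih.
rewrite e1 e2 -[in LHS](mulr1 ga) -w1 !mulr_sumr -!big_split /=.
by apply: eq_bigr => i _; rewrite fE; ring.
Qed.

Lemma affZ (k : R) f : aff f -> aff (fun x => k * f x).
Proof. by move=> [al [be [ga h]]]; exists (k * al), (k * be), (k * ga) => x; rewrite h; ring. Qed.
Lemma affD f g : aff f -> aff g -> aff (fun x => f x + g x).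
Proof.
move=> [al [be [ga h]]] [al' [be' [ga' h']]].
by exists (al + al'), (be + be'), (ga + ga') => x; rewrite h h'; ring.
Qed.
Lemma affB f g : aff f -> aff g -> aff (fun x => f x - g x).
Proof.
move=> [al [be [ga h]]] [al' [be' [ga' h']]].
by exists (al - al'), (be - be'), (ga - ga') => x; rewrite h h'; ring.
Qed.
Lemma aff_cst (k : R) : aff (fun=> k).
Proof. by exists 0, 0, k => x; ring. Qed.

Lemma aff_eq0 f a b c : aff f -> cross (b - a) (c - a) != 0 -> f a = 0 -> f b = 0 -> f c = 0 ->
  forall x, f x = 0.
Proof.
move=> [al [be [ga fE]]] d0 + + + x; rewrite !fE => ha hb hc.
have e1 : al * cross (b - a) (c - a) = 0.
  transitivity ((al * b.1 + be * b.2 + ga - (al * a.1 + be * a.2 + ga)) * (c.2 - a.2) -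
    (al * c.1 + be * c.2 + ga - (al * a.1 + be * a.2 + ga)) * (b.2 - a.2)).
    by rewrite /cross /=; ring.
  by rewrite ha hb hc; ring.
have e2 : be * cross (b - a) (c - a) = 0.
  transitivity ((al * c.1 + be * c.2 + ga - (al * a.1 + be * a.2 + ga)) * (b.1 - a.1) -
    (al * b.1 + be * b.2 + ga - (al * a.1 + be * a.2 + ga)) * (c.1 - a.1)).
    by rewrite /cross /=; ring.
  by rewrite ha hb hc; ring.
move/eqP: e1; rewrite mulf_eq0 (negbTE d0) orbF => /eqP al0.
move/eqP: e2; rewrite mulf_eq0 (negbTE d0) orbF => /eqP be0.
by move: ha; rewrite al0 be0 !mul0r !add0r.
Qed.

(** The barycentric coordinate of a as a quotient of signed areas. *)
Definition bar a b c x : R := cross (b - x) (c - x) / cross (b - a) (c - a).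

Lemma aff_bar a b c : aff (bar a b c).
Proof.
exists ((b.2 - c.2) / cross (b - a) (c - a)), ((c.1 - b.1) / cross (b - a) (c - a)),
  ((b.1 * c.2 - b.2 * c.1) / cross (b - a) (c - a)) => x.
by rewrite /bar /cross /=; ring.
Qed.

Lemma bar_vertex a b c : cross (b - a) (c - a) != 0 ->
  [/\ bar a b c a = 1, bar a b c b = 0 & bar a b c c = 0].
Proof.
move=> d0; split; first exact: divff.
  by rewrite /bar (_ : cross (b - b) (c - b) = 0) ?mul0r// /cross /=; ring.
by rewrite /bar (_ : cross (b - c) (c - c) = 0) ?mul0r// /cross /=; ring.
Qed.

(** Characterised by vertex values, hence indexed by a cell and a point, with no ordering of the
    vertices; for a point that is no vertex of a triangle it is the zero function. *)
Definition lam T a : plane R -> R :=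
  xget (cst 0) [set f | aff f /\ forall p, p \in T -> f p = (a == p)%:R].
Definition dlam T a : plane R := (lam T a (1, 0) - lam T a 0, lam T a (0, 1) - lam T a 0).

Definition tri T : Prop := #|` T| = 3%N /\ (hull T)° !=set0.

Lemma fset3E T : #|` T| = 3%N -> exists a b c,
  [/\ T = [fset a; b; c]%fset, a != b, a != c, b != c & perm_eq T [:: a; b; c]].
Proof.
move=> h; have us := fset_uniq T; move: us h.
case eT : (enum_fset T) => [|a [|b [|c [|d s]]]] //= us _.
move: us; rewrite !inE negb_or => /andP[/andP[ab ac] /andP[bc _]].
exists a, b, c; split => //.
apply/fsetP => x; have -> : (x \in T) = (x \in enum_fset T) by [].
by rewrite eT !inE orbA.
Qed.

Lemma big_fset3 (V : nmodType) (F : plane R -> V) a b c : a != b -> a != c -> b != c ->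
  \sum_(p <- [fset a; b; c]%fset) F p = F a + F b + F c.
Proof.
move=> ab ac bc; rewrite (perm_big [:: a; b; c]) /=.
  by rewrite !big_cons big_nil addr0 addrA.
apply: uniq_perm; first exact: fset_uniq.
  by rewrite /= !inE negb_or ab ac bc.
by move=> x; rewrite !inE orbA.
Qed.

Lemma hull3 a b c x : a != b -> a != c -> b != c -> hull [fset a; b; c]%fset x <->
  exists s t u : R, [/\ 0 <= s, 0 <= t, 0 <= u, s + t + u = 1 & x = s *: a + t *: b + u *: c].
Proof.
move=> ab ac bc; split => [[w [w0 w1 ->]]|[s [t [u [s0 t0 u0 e ->]]]]].
  have e1 := big_fset3 w ab ac bc; have e2 := big_fset3 (fun p => w p *: p) ab ac bc.
  exists (w a), (w b), (w c); rewrite -e1 w1 -e2.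
  by split => //; apply: w0; rewrite !inE eqxx ?orbT.
exists (fun p => if p == a then s else if p == b then t else u); split.
- by move=> p _; case: ifP => // _; case: ifP.
- by rewrite big_fset3// !eqxx ![b == _]eq_sym ![c == _]eq_sym (negbTE ab) (negbTE ac) (negbTE bc).
- by rewrite big_fset3// !eqxx ![b == _]eq_sym ![c == _]eq_sym (negbTE ab) (negbTE ac) (negbTE bc).
Qed.

Lemma cross_eq0_sum u v : cross u v = 0 -> u != 0 -> exists n : plane R, [/\ dot n u = 0, dot n v = 0 & dot n n != 0].
Proof.
move=> c0 u0; exists (- u.2, u.1); split; rewrite /dot /=.
- by ring.
- by move: c0; rewrite /cross => <-; ring.
- apply: contra_neq u0 => h.
  have : u.1 ^+ 2 + u.2 ^+ 2 = 0 by rewrite -[RHS]h; ring.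
  move/eqP; rewrite paddr_eq0 ?sqr_ge0// !sqrf_eq0 => /andP[/eqP e1 /eqP e2].
  by rewrite [u]surjective_pairing e1 e2.
Qed.

Lemma near_ray (Q : plane R -> Prop) x v : (\forall y \near x, Q y) ->
  exists2 d : R, 0 < d & forall t, `|t| < d -> Q (x + t *: v).
Proof.
move=> /near_normP[d d0 h]; exists (d / (`|v| + 1)).
  by rewrite divr_gt0// ltr_wpDl.
move=> t; rewrite ltr_pdivlMr ?ltr_wpDl// => ht; apply: h.
rewrite addrAC subrr add0r normrZ; apply: le_lt_trans ht.
by rewrite ler_wpM2l// lerDl.
Qed.

Lemma interior_ray (D : set (plane R)) x v : D° x ->
  exists2 d : R, 0 < d & forall t, `|t| < d -> D (x + t *: v).
Proof. by move=> h; apply: near_ray; exact: h. Qed.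

(** Collinear vertices would put the hull on a line, and an interior point could be moved off that
    line along its normal. *)
Lemma tri_abc T : tri T -> exists a b c, [/\ T = [fset a; b; c]%fset, a != b, a != c, b != c &
  cross (b - a) (c - a) != 0].
Proof.
move=> [/fset3E[a [b [c [TE ab ac bc _]]]] [x xT]]; exists a, b, c; split => //.
apply/negP => /eqP d0.
have ba : b - a != 0 by rewrite subr_eq0 eq_sym.
have [n [n1 n2 n3]] := cross_eq0_sum d0 ba.
have line y : hull T y -> dot n (y - a) = 0.
  rewrite TE => /hull3[]// s [t [u [_ _ _ e ->]]].
  have -> : dot n (s *: a + t *: b + u *: c - a) = (s + t + u - 1) * dot n a + t * dot n (b - a) + u * dot n (c - a).
    by rewrite /dot !planeE; ring.
  by rewrite e n1 n2; ring.
have [d dp hd] := interior_ray n xT.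
have h0 := line _ (hd 0 _); have h1 := line _ (hd (d / 2) _).
have {}h0 : dot n (x - a) = 0 by move: h0; rewrite scale0r addr0; apply; rewrite normr0.
have : d / 2 * dot n n = 0.
  have := h1 _; rewrite gtr0_norm ?divr_gt0// => /(_ _) h.
  have <- : dot n (x + (d / 2) *: n - a) - dot n (x - a) = d / 2 * dot n n.
    by rewrite /dot !planeE; ring.
  by rewrite h0 subr0 h//; lra.
by move/eqP; rewrite mulf_eq0 (negbTE n3) orbF gt_eqF// divr_gt0.
Qed.

Lemma aff_tri0 T f : tri T -> aff f -> (forall p, p \in T -> f p = 0) -> forall x, f x = 0.
Proof.
move=> /tri_abc[a [b [c [-> _ _ _ d0]]]] af h.
by apply: (aff_eq0 af d0); apply: h; rewrite !inE eqxx ?orbT.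
Qed.

Section GoodTriangle.
Variable T : {fset plane R}.
Hypothesis hT : tri T.

Lemma lam_spec a : aff (lam T a) /\ forall p, p \in T -> lam T a p = (a == p)%:R.
Proof.
suff [f hf] : exists f, aff f /\ forall p, p \in T -> f p = (a == p)%:R.
  by rewrite /lam; case: xgetP => [g _ //|/(_ f)]; case.
have [a' [b [c [TE ab ac bc d0]]]] := tri_abc hT.
have d1 : cross (c - b) (a' - b) != 0 by apply: contra_neq d0 => <-; rewrite /cross /=; ring.
have d2 : cross (a' - c) (b - c) != 0 by apply: contra_neq d0 => <-; rewrite /cross /=; ring.
have [v1 v2 v3] := bar_vertex d0; have [u1 u2 u3] := bar_vertex d1; have [w1 w2 w3] := bar_vertex d2.
exists (fun x => (a == a')%:R * bar a' b c x + (a == b)%:R * bar b c a' x + (a == c)%:R * bar c a' b x).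
split; first by do 2?apply: affD; apply: affZ; exact: aff_bar.
move=> p; rewrite TE !inE -orbA => /or3P[] /eqP ->; rewrite ?v1 ?v2 ?v3 ?u1 ?u2 ?u3 ?w1 ?w2 ?w3; ring.
Qed.

Lemma aff_lam a : aff (lam T a). Proof. by have [] := lam_spec a. Qed.
Lemma lam_vertex a p : p \in T -> lam T a p = (a == p)%:R.
Proof. by have [_] := lam_spec a; apply. Qed.

Lemma lam_notin a x : a \notin T -> lam T a x = 0.
Proof.
move=> aT; apply: (aff_tri0 hT (aff_lam a)) => p pT; rewrite lam_vertex//.
by case: eqP => // e; rewrite e pT in aT.
Qed.

Lemma aff_lamE f x : aff f -> f x = \sum_(p <- T) lam T p x * f p.
Proof.
move=> af; apply/eqP; rewrite -subr_eq0; apply/eqP; move: x.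
apply: (aff_tri0 hT) => [|p pT].
  apply: affB => //; elim: (enum_fset T) => [|q s ih].
    by under eq_fun do rewrite big_nil; exact: aff_cst.
  under eq_fun do rewrite big_cons mulrC.
  by apply: affD => //; apply: affZ; exact: aff_lam.
rewrite (bigD1_seq p) ?fset_uniq//= lam_vertex// eqxx mul1r big1 ?addr0 ?subrr// => q qp.
by rewrite lam_vertex// (negbTE qp) mul0r.
Qed.

Lemma sum_lam x : \sum_(p <- T) lam T p x = 1.
Proof.
have := aff_lamE x (aff_cst 1).
by under eq_bigr do rewrite mulr1; move <-.
Qed.

Lemma sum_lam_pt x : \sum_(p <- T) lam T p x *: p = x.
Proof.
have a1 : aff (fst : plane R -> R) by exists 1, 0, 0 => y; ring.
have a2 : aff (snd : plane R -> R) by exists 0, 1, 0 => y; ring.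
have e1 := aff_lamE x a1; have e2 := aff_lamE x a2; rewrite [RHS]surjective_pairing e1 e2.
elim: (enum_fset T) => [|q s ih]; first by rewrite !big_nil.
by rewrite !big_cons ih.
Qed.

Lemma lamB a x y : lam T a y - lam T a x = dot (dlam T a) (y - x).
Proof.
have [al [be [ga h]]] := aff_lam a.
by rewrite /dlam /dot !h /=; ring.
Qed.

Lemma lamDt a x v (t : R) : lam T a (x + t *: v) = lam T a x + t * dot (dlam T a) v.
Proof.
have := lamB a x (x + t *: v); rewrite addrAC subrr add0r => e.
by rewrite -[LHS](subrK (lam T a x)) e /dot !planeE; ring.
Qed.

Lemma dlam_dot a p q : p \in T -> q \in T -> dot (dlam T a) (q - p) = (a == q)%:R - (a == p)%:R.
Proof. by move=> pT qT; rewrite -lamB !lam_vertex. Qed.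

(** A face of T is where the coordinates of the missing vertices vanish; vertices, edges and the
    cell are covered at once. *)
Lemma hull_lam (e : {fset plane R}) x : (e `<=` T)%fset -> hull e x <->
  (forall p, p \in T -> 0 <= lam T p x) /\ (forall p, p \in T -> p \notin e -> lam T p x = 0).
Proof.
move=> eT; split => [[w [w0 w1 ->]]|[h1 h2]].
  have k a : lam T a (\sum_(p <- e) w p *: p) = if a \in e then w a else 0.
    rewrite aff_comb//; last exact: aff_lam.
    have -> : \sum_(p <- e) w p * lam T a p = \sum_(p <- e) w p * (a == p)%:R.
      by apply: eq_big_seq => p pe; rewrite lam_vertex// (fsubsetP eT).
    case: ifPn => ae.
      rewrite (bigD1_seq a) ?fset_uniq//= eqxx mulr1 big1 ?addr0// => p pa.
      by rewrite eq_sym (negbTE pa) mulr0.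
    rewrite big_seq big1// => p pe; case: eqP => [E|]; last by rewrite mulr0.
    by rewrite E pe in ae.
  by split => p pT; [rewrite k; case: ifP => // /w0|move=> pe; rewrite k (negbTE pe)].
have sub (V : nmodType) (F : plane R -> V) : (forall p, p \in T -> p \notin e -> F p = 0) ->
    \sum_(p <- T) F p = \sum_(p <- e) F p.
  move=> hF; rewrite (bigID (fun p => p \in e)) /= [X in _ + X]big_seq_cond [X in _ + X]big1 ?addr0.
    rewrite -big_filter; apply: perm_big; apply: uniq_perm; rewrite ?filter_uniq ?fset_uniq//.
    by move=> p; rewrite mem_filter; case: (boolP (p \in e)) => // pe; rewrite (fsubsetP eT).
  by move=> p /andP[pT pe]; exact: hF.
exists (lam T ^~ x); split.
- by move=> p pe; apply: h1; rewrite (fsubsetP eT).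
- by rewrite -[RHS](sum_lam x) sub.
- by rewrite -sub ?sum_lam_pt// => p pT pe; rewrite h2// scale0r.
Qed.

Lemma hull_lamT x : hull T x <-> forall p, p \in T -> 0 <= lam T p x.
Proof.
rewrite (hull_lam _ (fsubset_refl T)); split => [[]//|h]; split => // p pT.
by rewrite pT.
Qed.

Lemma lam_cont a : continuous (lam T a).
Proof.
have [al [be [ga h]]] := aff_lam a.
have -> : lam T a = (fun x => al * x.1 + be * x.2 + ga) by apply/funext.
move=> x; apply: cvgD; last exact: cvg_cst.
by apply: cvgD; (apply: cvgM; [exact: cvg_cst|]); [exact: cvg_fst|exact: cvg_snd].
Qed.

Lemma near_lam_gt0 a x : 0 < lam T a x -> \forall y \near x, 0 < lam T a y.
Proof. by move=> h; exact: (cvgr_gt _ (@lam_cont a x) _ h). Qed.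

Lemma closed_hull : closed (hull T).
Proof.
have -> : hull T = \bigcap_(p in [set` T]) (lam T p @^-1` [set t | 0 <= t]).
  by apply/seteqP; split => x; rewrite hull_lamT.
apply: closed_bigI => p _; apply: closed_comp; last exact: closed_ge.
by move=> x _; exact: lam_cont.
Qed.

Lemma dlam_neq0 a : a \in T -> dot (dlam T a) (dlam T a) != 0.
Proof.
move=> aT; apply/negP => /eqP h.
have z : dlam T a = 0.
  have : (dlam T a).1 ^+ 2 + (dlam T a).2 ^+ 2 = 0 by rewrite -[RHS]h /dot; ring.
  move/eqP; rewrite paddr_eq0 ?sqr_ge0// !sqrf_eq0 => /andP[/eqP e1 /eqP e2].
  by rewrite [dlam T a]surjective_pairing e1 e2.
have [b bT ab] : exists2 b, b \in T & a != b.
  have [a' [b' [c [TE ab _ _ _]]]] := tri_abc hT.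
  have [e|ne] := eqVneq a a'; last by exists a' => //; rewrite TE !inE eqxx.
  by exists b'; [rewrite TE !inE eqxx orbT|rewrite e].
have := dlam_dot a aT bT; rewrite z /dot !mul0r addr0 eqxx (negbTE ab) => /eqP.
by rewrite sub0r eq_sym oppr_eq0 oner_eq0.
Qed.

Lemma dot_ge0 (u : plane R) : 0 <= dot u u.
Proof. by rewrite /dot -!expr2 addr_ge0 ?sqr_ge0. Qed.

Lemma open_all_pos : open [set x | forall p, p \in T -> 0 < lam T p x].
Proof.
rewrite openE => x /= h.
have [a [b [c [TE _ _ _ _]]]] := tri_abc hT.
have [ha hb hc] : [/\ 0 < lam T a x, 0 < lam T b x & 0 < lam T c x].
  by split; apply: h; rewrite TE !inE eqxx ?orbT.
have na := near_lam_gt0 ha; have nb := near_lam_gt0 hb; have nc := near_lam_gt0 hc.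
apply: filterS3 na nb nc => y ya yb yc p.
move=> pT; have : p \in [fset a; b; c]%fset by rewrite -TE.
by rewrite !inE -orbA => /or3P[] /eqP ->.
Qed.

(** If a coordinate vanished at an interior point, a small step against its gradient would make it
    negative inside the hull. *)
Lemma int_hull_lam x : (hull T)° x <-> forall p, p \in T -> 0 < lam T p x.
Proof.
split => [xi p pT|h].
  have xh : hull T x by apply: interior_subset xi.
  rewrite lt_neqAle ((hull_lamT x).1 xh)// andbT eq_sym; apply/negP => /eqP z.
  have [d d0 hd] := interior_ray (dlam T p) xi.
  have d2 : `|- (d / 2)| < d by rewrite normrN gtr0_norm ?divr_gt0//; lra.
  have /hull_lamT/(_ p pT) := hd _ d2; rewrite lamDt z add0r mulNr.
  rewrite oppr_ge0 leNgt => /negP; apply; rewrite mulr_gt0 ?divr_gt0//.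
  by rewrite lt_neqAle eq_sym dlam_neq0//= dot_ge0.
have sub : [set x | forall p, p \in T -> 0 < lam T p x] `<=` hull T.
  by move=> y hy; apply/hull_lamT => p pT; apply: ltW; exact: hy.
have := open_all_pos; rewrite openE => /(_ x h); exact: filterS.
Qed.

End GoodTriangle.

(** A similarity carries the line onto the vertical axis, a rectangle with a null factor. *)
Lemma pnull_line (al be ga : R) : (al != 0) || (be != 0) ->
  pnull [set x : plane R | al * x.1 + be * x.2 + ga = 0].
Proof.
move=> n0.
have d0 : al * al - be * - be != 0.
  have -> : al * al - be * - be = al ^+ 2 + be ^+ 2 by ring.
  by rewrite paddr_eq0 ?sqr_ge0// !sqrf_eq0 negb_and.
have m0 : pmeas ([set 0 : R] `*` setT) by exact: pmeas_box.
have -> : [set x : plane R | al * x.1 + be * x.2 + ga = 0] = affm al be (- be) al ga 0 @^-1` ([set 0] `*` setT).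
  by apply/seteqP; split => x /=; [move=> ->|case].
apply: pnullP; first exact: pmeas_preimage.
rewrite mu2_affm//.
have -> : mu2 R ([set 0 : R] `*` setT) = 0%E.
  transitivity (lebesgue_measure [set (0 : R)%R] * lebesgue_measure [set: R])%E.
    by apply: product_measure1E.
  by rewrite lebesgue_measure_set1 mul0e.
by rewrite mule0.
Qed.

Lemma pnull_lam0 T a (k : R) : tri T -> a \in T -> pnull [set x | lam T a x = k].
Proof.
move=> hT aT; have [al [be [ga h]]] := aff_lam hT a.
have -> : [set x | lam T a x = k] = [set x : plane R | al * x.1 + be * x.2 + (ga - k) = 0].
  by apply/seteqP; split => x /=; rewrite h; lra.
apply: pnull_line; rewrite -negb_and; apply/negP => /andP[/eqP z1 /eqP z2].
have := dlam_neq0 hT aT; rewrite /dlam /dot !h z1 z2 /= => /eqP; apply; ring.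
Qed.

End Triangle.

(** * Moments of barycentric coordinates *)

Section Moments.
Variable R : realType.
Implicit Types (x y : plane R) (f g : plane R -> R).

Definition rtri : set (plane R) := [set x | [/\ 0 < x.1, 0 < x.2 & x.1 + x.2 < 1]].

Lemma rtri_box : rtri `<=` pbox 0 1.
Proof.
move=> x [h1 h2 h3]; rewrite /pbox /= subr0; apply/norm_leP.
by rewrite !gtr0_norm//; split; lra.
Qed.

Lemma pmeas_rtri : pmeas rtri.
Proof.
have -> : rtri = [set x | 0 < x.1] `&` [set x | 0 < x.2] `&` [set x : plane R | x.1 + x.2 < 1].
  by apply/seteqP; split => x /=; [move=> []|move=> [[]]].
have c1 : continuous (fst : plane R -> R) by move=> x; exact: cvg_fst.
have c2 : continuous (snd : plane R -> R) by move=> x; exact: cvg_snd.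
apply: pmeasI; first apply: pmeasI.
- apply: pmeas_open; apply: (@open_comp _ _ fst [set t : R | 0 < t]) => [x _|]; [exact: c1|exact: open_gt].
- apply: pmeas_open; apply: (@open_comp _ _ snd [set t : R | 0 < t]) => [x _|]; [exact: c2|exact: open_gt].
- apply: pmeas_open; apply: (@open_comp _ _ (fun x : plane R => x.1 + x.2) [set t : R | t < 1]) => [x _|]; last exact: open_lt.
  by apply: cvgD; [exact: c1|exact: c2].
Qed.

Lemma rtri_lty : (mu2 R rtri < +oo)%E.
Proof. exact: mu2_lty pmeas_rtri rtri_box. Qed.

Definition mom (i j : nat) : R := I2 rtri (fun x => x.1 ^+ i * x.2 ^+ j).
(** Polynomials as lists of coefficients and exponents, so that each change of variables becomes a
    linear relation among moments. *)
Definition pol2 (l : seq (R * (nat * nat))) x : R := \sum_(k <- l) k.1 * (x.1 ^+ k.2.1 * x.2 ^+ k.2.2).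

Lemma measf_mon D i j : measf D (fun x => x.1 ^+ i * x.2 ^+ j).
Proof. by apply: measfM; apply: measfX; [exact: measf_fst|exact: measf_snd]. Qed.

Lemma measf_pol2 l D : measf D (pol2 l).
Proof. by apply: measf_sum => k _; apply: measfZ; exact: measf_mon. Qed.

Lemma pintg_mon i j : pintg rtri (fun x => x.1 ^+ i * x.2 ^+ j).
Proof.
apply: (pintg_bounded (c := 1)); [exact: pmeas_rtri|exact: rtri_lty|exact: measf_mon|].
move=> x [h1 h2 h3]; rewrite normrM !normrX !gtr0_norm//.
by rewrite -[leRHS]mulr1 ler_pM ?exprn_ge0 ?exprn_ile1 ?ltW//; lra.
Qed.

Lemma pintg_pol2 l : pintg rtri (pol2 l).
Proof.
by apply: pintg_sum => [|k _]; [exact: pmeas_rtri|apply: pintgZ; [exact: pmeas_rtri|exact: pintg_mon]].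
Qed.

Lemma I2_pol2 l : I2 rtri (pol2 l) = \sum_(k <- l) k.1 * mom k.2.1 k.2.2.
Proof.
rewrite I2_sum; [|exact: pmeas_rtri|by move=> k _; apply: pintgZ; [exact: pmeas_rtri|exact: pintg_mon]].
by apply: eq_bigr => k _; rewrite I2Z//; [exact: pmeas_rtri|exact: pintg_mon].
Qed.

Lemma mom_affm (p q r s t1 t2 : R) l l' : p * s - q * r != 0 ->
  (forall x, rtri (affm p q r s t1 t2 x) <-> rtri x) ->
  (forall x, pol2 l (affm p q r s t1 t2 x) = pol2 l' x) ->
  \sum_(k <- l') k.1 * mom k.2.1 k.2.2 = `|p * s - q * r|^-1 * \sum_(k <- l) k.1 * mom k.2.1 k.2.2.
Proof.
move=> d0 hS hl; rewrite -!I2_pol2.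
rewrite -(I2_affm t1 t2 d0 pmeas_rtri (@measf_pol2 l setT) (pintg_pol2 l)).
have -> : affm p q r s t1 t2 @^-1` rtri = rtri by apply/seteqP; split => x /=; rewrite hS.
by apply: I2_eq => x _ /=; rewrite hl.
Qed.

Lemma mom_swap i j : mom i j = mom j i.
Proof.
have d0 : (0 * 0 - 1 * 1 : R) != 0 by rewrite mul0r mul1r sub0r oppr_eq0 oner_eq0.
have := @mom_affm 0 1 1 0 0 0 [:: (1, (j, i))] [:: (1, (i, j))] d0.
rewrite !big_cons !big_nil /= !mul1r !addr0 mul0r sub0r normrN normr1 invr1 mul1r; apply.
  by move=> x; rewrite /rtri /affm /=; split => -[h1 h2 h3]; split; lra.
move=> x; rewrite /pol2 !big_cons !big_nil /affm /= !mul1r !mul0r !addr0 add0r.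
by rewrite mulrC.
Qed.

(** The affine map involved permutes the vertices of the reference triangle cyclically. *)
Lemma mom_rot l l' : (forall x, pol2 l (x.2, 1 - x.1 - x.2) = pol2 l' x) ->
  \sum_(k <- l') k.1 * mom k.2.1 k.2.2 = \sum_(k <- l) k.1 * mom k.2.1 k.2.2.
Proof.
move=> h.
have e1 : (0 * (-1) - 1 * (-1) : R) = 1 by ring.
have d0 : (0 * (-1) - 1 * (-1) : R) != 0 by rewrite e1 oner_eq0.
rewrite (@mom_affm 0 1 (-1) (-1) 0 1 l l' d0).
- by rewrite e1 normr1 invr1 mul1r.
- by move=> x; rewrite /rtri /affm /=; split => -[h1 h2 h3]; split; lra.
- by move=> x; rewrite -h /affm; congr pol2; congr pair; ring.
Qed.

(* Cutting the reference triangle along its axis of symmetry leaves two affine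
   copies of it with half the area. *)
Lemma mom_bisect l l1 l2 : (forall x, pol2 l1 (x.1 - x.2, 2 * x.2) = pol2 l x) ->
  (forall x, pol2 l2 (x.2 - x.1, 2 * x.1) = pol2 l x) ->
  \sum_(k <- l) k.1 * mom k.2.1 k.2.2 = (\sum_(k <- l1) k.1 * mom k.2.1 k.2.2 + \sum_(k <- l2) k.1 * mom k.2.1 k.2.2) / 2.
Proof.
move=> h1 h2; rewrite -!I2_pol2.
have e1 : (1 * 2 - (-1) * 0 : R) = 2 by ring.
have d1 : (1 * 2 - (-1) * 0 : R) != 0 by rewrite e1.
have e2 : ((-1) * 0 - 1 * 2 : R) = - 2 by ring.
have d2 : ((-1) * 0 - 1 * 2 : R) != 0 by rewrite e2 oppr_eq0.
have k1 := I2_affm 0 0 d1 pmeas_rtri (@measf_pol2 l1 setT) (pintg_pol2 l1).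
have k2 := I2_affm 0 0 d2 pmeas_rtri (@measf_pol2 l2 setT) (pintg_pol2 l2).
have mS1 : pmeas (affm 1 (-1) 0 2 0 0 @^-1` rtri) by exact: pmeas_preimage pmeas_rtri.
have mS2 : pmeas (affm (-1) 1 2 0 0 0 @^-1` rtri) by exact: pmeas_preimage pmeas_rtri.
rewrite e1 gtr0_norm// in k1; rewrite e2 normrN gtr0_norm// in k2.
set S1 := affm 1 (-1) 0 2 0 0 @^-1` rtri in k1 mS1; set S2 := affm (-1) 1 2 0 0 0 @^-1` rtri in k2 mS2.
(* The two open halves miss the axis of symmetry, which is null. *)
set Dg : set (plane R) := rtri `&` [set x | 1 * x.1 + (-1) * x.2 + 0 = 0].
have nl : pnull [set x : plane R | 1 * x.1 + (-1) * x.2 + 0 = 0] by apply: pnull_line; rewrite oner_eq0.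
have nD : pnull Dg by apply: pnullS nl; exact: subIsetr.
have mD : pmeas Dg.
  apply: pmeasI; first exact: pmeas_rtri.
  apply: pmeas_closed; apply: (@closed_comp _ _ (fun x : plane R => 1 * x.1 + (-1) * x.2 + 0) [set t | t = 0]); last exact: closed_eq.
  move=> x _; apply: cvgD; last exact: cvg_cst.
  by apply: cvgD; (apply: cvgM; [exact: cvg_cst|]); [exact: cvg_fst|exact: cvg_snd].
have SE : rtri = (S1 `|` S2) `|` Dg.
  apply/seteqP; split => [x [p1 p2 p3]|x].
    have [c|c|c] := ltgtP x.1 x.2.
    - by left; right; rewrite /S2 /affm /rtri /=; split; lra.
    - by left; left; rewrite /S1 /affm /rtri /=; split; lra.
    - by right; split; [split|rewrite /= c; ring].
  case=> [[|]|[]//]; rewrite /S1 /S2 /affm /rtri /= => -[*]; split; lra.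
have disj : S1 `&` S2 = set0.
  by rewrite -subset0 => x [] /=; rewrite /S1 /S2 /affm /rtri /= => -[q1 q2 q3] [q4 q5 q6]; lra.
have il := pintg_pol2 l; rewrite [in pintg _](SE) in il.
rewrite [in LHS]SE I2_setU//; [|exact: pmeasU|by apply: pnullS nD; exact: subIsetr].
rewrite [X in _ + X]I2_pnull ?addr0//; last exact: measf_pol2.
rewrite I2_setU//; [|by rewrite disj; exact: pnull0|]; last first.
  by apply: pintgS il; [exact: pmeasU|exact: pmeasU (pmeasU mS1 mS2) mD|exact: subsetUl].
rewrite mulrDl mulrC -k1 mulrC -k2; congr (_ + _); apply: I2_eq => x _ /=.
  by rewrite -h1 /affm; congr pol2; congr pair; ring.
by rewrite -h2 /affm; congr pol2; congr pair; ring.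
Qed.

(** Symmetry, rotation and bisection give linear equations that determine these moments as multiples
    of the area, without any iterated integral. *)
Lemma mom_values : [/\ mom 1 1 = mom 0 0 / 12, mom 1 2 = mom 0 0 / 30, mom 2 1 = mom 0 0 / 30 &
  mom 1 1 - mom 2 1 - mom 1 2 = mom 0 0 / 60].
Proof.
have s01 := mom_swap 0 1; have s02 := mom_swap 0 2; have s12 := mom_swap 1 2.
have r1 := @mom_rot [:: (1, (0, 1)%N)] [:: (1, (0, 0)%N); (-1, (1, 0)%N); (-1, (0, 1)%N)].
have r2 := @mom_rot [:: (1, (1, 1)%N)] [:: (1, (0, 1)%N); (-1, (1, 1)%N); (-1, (0, 2)%N)].
have r3 := @mom_rot [:: (1, (2, 1)%N)] [:: (1, (0, 2)%N); (-1, (1, 2)%N); (-1, (0, 3)%N)].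
(* [b1] bisects the square of one coordinate; [b2] bisects the product of all three barycentric
   coordinates. *)
have b1 := @mom_bisect [:: (1, (0, 2)%N)] [:: (4^-1, (0, 2)%N)]
   [:: (1, (2, 0)%N); (1, (1, 1)%N); (4^-1, (0, 2)%N)].
have l3 := [:: (2^-1, (1, 1)%N); (- 2^-1, (2, 1)%N); (- 2^-1, (1, 2)%N); (4^-1, (0, 2)%N); (- 4^-1, (1, 2)%N); (- 4^-1, (0, 3)%N)].
have b2 := @mom_bisect [:: (1, (1, 1)%N); (-1, (2, 1)%N); (-1, (1, 2)%N)]
  [:: (2^-1, (1, 1)%N); (- 2^-1, (2, 1)%N); (- 2^-1, (1, 2)%N); (4^-1, (0, 2)%N); (- 4^-1, (1, 2)%N); (- 4^-1, (0, 3)%N)]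
  [:: (2^-1, (1, 1)%N); (- 2^-1, (2, 1)%N); (- 2^-1, (1, 2)%N); (4^-1, (0, 2)%N); (- 4^-1, (1, 2)%N); (- 4^-1, (0, 3)%N)].
rewrite !big_cons !big_nil /= in r1 r2 r3 b1 b2.
have {}r1 := r1 (fun x => ltac:(rewrite /pol2 !big_cons !big_nil /=; ring)).
have {}r2 := r2 (fun x => ltac:(rewrite /pol2 !big_cons !big_nil /=; ring)).
have {}r3 := r3 (fun x => ltac:(rewrite /pol2 !big_cons !big_nil /=; ring)).
have {}b1 := b1 (fun x => ltac:(rewrite /pol2 !big_cons !big_nil /=; field)) (fun x => ltac:(rewrite /pol2 !big_cons !big_nil /=; field)).
have {}b2 := b2 (fun x => ltac:(rewrite /pol2 !big_cons !big_nil /=; field)) (fun x => ltac:(rewrite /pol2 !big_cons !big_nil /=; field)).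
move: s01 s02 s12 r1 r2 r3 b1 b2.
move: (mom 0 0) (mom 0 1) (mom 1 0) (mom 1 1) (mom 0 2) (mom 2 0) (mom 1 2) (mom 2 1) (mom 0 3) => m00 m01 m10 m11 m02 m20 m12 m21 m03.
by move=> *; split; lra.
Qed.

Lemma mom00 : mom 0 0 = fine (mu2 R rtri).
Proof.
rewrite /mom; under eq_fun do rewrite !expr0 mulr1.
by rewrite I2_cst ?mul1r//; exact: pmeas_rtri.
Qed.

(** A crude bound by the enclosing square; it only affects the numerical constants. *)
Lemma mom00_le : mom 0 0 <= 4.
Proof.
rewrite mom00 -lee_fin fineK ?ge0_fin_numE ?rtri_lty//.
have <- : mu2 R (pbox 0 1) = 4%:E by rewrite mu2_pbox// expr1n mulr1.
by apply: le_measure; rewrite ?inE; [exact: pmeas_rtri|exact: pmeas_pbox|exact: rtri_box].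
Qed.

End Moments.

(** * Integrals, gradients and diameters on a cell *)

Section TriangleIntegrals.
Variable R : realType.
Implicit Types (a b c p x y u v : plane R) (f g : plane R -> R) (T e : {fset plane R}).

(** The determinant identity says that the coordinates of b and c form an affine bijection of the
    plane whose Jacobian is reciprocal to that of the edge vectors. *)
Lemma tri_labels T : tri T -> forall b c, b \in T -> c \in T -> b != c ->
  exists a, [/\ a \in T, a != b, a != c, T = [fset a; b; c]%fset &
    cross (dlam T b) (dlam T c) * cross (b - a) (c - a) = 1].
Proof.
move=> hT b c bT cT bc.
suff [a [ab ac TE]] : exists a, [/\ a != b, a != c & T = [fset a; b; c]%fset].
  have aT : a \in T by rewrite TE !inE eqxx.
  exists a; split => //.
  have -> : cross (dlam T b) (dlam T c) * cross (b - a) (c - a) =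
     dot (dlam T b) (b - a) * dot (dlam T c) (c - a) - dot (dlam T b) (c - a) * dot (dlam T c) (b - a).
    by rewrite /cross /dot; ring.
  rewrite !dlam_dot// !eqxx (negbTE bc) [c == b]eq_sym (negbTE bc) [b == a]eq_sym [c == a]eq_sym (negbTE ab) (negbTE ac) /=.
  by ring.
have [a' [b' [c' [TE ab ac bc' _]]]] := tri_abc hT.
move: bT cT bc; rewrite TE !inE -!orbA => /or3P[] /eqP -> /or3P[] /eqP ->; rewrite ?eqxx// => ne.
- exists c'; split; try by [|rewrite eq_sym]. by apply/fsetP => x; rewrite !inE; case: (x == a'); case: (x == b'); case: (x == c').
- exists b'; split; try by [|rewrite eq_sym]. by apply/fsetP => x; rewrite !inE; case: (x == a'); case: (x == b'); case: (x == c').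
- exists c'; split; try by [|rewrite eq_sym]. by apply/fsetP => x; rewrite !inE; case: (x == a'); case: (x == b'); case: (x == c').
- by exists a'.
- exists b'; split; try by [|rewrite eq_sym]. by apply/fsetP => x; rewrite !inE; case: (x == a'); case: (x == b'); case: (x == c').
- exists a'; split; try by [|rewrite eq_sym]. by apply/fsetP => x; rewrite !inE; case: (x == a'); case: (x == b'); case: (x == c').
Qed.

Lemma pmeas_int (D : set (plane R)) : pmeas D°.
Proof. by apply: pmeas_open; exact: open_interior. Qed.

Lemma hull_bnd T (hT : tri T) x : hull T x -> `|x| <= \sum_(p <- T) `|p|.
Proof.
move=> /(hull_lamT hT) h; rewrite -[x in leLHS](sum_lam_pt hT).
apply: le_trans (ler_norm_sum _ _ _) _.
rewrite big_seq [leRHS]big_seq; apply: ler_sum => p pT; rewrite normrZ ger0_norm ?h//.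
rewrite ler_piMl// -(sum_lam hT x) (bigD1_seq p) ?fset_uniq//= lerDl.
by rewrite big_seq_cond; apply: sumr_ge0 => q /andP[qT _]; exact: h.
Qed.

Lemma hull_lty T : tri T -> (mu2 R (hull T) < +oo)%E.
Proof.
move=> hT; apply: (mu2_lty (c := 0) (r := \sum_(p <- T) `|p|)).
  by apply: pmeas_closed; exact: closed_hull.
by move=> x hx; rewrite /pbox /= subr0; exact: hull_bnd.
Qed.

Lemma int_lty T : tri T -> (mu2 R (hull T)° < +oo)%E.
Proof.
move=> hT; apply: le_lt_trans (hull_lty hT); apply: le_measure; rewrite ?inE.
- exact: pmeas_int.
- by apply: pmeas_closed; exact: closed_hull.
- exact: interior_subset.
Qed.

Lemma hull_bdry_null T : tri T -> pnull (hull T `\` (hull T)°).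
Proof.
move=> hT.
apply: (@pnullS _ _ (\bigcup_(p in [set` enum_fset T]) [set x | lam T p x = 0])).
  move=> x [/(hull_lamT hT) h hn]; apply: contrapT => k; apply: hn.
  apply/(int_hull_lam hT) => p pT; rewrite lt_neqAle h// andbT eq_sym.
  by apply/negP => /eqP z; apply: k; exists p.
by apply: pnull_bigcup_seq => p pT; exact: pnull_lam0.
Qed.

(** The coordinates of b and c map the open cell onto the reference triangle. The reference area
    stays the symbol [mom R 0 0], since the moments used are ratios to it. *)
Lemma tri_affm T b c : tri T -> b \in T -> c \in T -> b != c ->
  exists d : R, [/\ 0 < d, forall a, a \in T -> a != b -> a != c -> `|cross (b - a) (c - a)| = d,
    d * mom R 0 0 = area T &
    forall f, measf setT f -> pintg (@rtri R) f ->
      I2 (hull T)° (fun x => f (lam T b x, lam T c x)) = d * I2 (@rtri R) f ].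
Proof.
move=> hT bT cT bc; have [a [aT ab ac TE dd]] := tri_labels hT bT cT bc.
have c0 : cross (b - a) (c - a) != 0.
  by apply/negP => /eqP z; move/eqP: dd; rewrite z mulr0 eq_sym oner_eq0.
have d0 : (dlam T b).1 * (dlam T c).2 - (dlam T b).2 * (dlam T c).1 != 0.
  by apply/negP => /eqP z; move/eqP: dd; rewrite {1}/cross z mul0r eq_sym oner_eq0.
have FE x : affm (dlam T b).1 (dlam T b).2 (dlam T c).1 (dlam T c).2 (lam T b 0) (lam T c 0) x = (lam T b x, lam T c x).
  rewrite /affm; congr pair.
    by have /eqP := lamB hT b 0 x; rewrite subr_eq subr0 => /eqP ->; rewrite /dot.
  by have /eqP := lamB hT c 0 x; rewrite subr_eq subr0 => /eqP ->; rewrite /dot.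
have abc x : lam T a x + lam T b x + lam T c x = 1.
  by have := sum_lam hT x; rewrite [in X in X -> _]TE big_fset3// -TE.
have pre : affm (dlam T b).1 (dlam T b).2 (dlam T c).1 (dlam T c).2 (lam T b 0) (lam T c 0) @^-1` (@rtri R) = (hull T)°.
  apply/seteqP; split => x; rewrite (int_hull_lam hT) /= FE /rtri /=.
    move=> [h1 h2 h3] p pT; have : p \in [fset a; b; c]%fset by rewrite -TE.
    by rewrite !inE -orbA => /or3P[] /eqP -> //; have := abc x; lra.
  by move=> h; split; [exact: h|exact: h|have := abc x; have := h a aT; lra].
have key f : measf setT f -> pintg (@rtri R) f ->
      I2 (hull T)° (fun x => f (lam T b x, lam T c x)) = `|cross (b - a) (c - a)| * I2 (@rtri R) f.
  move=> mf fi; have := I2_affm (lam T b 0) (lam T c 0) d0 (@pmeas_rtri R) mf fi.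
  rewrite pre; under [X in I2 _ X]eq_fun do rewrite /= FE.
  move=> ->; congr (_ * _); move: dd; rewrite {1}/cross => dd.
  apply: (mulIf (x := `|(dlam T b).1 * (dlam T c).2 - (dlam T b).2 * (dlam T c).1|)); first by rewrite normr_eq0.
  by rewrite mulVf ?normr_eq0// -normrM mulrC dd normr1.
exists `|cross (b - a) (c - a)|; split => //.
- by rewrite normr_gt0.
- move=> a' a'T a'b a'c; suff -> : a' = a by [].
  by move: a'T; rewrite TE !inE (negbTE a'b) (negbTE a'c) !orbF => /eqP.
- have := key (fun=> 1) (measf_cst 1).
  have i1 : pintg (@rtri R) (fun=> 1) by have := pintg_mon R 0 0; under eq_fun do rewrite !expr0 mulr1.
  move=> /(_ i1) h.
  have -> : mom R 0 0 = I2 (@rtri R) (fun=> 1) by rewrite /mom; under eq_fun do rewrite !expr0 mulr1.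
  rewrite -h.
  have mh : pmeas (hull T) by apply: pmeas_closed; exact: closed_hull.
  have -> : area T = I2 (hull T) (fun=> 1) by rewrite I2_cst// mul1r.
  have hE : hull T = (hull T)° `|` (hull T `\` (hull T)°) by rewrite setDUK//; exact: interior_subset.
  rewrite [in RHS]hE I2_setU.
  + rewrite [X in _ + X]I2_pnull ?addr0//; [exact: pmeasD mh (pmeas_int _)|exact: measf_cst|exact: hull_bdry_null].
  + exact: pmeas_int.
  + exact: pmeasD mh (pmeas_int _).
  + by rewrite setDIK; exact: pnull0.
  + by rewrite -hE; apply: (pintg_bounded (c := 1)) => [//|||x _]; [exact: hull_lty|exact: measf_cst|rewrite normr1].
Qed.

Lemma I2_lam2 T b c : tri T -> b \in T -> c \in T -> b != c ->
  I2 (hull T)° (fun x => lam T b x * lam T c x) = area T / 12.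
Proof.
move=> hT bT cT bc; have [d [_ _ <- k]] := tri_affm hT bT cT bc.
have := k (fun x => x.1 ^+ 1 * x.2 ^+ 1) (measf_mon _ _) (pintg_mon _ _ _).
rewrite -/(mom R 1 1) => h; rewrite h; have [-> _ _ _] := mom_values R; ring.
Qed.

Lemma I2_lam21 T b c : tri T -> b \in T -> c \in T -> b != c ->
  I2 (hull T)° (fun x => lam T b x ^+ 2 * lam T c x) = area T / 30.
Proof.
move=> hT bT cT bc; have [d [_ _ <- k]] := tri_affm hT bT cT bc.
have := k (fun x => x.1 ^+ 2 * x.2 ^+ 1) (measf_mon _ _) (pintg_mon _ _ _).
rewrite -/(mom R 2 1) => h; rewrite h; have [_ _ -> _] := mom_values R; ring.
Qed.

Lemma I2_lam111 T a b c : tri T -> T = [fset a; b; c]%fset -> a != b -> a != c -> b != c ->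
  I2 (hull T)° (fun x => lam T a x * lam T b x * lam T c x) = area T / 60.
Proof.
move=> hT TE ab ac bc.
have bT : b \in T by rewrite TE !inE eqxx orbT.
have cT : c \in T by rewrite TE !inE eqxx orbT.
have [d [_ _ <- k]] := tri_affm hT bT cT bc.
pose l : seq (R * (nat * nat)) := [:: (1, (1, 1)%N); (-1, (2, 1)%N); (-1, (1, 2)%N)].
have := k (pol2 l) (@measf_pol2 R l setT) (pintg_pol2 l).
rewrite I2_pol2 /l !big_cons !big_nil /= => h.
have [_ _ _ v] := mom_values R.
have <- : d * (1 * mom R 1 1 + (-1 * mom R 2 1 + (-1 * mom R 1 2 + 0))) = d * mom R 0 0 / 60.
  by rewrite -mulrA -v; ring.
rewrite -h; apply: I2_eq => x _; rewrite /pol2 !big_cons !big_nil /=.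
have := sum_lam hT x; rewrite [in X in X -> _]TE big_fset3// -TE => e.
have -> : lam T a x = 1 - lam T b x - lam T c x by rewrite -e; ring.
by ring.
Qed.

Lemma eucl_sqr x y : eucl_dist x y ^+ 2 = dot (x - y) (x - y).
Proof. by rewrite sqr_sqrtr// dot_ge0. Qed.

Lemma eucl_norm x y : `|x - y| <= eucl_dist x y.
Proof.
apply/norm_leP; split; rewrite -(@ler_pXn2r _ 2)// ?nnegrE ?sqrtr_ge0// eucl_sqr real_normK ?num_real//.
  by rewrite /dot -!expr2 lerDl sqr_ge0.
by rewrite /dot -!expr2 lerDr sqr_ge0.
Qed.

Lemma eucl_diam T x y : tri T -> hull T x -> hull T y -> eucl_dist x y <= diam T.
Proof.
move=> hT hx hy; apply: ub_le_sup; last by exists x => //; exists y.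
pose B := 2 * \sum_(p <- T) `|p|.
exists (2 * B) => _ [u hu [v hv <-]].
have B0 : 0 <= B by rewrite /B mulr_ge0// sumr_ge0.
have n : `|u - v| <= B.
  apply: le_trans (ler_normB _ _) _; have := hull_bnd hT hu; have := hull_bnd hT hv.
  by rewrite /B; lra.
have B2 : 0 <= 2 * B by rewrite mulr_ge0.
suff : eucl_dist u v ^+ 2 <= (2 * B) ^+ 2 by rewrite ler_pXn2r// nnegrE// sqrtr_ge0.
rewrite eucl_sqr /dot -!expr2.
have [n1 n2] := (norm_leP _ _).1 n.
have s1 : (u - v).1 ^+ 2 <= B ^+ 2 by rewrite -real_normK ?num_real// ler_pXn2r// nnegrE.
have s2 : (u - v).2 ^+ 2 <= B ^+ 2 by rewrite -real_normK ?num_real// ler_pXn2r// nnegrE.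
have s3 : 0 <= B ^+ 2 by rewrite sqr_ge0.
by rewrite exprMn; lra.
Qed.

Lemma hull_vertex T p : tri T -> p \in T -> hull T p.
Proof. by move=> hT pT; apply/(hull_lamT hT) => q qT; rewrite lam_vertex// ler0n. Qed.

Lemma edge_le T a b : tri T -> a \in T -> b \in T -> dot (b - a) (b - a) <= diam T ^+ 2.
Proof.
move=> hT aT bT; rewrite -eucl_sqr ler_pXn2r// ?nnegrE ?sqrtr_ge0//.
  exact: eucl_diam (hull_vertex hT bT) (hull_vertex hT aT).
by apply: le_trans (eucl_diam hT (hull_vertex hT bT) (hull_vertex hT aT)); exact: sqrtr_ge0.
Qed.

(** The gradient has the length of the opposite edge divided by the Jacobian d, and the area is d
    times the reference area, which is at most 4; hence 16. *)
Lemma dlam_le T a : tri T -> a \in T -> dot (dlam T a) (dlam T a) * area T ^+ 2 <= 16 * diam T ^+ 2.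
Proof.
move=> hT aT.
have [b [c [bT cT ab ac bc]]] : exists b c, [/\ b \in T, c \in T, a != b, a != c & b != c].
  have [a' [b' [c' [TE ab ac bc _]]]] := tri_abc hT.
  have i1 : a' \in T by rewrite TE !inE eqxx.
  have i2 : b' \in T by rewrite TE !inE eqxx orbT.
  have i3 : c' \in T by rewrite TE !inE eqxx orbT.
  move: aT; rewrite TE !inE -orbA => /or3P[] /eqP ->; rewrite -?TE.
  - by exists b', c'.
  - by exists a', c'; split; rewrite // eq_sym.
  - by exists a', b'; split; rewrite // eq_sym.
have [d [d0 dE <- _]] := tri_affm hT bT cT bc.
have {}dE := dE a aT ab ac.
have m0 : 0 <= mom R 0 0 by rewrite mom00 fine_ge0.
have m4 : mom R 0 0 ^+ 2 <= 16.
  have -> : 16 = 4 ^+ 2 :> R by rewrite -natrX.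
  by rewrite ler_pXn2r// ?nnegrE//; exact: mom00_le.
have e : dot (dlam T a) (dlam T a) * d ^+ 2 = dot (c - b) (c - b).
  have h1 := dlam_dot hT a aT bT; have h2 := dlam_dot hT a aT cT.
  rewrite eqxx (negbTE ab) sub0r /= mulr1n in h1; rewrite eqxx (negbTE ac) sub0r /= mulr1n in h2.
  have g1 : (dlam T a).1 * cross (b - a) (c - a) = b.2 - c.2.
    transitivity (dot (dlam T a) (b - a) * (c - a).2 - dot (dlam T a) (c - a) * (b - a).2).
      by rewrite /cross /dot; ring.
    by rewrite h1 h2 !planeE; ring.
  have g2 : (dlam T a).2 * cross (b - a) (c - a) = c.1 - b.1.
    transitivity (dot (dlam T a) (c - a) * (b - a).1 - dot (dlam T a) (b - a) * (c - a).1).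
      by rewrite /cross /dot; ring.
    by rewrite h1 h2 !planeE; ring.
  rewrite -dE real_normK ?num_real//.
  transitivity (((dlam T a).1 * cross (b - a) (c - a)) ^+ 2 + ((dlam T a).2 * cross (b - a) (c - a)) ^+ 2).
    by rewrite /dot; ring.
  by rewrite g1 g2 /dot !planeE; ring.
rewrite exprMn mulrA e mulrC; apply: ler_pM => //; [exact: sqr_ge0|exact: dot_ge0|exact: edge_le].
Qed.

End TriangleIntegrals.

(** * Interior and boundary edges *)

Section Domain.
Variable R : realType.
Implicit Types (x y p : plane R) (Omega : set (plane R)).

Lemma closure_near Omega y (r : R) : closure Omega y -> 0 < r -> exists2 z, Omega z & `|z - y| < r.
Proof.
move=> cy r0; have [|z [Oz hz]] := cy [set z | `|z - y| < r]; last by exists z.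
by apply/near_normP; exists r.
Qed.

(* Below a boundary point the local epigraph representation leaves room for a
   ball that misses the domain. *)
Lemma closure_interior Omega : open Omega -> lipschitz_boundary Omega -> (closure Omega)° = Omega.
Proof.
move=> oO lb; apply/seteqP; split => [p pi|]; last first.
  by rewrite -[X in X `<=` _](interior_id _).1//; apply: interiorS; exact: subset_closure.
apply: contrapT => pO.
have bp : bdry Omega p by split; [exact: interior_subset pi|rewrite (interior_id _).1].
have [c [s [L [gamma [cs lg hg]]]]] := lb p bp.
have [d d0 hd] := (near_normP _ _).1 (filterI pi hg).
have L1 : 0 < `|L| + 1 by rewrite ltr_wpDl.
(* The point y lies d / 2 below p in the rotated frame. Within r of y heights change by at most 2 r
   and the graph by at most 2 |L| r, together d / 2, so no point there is above the graph. *)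
pose r := d / (4 * (`|L| + 1)).
have r0 : 0 < r by rewrite divr_gt0// mulr_gt0.
have rE : r * (4 * (`|L| + 1)) = d by rewrite /r mulfVK// gt_eqF// mulr_gt0.
have rL : 0 <= r * `|L| by rewrite mulr_ge0// ltW.
have c2 : `|c| <= 1.
  rewrite -(@ler_pXn2r _ 2)// ?nnegrE// real_normK ?num_real// expr1n -cs lerDl; exact: sqr_ge0.
have s2 : `|s| <= 1.
  rewrite -(@ler_pXn2r _ 2)// ?nnegrE// real_normK ?num_real// expr1n -cs lerDr; exact: sqr_ge0.
pose y : plane R := (p.1 + d / 2 * s, p.2 - d / 2 * c).
have yp : `|y - p| <= d / 2.
  apply/norm_leP; rewrite /y !planeE /= addrAC subrr add0r [p.2 - _ - _]addrAC subrr add0r normrN (normrM _ s) (normrM _ c).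
  have q0 : 0 < d / 2 by rewrite divr_gt0.
  by rewrite (gtr0_norm q0); split; rewrite ler_piMr// ltW.
have d2 : d / 2 < d by rewrite ltr_pdivrMr// ltr_pMr// ltr1n.
have [cy _] := hd y (le_lt_trans yp d2).
have [z Oz zy] := closure_near cy r0.
have zp : `|z - p| < d.
  have -> : z - p = (z - y) + (y - p) by rewrite addrA subrK.
  apply: le_lt_trans (ler_normD _ _) _; move: zy yp rE r0 rL.
  by move: (`|z - y|) (`|y - p|) (`|L|) => u w l; clear; lra.
have [_ hp] := hd p ltac:(by rewrite subrr normr0); have [_ hz] := hd z zp.
have gz := hz.1 Oz.
have gp : - s * p.1 + c * p.2 <= gamma (c * p.1 + s * p.2).
  by rewrite leNgt; apply/negP => /hp.
have [z1 z2] := (norm_ltP _ _).1 zy; rewrite /y !planeE /= in z1 z2.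
have ey : c * p.1 + s * p.2 = c * (p.1 + d / 2 * s) + s * (p.2 - d / 2 * c) by ring.
have ev : - s * (p.1 + d / 2 * s) + c * (p.2 - d / 2 * c) = - s * p.1 + c * p.2 - d / 2.
  by rewrite -[d / 2 in RHS]mulr1 -cs; ring.
have := lg (c * p.1 + s * p.2, c * z.1 + s * z.2) (conj I I) => /=.
rewrite {2}ey.
have -> : c * (p.1 + d / 2 * s) + s * (p.2 - d / 2 * c) - (c * z.1 + s * z.2) =
   - (c * (z.1 - (p.1 + d / 2 * s)) + s * (z.2 - (p.2 - d / 2 * c))) by ring.
have bnd (a b : R) : `|a| <= 1 -> `|b| < r -> - r <= a * b <= r.
  move=> ha hb; rewrite -ler_norml normrM -[leRHS]mul1r; apply: ler_pM => //; exact: ltW.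
have /andP[p1 p2] := bnd _ _ c2 z1; have /andP[p3 p4] := bnd _ _ s2 z2.
have /andP[p5 p6] := bnd _ _ c2 z2; have /andP[p7 p8] := bnd _ _ s2 z1.
clear bnd hd lg hg hp hz.
set A := c * (z.1 - _) + s * (z.2 - _).
have hA : `|A| <= 2 * r.
  by rewrite ler_norml /A; move: p1 p2 p3 p4; move: (c * _) (s * _) => u w; clear; move=> *; apply/andP; split; lra.
rewrite normrN => h1.
have h2 : L * `|A| <= `|L| * (2 * r).
  apply: (@le_trans _ _ (`|L| * `|A|)); first by rewrite ler_wpM2r// ler_norm.
  by rewrite ler_wpM2l.
have h3 := le_trans h1 h2; move: h3; rewrite ler_norml => /andP[h3 h4].
have ez : - s * z.1 + c * z.2 = (- s * (p.1 + d / 2 * s) + c * (p.2 - d / 2 * c)) +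
   (c * (z.2 - (p.2 - d / 2 * c)) - s * (z.1 - (p.1 + d / 2 * s))) by ring.
rewrite ev in ez.
move: gz gp h3 h4 ez p5 p6 p7 p8 rE; rewrite -[- s * z.1 + c * z.2]/(- s * z.1 + c * z.2).
move: (gamma _) (gamma _) (- s * z.1 + c * z.2) (- s * p.1 + c * p.2) (c * (z.2 - _)) (s * (z.1 - _)) => G G' V P W1 W2.
by move: (`|L|) => l; clear; lra.
Qed.

End Domain.

(** * Conforming meshes *)

Section Mesh.
Variable R : realType.
Implicit Types (x y p a b c z : plane R) (T e : {fset plane R}).
Variables (Omega : set (plane R)) (Th : {fset {fset plane R}}).
Hypotheses (hOm : polygonal_lipschitz_domain Omega) (hTh : triangulation Omega Th).

Lemma dom_open : open Omega. Proof. by have [[]] := hOm. Qed.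
Lemma dom_meas : pmeas Omega. Proof. exact: pmeas_open dom_open. Qed.
Lemma dom_box : exists2 M : R, 0 <= M & Omega `<=` pbox 0 M.
Proof. by have [_ h _ _] := hOm; exact: bounded_pbox. Qed.
Lemma dom_lty : (mu2 R Omega < +oo)%E.
Proof. by have [M _ h] := dom_box; exact: mu2_lty dom_meas h. Qed.
Lemma dom_clint : (closure Omega)° = Omega.
Proof. by have [[oO _ _] _ _ lb] := hOm; exact: closure_interior. Qed.
Lemma bdry_notin x : bdry Omega x -> ~ Omega x.
Proof. by move=> [_ h] Ox; apply: h; rewrite (interior_id _).1//; exact: dom_open. Qed.
Lemma bdryP x : closure Omega x -> ~ Omega x -> bdry Omega x.
Proof. by move=> cx nx; split => // /interior_subset. Qed.

Lemma mesh_tri T : T \in Th -> tri T. Proof. by have [h _ _] := hTh; exact: h. Qed.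

Lemma hull_cl T : T \in Th -> hull T `<=` closure Omega.
Proof. by have [_ _ <-] := hTh; move=> hT x hx; exists T. Qed.

(** Cells are only given inside the closure; the domain is recovered as the interior of its closure,
    which excludes slits. *)
Lemma int_dom T : T \in Th -> (hull T)° `<=` Omega.
Proof. by move=> /hull_cl h; rewrite -[X in _ `<=` X]dom_clint; exact: interiorS. Qed.

Lemma cl_hull x : closure Omega x -> exists2 T, T \in Th & hull T x.
Proof. by have [_ _ <-] := hTh; move=> [T]; exists T. Qed.

Lemma hullI T T' x : T \in Th -> T' \in Th -> hull T x -> hull T' x -> hull (T `&` T')%fset x.
Proof. by have [_ h _] := hTh; move=> hT hT' h1 h2; rewrite -h. Qed.

(** By conformity a point of two cells lies in the hull of their common vertices, so a vertex with
    nonzero coordinate is common. *)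
Lemma lam_gt0_in T T' x a : T \in Th -> T' \in Th -> hull T x -> hull T' x -> a \in T ->
  lam T a x != 0 -> a \in T'.
Proof.
move=> hT hT' h1 h2 aT la; have := hullI hT hT' h1 h2.
move=> /(hull_lam (mesh_tri hT) _ (fsubsetIl _ _))[_ /(_ a aT)].
by rewrite in_fsetI aT /=; case: (a \in T') => // /(_ isT) z; rewrite z eqxx in la.
Qed.

(** On the common face both coordinates are affine with the same vertex values; this makes cellwise
    definitions single-valued. *)
Lemma lam_compat T T' x a : T \in Th -> T' \in Th -> hull T x -> hull T' x ->
  lam T a x = lam T' a x.
Proof.
move=> hT hT' h1 h2.
have tT := mesh_tri hT; have tT' := mesh_tri hT'.
have h := hullI hT hT' h1 h2.
have [aT|aT] := boolP (a \in T); last first.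
  rewrite lam_notin//.
  have [aT'|aT'] := boolP (a \in T'); last by rewrite lam_notin.
  by move/(hull_lam tT' _ (fsubsetIr _ _)): h => [_ ->]//; rewrite in_fsetI (negbTE aT).
have [aT'|aT'] := boolP (a \in T'); last first.
  rewrite [RHS]lam_notin//.
  by move/(hull_lam tT _ (fsubsetIl _ _)): h => [_ ->]//; rewrite in_fsetI (negbTE aT') andbF.
have [w [w0 w1 ->]] := h.
rewrite (aff_comb _ (aff_lam tT a) w1) (aff_comb _ (aff_lam tT' a) w1).
apply: eq_big_seq => p; rewrite in_fsetI => /andP[pT pT'].
by rewrite !lam_vertex.
Qed.

Lemma sub_eq T T' : T \in Th -> T' \in Th -> (forall a, a \in T -> a \in T') -> T = T'.
Proof.
move=> hT hT' h; apply/eqP; rewrite eqEfcard.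
by rewrite (mesh_tri hT).1 (mesh_tri hT').1 leqnn andbT; apply/fsubsetP.
Qed.

Lemma int_uniq T T' x : T \in Th -> T' \in Th -> (hull T)° x -> hull T' x -> T = T'.
Proof.
move=> hT hT' xi xh; apply: sub_eq => // a aT.
apply: (lam_gt0_in hT hT' (interior_subset xi) xh aT).
by rewrite gt_eqF//; apply: (int_hull_lam (mesh_tri hT) x).1.
Qed.

Lemma near_all_seq (I : eqType) (s : seq I) (Q : I -> plane R -> Prop) x :
  (forall i, i \in s -> \forall y \near x, Q i y) -> \forall y \near x, forall i, i \in s -> Q i y.
Proof.
elim: s => [|i s ih] h; first by apply: filterE.
have h1 : \forall y \near x, Q i y by apply: h; rewrite mem_head.
have h2 : \forall y \near x, forall j, j \in s -> Q j y.
  by apply: ih => j js; apply: h; rewrite in_cons js orbT.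
by apply: filterS2 h1 h2 => y q1 q2 j; rewrite in_cons => /orP[/eqP ->//|]; exact: q2.
Qed.

(** There are finitely many cells and each is closed. *)
Lemma near_hull x : \forall y \near x, forall T, T \in Th -> hull T y -> hull T x.
Proof.
apply: (near_all_seq (s := enum_fset Th)) => T hT.
have [hx|hx] := pselect (hull T x); first by apply: filterE.
have op : open (~` hull T) by apply: closed_openC; exact: closed_hull (mesh_tri hT).
by move: op; rewrite openE => /(_ x hx); apply: filterS => y ny /ny.
Qed.

Lemma tri_third T a b : T \in Th -> a \in T -> b \in T -> a != b ->
  exists c, [/\ c \in T, c != a, c != b & T = [fset c; a; b]%fset].
Proof.
move=> hT aT bT ab; have [c [cT ca cb TE _]] := tri_labels (mesh_tri hT) aT bT ab.
by exists c.
Qed.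

Lemma in3 T a b c p : T = [fset c; a; b]%fset -> p \in T -> [\/ p = c, p = a | p = b].
Proof. by move=> -> ; rewrite !inE -orbA => /or3P[] /eqP ->; [constructor 1|constructor 2|constructor 3]. Qed.

(* The two cells lie on opposite sides of ab, hence cover a neighbourhood of y. *)
Lemma shared_relint T T' a b y : T \in Th -> T' \in Th -> T <> T' ->
  a \in T -> b \in T -> a != b -> a \in T' -> b \in T' ->
  hull T y -> hull T' y -> 0 < lam T a y -> 0 < lam T b y -> Omega y.
Proof.
move=> hT hT' nT aT bT ab aT' bT' yT yT' la lb.
have tT := mesh_tri hT; have tT' := mesh_tri hT'.
have [c [cT ca cb TE]] := tri_third hT aT bT ab.
have [c' [cT' ca' cb' TE']] := tri_third hT' aT' bT' ab.
have [ypos|y0] := ltP 0 (lam T c y).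
  apply: (int_dom hT); apply/(int_hull_lam tT) => p /(in3 TE)[] -> //.
have lc : lam T c y = 0 by apply/eqP; rewrite eq_le y0; move/(hull_lamT tT): yT => ->.
have la' : 0 < lam T' a y by rewrite -(lam_compat a hT hT' yT yT').
have lb' : 0 < lam T' b y by rewrite -(lam_compat b hT hT' yT yT').
(* The coordinates opposite to ab in the two cells both vanish on the line ab, hence are
   proportional; the sign of k decides on which side the second cell lies. *)
pose k := lam T' c' c.
have kE z : lam T' c' z = k * lam T c z.
  rewrite (aff_lamE tT z (aff_lam tT' c')) [X in \sum_(_ <- enum_fset X) _]TE big_fset3//.
  by rewrite (lam_vertex tT' c' aT') (lam_vertex tT' c' bT') (negbTE ca') (negbTE cb') !mulr0 !addr0 mulrC.
have na := near_lam_gt0 tT la; have nb := near_lam_gt0 tT lb.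
have na' := near_lam_gt0 tT' la'; have nb' := near_lam_gt0 tT' lb'.
have nn : \forall z \near y, (0 < lam T a z /\ 0 < lam T b z) /\ (0 < lam T' a z /\ 0 < lam T' b z).
  by apply: filterI; exact: filterI.
have k0 : k <= 0.
  rewrite leNgt; apply/negP => k0; apply: nT.
  have [d d0 hd] := near_ray (c - y) nn.
  have dd : `|d / 2| < d by rewrite gtr0_norm ?divr_gt0//; lra.
  have [[h1 h2] [h3 h4]] := hd _ dd.
  have lz : 0 < lam T c (y + (d / 2) *: (c - y)).
    rewrite (lamDt tT) lc add0r -(lamB tT) lc (lam_vertex tT)// eqxx subr0 mulr1.
    by rewrite divr_gt0.
  apply: (@int_uniq T T' (y + (d / 2) *: (c - y))) => //.
    by apply/(int_hull_lam tT) => p /(in3 TE)[] ->.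
  by apply/(hull_lamT tT') => p /(in3 TE')[] ->; rewrite ltW// kE mulr_gt0.
rewrite -dom_clint; apply: filterS nn => z [[h1 h2] [h3 h4]].
have [lz|lz] := leP 0 (lam T c z).
  by apply: (hull_cl hT); apply/(hull_lamT tT) => p /(in3 TE)[] -> //; rewrite ltW.
apply: (hull_cl hT'); apply/(hull_lamT tT') => p /(in3 TE')[] -> //; rewrite ?(ltW h3) ?(ltW h4)//.
by rewrite kE mulr_le0// ltW.
Qed.

(** If the edge meets the domain, some point y of its relative interior does too. A small step from
    y away from c leaves T but not the domain, so it enters another cell, and cells met near y
    contain y. *)
Lemma shared_or_bdry T a b : T \in Th -> a \in T -> b \in T -> a != b ->
  (exists T', [/\ T' \in Th, T <> T', a \in T' & b \in T']) \/ hull [fset a; b]%fset `<=` bdry Omega.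
Proof.
move=> hT aT bT ab.
have [|ns] := pselect (exists T', [/\ T' \in Th, T <> T', a \in T' & b \in T']); first by left.
right => x; have tT := mesh_tri hT.
have [c [cT ca cb TE]] := tri_third hT aT bT ab.
have eT : ([fset a; b] `<=` T)%fset by apply/fsubsetP => p; rewrite !inE => /orP[] /eqP ->.
move/(hull_lam tT _ eT) => [l0 le].
have xT : hull T x by apply/(hull_lamT tT).
apply: bdryP; first exact: hull_cl hT _ xT.
move=> Ox; apply: ns.
have lc : lam T c x = 0 by apply: le => //; rewrite !inE negb_or ca cb.
have oO := dom_open.
have [y [Oy la lb ly]] : exists y, [/\ Omega y, 0 < lam T a y, 0 < lam T b y & lam T c y = 0].
  have nx : \forall y \near x, Omega y by move: oO; rewrite openE => /(_ x Ox).
  have [d d0 hd] := near_ray (2^-1 *: (a + b) - x) nx.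
  (* Moving part of the way towards the midpoint of the edge makes both end coordinates positive
     while staying in the domain. *)
  pose t := Num.min (d / 2) (2^-1).
  have t0 : 0 < t by rewrite lt_min divr_gt0//= invr_gt0.
  have t1 : t <= 2^-1 by rewrite ge_min lexx orbT.
  have td : `|t| < d by rewrite gtr0_norm//; apply: le_lt_trans (_ : d / 2 < d); [rewrite ge_min lexx|lra].
  have mid q : lam T q (2^-1 *: (a + b)) = (lam T q a + lam T q b) / 2.
    have [al [be [ga h]]] := aff_lam tT q.
    by rewrite !h !planeE; field.
  exists (x + t *: (2^-1 *: (a + b) - x)); split; first exact: hd.
  - rewrite (lamDt tT) -(lamB tT) mid (lam_vertex tT a aT) (lam_vertex tT a bT) eqxx (negbTE ab) addr0 /=.
    have := l0 _ aT; move: (lam T a x) => u u0.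
    have -> : u + t * (1%:R / 2 - u) = (1 - t) * u + t / 2 by ring.
    by rewrite ltr_wpDl ?mulr_ge0 ?divr_gt0//; lra.
  - rewrite (lamDt tT) -(lamB tT) mid (lam_vertex tT b aT) (lam_vertex tT b bT) eqxx [b == a]eq_sym (negbTE ab) add0r /=.
    have := l0 _ bT; move: (lam T b x) => u u0.
    have -> : u + t * (1%:R / 2 - u) = (1 - t) * u + t / 2 by ring.
    by rewrite ltr_wpDl ?mulr_ge0 ?divr_gt0//; lra.
  - by rewrite (lamDt tT) -(lamB tT) mid lc (lam_vertex tT c aT) (lam_vertex tT c bT) (negbTE ca) (negbTE cb) addr0 mul0r subr0 mulr0 addr0.
have yT : hull T y by apply/(hull_lamT tT) => p /(in3 TE)[] ->; rewrite ?ly// ltW.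
have ny : \forall z \near y, Omega z by move: oO; rewrite openE => /(_ y Oy).
have [d d0 hd] := near_ray (y - c) (filterI ny (near_hull y)).
have dd : `|d / 2| < d by rewrite gtr0_norm ?divr_gt0//; lra.
have [Oz hz] := hd _ dd.
have [T' hT' zT'] := cl_hull (subset_closure Oz).
have yT' := hz _ hT' zT'.
exists T'; split => //.
- move=> TT'; move: zT'; rewrite -TT' => /(hull_lamT tT)/(_ c cT).
  rewrite (lamDt tT) ly add0r -(lamB tT) ly (lam_vertex tT)// eqxx sub0r mulrN1 oppr_ge0 leNgt.
  by rewrite divr_gt0.
- by apply: (lam_gt0_in hT hT' yT yT') => //; rewrite gt_eqF.
- by apply: (lam_gt0_in hT hT' yT yT') => //; rewrite gt_eqF.
Qed.

Lemma int_edge_shared T a b : T \in Th -> a \in T -> b \in T -> a != b ->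
  int_edge Omega Th [fset a; b]%fset -> exists T', [/\ T' \in Th, T <> T', a \in T' & b \in T'].
Proof.
move=> hT aT bT ab [_ nb]; case: (shared_or_bdry hT aT bT ab) => //.
Qed.

Lemma edge_or T a b : T \in Th -> a \in T -> b \in T -> a != b ->
  int_edge Omega Th [fset a; b]%fset \/ bdry_edge Omega Th [fset a; b]%fset.
Proof.
move=> hT aT bT ab.
have ie : is_edge Th [fset a; b]%fset.
  split; first by rewrite cardfs2 ab.
  by exists T => //; apply/fsubsetP => p; rewrite !inE => /orP[] /eqP ->.
by have [h|h] := pselect (hull [fset a; b]%fset `<=` bdry Omega); [right|left].
Qed.

Lemma int_edge_neq a b : int_edge Omega Th [fset a; b]%fset -> a != b.
Proof. by move=> [[]]; rewrite cardfs2; case: (a != b). Qed.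

(** With both coordinates nonzero the point would be inside a cell or in the relative interior of a
    shared edge, hence in the open domain. *)
Lemma int_edge_bdry T a b x : int_edge Omega Th [fset a; b]%fset -> T \in Th -> hull T x ->
  bdry Omega x -> lam T a x * lam T b x = 0.
Proof.
move=> ie hT xT bx; have tT := mesh_tri hT; have ab := int_edge_neq ie.
have [aT|aT] := boolP (a \in T); last by rewrite lam_notin ?mul0r.
have [bT|bT] := boolP (b \in T); last by rewrite [lam T b x]lam_notin ?mulr0.
have l0 := (hull_lamT tT x).1 xT.
have [la|la] := eqVneq (lam T a x) 0; first by rewrite la mul0r.
have [lb|lb] := eqVneq (lam T b x) 0; first by rewrite lb mulr0.
have pa : 0 < lam T a x by rewrite lt_neqAle eq_sym la l0.
have pb : 0 < lam T b x by rewrite lt_neqAle eq_sym lb l0.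
have [T' [hT' nT aT' bT']] := int_edge_shared hT aT bT ab ie.
exfalso; apply: (bdry_notin bx).
have [c [cT ca cb TE]] := tri_third hT aT bT ab.
have [ypos|y0] := ltP 0 (lam T c x).
  by apply: (int_dom hT); apply/(int_hull_lam tT) => p /(in3 TE)[] ->.
have lc : lam T c x = 0 by apply/eqP; rewrite eq_le y0 l0.
have eT : ([fset a; b] `<=` T)%fset by apply/fsubsetP => p; rewrite !inE => /orP[] /eqP ->.
have eT' : ([fset a; b] `<=` T')%fset by apply/fsubsetP => p; rewrite !inE => /orP[] /eqP ->.
have xe : hull [fset a; b]%fset x.
  by apply/(hull_lam tT _ eT); split => // p /(in3 TE)[] ->; rewrite ?lc// !inE eqxx ?orbT.
apply: (shared_relint hT hT' nT aT bT ab aT' bT' xT) => //.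
by apply/(hull_lamT (mesh_tri hT')); have [] := (hull_lam (mesh_tri hT') x eT').1 xe.
Qed.

(** Two distinct cells along the edge would make its midpoint a point of the domain. *)
Lemma bdry_edge_uniq T T' a b : a != b -> bdry_edge Omega Th [fset a; b]%fset -> T \in Th -> T' \in Th ->
  a \in T -> b \in T -> a \in T' -> b \in T' -> T = T'.
Proof.
move=> ab [_ be] hT hT' aT bT aT' bT'; apply: contrapT => nT.
have tT := mesh_tri hT; have tT' := mesh_tri hT'.
pose x := 2^-1 *: (a + b).
have mid T0 q : T0 \in Th -> lam T0 q x = (lam T0 q a + lam T0 q b) / 2.
  move=> h0; have [al [be' [ga h]]] := aff_lam (mesh_tri h0) q.
  by rewrite /x !h !planeE; field.
have hx T0 : T0 \in Th -> a \in T0 -> b \in T0 -> hull T0 x.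
  move=> h0 a0 b0; apply/(hull_lamT (mesh_tri h0)) => p p0.
  by rewrite mid// !lam_vertex ?divr_ge0 ?addr_ge0 ?ler0n//; exact: mesh_tri.
have eT : ([fset a; b] `<=` T)%fset by apply/fsubsetP => p; rewrite !inE => /orP[] /eqP ->.
have xe : hull [fset a; b]%fset x.
  apply/(hull_lam tT _ eT); split => [|p pT]; first by apply/(hull_lamT tT); exact: hx.
  rewrite !inE negb_or => /andP[pa pb].
  by rewrite mid// !lam_vertex// (negbTE pa) (negbTE pb) addr0 mul0r.
apply: (bdry_notin (be x xe)).
apply: (shared_relint hT hT' nT aT bT ab aT' bT' (hx T hT aT bT) (hx T' hT' aT' bT')).
  by rewrite mid// !lam_vertex// eqxx (negbTE ab) addr0 divr_gt0.
by rewrite mid// !lam_vertex// eqxx [b == a]eq_sym (negbTE ab) add0r divr_gt0.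
Qed.

End Mesh.

(** * Affine functions and squared norms *)

Section Affine.
Variable R : realType.
Implicit Types (x y p : plane R) (f g : plane R -> R) (T : {fset plane R}) (D : set (plane R)).

Definition daff f : plane R := (f (1, 0) - f 0, f (0, 1) - f 0).

Lemma daffB f x y : aff f -> f y - f x = dot (daff f) (y - x).
Proof. by move=> [al [be [ga h]]]; rewrite /daff /dot !h /=; ring. Qed.

Lemma aff_grad f x : aff f -> grad f x (daff f).1 (daff f).2.
Proof.
move=> af e e0; apply: filterE => y; rewrite (daffB _ _ af) /dot !planeE subrr normr0.
by rewrite mulr_ge0// ltW.
Qed.

Lemma aff_lip f : aff f -> lip (`|(daff f).1| + `|(daff f).2|) f.
Proof.
move=> af x y; rewrite (daffB y x af) /dot; move: (daff f) => d; rewrite mulrDl.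
apply: le_trans (ler_normD _ _) _; rewrite !normrM.
by apply: lerD; rewrite ler_wpM2l//; [exact: norm_fst|exact: norm_snd].
Qed.

Lemma aff_cont f : aff f -> continuous f.
Proof. by move=> /aff_lip; exact: lip_cont. Qed.

Lemma aff_measf f : aff f -> measf setT f.
Proof. by move=> /aff_lip; exact: lip_measf. Qed.

Lemma aff_null f : aff f -> daff f != 0 -> pnull [set x | f x = 0].
Proof.
move=> [al [be [ga h]]] d0.
have -> : [set x | f x = 0] = [set x : plane R | al * x.1 + be * x.2 + ga = 0].
  by apply/seteqP; split => x /=; rewrite h.
apply: pnull_line; rewrite -negb_and; apply: contra d0 => /andP[/eqP z1 /eqP z2].
by rewrite /daff !h z1 z2 /= !mul0r !add0r subrr.
Qed.

Definition interp T f x : R := \sum_(p <- T) lam T p x * f p.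

Lemma aff_interp T f : tri T -> aff (interp T f).
Proof.
move=> hT; rewrite /interp; elim: (enum_fset T) => [|q s ih].
  by under eq_fun do rewrite big_nil; exact: aff_cst.
under eq_fun do rewrite big_cons mulrC.
by apply: affD => //; apply: affZ; exact: aff_lam.
Qed.

Lemma poly_on_aff D f g : (forall x, D x -> f x = g x) -> aff g -> poly_on 1 D f.
Proof.
move=> fg [al [be [ga h]]].
exists (fun i j => if i is 0%N then (if j is 0%N then ga else be) else al) => x Dx.
rewrite fg// h; under eq_bigr do rewrite big_mkcond.
by rewrite !big_ord_recl !big_ord0 /bump /= ?expr0 ?expr1; ring.
Qed.

Lemma aff_poly_on D f : poly_on 1 D f -> exists2 g, aff g & forall x, D x -> f x = g x.
Proof.
move=> [c h]; exists (fun x => c 1%N 0%N * x.1 + c 0%N 1%N * x.2 + c 0%N 0%N).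
  by exists (c 1%N 0%N), (c 0%N 1%N), (c 0%N 0%N).
move=> x Dx; rewrite h//; under eq_bigr do rewrite big_mkcond.
by rewrite !big_ord_recl !big_ord0 /bump /= ?expr0 ?expr1; ring.
Qed.

Lemma poly_on_interp T f x : tri T -> poly_on 1 (hull T) f -> hull T x -> f x = interp T f x.
Proof.
move=> hT /aff_poly_on[g ag fg] xT; rewrite fg// (aff_lamE hT x ag) /interp.
by apply: eq_big_seq => p pT; rewrite fg//; exact: hull_vertex.
Qed.

Lemma poly_onD k D f g : poly_on k D f -> poly_on k D g -> poly_on k D (fun x => f x + g x).
Proof.
move=> [c h] [c' h']; exists (fun i j => c i j + c' i j) => x Dx.
rewrite h// h'// -big_split /=; apply: eq_bigr => i _; rewrite -big_split /=.
by apply: eq_bigr => j _; ring.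
Qed.

Lemma poly_onZ k D f (r : R) : poly_on k D f -> poly_on k D (fun x => r * f x).
Proof.
move=> [c h]; exists (fun i j => r * c i j) => x Dx.
rewrite h// mulr_sumr; apply: eq_bigr => i _; rewrite mulr_sumr.
by apply: eq_bigr => j _; ring.
Qed.

Lemma poly_on_eq k D f g : (forall x, D x -> f x = g x) -> poly_on k D f -> poly_on k D g.
Proof. by move=> fg [c h]; exists c => x Dx; rewrite -fg// h. Qed.

Lemma poly_on_mul D f g : aff f -> aff g -> poly_on 2 D (fun x => f x * g x).
Proof.
move=> [al [be [ga h]]] [al' [be' [ga' h']]].
exists (fun i j => match i, j with
  | 0%N, 0%N => ga * ga' | 1%N, 0%N => al * ga' + ga * al' | 0%N, 1%N => be * ga' + ga * be'
  | 2%N, 0%N => al * al' | 0%N, 2%N => be * be' | _, _ => al * be' + be * al' end) => x Dx.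
rewrite h h'; under eq_bigr do rewrite big_mkcond.
by rewrite !big_ord_recl !big_ord0 /bump /= ?expr0 ?expr1; ring.
Qed.

Lemma poly_on12 D f : poly_on 1 D f -> poly_on 2 D f.
Proof.
move=> /aff_poly_on[g ag fg]; apply: (poly_on_eq _ (poly_on_mul D ag (aff_cst 1))) => x Dx.
by rewrite mulr1 fg.
Qed.

Lemma lip_le f (L L' : R) : L <= L' -> lip L f -> lip L' f.
Proof. by move=> h l x y; apply: le_trans (l x y) _; rewrite ler_wpM2r. Qed.

Lemma unif_bound (I : eqType) (s : seq I) (Q : I -> R -> Prop) :
  (forall i (L L' : R), L <= L' -> Q i L -> Q i L') -> (forall i, i \in s -> exists L, Q i L) ->
  exists2 L : R, 0 <= L & forall i, i \in s -> Q i L.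
Proof.
move=> mono; elim: s => [|i s ih] h; first by exists 0.
have [L L0 hL] := ih (fun j js => h j ltac:(by rewrite in_cons js orbT)).
have [L' hL'] := h i (mem_head _ _).
exists (Num.max L L'); first by rewrite le_max L0.
move=> j; rewrite in_cons => /orP[/eqP ->|js].
  by apply: mono hL'; rewrite le_max lexx orbT.
by apply: mono (hL j js); rewrite le_max lexx.
Qed.

Lemma I2_sub D (E : set (plane R)) f : pmeas D -> pmeas E -> D `<=` E -> pintg E f ->
  (forall x, E x -> 0 <= f x) -> I2 D f <= I2 E f.
Proof.
move=> mD mE DE fi f0.
have EE : E = D `|` (E `\` D) by rewrite setDUK.
rewrite [in leRHS]EE I2_setU//; [|exact: pmeasD|by rewrite setDIK; exact: pnull0|by rewrite -EE].
by rewrite lerDl; apply: I2_ge0 => x [Ex _]; exact: f0.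
Qed.

End Affine.

(* Locking keeps unification from unfolding the integrals behind the norms. *)
HB.lock Definition sqn (R : realType) (D : set (plane R)) (f : plane R -> R) : R := L2norm D f ^+ 2.
HB.lock Definition hsq (R : realType) (D : set (plane R)) (f : plane R -> R) : R := H1norm D f ^+ 2.

(** * Squared norms and the spaces H^1 and H^1_0 *)

Section Transfer.
Variable R : realType.
Implicit Types (f g : plane R -> R) (D : set (plane R)).

Lemma weak_deriv_eq D v f f' g : (forall x, D x -> f x = f' x) -> weak_deriv D v f g -> weak_deriv D v f' g.
Proof.
move=> e h phi tp; rewrite -(h phi tp) !innerE; apply: I2_eq => x Dx; by rewrite e.
Qed.

(** The weak derivatives are chosen from the same sets of candidates, so the choices coincide. *)
Lemma hsq_eq D f f' : (forall x, D x -> f x = f' x) -> hsq D f = hsq D f'.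
Proof.
move=> e; have e' x : D x -> f' x = f x by move=> Dx; rewrite e.
have eR : f \_ D = f' \_ D.
  by apply/funext => x; rewrite !patchE; case: ifPn => // /set_mem Dx; rewrite e.
have eW v : wD D v f = wD D v f'.
  rewrite /wD; congr xget; apply/seteqP; split => g [h1 h2]; split => //.
    exact: weak_deriv_eq h2.
  exact: weak_deriv_eq h2.
by rewrite hsq.unlock /H1norm /L2norm eR !eW.
Qed.

Lemma hsq_ge0 D f : 0 <= hsq D f. Proof. by rewrite hsq.unlock sqr_ge0. Qed.
Lemma sqn_ge0 D f : 0 <= sqn D f. Proof. by rewrite sqn.unlock sqr_ge0. Qed.

Lemma H1norm_lt D f (e : R) : 0 < e -> H1norm D f < e <-> hsq D f < e ^+ 2.
Proof.
move=> e0; rewrite hsq.unlock; have h0 : 0 <= H1norm D f by exact: sqrtr_ge0.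
by move: (H1norm D f) h0 => u u0; rewrite ltr_pXn2r// nnegrE// ltW.
Qed.

Lemma sqnE D f : pmeas D -> L2 D f -> sqn D f = I2 D (fun x => f x ^+ 2).
Proof. by move=> mD Lf; rewrite sqn.unlock; exact: L2norm_sq. Qed.

Lemma sqnD D f g : pmeas D -> L2 D f -> L2 D g ->
  sqn D (fun x => f x + g x) <= 2 * sqn D f + 2 * sqn D g.
Proof. by move=> mD Lf Lg; rewrite sqn.unlock; exact: L2norm_sqD. Qed.

Lemma sqnZ D f (c : R) : pmeas D -> L2 D f -> sqn D (fun x => c * f x) = c ^+ 2 * sqn D f.
Proof.
move=> mD Lf; rewrite (sqnE mD (L2Z c mD Lf)) (sqnE mD Lf) -I2Z//; last exact: L2_pintg_sq.
by apply: I2_eq => x _; rewrite exprMn.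
Qed.

Lemma sqn_eq D f g : (forall x, D x -> f x = g x) -> sqn D f = sqn D g.
Proof.
move=> e; rewrite sqn.unlock /L2norm.
have -> // : f \_ D = g \_ D.
by apply/funext => x; rewrite !patchE; case: ifPn => // /set_mem Dx; rewrite e.
Qed.

Lemma sqn_young D f g (t : R) : 0 < t -> pmeas D -> L2 D f -> L2 D g ->
  `|I2 D (fun x => f x * g x)| <= t / 2 * sqn D f + (2 * t)^-1 * sqn D g.
Proof. by move=> *; rewrite sqn.unlock; exact: inner_young. Qed.

Lemma hsq_weak D f g1 g2 : open D -> L2 D f -> L2 D g1 -> L2 D g2 ->
  weak_deriv D (ex R) f g1 -> weak_deriv D (ey R) f g2 ->
  hsq D f = sqn D f + sqn D g1 + sqn D g2.
Proof. by move=> *; rewrite hsq.unlock sqn.unlock; exact: H1norm_sq. Qed.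

Lemma H1_0_eq D f f' : pmeas D -> (forall x, D x -> f x = f' x) -> H1_0 D f -> H1_0 D f'.
Proof.
move=> mD e [[Lf [g Lg wg] [g' Lg' wg']] h]; split.
  split; first exact: L2_eq Lf.
    by exists g => //; exact: weak_deriv_eq wg.
  by exists g' => //; exact: weak_deriv_eq wg'.
move=> eps e0; have [phi tp /(H1norm_lt _ _ e0) hp] := h _ e0; exists phi; first exact: tp.
apply/(H1norm_lt _ _ e0).
have <- : hsq D (f - phi) = hsq D (f' - phi) by apply: hsq_eq => x Dx; rewrite !fctE e.
exact: hp.
Qed.

Lemma testD D f g : test_function D f -> test_function D g -> test_function D (f + g).
Proof.
move=> [sf [K [cK KD zf]]] [sg [K' [cK' KD' zg]]]; split; first exact: smooth_add.
exists (K `|` K'); split; first exact: compactU.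
  by rewrite subUset.
move=> x hx; rewrite fctE zf ?zg ?addr0//; first by move=> ?; apply: hx; right.
by move=> ?; apply: hx; left.
Qed.

Lemma testZ D f (c : R) : test_function D f -> test_function D (c *: f).
Proof.
move=> [sf [K [cK KD zf]]]; split; first exact: smooth_scale.
by exists K; split => // x hx; rewrite fctE zf// scaler0.
Qed.

Section OpenDomain.
Variable D : set (plane R).
Hypothesis oD : open D.
Let mD : pmeas D := pmeas_open oD.

Lemma H1_add f g : H1 D f -> H1 D g -> H1 D (fun x => f x + g x).
Proof.
move=> [Lf [f1 L1 w1] [f2 L2 w2]] [Lg [g1 M1 v1] [g2 M2 v2]]; split; first exact: L2D.
  by exists (fun x => f1 x + g1 x); [exact: L2D|exact: weak_derivD].
by exists (fun x => f2 x + g2 x); [exact: L2D|exact: weak_derivD].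
Qed.

Lemma H1_scale f (c : R) : H1 D f -> H1 D (fun x => c * f x).
Proof.
move=> [Lf [f1 L1 w1] [f2 L2 w2]]; split; first exact: L2Z.
  by exists (fun x => c * f1 x); [exact: L2Z|exact: weak_derivZ].
by exists (fun x => c * f2 x); [exact: L2Z|exact: weak_derivZ].
Qed.

Lemma hsqE f : H1 D f -> hsq D f = sqn D f + sqn D (wD D (ex R) f) + sqn D (wD D (ey R) f).
Proof. by move=> /(H1_wD oD)[L0 L1 L2 w1 w2]; exact: hsq_weak. Qed.

Lemma H1_ex f : H1 D f -> exists g1 g2, [/\ L2 D g1, L2 D g2, weak_deriv D (ex R) f g1,
  weak_deriv D (ey R) f g2 & hsq D f = sqn D f + sqn D g1 + sqn D g2].
Proof.
move=> hf; have [L0 L1 L2 w1 w2] := H1_wD oD hf.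
by exists (wD D (ex R) f), (wD D (ey R) f); split => //; exact: hsqE.
Qed.

Lemma sqn_hsq f : H1 D f -> sqn D f <= hsq D f.
Proof. by move=> hf; rewrite (hsqE hf) -addrA lerDl addr_ge0 ?sqn_ge0. Qed.

Lemma hsqD f g : H1 D f -> H1 D g -> hsq D (fun x => f x + g x) <= 2 * hsq D f + 2 * hsq D g.
Proof.
move=> hf hg; have [[L0 _ _] [M0 _ _]] := (hf, hg).
have [f1 [f2 [L1 L2 w1 w2 ->]]] := H1_ex hf; have [g1 [g2 [M1 M2 v1 v2 ->]]] := H1_ex hg.
rewrite (hsq_weak oD (L2D mD L0 M0) (L2D mD L1 M1) (L2D mD L2 M2)
  (weak_derivD mD L0 M0 L1 M1 w1 v1) (weak_derivD mD L0 M0 L2 M2 w2 v2)).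
have := sqnD mD L0 M0; have := sqnD mD L1 M1; have := sqnD mD L2 M2; lra.
Qed.

Lemma hsqZ f (c : R) : H1 D f -> hsq D (fun x => c * f x) = c ^+ 2 * hsq D f.
Proof.
move=> hf; have [L0 _ _] := hf; have [f1 [f2 [L1 L2 w1 w2 ->]]] := H1_ex hf.
rewrite (hsq_weak oD (L2Z c mD L0) (L2Z c mD L1) (L2Z c mD L2)
  (weak_derivZ c mD L0 L1 w1) (weak_derivZ c mD L0 L2 w2)).
by rewrite (sqnZ _ mD L0) (sqnZ _ mD L1) (sqnZ _ mD L2) !mulrDr.
Qed.

Lemma test_H1 phi : test_function D phi -> H1 D phi.
Proof.
move=> tp; split; first exact: test_L2 mD tp.
  by exists (fun x => 'D_(ex R) phi x); [exact: test_D_L2 mD tp|exact: test_weak].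
by exists (fun x => 'D_(ey R) phi x); [exact: test_D_L2 mD tp|exact: test_weak].
Qed.

Lemma H1_sub f g : H1 D f -> H1 D g -> H1 D (f - g).
Proof.
move=> hf hg; have := H1_add hf (H1_scale (-1) hg).
by have -> : (fun x => f x + -1 * g x) = f - g by apply/funext => x; rewrite mulN1r.
Qed.

Lemma H1_0_add f g : H1_0 D f -> H1_0 D g -> H1_0 D (fun x => f x + g x).
Proof.
move=> [hf af] [hg ag]; split; first exact: H1_add.
move=> eps e0; have e2 : 0 < eps / 2 by rewrite divr_gt0.
have [phi tp /(H1norm_lt _ _ e2) hp] := af _ e2; have [psi tq /(H1norm_lt _ _ e2) hq] := ag _ e2.
exists (phi + psi); first exact: testD.
apply/(H1norm_lt _ _ e0).
have -> : (fun x => f x + g x) - (phi + psi) = (fun x => (f - phi) x + (g - psi) x).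
  by apply/funext => x; rewrite !fctE; ring.
apply: le_lt_trans (hsqD (H1_sub hf (test_H1 tp)) (H1_sub hg (test_H1 tq))) _.
have -> : eps ^+ 2 = 2 * (eps / 2) ^+ 2 + 2 * (eps / 2) ^+ 2 by field.
by apply: ltrD; rewrite ltr_pM2l.
Qed.

Lemma H1_0_scale f (c : R) : H1_0 D f -> H1_0 D (fun x => c * f x).
Proof.
move=> [hf af]; split; first exact: H1_scale.
move=> eps e0; have c0 : 0 < `|c| + 1 by rewrite ltr_wpDl.
have ec := divr_gt0 e0 c0.
have [phi tp /(H1norm_lt _ _ ec) hp] := af _ ec.
exists (c *: phi); first exact: testZ.
apply/(H1norm_lt _ _ e0).
have -> : (fun x => c * f x) - c *: phi = (fun x => c * (f - phi) x).
  by apply/funext => x; rewrite !fctE /GRing.scale /=; ring.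
rewrite (hsqZ c (H1_sub hf (test_H1 tp))).
have -> : eps ^+ 2 = (`|c| + 1) ^+ 2 * (eps / (`|c| + 1)) ^+ 2.
  by rewrite -exprMn mulrC mulfVK// gt_eqF.
apply: (@le_lt_trans _ _ ((`|c| + 1) ^+ 2 * hsq D (f - phi))).
  rewrite ler_wpM2r ?hsq_ge0// -[leLHS]real_normK ?num_real// ler_pXn2r// ?nnegrE ?(ltW c0)//.
  by rewrite lerDl.
by rewrite ltr_pM2l// exprn_gt0.
Qed.

Lemma H1_0_0 : H1_0 D (fun=> 0).
Proof.
have t0 : test_function D (fun=> 0).
  split; last by exists set0; split => //; exact: compact0.
  apply: (@sm2_smooth _ (fun=> 0)).
  have -> : (fun=> 0) = (fun x : plane R => (fun=> 0 : R) x.1 * (fun=> 0 : R) x.2) by apply/funext => x; rewrite mul0r.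
  by apply: (@sm2_tens _ (fun=> 0) (fun=> 0)); exact: sm_cst.
split; first exact: test_H1.
move=> eps e0; exists (fun=> 0) => //; apply/(H1norm_lt _ _ e0).
have -> : (fun=> 0) - (fun=> 0) = (fun x => 0 * (fun=> 0 : R) x) :> (plane R -> R).
  by apply/funext => x; rewrite !fctE; ring.
by rewrite (hsqZ 0 (test_H1 t0)) expr0n mul0r exprn_gt0.
Qed.

Lemma H1_0_sum I (s : seq I) (F : I -> plane R -> R) : (forall i, H1_0 D (F i)) ->
  H1_0 D (fun x => \sum_(i <- s) F i x).
Proof.
move=> h; elim: s => [|i s ih].
  by under eq_fun do rewrite big_nil; exact: H1_0_0.
by under eq_fun do rewrite big_cons; exact: (H1_0_add (h i) ih).
Qed.

End OpenDomain.
End Transfer.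

(** * Piecewise polynomial functions *)

Lemma sum3_lt (R : realType) (r0 r1 r2 t : R) : 0 <= r0 -> 0 <= r1 -> 0 <= r2 -> r0 + r1 + r2 < t ->
  [/\ r0 <= t, r1 <= t & r2 <= t].
Proof. by move=> *; split; lra. Qed.

Section MeshFunctions.
Variable R : realType.
Implicit Types (x y p a b c z : plane R) (T e : {fset plane R}) (f g : plane R -> R).
Variables (Omega : set (plane R)) (Th : {fset {fset plane R}}).
Hypotheses (hOm : polygonal_lipschitz_domain Omega) (hTh : triangulation Omega Th).

Let oO : open Omega := dom_open hOm.
Let mO : pmeas Omega := dom_meas hOm.
Let mi T : pmeas (hull T)° := pmeas_int (hull T).

Lemma lam01 T a x : T \in Th -> hull T x -> 0 <= lam T a x <= 1.
Proof.
move=> hT xT; have tT := mesh_tri hTh hT.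
have [aT|aT] := boolP (a \in T); last by rewrite lam_notin ?lexx ?ler01.
have l0 := (hull_lamT tT x).1 xT; rewrite l0//=.
rewrite -(sum_lam tT x) (bigD1_seq a) ?fset_uniq//= lerDl.
by rewrite big_seq_cond; apply: sumr_ge0 => q /andP[qT _]; exact: l0.
Qed.

Lemma lam_norm T a x : T \in Th -> hull T x -> `|lam T a x| <= 1.
Proof. by move=> hT xT; have /andP[l0 l1] := lam01 a hT xT; rewrite ger0_norm. Qed.

(** Glues cellwise functions on the open cells and is zero elsewhere; inside the domain that affects
    only edges, a null set. The sum makes measurability immediate. *)
Definition pwz (F : {fset plane R} -> plane R -> R) x : R := \sum_(T <- Th) (F T \_ (hull T)°) x.

Lemma pwzE F T x : T \in Th -> (hull T)° x -> pwz F x = F T x.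
Proof.
move=> hT xT; rewrite /pwz (bigD1_seq T) ?fset_uniq//= patchE mem_set//.
rewrite big_seq_cond big1 ?addr0// => T' /andP[hT' nT].
rewrite patchE memNset// => xT'; move/eqP: nT; apply.
exact: (int_uniq hTh hT' hT xT' (interior_subset xT)).
Qed.

Lemma pwz_out F x : (forall T, T \in Th -> ~ (hull T)° x) -> pwz F x = 0.
Proof.
by move=> h; rewrite /pwz big_seq big1// => T hT; rewrite patchE memNset//; exact: h.
Qed.

Lemma pwz_bnd F x (C : R) : 0 <= C -> (forall T, T \in Th -> (hull T)° x -> `|F T x| <= C) -> `|pwz F x| <= C.
Proof.
move=> C0 h; have [[T hT xT]|no] := pselect (exists2 T, T \in Th & (hull T)° x).
  by rewrite (pwzE _ hT xT); exact: h.
by rewrite pwz_out ?normr0// => T hT xT; apply: no; exists T.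
Qed.

Lemma measf_pwz F D : (forall T, T \in Th -> measf setT (F T)) -> measf D (pwz F).
Proof.
move=> h; apply: measfT; rewrite /pwz; under eq_fun do rewrite big_seq.
by apply: measf_sum => T hT; apply: measf_restrict => //; apply: measfT; exact: h.
Qed.

Lemma pae_cells (Q : plane R -> Prop) : (forall T, T \in Th -> pae (hull T)° Q) -> pae Omega Q.
Proof.
move=> h.
pose N := \bigcup_(T in [set` enum_fset Th]) ((~` [set x | (hull T)° x -> Q x]) `|` (hull T `\` (hull T)°)).
apply: (@pae_pnull _ _ _ N).
  apply: pnull_bigcup_seq => T hT; apply: pnullU; first exact: h.
  exact: hull_bdry_null (mesh_tri hTh hT).
move=> x Ox nN; have [T hT xT] := cl_hull hTh (subset_closure Ox).
apply: contrapT => nQ; apply: nN; exists T => //.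
have [xi|xi] := pselect ((hull T)° x); last by right.
by left => /= k; apply: nQ; exact: k.
Qed.

Let U (s : seq {fset plane R}) := \bigcup_(T in [set` s]) (hull T)°.

Let mU s : pmeas (U s). Proof. exact: pmeas_bigcup_seq. Qed.

Lemma I2_cells (s : seq {fset plane R}) F : uniq s -> {subset s <= Th} -> pintg (U s) F ->
  I2 (U s) F = \sum_(T <- s) I2 (hull T)° F.
Proof.
elim: s => [|T s ih] /=.
  move=> _ _ _; rewrite big_nil; apply: I2_pnull => //; rewrite /U.
    by apply: (@measf_eq _ _ (fun=> 0)); [move=> x []|exact: measf_cst].
  by apply: pnullS (pnull0 R) => x [].
move=> /andP[Ts us] sub; rewrite /U bigcup_seq_cons -/(U s) => fi.
have d : (hull T)° `&` U s = set0.
  rewrite -subset0 => x [xT [T' /= T's xT']]; move/negP: Ts; apply.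
  rewrite (int_uniq hTh _ _ xT (interior_subset xT')) ?T's//; apply: sub; rewrite ?mem_head//.
  by rewrite in_cons T's orbT.
rewrite I2_setU//; last by rewrite d; exact: pnull0.
rewrite big_cons ih//.
  by move=> T' T's; apply: sub; rewrite in_cons T's orbT.
by apply: pintgS fi; [exact: mU|exact: pmeasU|exact: subsetUr].
Qed.

Lemma U_dom s : {subset s <= Th} -> U s `<=` Omega.
Proof. by move=> h x [T /= Ts]; exact: (int_dom hOm hTh (h T Ts)). Qed.

Lemma cover_null s D : {subset s <= Th} -> D `<=` \bigcup_(T in [set` s]) hull T -> pnull (D `\` U s).
Proof.
move=> hs hD; apply: (@pnullS _ _ (\bigcup_(T in [set` s]) (hull T `\` (hull T)°))).
  by move=> x [/hD [T Ts xT] nx]; exists T => //; split => // xi; apply: nx; exists T.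
by apply: pnull_bigcup_seq => T Ts; apply: hull_bdry_null; apply: (mesh_tri hTh); exact: hs.
Qed.

Lemma I2_mesh F : pintg Omega F -> I2 Omega F = \sum_(T <- Th) I2 (hull T)° F.
Proof.
move=> fi; have sub : {subset enum_fset Th <= Th} by [].
have OE : Omega = U Th `|` (Omega `\` U Th) by rewrite setDUK//; exact: U_dom.
have mD : pmeas (Omega `\` U Th) by exact: pmeasD.
rewrite [in LHS]OE I2_setU//; [|by rewrite setDIK; exact: pnull0|by rewrite -OE].
rewrite [X in _ + X]I2_pnull//; last 2 first.
- by apply: measfS (pintg_measf fi) => //; exact: subDsetl.
- by apply: cover_null => // x Ox; have [T hT xT] := cl_hull hTh (subset_closure Ox); exists T.
rewrite addr0 I2_cells ?fset_uniq//.
by apply: pintgS fi => //; exact: U_dom.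
Qed.

Lemma I2_cover (P : pred {fset plane R}) D F : pmeas D -> D `<=` Omega -> pintg Omega F ->
  (forall x, Omega x -> 0 <= F x) -> (forall x, D x -> exists T, [/\ T \in Th, P T & hull T x]) ->
  I2 D F <= \sum_(T <- Th | P T) I2 (hull T)° F.
Proof.
move=> mD DO fi F0 hD; pose s := [seq T <- Th | P T].
have hs : {subset s <= Th} by move=> T; rewrite mem_filter => /andP[].
have DE : D = (D `&` U s) `|` (D `\` U s) by rewrite setUIDK.
have m1 : pmeas (D `&` U s) by exact: pmeasI.
have m2 : pmeas (D `\` U s) by exact: pmeasD.
have di : pintg D F by apply: pintgS fi.
rewrite [in leLHS]DE I2_setU//; last 2 first.
- by rewrite (_ : _ `&` _ = set0) ?pnull0//; [exact: pnull0|rewrite -subset0 => x [[_ ?] [_]]].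
- by rewrite -DE.
rewrite [X in _ + X]I2_pnull//; last 2 first.
- by apply: measfS (pintg_measf di) => //; exact: subDsetl.
- by apply: cover_null => // x /hD[T [hT PT xT]]; exists T => //=; rewrite mem_filter PT.
rewrite addr0 -big_filter -/s -I2_cells ?filter_uniq ?fset_uniq//; last first.
  by apply: pintgS fi => //; exact: U_dom.
apply: I2_sub => //.
  by apply: pintgS fi => //; exact: U_dom.
by move=> x /(U_dom hs); exact: F0.
Qed.

Lemma pintg_cell T F : T \in Th -> pintg Omega F -> pintg (hull T)° F.
Proof. by move=> hT; apply: pintgS => //; exact: (int_dom hOm hTh hT). Qed.

(** Close to x only cells through x occur, and on each of them f agrees with a continuous function
    that also has the value f x at x. *)
Lemma cont_pieces f (F : {fset plane R} -> plane R -> R) :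
  (forall T x, T \in Th -> hull T x -> f x = F T x) -> (forall T, T \in Th -> continuous (F T)) ->
  {within closure Omega, continuous f}.
Proof.
move=> fF cF; apply/subspace_continuousP => x cx; apply/cvgrPdist_lt => e e0.
have h : \forall y \near x, forall T, T \in enum_fset Th -> hull T x -> `|F T x - F T y| < e.
  apply: near_all_seq => T hT; have [xT|xT] := pselect (hull T x); last by apply: filterE.
  by have := cF T hT x => /cvgrPdist_lt/(_ e e0); apply: filterS => y hy _.
have h' : \forall y \near x, closure Omega y -> `|f x - f y| < e.
  apply: filterS2 h (near_hull hTh x) => y h1 h2 cy.
  have [T hT yT] := cl_hull hTh cy; have xT := h2 T hT yT.
  by rewrite (fF _ _ hT xT) (fF _ _ hT yT); exact: h1.
exact: h'.
Qed.

Lemma measf_pieces f (F : {fset plane R} -> plane R -> R) :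
  (forall T x, T \in Th -> hull T x -> f x = F T x) -> (forall T, T \in Th -> measf setT (F T)) ->
  measf Omega f.
Proof.
move=> fF mF.
have mh T : T \in Th -> pmeas (hull T).
  by move=> hT; apply: pmeas_closed; exact: closed_hull (mesh_tri hTh hT).
suff h (s : seq {fset plane R}) : {subset s <= Th} -> measf (\bigcup_(T in [set` s]) hull T) f.
  have sub : {subset enum_fset Th <= Th} by [].
  apply: measfS (h _ sub); first exact: pmeas_bigcup_seq.
  by move=> x Ox; have [T hT xT] := cl_hull hTh (subset_closure Ox); exists T.
elim: s => [|T s ih] hs.
  by apply: (@measf_eq _ _ (fun=> 0)); [move=> x []|exact: measf_cst].
have hT : T \in Th by apply: hs; rewrite mem_head.
have hs' : {subset s <= Th} by move=> T' T's; apply: hs; rewrite in_cons T's orbT.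
rewrite bigcup_seq_cons; apply: measfU; [exact: mh|by apply: pmeas_bigcup_seq => T' /hs'; exact: mh| |exact: ih].
by apply: (@measf_eq _ _ (F T)) => [x xT|]; [rewrite (fF T)|apply: measfT; exact: mF].
Qed.

(** Points of the domain near x share a cell with x. The values 0 outside let [lip_local] follow
    segments that leave the domain. *)
Lemma lip_pieces f (L : R) : 0 <= L -> (forall x, ~ Omega x -> f x = 0) ->
  (forall T x y, T \in Th -> hull T x -> hull T y -> `|f x - f y| <= L * `|x - y|) -> lip L f.
Proof.
move=> L0 f0 hf.
have loc x : \forall y \near x, `|f y - f x| <= L * `|y - x|.
  have nO : \forall y \near x, Omega x -> Omega y.
    have [Ox|Ox] := pselect (Omega x); last by apply: filterE.
    by move: oO; rewrite openE => /(_ x Ox); apply: filterS => y Oy _.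
  apply: filterS2 nO (near_hull hTh x) => y h1 h2.
  have [Oy|Oy] := pselect (Omega y).
    have [T hT yT] := cl_hull hTh (subset_closure Oy).
    by apply: (hf T) => //; exact: h2.
  by rewrite (f0 y)// (f0 x) ?subrr ?normr0 ?mulr_ge0// => Ox; apply: Oy; exact: h1.
apply: lip_local => //.
  move=> x; apply/cvgrPdist_lt => e e0.
  have L1 : 0 < L + 1 by rewrite ltr_wpDl.
  have nb : \forall y \near x, `|y - x| < e / (L + 1).
    by apply/near_normP; exists (e / (L + 1)) => //; rewrite divr_gt0.
  apply: filterS2 (loc x) nb => y h1 h2; rewrite distrC; apply: le_lt_trans h1 _.
  apply: (@le_lt_trans _ _ ((L + 1) * `|y - x|)); first by rewrite ler_wpM2r// lerDl.
  by rewrite mulrC -ltr_pdivlMr.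
move=> x y; have [d d0 hd] := near_ray y (loc x); exists d => // t /andP[t0 td].
have := hd t; rewrite gtr0_norm// => /(_ td).
by rewrite [x + _ - x]addrAC subrr add0r.
Qed.

(** Cellwise Lipschitz bounds and zero boundary values make the extension by zero Lipschitz on the
    plane. The last hypothesis supplies, cell by cell, that gradients vanish where the function
    does. *)
Lemma pw_H10 f F G1 G2 :
  (forall T x, T \in Th -> hull T x -> f x = F T x) -> (forall x, bdry Omega x -> f x = 0) ->
  (forall T, T \in Th -> exists L, forall x y, hull T x -> hull T y -> `|F T x - F T y| <= L * `|x - y|) ->
  (forall T, T \in Th -> measf setT (G1 T)) -> (forall T, T \in Th -> measf setT (G2 T)) ->
  (forall T, T \in Th -> exists C, forall x, hull T x -> `|G1 T x| <= C /\ `|G2 T x| <= C) ->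
  (forall T, T \in Th -> pae (hull T)° (fun x => grad (F T) x (G1 T x) (G2 T x) /\
     (F T x = 0 -> G1 T x = 0 /\ G2 T x = 0))) ->
  H1_0 Omega f /\ [/\ L2 Omega (pwz G1), L2 Omega (pwz G2), weak_deriv Omega (ex R) f (pwz G1) &
    weak_deriv Omega (ey R) f (pwz G2)].
Proof.
move=> fF fb lF mG1 mG2 bG gF.
have [L L0 hL] := unif_bound (s := enum_fset Th)
  (Q := fun T L => forall x y, hull T x -> hull T y -> `|F T x - F T y| <= L * `|x - y|)
  (fun T L L' LL h x y xT yT => le_trans (h x y xT yT) (ler_wpM2r (normr_ge0 _) LL)) lF.
have [C C0 hC] := unif_bound (s := enum_fset Th)
  (Q := fun T C => forall x, hull T x -> `|G1 T x| <= C /\ `|G2 T x| <= C)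
  (fun T L L' LL h x xT => conj (le_trans (h x xT).1 LL) (le_trans (h x xT).2 LL)) bG.
(* The values of f outside the closed domain are arbitrary. *)
pose f' x := if `[< Omega x >] then f x else 0.
have f'O x : Omega x -> f' x = f x by move=> Ox; rewrite /f'; case: asboolP.
have f'F T x : T \in Th -> hull T x -> f' x = F T x.
  move=> hT xT; have [Ox|Ox] := pselect (Omega x); first by rewrite f'O// (fF T).
  rewrite /f'; case: asboolP => // _; rewrite -(fF T)// fb//.
  by apply: (bdryP _ Ox); apply: (hull_cl hTh hT).
have f'0 x : ~ Omega x -> f' x = 0 by move=> Ox; rewrite /f'; case: asboolP.
have lf' : lip L f'.
  apply: lip_pieces => // T x y hT xT yT; rewrite (f'F T)// (f'F T y)//.
  exact: hL.
have [rho rho0 bO] := dom_box hOm.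
have b1 x : Omega x -> `|pwz G1 x| <= C.
  move=> _; apply: pwz_bnd => //.
  by move=> T hT xT; have [] := hC T hT x (interior_subset xT).
have b2 x : Omega x -> `|pwz G2 x| <= C.
  move=> _; apply: pwz_bnd => //.
  by move=> T hT xT; have [] := hC T hT x (interior_subset xT).
have gf : pae Omega (fun x => grad f' x (pwz G1 x) (pwz G2 x) /\ (f' x = 0 -> pwz G1 x = 0 /\ pwz G2 x = 0)).
  apply: pae_cells => T hT; apply: pae_imp (gF T hT) => x xT [h1 h2].
  rewrite !(pwzE _ hT xT) (f'F T x hT (interior_subset xT)); split => //.
  apply: grad_near h1; have := open_interior (hull T); rewrite openE => /(_ x xT).
  by apply: filterS => y yT; rewrite (f'F T)//; exact: interior_subset.
have m1 := @measf_pwz G1 Omega mG1; have m2 := @measf_pwz G2 Omega mG2.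
have H := lip_H10 oO bO L0 lf' rho0 f'0 m1 m2 b1 b2 gf.
have [Lf [L1 L2' w1 w2]] := lip_weak oO bO L0 lf' rho0 f'0 m1 m2 b1 b2 gf.
split; first exact: (H1_0_eq mO f'O H).
by split => //; [exact: (weak_deriv_eq f'O w1)|exact: (weak_deriv_eq f'O w2)].
Qed.

Lemma Lagrange1_interp f T x : Lagrange 1 Omega Th f -> T \in Th -> hull T x -> f x = interp T f x.
Proof. by move=> [_ h] hT xT; apply: poly_on_interp => //; [exact: (mesh_tri hTh hT)|exact: h]. Qed.

Lemma aff_interp_mesh T f : T \in Th -> aff (interp T f).
Proof. by move=> hT; apply: aff_interp; exact: (mesh_tri hTh hT). Qed.

Lemma Lagrange1_measf f : Lagrange 1 Omega Th f -> measf Omega f.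
Proof.
move=> hf; apply: (@measf_pieces _ (fun T => interp T f)) => [T x|T hT].
  exact: Lagrange1_interp.
by apply: aff_measf; exact: aff_interp_mesh.
Qed.

Lemma Vh1_H10 f : Lagrange 1 Omega Th f -> (forall x, bdry Omega x -> f x = 0) -> H1_0 Omega f.
Proof.
move=> lf fb.
have [] // := @pw_H10 f (fun T => interp T f) (fun T _ => (daff (interp T f)).1) (fun T _ => (daff (interp T f)).2).
- by move=> T x hT xT; exact: Lagrange1_interp.
- move=> T hT; have l := aff_lip (aff_interp_mesh f hT).
  by exists (`|(daff (interp T f)).1| + `|(daff (interp T f)).2|) => x y _ _; exact: l.
- by move=> T _; exact: measf_cst.
- by move=> T _; exact: measf_cst.
- move=> T _; exists (Num.max `|(daff (interp T f)).1| `|(daff (interp T f)).2|) => x _.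
  by rewrite !le_max !lexx orbT.
- move=> T hT; have af := aff_interp_mesh f hT.
  (* An affine function either has zero gradient or vanishes only on a line, which is null. *)
  have [d0|d0] := eqVneq (daff (interp T f)) 0.
    by apply: pae_all => x xT; split; [exact: aff_grad|rewrite d0].
  apply: pae_pnull (aff_null af d0) _ => x xT nx; split; first exact: aff_grad.
  by move=> z; exfalso; apply: nx.
Qed.

Lemma vertex_lam T a b : T \in Th -> b \in T -> lam T a b = (a == b)%:R.
Proof. by move=> hT bT; apply: lam_vertex => //; exact: (mesh_tri hTh hT). Qed.

(** Pasting barycentric coordinates gives a candidate, and any candidate agrees with them on each
    cell because it is affine there with the same vertex values. *)
Lemma hat_spec a : Lagrange 1 Omega Th (hat Omega Th a) /\
  forall T x, T \in Th -> hull T x -> hat Omega Th a x = lam T a x.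
Proof.
pose cell x := xget fset0 [set T | T \in Th /\ hull T x].
pose f0 x := lam (cell x) a x.
have cellP x T : T \in Th -> hull T x -> cell x \in Th /\ hull (cell x) x.
  by move=> hT xT; rewrite /cell; case: xgetP => [T' _ //|/(_ T)]; case.
have f0E T x : T \in Th -> hull T x -> f0 x = lam T a x.
  by move=> hT xT; have [h1 h2] := cellP x T hT xT; exact: (lam_compat hTh a h1 hT h2 xT).
have al T : T \in Th -> aff (lam T a) by move=> hT; apply: aff_lam; exact: (mesh_tri hTh hT).
have l0 : Lagrange 1 Omega Th f0.
  split; first by apply: (cont_pieces f0E) => T hT; apply: aff_cont; exact: al.
  by move=> T hT; apply: (@poly_on_aff _ _ _ (lam T a)) => [x xT|]; [exact: f0E|exact: al].
have v0 b : is_vertex Th b -> f0 b = (a == b)%:R.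
  move=> [T hT bT]; rewrite (f0E T)//; first exact: vertex_lam.
  by apply: hull_vertex => //; exact: (mesh_tri hTh hT).
rewrite /hat; case: xgetP => [g _ [lg vg]|/(_ f0)]; last by case.
split => // T x hT xT; rewrite (Lagrange1_interp lg hT xT) (aff_lamE (mesh_tri hTh hT) x (al T hT)).
apply: eq_big_seq => p pT; have vp : is_vertex Th p by exists T.
by rewrite (vg p vp) (vertex_lam a hT pT).
Qed.

Lemma hatE a T x : T \in Th -> hull T x -> hat Omega Th a x = lam T a x.
Proof. by have [_] := hat_spec a; apply. Qed.

Lemma dlam_notin T a : T \in Th -> a \notin T -> dlam T a = 0.
Proof.
by move=> hT aT; rewrite /dlam !(lam_notin (mesh_tri hTh hT))// subrr.
Qed.

(** The scalar edge bubble that [psi] multiplies by an edge vector. *)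
Definition hh a b x : R := hat Omega Th a x * hat Omega Th b x.

Lemma hh_lam a b T x : T \in Th -> hull T x -> hh a b x = lam T a x * lam T b x.
Proof. by move=> hT xT; rewrite /hh !(hatE _ hT xT). Qed.

Lemma hh_bdry a b x : int_edge Omega Th [fset a; b]%fset -> bdry Omega x -> hh a b x = 0.
Proof.
move=> ie bx; have [T hT xT] := cl_hull hTh bx.1.
by rewrite (hh_lam _ _ hT xT); exact: (int_edge_bdry hOm hTh ie hT xT bx).
Qed.

(** A zero of the bubble in an open cell means that a or b is no vertex of that cell, and then the
    gradient vanishes as well. *)
Lemma hh_H10 a b : int_edge Omega Th [fset a; b]%fset ->
  let G1 T x := lam T a x * (dlam T b).1 + lam T b x * (dlam T a).1 in
  let G2 T x := lam T a x * (dlam T b).2 + lam T b x * (dlam T a).2 in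
  H1_0 Omega (hh a b) /\ [/\ L2 Omega (pwz G1), L2 Omega (pwz G2), weak_deriv Omega (ex R) (hh a b) (pwz G1) &
    weak_deriv Omega (ey R) (hh a b) (pwz G2)].
Proof.
move=> ie G1 G2; apply: (pw_H10 (F := fun T x => lam T a x * lam T b x)).
- by move=> T x; exact: hh_lam.
- by move=> x; exact: hh_bdry.
- move=> T hT; have tT := mesh_tri hTh hT.
  have la := aff_lip (aff_lam tT a); have lb := aff_lip (aff_lam tT b).
  set La := `|_| + `|_| in la; set Lb := `|_| + `|_| in lb.
  exists (Lb + La) => x y xT yT.
  have -> : lam T a x * lam T b x - lam T a y * lam T b y =
    lam T a x * (lam T b x - lam T b y) + lam T b y * (lam T a x - lam T a y) by ring.
  apply: le_trans (ler_normD _ _) _; rewrite !normrM mulrDl; apply: lerD.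
    rewrite -[leRHS]mul1r; apply: ler_pM => //; exact: lam_norm.
  rewrite -[leRHS]mul1r; apply: ler_pM => //; exact: lam_norm.
- move=> T hT; have tT := mesh_tri hTh hT; apply: measfD; apply: measfM;
    by [exact: measf_cst|exact: (aff_measf (aff_lam tT _))].
- move=> T hT; have tT := mesh_tri hTh hT; apply: measfD; apply: measfM;
    by [exact: measf_cst|exact: (aff_measf (aff_lam tT _))].
- move=> T hT; exists (`|dlam T a| + `|dlam T b|) => x xT.
  have k (u v : R) : `|u| <= `|dlam T b| -> `|v| <= `|dlam T a| -> `|lam T a x * u + lam T b x * v| <= `|dlam T a| + `|dlam T b|.
    move=> hu hv; rewrite addrC; apply: le_trans (ler_normD _ _) _; rewrite !normrM; apply: lerD.
      by rewrite -[leRHS]mul1r; apply: ler_pM => //; exact: lam_norm.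
    by rewrite -[leRHS]mul1r; apply: ler_pM => //; exact: lam_norm.
  by split; apply: k; rewrite ?norm_fst ?norm_snd.
- move=> T hT; have tT := mesh_tri hTh hT; apply: pae_all => x xT; split.
    by apply: grad_mul; apply: aff_grad; exact: aff_lam.
  have pos q : q \in T -> 0 < lam T q x by apply: (int_hull_lam tT x).1.
  have [aT|aT] := boolP (a \in T); last first.
    have da := dlam_notin hT aT; have la : lam T a x = 0 by exact: lam_notin.
    by rewrite /G1 /G2 da la /= !mul0r !mulr0 !addr0.
  have [bT|bT] := boolP (b \in T); last first.
    have da := dlam_notin hT bT; have la : lam T b x = 0 by exact: lam_notin.
    by rewrite /G1 /G2 da la /= !mul0r !mulr0 !addr0.
  by move=> /eqP; rewrite gt_eqF// mulr_gt0 ?pos.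
Qed.

Definition pgrad f T : plane R := daff (interp T f).

(** The test function cuts f off before the boundary, so the product is Lipschitz on the plane and
    [by_parts] applies. *)
Lemma Lagrange_parts f v phi : Lagrange 1 Omega Th f -> test_function Omega phi ->
  inner Omega f (fun x => 'D_v phi x) =
  - inner Omega (fun x => v.1 * pwz (fun T _ => (pgrad f T).1) x + v.2 * pwz (fun T _ => (pgrad f T).2) x) phi.
Proof.
move=> lf tp; have [K [cK KO k0 kD]] := test_D_supp tp.
have [C [C0 pC _ _ pM]] := test_bounds tp; have [Lp Lp0 lp] := test_lip tp.
have Ooo := dom_lty hOm.
have mf := Lagrange1_measf lf.
have bq : exists2 Cq : R, 0 <= Cq & forall T, T \in enum_fset Th -> forall x, hull T x -> `|f x| <= Cq.
  apply: unif_bound => [T L L' LL h x xT|T hT]; first exact: le_trans (h x xT) LL.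
  exists (\sum_(p <- T) `|f p|) => x xT; rewrite (Lagrange1_interp lf hT xT) /interp.
  apply: le_trans (ler_norm_sum _ _ _) _; apply: ler_sum => p _; rewrite normrM.
  by rewrite ler_piMl//; exact: lam_norm.
have [Cq Cq0 hq] := bq.
have bl : exists2 L : R, 0 <= L & forall T, T \in enum_fset Th -> lip L (interp T f).
  apply: (unif_bound (Q := fun T L => lip L (interp T f))) => [T L L' LL h|T hT]; first exact: (lip_le LL h).
  by eexists; apply: aff_lip; exact: aff_interp_mesh.
have [L L0 hL] := bl.
have fO x : Omega x -> `|f x| <= Cq.
  by move=> Ox; have [T hT xT] := cl_hull hTh (subset_closure Ox); exact: (hq T hT x xT).
have lfp : lip (Cq * Lp + C * L) (fun x => f x * phi x).
  apply: lip_pieces; first by rewrite addr_ge0// mulr_ge0.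
    by move=> x Ox; rewrite k0 ?mulr0// => /KO.
  move=> T x y hT xT yT.
  have -> : f x * phi x - f y * phi y = f x * (phi x - phi y) + phi y * (f x - f y) by ring.
  apply: le_trans (ler_normD _ _) _; rewrite !normrM mulrDl; apply: lerD.
    by rewrite -mulrA; apply: ler_pM => //; exact: (hq T hT x xT).
  rewrite -mulrA; apply: ler_pM => //.
  by rewrite (Lagrange1_interp lf hT xT) (Lagrange1_interp lf hT yT); exact: hL.
have m1 : measf Omega (pwz (fun T _ => (pgrad f T).1)) by apply: measf_pwz => T _; exact: measf_cst.
have m2 : measf Omega (pwz (fun T _ => (pgrad f T).2)) by apply: measf_pwz => T _; exact: measf_cst.
have bg : exists2 G : R, 0 <= G & forall T, T \in enum_fset Th -> `|pgrad f T| <= G.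
  by apply: unif_bound => [T A B AB|T hT]; [move=> h; exact: (le_trans h AB)|exists `|pgrad f T|].
have [G G0 hG] := bg.
have g1 x : `|pwz (fun T _ => (pgrad f T).1) x| <= G.
  by apply: pwz_bnd => // T hT _; exact: (le_trans (norm_fst _) (hG T hT)).
have g2 x : `|pwz (fun T _ => (pgrad f T).2) x| <= G.
  by apply: pwz_bnd => // T hT _; exact: (le_trans (norm_snd _) (hG T hT)).
have [Cv [Cv0 dC _]] := test_D_bounds v tp.
apply: (@by_parts _ Omega f phi (Cq * Lp + C * L) C) => //.
- by move=> x Ox; split; [apply: k0|apply: kD] => /KO.
- exact: (test_smooth tp).
- apply: (pintg_bounded (c := Cq * Cv)) => //.
    by apply: measfM => //; apply: measfT; exact: (test_D_measf v tp).
  by move=> x Ox; rewrite normrM; apply: ler_pM => //; exact: fO.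
- apply: (pintg_bounded (c := (`|v.1| * G + `|v.2| * G) * C)) => //.
    by apply: measfM; [apply: measfD; exact: measfZ|apply: measfT; exact: (test_measf tp)].
  move=> x Ox; rewrite normrM; apply: ler_pM => //.
  by apply: le_trans (ler_normD _ _) _; rewrite !normrM; apply: lerD; rewrite ler_wpM2l.
- apply: pae_cells => T hT; apply: pae_all => x xT; rewrite !(pwzE _ hT xT).
  have := aff_grad x (aff_interp_mesh f hT); apply: grad_near.
  have := open_interior (hull T); rewrite openE => /(_ x xT).
  by apply: filterS => y yT; rewrite (Lagrange1_interp lf hT (interior_subset yT)).
- apply: pae_all => x Ox; have nx : ~ K x by move=> /KO.
  apply: grad_near (grad_cst 0 x); have := near_compl cK nx.
  by apply: filterS => y ny; rewrite k0 ?mulr0.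
Qed.

Lemma pgrad_L2 f : L2 Omega (pwz (fun T _ => (pgrad f T).1)) /\ L2 Omega (pwz (fun T _ => (pgrad f T).2)).
Proof.
have bg : exists2 G : R, 0 <= G & forall T, T \in enum_fset Th -> `|pgrad f T| <= G.
  by apply: unif_bound => [T A B AB|T hT]; [move=> h; exact: (le_trans h AB)|exists `|pgrad f T|].
have [G G0 hG] := bg; have Ooo := dom_lty hOm.
split; apply: (L2_bounded (c := G)) => //; try by apply: measf_pwz => T _; exact: measf_cst.
  by move=> x _; apply: pwz_bnd => // T hT _; exact: (le_trans (norm_fst _) (hG T hT)).
by move=> x _; apply: pwz_bnd => // T hT _; exact: (le_trans (norm_snd _) (hG T hT)).
Qed.

Lemma Lagrange1_L2 f : Lagrange 1 Omega Th f -> L2 Omega f.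
Proof.
move=> lf.
have bq : exists2 Cq : R, 0 <= Cq & forall T, T \in enum_fset Th -> forall x, hull T x -> `|f x| <= Cq.
  apply: unif_bound => [T L L' LL h x xT|T hT]; first exact: le_trans (h x xT) LL.
  exists (\sum_(p <- T) `|f p|) => x xT; rewrite (Lagrange1_interp lf hT xT) /interp.
  apply: le_trans (ler_norm_sum _ _ _) _; apply: ler_sum => p _; rewrite normrM.
  by rewrite ler_piMl//; exact: lam_norm.
have [Cq Cq0 hq] := bq.
apply: (L2_bounded (c := Cq)) => //; [exact: (dom_lty hOm)|exact: Lagrange1_measf|].
by move=> x Ox; have [T hT xT] := cl_hull hTh (subset_closure Ox); exact: (hq T hT x xT).
Qed.

(* Integration by parts against a continuous piecewise linear function passes
   from test functions to their closure in H1. *)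
Lemma H10_parts q f d1 d2 (i : bool) : Lagrange 1 Omega Th q -> H1_0 Omega f ->
  L2 Omega d1 -> L2 Omega d2 -> weak_deriv Omega (ex R) f d1 -> weak_deriv Omega (ey R) f d2 ->
  inner Omega (if i then d1 else d2) q =
  - inner Omega f (pwz (fun T _ => if i then (pgrad q T).1 else (pgrad q T).2)).
Proof.
move=> lq [[Lf _ _] af] L1 L2' w1 w2; set g := pwz _.
pose v := if i then ex R else ey R.
have Lq := Lagrange1_L2 lq; have [Lg1 Lg2] := pgrad_L2 q.
have Lg : L2 Omega g by rewrite /g; case: (i).
pose D := if i then d1 else d2; rewrite -/D.
have LD : L2 Omega D by rewrite /D; case: (i).
have tq phi : test_function Omega phi -> inner Omega (fun x => 'D_v phi x) q = - inner Omega phi g.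
  move=> tp; have := Lagrange_parts v lq tp.
  rewrite !innerE => h.
  have -> : I2 Omega (fun x => 'D_v phi x * q x) = I2 Omega (fun x => q x * 'D_v phi x).
    by apply: I2_eq => x _; rewrite mulrC.
  rewrite h; congr (- _); apply: I2_eq => x _; rewrite /g /v.
  by case: (i); rewrite /ex /ey /= ?mul1r ?mul0r ?addr0 ?add0r mulrC.
pose A := 1 + sqn Omega q + sqn Omega g.
have A0 : 0 < A by rewrite /A -addrA ltr_pwDl// addr_ge0// sqn_ge0.
suff key (e : R) : 0 < e -> `|inner Omega D q + inner Omega f g| <= e * A.
  apply/eqP; rewrite -subr_eq0 opprK -normr_eq0 eq_le normr_ge0 andbT leNgt; apply/negP => X0.
  have := key (`|inner Omega D q + inner Omega f g| / (2 * A)).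
  move: X0; move: (`|_|) => X X0; rewrite divr_gt0 ?mulr_gt0// => /(_ isT).
  have -> : X / (2 * A) * A = X / 2 by field; rewrite gt_eqF.
  by rewrite leNgt ltr_pdivrMr// ltr_pMr// ltr1n.
move=> e0; have [phi tp /(H1norm_lt _ _ e0) hp] := af _ e0.
have Lp := test_L2 mO tp; have Lpx := test_D_L2 (ex R) mO tp; have Lpy := test_D_L2 (ey R) mO tp.
have Lpv := test_D_L2 v mO tp.
have wx := test_weak (ex R) oO tp; have wy := test_weak (ey R) oO tp.
have sub : f - phi = (fun x => f x + -1 * phi x) by apply/funext => x; rewrite mulN1r.
have hs := hsq_weak oO (L2D mO Lf (L2Z (-1) mO Lp)) (L2D mO L1 (L2Z (-1) mO Lpx)) (L2D mO L2' (L2Z (-1) mO Lpy))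
  (weak_derivD mO Lf (L2Z (-1) mO Lp) L1 (L2Z (-1) mO Lpx) w1 (weak_derivZ (-1) mO Lp Lpx wx))
  (weak_derivD mO Lf (L2Z (-1) mO Lp) L2' (L2Z (-1) mO Lpy) w2 (weak_derivZ (-1) mO Lp Lpy wy)).
rewrite sub hs in hp.
have s0 := sqn_ge0 Omega (fun x => f x + -1 * phi x).
have s1 := sqn_ge0 Omega (fun x => d1 x + -1 * 'D_(ex R) phi x).
have s2 := sqn_ge0 Omega (fun x => d2 x + -1 * 'D_(ey R) phi x).
have [b0 bx b2] := sum3_lt s0 s1 s2 hp.
have b1 : sqn Omega (fun x => D x + -1 * 'D_v phi x) <= e ^+ 2 by rewrite /D /v; case: (i).
(* The squared distances are at most e^2, so the weight 1 / e in Young's inequality makes both terms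
   of order e. *)
have e1 : 0 < e^-1 by rewrite invr_gt0.
have y1 := sqn_young e1 mO (L2D mO LD (L2Z (-1) mO Lpv)) Lq.
have y2 := sqn_young e1 mO (L2D mO Lf (L2Z (-1) mO Lp)) Lg.
have -> : inner Omega D q + inner Omega f g =
  I2 Omega (fun x => (D x + -1 * 'D_v phi x) * q x) + I2 Omega (fun x => (f x + -1 * phi x) * g x).
  have -> : I2 Omega (fun x => (D x + -1 * 'D_v phi x) * q x) = inner Omega D q - inner Omega (fun x => 'D_v phi x) q.
    rewrite !innerE -I2B//; [|exact: L2_pintgM|exact: L2_pintgM].
    by apply: I2_eq => x _; ring.
  have -> : I2 Omega (fun x => (f x + -1 * phi x) * g x) = inner Omega f g - inner Omega phi g.
    rewrite !innerE -I2B//; [|exact: L2_pintgM|exact: L2_pintgM].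
    by apply: I2_eq => x _; ring.
  by rewrite (tq _ tp); ring.
apply: le_trans (ler_normD _ _) _; apply: le_trans (lerD y1 y2) _.
have -> : (2 * e^-1)^-1 = e / 2 by field; rewrite gt_eqF.
have k1 : e^-1 / 2 * sqn Omega (fun x => D x + -1 * 'D_v phi x) <= e / 2.
  have -> : e / 2 = e^-1 / 2 * e ^+ 2 by field; rewrite gt_eqF.
  by rewrite ler_wpM2l// divr_ge0// ltW.
have k2 : e^-1 / 2 * sqn Omega (fun x => f x + -1 * phi x) <= e / 2.
  have -> : e / 2 = e^-1 / 2 * e ^+ 2 by field; rewrite gt_eqF.
  by rewrite ler_wpM2l// divr_ge0// ltW.
apply: le_trans (lerD (lerD k1 (lexx _)) (lerD k2 (lexx _))) _.
rewrite /A; have := sqn_ge0 Omega q; have := sqn_ge0 Omega g.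
move: (sqn _ q) (sqn _ g) => u w w0 u0.
have -> : e / 2 + e / 2 * u + (e / 2 + e / 2 * w) = e * (1 + u / 2 + w / 2) by field.
rewrite ler_pM2l//; apply: lerD; [apply: lerD|] => //; by rewrite ler_pdivrMr// ler_peMr// ler1n.
Qed.

End MeshFunctions.

(** * The local form on V_h^b x Z_h^0 *)

Section HasIntegral.
Variable R : realType.
Implicit Types (f g : plane R -> R) (D : set (plane R)).

(** Carries integrability along with the value, so that a combination of moments is evaluated in one
    term. *)
Definition hasI D f (v : R) : Prop := pintg D f /\ I2 D f = v.

Lemma hasI_add D f g u v : pmeas D -> hasI D f u -> hasI D g v -> hasI D (fun x => f x + g x) (u + v).
Proof. by move=> mD [fi <-] [gi <-]; split; [exact: pintgD|exact: I2D]. Qed.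
Lemma hasI_scale D f (c u : R) : pmeas D -> hasI D f u -> hasI D (fun x => c * f x) (c * u).
Proof. by move=> mD [fi <-]; split; [exact: pintgZ|exact: I2Z]. Qed.

Lemma le_sqr (a b : R) : 0 <= a -> 0 <= b -> a ^+ 2 <= b ^+ 2 -> a <= b.
Proof. by move=> a0 b0; rewrite ler_pXn2r// nnegrE. Qed.

Lemma sq3 (x y z f1 f2 f3 B : R) : `|f1| <= B -> `|f2| <= B -> `|f3| <= B ->
  (x * f1 + y * f2 + z * f3) ^+ 2 <= 3 * B ^+ 2 * (x ^+ 2 + y ^+ 2 + z ^+ 2).
Proof.
move=> h1 h2 h3; have B0 : 0 <= B by apply: le_trans h1.
have k (f u : R) : `|f| <= B -> (u * f) ^+ 2 <= B ^+ 2 * u ^+ 2.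
  move=> hf; rewrite exprMn mulrC ler_wpM2r ?sqr_ge0// -real_normK ?num_real//.
  by rewrite ler_pXn2r// nnegrE.
have k1 := k f1 x h1; have k2 := k f2 y h2; have k3 := k f3 z h3.
have s1 := sqr_ge0 (x * f1 - y * f2); have s2 := sqr_ge0 (x * f1 - z * f3); have s3 := sqr_ge0 (y * f2 - z * f3).
apply: (@le_trans _ _ (3 * ((x * f1) ^+ 2 + (y * f2) ^+ 2 + (z * f3) ^+ 2))).
  rewrite -subr_ge0.
  have -> : 3 * ((x * f1) ^+ 2 + (y * f2) ^+ 2 + (z * f3) ^+ 2) - (x * f1 + y * f2 + z * f3) ^+ 2 =
    (x * f1 - y * f2) ^+ 2 + (x * f1 - z * f3) ^+ 2 + (y * f2 - z * f3) ^+ 2 by ring.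
  by rewrite !addr_ge0.
rewrite -mulrA ler_pM2l// !mulrDr.
by rewrite !lerD.
Qed.

(** The right side is the local form of an interior cell with its moments inserted. The constant 1/5
    is sharp: the gap is a sum of squared differences, zero for x = y = z. *)
Lemma quad_bound (x y z A : R) : 0 <= A ->
  A / 5 * (x ^+ 2 + y ^+ 2 + z ^+ 2) <=
  6 * x ^+ 2 * (A / 30) + 6 * x ^+ 2 * (A / 30) + (6 * y ^+ 2 * (A / 30) + 6 * y ^+ 2 * (A / 30)) +
  (6 * z ^+ 2 * (A / 30) + 6 * z ^+ 2 * (A / 30)) + - (12 * (x * y + y * z + z * x)) * (A / 60).
Proof.
move=> A0; rewrite -subr_ge0.
have -> : 6 * x ^+ 2 * (A / 30) + 6 * x ^+ 2 * (A / 30) + (6 * y ^+ 2 * (A / 30) + 6 * y ^+ 2 * (A / 30)) +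
  (6 * z ^+ 2 * (A / 30) + 6 * z ^+ 2 * (A / 30)) + - (12 * (x * y + y * z + z * x)) * (A / 60) -
  A / 5 * (x ^+ 2 + y ^+ 2 + z ^+ 2) = A / 10 * ((x - y) ^+ 2 + (y - z) ^+ 2 + (z - x) ^+ 2) by field.
by rewrite mulr_ge0 ?divr_ge0 ?addr_ge0 ?sqr_ge0.
Qed.

End HasIntegral.

(** * Edge coefficients and the fields they define on a cell *)

Section LocalForms.
Variable R : realType.
Implicit Types (x y p q a b c z : plane R) (T : {fset plane R}).
Variables (Omega : set (plane R)) (Th : {fset {fset plane R}}).
Hypotheses (hOm : polygonal_lipschitz_domain Omega) (hTh : triangulation Omega Th)
  (h1e : at_most_one_bdry_edge Omega Th).
Implicit Types C : plane R -> plane R -> R.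

Let mi T : pmeas (hull T)° := pmeas_int (hull T).
Let lamn T p x : T \in Th -> hull T x -> `|lam T p x| <= 1.
Proof. by move=> hT xT; exact: (@lam_norm R Omega Th hTh T p x hT xT). Qed.

(** Components indexed by a boolean, so that a vector statement is proved once for both. *)
Definition pr (i : bool) (v : plane R) : R := if i then v.1 else v.2.

Lemma prD i u v : pr i (u + v) = pr i u + pr i v. Proof. by case: i. Qed.
Lemma prN i u : pr i (- u) = - pr i u. Proof. by case: i. Qed.
Lemma prZ i (t : R) u : pr i (t *: u) = t * pr i u. Proof. by case: i. Qed.
Definition prE := (prD, prN, prZ).

Lemma pr_sqr i v : pr i v ^+ 2 <= dot v v.
Proof. by case: i; rewrite /dot -!expr2 /= ?lerDl ?lerDr sqr_ge0. Qed.

(* Vertices a, b, c of a cell; the flag tells whether the edge bc lies on the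
   boundary, and the other two edges never do. *)
Definition lab_spec T (l : plane R * plane R * plane R * bool) : Prop :=
  let: (a, b, c, bd) := l in
  [/\ T = [fset a; b; c]%fset, [/\ a != b, a != c & b != c],
      int_edge Omega Th [fset a; b]%fset, int_edge Omega Th [fset c; a]%fset &
      if bd then bdry_edge Omega Th [fset b; c]%fset else int_edge Omega Th [fset b; c]%fset].

Lemma fset2C a b : [fset a; b]%fset = [fset b; a]%fset :> {fset plane R}.
Proof. by apply/fsetP => x; rewrite !inE orbC. Qed.

Lemma fset2_neq a b c : a != b -> a != c -> [fset a; b]%fset <> [fset b; c]%fset :> {fset plane R}.
Proof.
move=> ab ac /fsetP/(_ a); rewrite !inE eqxx /= (negbTE ab) (negbTE ac) //.
Qed.

(** A boundary edge, of which there is at most one, is rotated into the position bc. *)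
Lemma lab_ex T : T \in Th -> exists l, lab_spec T l.
Proof.
move=> hT; have tT := mesh_tri hTh hT.
have [a [b [c [TE ab ac bc _]]]] := tri_abc tT.
have [aT bT cT] : [/\ a \in T, b \in T & c \in T] by rewrite TE !inE !eqxx !orbT.
have ca : c != a by rewrite eq_sym.
have ba : b != a by rewrite eq_sym.
have cb : c != b by rewrite eq_sym.
have sub p q : p \in T -> q \in T -> ([fset p; q] `<=` T)%fset.
  by move=> pT qT; apply/fsubsetP => x; rewrite !inE => /orP[] /eqP ->.
have only p q r : p \in T -> q \in T -> r \in T -> p != q -> p != r -> q != r ->
    bdry_edge Omega Th [fset q; r]%fset -> int_edge Omega Th [fset p; q]%fset /\ int_edge Omega Th [fset r; p]%fset.
  move=> pT qT rT pq pr' qr be; split.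
    case: (edge_or Omega hT pT qT pq) => // be'; exfalso.
    exact: (fset2_neq pq pr' (h1e hT be' (sub _ _ pT qT) be (sub _ _ qT rT))).
  rewrite fset2C; case: (edge_or Omega hT pT rT pr') => // be'; exfalso.
  apply: (fset2_neq pr' pq); rewrite (h1e hT be' (sub _ _ pT rT) be (sub _ _ qT rT)).
  exact: fset2C.
case: (edge_or Omega hT bT cT bc) => ebc; last first.
  exists (a, b, c, true); have [i1 i2] := only _ _ _ aT bT cT ab ac bc ebc.
  by split.
case: (edge_or Omega hT cT aT ca) => eca; last first.
  exists (b, c, a, true); have [i1 i2] := only _ _ _ bT cT aT bc ba ca eca.
  by split => //; apply/fsetP => x; rewrite TE !inE; case: (x == a); case: (x == b); case: (x == c).
case: (edge_or Omega hT aT bT ab) => eab; last first.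
  exists (c, a, b, true); have [i1 i2] := only _ _ _ cT aT bT ca cb ab eab.
  by split => //; apply/fsetP => x; rewrite TE !inE; case: (x == a); case: (x == b); case: (x == c).
by exists (a, b, c, false); split.
Qed.

Definition lab T := xget (0, 0, 0, false) [set l | lab_spec T l].

Lemma labP T : T \in Th -> lab_spec T (lab T).
Proof.
by move=> hT; rewrite /lab; case: xgetP => [l _ //|no]; have [l hl] := lab_ex hT; case: (no l hl).
Qed.

Lemma int_not_bdry e : int_edge Omega Th e -> bdry_edge Omega Th e -> False.
Proof. by move=> [_ h] [_ /h]. Qed.

Lemma fset2E (e : {fset plane R}) : #|` e| = 2%N -> exists a b, a != b /\ e = [fset a; b]%fset.
Proof.
have ue := fset_uniq e; move: ue; case eE : (enum_fset e) => [|a [|b [|]]] //= /andP[ab _] _.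
exists a, b; split; first by rewrite inE in ab.
by apply/fsetP => x; have -> : (x \in e) = (x \in enum_fset e) by []; rewrite eE !inE.
Qed.

Lemma lab_bdry T a b c bd : T \in Th -> lab T = (a, b, c, bd) -> bd <-> bdry_cell Omega Th T.
Proof.
move=> hT lE; have := labP hT; rewrite lE => -[TE [ab ac bc] i1 i2 i3]; split.
  move=> h; rewrite h in i3; split => //; exists [fset b; c]%fset => //.
  by apply/fsubsetP => x; rewrite TE !inE => /orP[] /eqP ->; rewrite eqxx ?orbT.
move=> [_ [e be eT]]; case: bd lE i3 => // _ i3; exfalso.
have [p [q [pq eE]]] := fset2E be.1.1.
have pT : p \in [fset a; b; c]%fset by rewrite -TE; apply: (fsubsetP eT); rewrite eE !inE eqxx.
have qT : q \in [fset a; b; c]%fset by rewrite -TE; apply: (fsubsetP eT); rewrite eE !inE eqxx orbT.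
rewrite eE in be; move: pT qT pq be; rewrite !inE -!orbA => /or3P[] /eqP -> /or3P[] /eqP ->; rewrite ?eqxx//= => _ be.
- exact: int_not_bdry i1 be.
- by rewrite fset2C in be; exact: int_not_bdry i2 be.
- by rewrite fset2C in be; exact: int_not_bdry i1 be.
- exact: int_not_bdry i3 be.
- exact: int_not_bdry i2 be.
- by rewrite fset2C in be; exact: int_not_bdry i3 be.
Qed.

(** When C and Phi are antisymmetric, a summand does not depend on the orientation given to its edge
    by [lab]. *)
Definition cell3 C T (Phi : plane R -> plane R -> R) : R :=
  let: (a, b, c, _) := lab T in C a b * Phi a b + C b c * Phi b c + C c a * Phi c a.

Definition Qf C T : R := let: (a, b, c, _) := lab T in C a b ^+ 2 + C b c ^+ 2 + C c a ^+ 2.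

Definition Cok C : Prop := (forall a b, C a b = - C b a) /\
  (forall a b, bdry_edge Omega Th [fset a; b]%fset -> C a b = 0).

Definition wphi T i x p q : R := 6 * (lam T p x * lam T q x) * pr i (q - p).
Definition dphi T e i x p q : R :=
  6 * (lam T p x * pr e (dlam T q) + lam T q x * pr e (dlam T p)) * pr i (q - p).
(** The Whitney form of the edge pq: its product with q - p is 1 along pq, and it has no tangential
    component on the other two edges. *)
Definition zphi T i x p q : R := lam T p x * pr i (dlam T q) - lam T q x * pr i (dlam T p).

Definition wc C T i x : R := cell3 C T (wphi T i x).
Definition dc C T e i x : R := cell3 C T (dphi T e i x).

(* On a boundary cell the field is constant and is determined by its tangential
   components along the two interior edges. *)
Definition zc C T i x : R :=
  let: (a, b, c, bd) := lab T in
  if bd then C a b * pr i (dlam T b) + C a c * pr i (dlam T c) else cell3 C T (zphi T i x).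

Lemma Qf_ge0 C T : 0 <= Qf C T.
Proof. by rewrite /Qf; case: (lab T) => [[[a b] c] bd]; rewrite !addr_ge0 ?sqr_ge0. Qed.

Section Size.
Variables (h ka : R).
Hypotheses (h0 : 0 < h) (k0 : 0 < ka) (hA : forall T, T \in Th -> ka * h ^+ 2 <= area T)
  (hD : forall T, T \in Th -> diam T <= h).

Lemma diam_ge0 T : T \in Th -> 0 <= diam T.
Proof.
move=> hT; have tT := mesh_tri hTh hT; have [x xi] := tT.2.
by apply: le_trans (eucl_diam tT (interior_subset xi) (interior_subset xi)); exact: sqrtr_ge0.
Qed.

Lemma edge_bnd T p q i : T \in Th -> p \in T -> q \in T -> `|pr i (q - p)| <= h.
Proof.
move=> hT pT qT; have tT := mesh_tri hTh hT.
rewrite -(@ler_pXn2r _ 2)// ?nnegrE ?(ltW h0)// real_normK ?num_real//.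
apply: le_trans (pr_sqr _ _) _; apply: le_trans (edge_le tT pT qT) _.
by rewrite ler_pXn2r ?nnegrE ?(ltW h0) ?diam_ge0 ?hD.
Qed.

Lemma area_gt0 T : T \in Th -> 0 < area T.
Proof. by move=> hT; apply: lt_le_trans (hA hT); rewrite mulr_gt0// exprn_gt0. Qed.

(** By [dlam_le] the gradient times the area is at most 4 h, and the area is at least ka h^2. *)
Lemma dlam_bnd T p i : T \in Th -> p \in T -> `|pr i (dlam T p)| <= 4 / (ka * h).
Proof.
move=> hT pT; have tT := mesh_tri hTh hT.
have kh : 0 < ka * h by rewrite mulr_gt0.
rewrite ler_pdivlMr//.
have kh2 : 0 < ka * h ^+ 2 by rewrite mulr_gt0// exprn_gt0.
suff : `|pr i (dlam T p)| * (ka * h ^+ 2) <= 4 * h.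
  by rewrite expr2 !mulrA ler_pM2r// -mulrA.
have h40 : 0 <= 4 * h by rewrite mulr_ge0// ltW.
have p0 : 0 <= `|pr i (dlam T p)| * (ka * h ^+ 2) by rewrite mulr_ge0// ltW.
apply: (le_sqr p0 h40); rewrite exprMn real_normK ?num_real//.
apply: (@le_trans _ _ (dot (dlam T p) (dlam T p) * area T ^+ 2)).
  apply: ler_pM; rewrite ?sqr_ge0 ?pr_sqr//.
  by rewrite ler_pXn2r ?nnegrE ?(ltW kh2) ?(ltW (area_gt0 hT)) ?hA.
apply: le_trans (dlam_le tT pT) _.
have -> : (4 * h) ^+ 2 = 16 * h ^+ 2 by ring.
by rewrite ler_pM2l// ler_pXn2r ?nnegrE ?(ltW h0) ?diam_ge0 ?hD.
Qed.

(** The square of a sum of three terms costs a factor 3; hence 108 = 3 * 6^2, 6912 = 3 * 48^2 and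
    192 = 3 * 8^2 in the estimates that follow. *)
Lemma cell3_bnd C T (Phi : plane R -> plane R -> R) (B : R) : T \in Th ->
  (forall p q, p \in T -> q \in T -> `|Phi p q| <= B) -> cell3 C T Phi ^+ 2 <= 3 * B ^+ 2 * Qf C T.
Proof.
move=> hT hB; have := labP hT; rewrite /cell3 /Qf; case: (lab T) => [[[a b] c] bd] [TE _ _ _ _].
have [aT bT cT] : [/\ a \in T, b \in T & c \in T] by rewrite TE !inE !eqxx !orbT.
by apply: sq3; exact: hB.
Qed.

Lemma wc_bnd C T i x : T \in Th -> hull T x -> wc C T i x ^+ 2 <= 108 * h ^+ 2 * Qf C T.
Proof.
move=> hT xT; have -> : 108 * h ^+ 2 = 3 * (6 * h) ^+ 2 by ring.
apply: cell3_bnd => // p q pT qT; rewrite /wphi !normrM (ger0_norm (ler0n R 6)) -mulrA ler_pM2l//.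
rewrite -[leRHS]mul1r; apply: ler_pM => //; rewrite ?mulr_ge0//; last exact: (edge_bnd i hT pT qT).
by rewrite -[leRHS]mul1r; apply: ler_pM => //; exact: lamn.
Qed.

Lemma dc_bnd C T e i x : T \in Th -> hull T x -> dc C T e i x ^+ 2 <= 6912 / ka ^+ 2 * Qf C T.
Proof.
move=> hT xT; have -> : 6912 / ka ^+ 2 = 3 * (6 * (4 / (ka * h) + 4 / (ka * h)) * h) ^+ 2.
  by field; rewrite !gt_eqF.
apply: cell3_bnd => // p q pT qT; rewrite /dphi !normrM (ger0_norm (ler0n R 6)) -!mulrA ler_pM2l//.
apply: ler_pM => //; last exact: (edge_bnd i hT pT qT).
apply: le_trans (ler_normD _ _) _; rewrite !normrM; apply: lerD.
  by rewrite -[leRHS]mul1r; apply: ler_pM => //; [exact: lamn|exact: dlam_bnd].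
by rewrite -[leRHS]mul1r; apply: ler_pM => //; [exact: lamn|exact: dlam_bnd].
Qed.

Lemma zc_bnd C T i x : (forall a b, C a b = - C b a) -> T \in Th -> hull T x ->
  zc C T i x ^+ 2 <= 192 / (ka * h) ^+ 2 * Qf C T.
Proof.
move=> anti hT xT; have := labP hT; rewrite /zc; case lE : (lab T) => [[[a b] c] bd] [TE _ _ _ _].
have [aT bT cT] : [/\ a \in T, b \in T & c \in T] by rewrite TE !inE !eqxx !orbT.
have B0 : 0 <= 4 / (ka * h) by rewrite divr_ge0// ltW// mulr_gt0.
case: bd lE => lE; last first.
  have -> : 192 / (ka * h) ^+ 2 = 3 * (4 / (ka * h) + 4 / (ka * h)) ^+ 2.
    by field; rewrite !gt_eqF.
  apply: cell3_bnd => // p q pT qT; apply: le_trans (ler_normB _ _) _; rewrite !normrM; apply: lerD.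
    by rewrite -[leRHS]mul1r; apply: ler_pM => //; [exact: lamn|exact: dlam_bnd].
  by rewrite -[leRHS]mul1r; apply: ler_pM => //; [exact: lamn|exact: dlam_bnd].
have -> : C a b * pr i (dlam T b) + C a c * pr i (dlam T c) = C a b * pr i (dlam T b) + C b c * 0 + C c a * - pr i (dlam T c).
  by rewrite (anti a c); ring.
rewrite /Qf lE; apply: (@le_trans _ _ (3 * (4 / (ka * h)) ^+ 2 * (C a b ^+ 2 + C b c ^+ 2 + C c a ^+ 2))).
  by apply: sq3; rewrite ?normr0 ?normrN//; exact: dlam_bnd.
rewrite ler_wpM2r ?addr_ge0 ?sqr_ge0//.
have -> : 192 / (ka * h) ^+ 2 = 4 * (3 * (4 / (ka * h)) ^+ 2) by field; rewrite !gt_eqF.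
have t0 : 0 <= 3 * (4 / (ka * h)) ^+ 2 by rewrite mulr_ge0// sqr_ge0.
by rewrite -[leLHS]mul1r ler_wpM2r// ler1n.
Qed.

End Size.

Lemma pintg_lam T f : T \in Th -> measf setT f -> (forall x, hull T x -> `|f x| <= 1) -> pintg (hull T)° f.
Proof.
move=> hT mf fb; apply: (pintg_bounded (c := 1)) => //; first exact: int_lty (mesh_tri hTh hT).
  exact: measfT.
by move=> x /interior_subset; exact: fb.
Qed.

Lemma measf_lam T p : T \in Th -> measf setT (lam T p).
Proof. by move=> hT; apply: aff_measf; apply: aff_lam; exact: (mesh_tri hTh hT). Qed.

Lemma hasI_lam21 T p q : T \in Th -> p \in T -> q \in T -> p != q ->
  hasI (hull T)° (fun x => lam T p x ^+ 2 * lam T q x) (area T / 30).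
Proof.
move=> hT pT qT pq; split; last exact: I2_lam21 (mesh_tri hTh hT) pT qT pq.
apply: pintg_lam => // [|x xT]; first by apply: measfM; [apply: measfX|]; exact: measf_lam.
rewrite normrM normrX -[leRHS]mul1r; apply: ler_pM => //; rewrite ?exprn_ge0//; last exact: lamn.
by rewrite exprn_ile1//; exact: lamn.
Qed.

Lemma hasI_lam2 T p q : T \in Th -> p \in T -> q \in T -> p != q ->
  hasI (hull T)° (fun x => lam T p x * lam T q x) (area T / 12).
Proof.
move=> hT pT qT pq; split; last exact: I2_lam2 (mesh_tri hTh hT) pT qT pq.
apply: pintg_lam => // [|x xT]; first by apply: measfM; exact: measf_lam.
by rewrite normrM -[leRHS]mul1r; apply: ler_pM => //; exact: lamn.
Qed.

Lemma hasI_lam111 T a b c : T \in Th -> T = [fset a; b; c]%fset -> a != b -> a != c -> b != c ->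
  hasI (hull T)° (fun x => lam T a x * lam T b x * lam T c x) (area T / 60).
Proof.
move=> hT TE ab ac bc; split; last exact: I2_lam111 (mesh_tri hTh hT) TE ab ac bc.
apply: pintg_lam => // [|x xT]; first by apply: measfM; [apply: measfM|]; exact: measf_lam.
rewrite !normrM -[leRHS]mul1r; apply: ler_pM => //; rewrite ?mulr_ge0//; last exact: lamn.
by rewrite -[leRHS]mul1r; apply: ler_pM => //; exact: lamn.
Qed.

Lemma dlam_pr T r p q : T \in Th -> p \in T -> q \in T ->
  pr true (q - p) * pr true (dlam T r) + pr false (q - p) * pr false (dlam T r) = (r == q)%:R - (r == p)%:R.
Proof.
move=> hT pT qT; rewrite -(dlam_dot (mesh_tri hTh hT) r pT qT) /dot /pr.
by rewrite mulrC [X in _ + X]mulrC.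
Qed.

(** Products of edge vectors with coordinate gradients are 0, 1 or -1, so the integrand is a cubic
    in the coordinates on an interior cell and a quadratic on a boundary cell, where z is
    constant. *)
Lemma local_coercive C T : T \in Th -> Cok C -> 0 <= area T ->
  area T / 5 * Qf C T <=
  I2 (hull T)° (fun x => wc C T true x * zc C T true x + wc C T false x * zc C T false x).
Proof.
move=> hT [anti Cb] A0; have := labP hT; rewrite /wc /zc /cell3 /Qf.
case lE : (lab T) => [[[a b] c] bd] [TE [ab ac bc] i1 i2 i3].
have [aT bT cT] : [/\ a \in T, b \in T & c \in T] by rewrite TE !inE !eqxx !orbT.
have ba : b != a by rewrite eq_sym.
have ca : c != a by rewrite eq_sym.
have cb : c != b by rewrite eq_sym.
have ua : pr true (b - a) * pr true (dlam T a) + pr false (b - a) * pr false (dlam T a) = -1.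
  by rewrite (dlam_pr a hT aT bT) eqxx (negbTE ab) /= mulr0n mulr1n sub0r.
have ub : pr true (b - a) * pr true (dlam T b) + pr false (b - a) * pr false (dlam T b) = 1.
  by rewrite (dlam_pr b hT aT bT) eqxx (negbTE ba) /= mulr0n mulr1n subr0.
have uc : pr true (b - a) * pr true (dlam T c) + pr false (b - a) * pr false (dlam T c) = 0.
  by rewrite (dlam_pr c hT aT bT) (negbTE ca) (negbTE cb) /= mulr0n subr0.
have va : pr true (c - b) * pr true (dlam T a) + pr false (c - b) * pr false (dlam T a) = 0.
  by rewrite (dlam_pr a hT bT cT) (negbTE ab) (negbTE ac) /= mulr0n subr0.
have vb : pr true (c - b) * pr true (dlam T b) + pr false (c - b) * pr false (dlam T b) = -1.
  by rewrite (dlam_pr b hT bT cT) eqxx (negbTE bc) /= mulr0n mulr1n sub0r.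
have vc : pr true (c - b) * pr true (dlam T c) + pr false (c - b) * pr false (dlam T c) = 1.
  by rewrite (dlam_pr c hT bT cT) eqxx (negbTE cb) /= mulr0n mulr1n subr0.
have ta : pr true (a - c) * pr true (dlam T a) + pr false (a - c) * pr false (dlam T a) = 1.
  by rewrite (dlam_pr a hT cT aT) eqxx (negbTE ac) /= mulr0n mulr1n subr0.
have tb : pr true (a - c) * pr true (dlam T b) + pr false (a - c) * pr false (dlam T b) = 0.
  by rewrite (dlam_pr b hT cT aT) (negbTE ba) (negbTE bc) /= mulr0n subr0.
have tc : pr true (a - c) * pr true (dlam T c) + pr false (a - c) * pr false (dlam T c) = -1.
  by rewrite (dlam_pr c hT cT aT) eqxx (negbTE ca) /= mulr0n mulr1n sub0r.
set x := C a b; set y := C b c; set z := C c a.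
case: bd lE i3 => lE i3; last first.
  have H := hasI_add (mi T) (hasI_add (mi T) (hasI_add (mi T)
    (hasI_add (mi T) (hasI_scale (6 * x ^+ 2) (mi T) (hasI_lam21 hT aT bT ab)) (hasI_scale (6 * x ^+ 2) (mi T) (hasI_lam21 hT bT aT ba)))
    (hasI_add (mi T) (hasI_scale (6 * y ^+ 2) (mi T) (hasI_lam21 hT bT cT bc)) (hasI_scale (6 * y ^+ 2) (mi T) (hasI_lam21 hT cT bT cb))))
    (hasI_add (mi T) (hasI_scale (6 * z ^+ 2) (mi T) (hasI_lam21 hT cT aT ca)) (hasI_scale (6 * z ^+ 2) (mi T) (hasI_lam21 hT aT cT ac))))
    (hasI_scale (- (12 * (x * y + y * z + z * x))) (mi T) (hasI_lam111 hT TE ab ac bc)).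
  apply: le_trans (quad_bound _ _ _ A0) _; rewrite le_eqVlt; apply/orP; left; apply/eqP.
  rewrite -[LHS]H.2; apply: I2_eq => s _ /=; rewrite /wphi /zphi.
  move: (lam T a s) (lam T b s) (lam T c s) ua ub uc va vb vc ta tb tc => la lb lc.
  move: (pr true (b - a)) (pr false (b - a)) (pr true (c - b)) (pr false (c - b)) (pr true (a - c)) (pr false (a - c)) => u1 u2 v1 v2 t1 t2.
  move: (pr true (dlam T a)) (pr false (dlam T a)) (pr true (dlam T b)) (pr false (dlam T b)) (pr true (dlam T c)) (pr false (dlam T c)) => A1 A2 B1 B2 D1 D2.
  move=> ua ub uc va vb vc ta tb tc.
  transitivity (6 * (x * la * lb * (x * (la * (u1 * B1 + u2 * B2) - lb * (u1 * A1 + u2 * A2)) + y * (lb * (u1 * D1 + u2 * D2) - lc * (u1 * B1 + u2 * B2)) + z * (lc * (u1 * A1 + u2 * A2) - la * (u1 * D1 + u2 * D2))) +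
   y * lb * lc * (x * (la * (v1 * B1 + v2 * B2) - lb * (v1 * A1 + v2 * A2)) + y * (lb * (v1 * D1 + v2 * D2) - lc * (v1 * B1 + v2 * B2)) + z * (lc * (v1 * A1 + v2 * A2) - la * (v1 * D1 + v2 * D2))) +
   z * lc * la * (x * (la * (t1 * B1 + t2 * B2) - lb * (t1 * A1 + t2 * A2)) + y * (lb * (t1 * D1 + t2 * D2) - lc * (t1 * B1 + t2 * B2)) + z * (lc * (t1 * A1 + t2 * A2) - la * (t1 * D1 + t2 * D2))))).
    by rewrite ua ub uc va vb vc ta tb tc; ring.
  by ring.
(* On a boundary cell the mixed terms drop out, and the form is |T| / 2 times the sum of two
   squares, more than is needed. *)
have y0 : y = 0 by exact: Cb.
have H := hasI_add (mi T) (hasI_scale (6 * x ^+ 2) (mi T) (hasI_lam2 hT aT bT ab)) (hasI_scale (6 * z ^+ 2) (mi T) (hasI_lam2 hT aT cT ac)).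
apply: (@le_trans _ _ (6 * x ^+ 2 * (area T / 12) + 6 * z ^+ 2 * (area T / 12))).
  rewrite -/y y0 -subr_ge0.
  have -> : 6 * x ^+ 2 * (area T / 12) + 6 * z ^+ 2 * (area T / 12) - area T / 5 * (x ^+ 2 + 0 ^+ 2 + z ^+ 2) =
    area T * (3 / 10) * (x ^+ 2 + z ^+ 2) by field.
  by rewrite !mulr_ge0 ?addr_ge0 ?sqr_ge0 ?divr_ge0.
rewrite le_eqVlt; apply/orP; left; apply/eqP.
rewrite -[LHS]H.2; apply: I2_eq => s _; cbv beta; rewrite /wphi -/y y0 (anti a c) -/z.
move: (lam T a s) (lam T b s) (lam T c s) ua ub uc va vb vc ta tb tc => la lb lc.
move: (pr true (b - a)) (pr false (b - a)) (pr true (c - b)) (pr false (c - b)) (pr true (a - c)) (pr false (a - c)) => u1 u2 v1 v2 t1 t2.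
move: (pr true (dlam T a)) (pr false (dlam T a)) (pr true (dlam T b)) (pr false (dlam T b)) (pr true (dlam T c)) (pr false (dlam T c)) => A1 A2 B1 B2 D1 D2.
move=> ua ub uc va vb vc ta tb tc.
transitivity (6 * (x * la * lb * (x * (u1 * B1 + u2 * B2) - z * (u1 * D1 + u2 * D2)) +
  z * lc * la * (x * (t1 * B1 + t2 * B2) - z * (t1 * D1 + t2 * D2)))).
  by rewrite ub uc tb tc; ring.
by ring.
Qed.

End LocalForms.

(** * Fields with prescribed edge coefficients *)

Section Fields.
Variable R : realType.
Implicit Types (x y p q a b c : plane R) (T : {fset plane R}) (z w : plane R -> plane R).
Variables (Omega : set (plane R)) (Th : {fset {fset plane R}}).
Hypotheses (hOm : polygonal_lipschitz_domain Omega) (hTh : triangulation Omega Th)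
  (h1e : at_most_one_bdry_edge Omega Th).
Implicit Types C : plane R -> plane R -> R.

Let oO : open Omega := dom_open hOm.
Let mO : pmeas Omega := dom_meas hOm.
Let tri_ T (hT : T \in Th) : tri T := mesh_tri hTh hT.
Let labS T (hT : T \in Th) := labP hTh h1e hT.

Lemma weak_deriv_sum I (s : seq I) v (F G : I -> plane R -> R) :
  (forall i, L2 Omega (F i)) -> (forall i, L2 Omega (G i)) -> (forall i, weak_deriv Omega v (F i) (G i)) ->
  weak_deriv Omega v (fun x => \sum_(i <- s) F i x) (fun x => \sum_(i <- s) G i x).
Proof.
have e0 (H : I -> plane R -> R) : (fun x => \sum_(i <- [::]) H i x) = fun=> 0 by apply/funext => x; rewrite big_nil.
have eS (H : I -> plane R -> R) i r : (fun x => \sum_(j <- i :: r) H j x) = (fun x => H i x + \sum_(j <- r) H j x) by apply/funext => x; rewrite big_cons.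
move=> LF LG h; elim: s => [|i s ih]; [rewrite !e0|rewrite !eS].
  move=> phi tp; rewrite !innerE.
  have -> : I2 Omega (fun x => 0 * 'D_v phi x) = 0.
    by transitivity (I2 Omega (fun=> 0)); [apply: I2_eq => x _; rewrite mul0r|exact: I20].
  have -> : I2 Omega (fun x => 0 * phi x) = 0.
    by transitivity (I2 Omega (fun=> 0)); [apply: I2_eq => x _; rewrite mul0r|exact: I20].
  by rewrite oppr0.
by apply: weak_derivD => //; apply: L2_sum.
Qed.

(** The antisymmetric indicator of the oriented edge e. *)
Definition ecoef (e : plane R * plane R) a b : R :=
  ((a == e.1) && (b == e.2))%:R - ((a == e.2) && (b == e.1))%:R.

(** The edge pq occurs among the three edges of the cell in at most one orientation; if p or q is
    not a vertex of the cell, both sides vanish. *)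
Lemma cell3_ecoef T (Phi : plane R -> plane R -> R) p q : T \in Th -> p != q ->
  (forall a b, Phi a b = - Phi b a) -> (forall a b, a \notin T -> Phi a b = 0) ->
  cell3 Omega Th (ecoef (p, q)) T Phi = Phi p q.
Proof.
move=> hT pq anti out; have := labS hT; rewrite /cell3 /ecoef /=.
case: (lab _ _ T) => [[[a b] c] bd] [TE [ab ac bc] _ _ _].
have [aT bT cT] : [/\ a \in T, b \in T & c \in T] by rewrite TE !inE !eqxx !orbT.
have ba : b != a by rewrite eq_sym.
have ca : c != a by rewrite eq_sym.
have cb : c != b by rewrite eq_sym.
have [pT|pT] := boolP (p \in T); last first.
  rewrite (out p q pT).
  have ne s : s \in T -> (s == p) = false by move=> sT; apply/eqP => e; rewrite e (negbTE pT) in sT.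
  by rewrite !ne// !andbF !subrr !mul0r !addr0.
have [qT|qT] := boolP (q \in T); last first.
  rewrite [RHS]anti (out q p qT) oppr0.
  have ne s : s \in T -> (s == q) = false by move=> sT; apply/eqP => e; rewrite e (negbTE qT) in sT.
  by rewrite !ne// !andbF !subrr !mul0r !addr0.
move: pT qT pq; rewrite TE !inE -!orbA => /or3P[] /eqP -> /or3P[] /eqP ->; rewrite ?eqxx//= => _;
rewrite ?eqxx ?(negbTE ab) ?(negbTE ac) ?(negbTE bc) ?(negbTE ba) ?(negbTE ca) ?(negbTE cb) /= ?mulr0n ?mulr1n;
 rewrite ?subrr ?subr0 ?sub0r ?mul0r ?addr0 ?add0r ?mul1r ?mulN1r //; by rewrite [RHS]anti.
Qed.

Lemma cell3_sum I (s : seq I) (c : I -> R) (D : I -> plane R -> plane R -> R) T Phi :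
  cell3 Omega Th (fun a b => \sum_(i <- s) c i * D i a b) T Phi = \sum_(i <- s) c i * cell3 Omega Th (D i) T Phi.
Proof.
rewrite /cell3; case: (lab _ _ T) => [[[a b] k] bd].
by rewrite !mulr_suml -!big_split /=; apply: eq_bigr => i _; ring.
Qed.

Lemma zc_sum I (s : seq I) (c : I -> R) (D : I -> plane R -> plane R -> R) T i x :
  zc Omega Th (fun a b => \sum_(j <- s) c j * D j a b) T i x = \sum_(j <- s) c j * zc Omega Th (D j) T i x.
Proof.
rewrite /zc cell3_sum; case: (lab _ _ T) => [[[a b] k] bd]; case: bd => //.
by rewrite !mulr_suml -big_split /=; apply: eq_bigr => j _; ring.
Qed.

Definition esum_coef n (c : 'I_n -> R) (e : 'I_n -> plane R * plane R) a b : R :=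
  \sum_(i <- index_enum 'I_n) c i * ecoef (e i) a b.

Lemma ecoef_anti e a b : ecoef e a b = - ecoef e b a.
Proof. by rewrite /ecoef opprB andbC [in X in _ - X]andbC. Qed.

Lemma ecoef_bdry e a b : int_edge Omega Th [fset e.1; e.2]%fset -> bdry_edge Omega Th [fset a; b]%fset ->
  ecoef e a b = 0.
Proof.
move=> ie be; rewrite /ecoef.
case: eqP => [ea|_] /=.
  case: eqP => [eb|_] /=; first by rewrite -ea -eb in ie; case: (int_not_bdry ie be).
  case: eqP => [ea'|_] /=; last by rewrite subrr.
  case: eqP => [eb|_] /=; last by rewrite subrr.
  by rewrite -ea' -eb fset2C in ie; case: (int_not_bdry ie be).
case: eqP => [ea'|_] /=; last by rewrite subrr.
case: eqP => [eb|_] /=; last by rewrite subrr.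
by rewrite -ea' -eb fset2C in ie; case: (int_not_bdry ie be).
Qed.

Lemma Cok_ecoef e : int_edge Omega Th [fset e.1; e.2]%fset -> Cok Omega Th (ecoef e).
Proof. by move=> ie; split => a b; [exact: ecoef_anti|exact: ecoef_bdry]. Qed.

Lemma Cok_sum I (s : seq I) (c : I -> R) (D : I -> plane R -> plane R -> R) : (forall i, Cok Omega Th (D i)) ->
  Cok Omega Th (fun a b => \sum_(i <- s) c i * D i a b).
Proof.
move=> h; split => a b.
  by rewrite -sumrN; apply: eq_bigr => i _; rewrite (h i).1 mulrN.
by move=> be; rewrite big1// => i _; rewrite (h i).2// mulr0.
Qed.

Lemma wphi_anti T i x a b : wphi T i x a b = - wphi T i x b a.
Proof. by rewrite /wphi !prE; ring. Qed.
Lemma dphi_anti T e i x a b : dphi T e i x a b = - dphi T e i x b a.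
Proof. by rewrite /dphi !prE; ring. Qed.
Lemma wphi_out T i x a b : T \in Th -> a \notin T -> wphi T i x a b = 0.
Proof.
move=> hT aT; have l0 : lam T a x = 0 by apply: lam_notin => //; exact: tri_.
by rewrite /wphi l0 mul0r mulr0 mul0r.
Qed.
Lemma pr0 i : pr i (0 : plane R) = 0. Proof. by case: i. Qed.
Lemma dphi_out T e i x a b : T \in Th -> a \notin T -> dphi T e i x a b = 0.
Proof.
move=> hT aT; have l0 : lam T a x = 0 by apply: lam_notin => //; exact: tri_.
by rewrite /dphi l0 (dlam_notin hTh hT aT) pr0 mul0r mulr0 addr0 mulr0 mul0r.
Qed.

Lemma pr_sum i I (s : seq I) (F : I -> plane R) : pr i (\sum_(j <- s) F j) = \sum_(j <- s) pr i (F j).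
Proof.
elim: s => [|j s ih]; first by rewrite !big_nil pr0.
by rewrite !big_cons prE ih.
Qed.

Lemma psi_sumE n (c : 'I_n -> R) (e : 'I_n -> plane R * plane R) i x :
  pr i ((\sum_j c j *: psi Omega Th (e j).1 (e j).2) x) =
    \sum_(j <- index_enum 'I_n) (c j * (6 * pr i ((e j).2 - (e j).1))) * hh Omega Th (e j).1 (e j).2 x.
Proof.
have -> : (\sum_j c j *: psi Omega Th (e j).1 (e j).2) x =
    \sum_(j <- index_enum 'I_n) c j *: psi Omega Th (e j).1 (e j).2 x.
  by rewrite fct_sumE.
by rewrite pr_sum; apply: eq_bigr => j _; rewrite prE /psi prE /hh; ring.
Qed.

Lemma psi_sum_wc n (c : 'I_n -> R) (e : 'I_n -> plane R * plane R) T i x :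
  (forall j, int_edge Omega Th [fset (e j).1; (e j).2]%fset) -> T \in Th -> hull T x ->
  pr i ((\sum_j c j *: psi Omega Th (e j).1 (e j).2) x) = wc Omega Th (esum_coef c e) T i x.
Proof.
move=> ie hT xT; rewrite psi_sumE /wc /esum_coef cell3_sum; apply: eq_bigr => j _.
rewrite (hh_lam hTh _ _ hT xT) [e j]surjective_pairing cell3_ecoef//.
+ by rewrite /wphi /=; ring.
+ exact: int_edge_neq (ie j).
+ by move=> a b; exact: wphi_anti.
+ by move=> a b; exact: wphi_out.
Qed.

Lemma Vhb_rep w : Vhb Omega Th w -> exists C, [/\ Cok Omega Th C,
  forall T x i, T \in Th -> hull T x -> pr i (w x) = wc Omega Th C T i x,
  forall i, H1_0 Omega (fun x => pr i (w x)) &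
  forall i, exists g : bool -> plane R -> R, forall e : bool, [/\ L2 Omega (g e),
    weak_deriv Omega (if e then ex R else ey R) (fun x => pr i (w x)) (g e) &
    forall T x, T \in Th -> (hull T)° x -> g e x = dc Omega Th C T e i x]].
Proof.
move=> [n [c [s [hs ->]]]].
have /choice[e he] : forall i : 'I_n, exists e : plane R * plane R,
   int_edge Omega Th [fset e.1; e.2]%fset /\ s i = psi Omega Th e.1 e.2.
  by move=> i; have [a [b [ie se]]] := hs i; exists (a, b).
have ie i := (he i).1.
have -> : \sum_i c i *: s i = \sum_j c j *: psi Omega Th (e j).1 (e j).2.
  by apply: eq_bigr => i _; rewrite (he i).2.
pose G (d : bool) a b := pwz Th (fun T x => lam T a x * pr d (dlam T b) + lam T b x * pr d (dlam T a)).
have hp i : H1_0 Omega (hh Omega Th (e i).1 (e i).2) /\ forall d, L2 Omega (G d (e i).1 (e i).2) /\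
    weak_deriv Omega (if d then ex R else ey R) (hh Omega Th (e i).1 (e i).2) (G d (e i).1 (e i).2).
  have [h1 [h2 h3 h4 h5]] := hh_H10 hOm hTh (ie i).
  by split => // -[]; split.
have wE i : (fun x => pr i ((\sum_j c j *: psi Omega Th (e j).1 (e j).2) x)) =
    (fun x => \sum_(j <- index_enum 'I_n) (c j * (6 * pr i ((e j).2 - (e j).1))) * hh Omega Th (e j).1 (e j).2 x).
  by apply/funext => x; exact: psi_sumE.
exists (esum_coef c e); split.
- by apply: Cok_sum => i; exact: Cok_ecoef.
- by move=> T x i hT xT; exact: psi_sum_wc.
- move=> i; rewrite wE.
  by apply: H1_0_sum => // j; apply: H1_0_scale => //; have [] := hp j.
- move=> i; exists (fun d x => \sum_(j <- index_enum 'I_n) (c j * (6 * pr i ((e j).2 - (e j).1))) * G d (e j).1 (e j).2 x) => d.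
  have LG j : L2 Omega (G d (e j).1 (e j).2) by have [_ /(_ d)[]] := hp j.
  have Lh j : L2 Omega (hh Omega Th (e j).1 (e j).2) by have [[[]]] := hp j.
  have wd j : weak_deriv Omega (if d then ex R else ey R) (hh Omega Th (e j).1 (e j).2) (G d (e j).1 (e j).2) by have [_ /(_ d)[]] := hp j.
  split.
  + by apply: L2_sum => // j _; apply: L2Z.
  + by rewrite wE; apply: weak_deriv_sum => j; [exact: L2Z|exact: L2Z|exact: weak_derivZ].
  + move=> T x hT xT; rewrite /dc /esum_coef cell3_sum; apply: eq_bigr => j _.
    rewrite /G (pwzE hTh _ hT xT) [e j]surjective_pairing cell3_ecoef//.
    * by rewrite /dphi /=; ring.
    * exact: int_edge_neq (ie j).
    * by move=> a b; exact: dphi_anti.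
    * by move=> a b; exact: dphi_out.
Qed.

Lemma aff_hull_bnd T f x : T \in Th -> aff f -> hull T x -> `|f x| <= \sum_(p <- T) `|f p|.
Proof.
move=> hT af xT; rewrite (aff_lamE (tri_ hT) x af).
apply: le_trans (ler_norm_sum _ _ _) _; apply: ler_sum => p _; rewrite normrM.
by rewrite ler_piMl//; exact: (@lam_norm R Omega Th hTh T p x hT xT).
Qed.

Lemma pwz_L2 (F : {fset plane R} -> plane R -> R) : (forall T, T \in Th -> aff (F T)) -> L2 Omega (pwz Th F).
Proof.
move=> aF; have hb T (hT : T \in enum_fset Th) : exists M : R, forall x, hull T x -> `|F T x| <= M.
  by exists (\sum_(p <- T) `|F T p|) => x xT; exact: (aff_hull_bnd hT (aF T hT) xT).
have [M M0 hM] := unif_bound (s := enum_fset Th)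
  (Q := fun T M => forall x, hull T x -> `|F T x| <= M)
  (fun T L L' LL h x xT => le_trans (h x xT) LL) hb.
apply: (L2_bounded (c := M)) => //; first exact: dom_lty.
  by apply: measf_pwz => T hT; apply: aff_measf; exact: aF.
by move=> x _; apply: (pwz_bnd hTh) => // T hT xT; exact: (hM T hT x (interior_subset xT)).
Qed.

Lemma aff_zc C T i : T \in Th -> aff (zc Omega Th C T i).
Proof.
move=> hT; rewrite /zc /cell3; case: (lab _ _ T) => [[[a b] c] bd]; case: bd; first exact: aff_cst.
have z p q : aff (fun x => zphi T i x p q).
  rewrite /zphi; apply: affB; under eq_fun do rewrite mulrC; apply: affZ; apply: aff_lam; exact: tri_.
by apply: affD; [apply: affD|]; apply: affZ.
Qed.

(** The trace on a closed cell; [zg] glues these traces on the open cells. *)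
Definition zT C T x : plane R := (zc Omega Th C T true x, zc Omega Th C T false x).
Definition zg C x : plane R :=
  (pwz Th (fun T => zc Omega Th C T true) x, pwz Th (fun T => zc Omega Th C T false) x).

Lemma zgE C T x : T \in Th -> (hull T)° x -> zg C x = zT C T x.
Proof. by move=> hT xT; rewrite /zg !(pwzE hTh _ hT xT). Qed.

Lemma zT_dot C T x a b : T \in Th -> a \in T -> b \in T ->
  let d s : R := (s == b)%:R - (s == a)%:R in
  dot (zT C T x) (b - a) = let: (p, q, r, bd) := lab Omega Th T in
   if bd then C p q * d q + C p r * d r else
    C p q * (lam T p x * d q - lam T q x * d p) + C q r * (lam T q x * d r - lam T r x * d q) +
    C r p * (lam T r x * d p - lam T p x * d r).
Proof.
move=> hT aT bT d.
have dE s : dot (dlam T s) (b - a) = d s by exact: (dlam_dot (tri_ hT) s aT bT).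
rewrite /zT /zc /cell3; case: (lab _ _ T) => [[[p q] r] bd]; case: bd.
  rewrite -!dE; move: (dlam T q) (dlam T r) => u v; rewrite /dot /pr /=; ring.
rewrite -!dE /zphi; move: (dlam T p) (dlam T q) (dlam T r) => u v w; rewrite /dot /pr /=; ring.
Qed.

(** The value does not depend on the cell from which the edge is seen, which is the tangential
    continuity of the glued field. *)
Lemma zT_tangent C T a b x : Cok Omega Th C -> T \in Th -> a \in T -> b \in T -> a != b ->
  int_edge Omega Th [fset a; b]%fset -> hull [fset a; b]%fset x -> dot (zT C T x) (b - a) = C a b.
Proof.
move=> [anti Cb] hT aT bT ab ie xe.
have eT : ([fset a; b] `<=` T)%fset by apply/fsubsetP => p; rewrite !inE => /orP[] /eqP ->.
have [_ l0] := (hull_lam (tri_ hT) x eT).1 xe.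
have s1 := sum_lam (tri_ hT) x.
rewrite zT_dot//; have := labS hT; case: (lab _ _ T) => [[[p q] r] bd] [TE [pq pr' qr] _ _ i3].
have [pT qT rT] : [/\ p \in T, q \in T & r \in T] by rewrite TE !inE !eqxx !orbT.
have qp : q != p by rewrite eq_sym.
have rp : r != p by rewrite eq_sym.
have rq : r != q by rewrite eq_sym.
have {}s1 : lam T p x + lam T q x + lam T r x = 1 by rewrite -s1 [in RHS]TE big_fset3// -TE.
have e : lam T p x = 1 - lam T q x - lam T r x by rewrite -s1; ring.
have e' : lam T q x = 1 - lam T p x - lam T r x by rewrite -s1; ring.
have L s : s \in T -> s != a -> s != b -> lam T s x = 0.
  by move=> sT sa sb; apply: l0; rewrite // !inE negb_or sa sb.
have aT' : a \in [fset p; q; r]%fset by rewrite -TE.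
have bT' : b \in [fset p; q; r]%fset by rewrite -TE.
move: aT' bT' ab ie L; rewrite !inE -!orbA => /or3P[] /eqP -> /or3P[] /eqP ->; rewrite ?eqxx//= => _ ie L;
 rewrite ?eqxx ?(negbTE pq) ?(negbTE pr') ?(negbTE qr) ?(negbTE qp) ?(negbTE rp) ?(negbTE rq) /= ?mulr0n ?mulr1n.
- have l : lam T r x = 0 by exact: L.
  case: bd i3 => _; first by ring.
  by rewrite e l; ring.
- have l : lam T q x = 0 by exact: L.
  case: bd i3 => _; first by ring.
  by rewrite (anti p r) e l; ring.
- have l : lam T r x = 0 by exact: L.
  case: bd i3 => _; first by rewrite (anti q p); ring.
  by rewrite (anti q p) e l; ring.
- have l : lam T p x = 0 by exact: L.
  case: bd i3 => [be|_]; first by case: (int_not_bdry ie be).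
  by rewrite e' l; ring.
- have l : lam T q x = 0 by exact: L.
  case: bd i3 => _; first by rewrite (anti r p); ring.
  by rewrite e l; ring.
- have l : lam T p x = 0 by exact: L.
  case: bd i3 => [be|_]; first by rewrite fset2C in be; case: (int_not_bdry ie be).
  by rewrite (anti r q) e' l; ring.
Qed.

Lemma line_integral_cst (v : plane R -> plane R) a b (k : R) :
  (forall t, 0 <= t <= 1 -> dot (v (a + t *: (b - a))) (b - a) = k) -> line_integral v a b = k.
Proof.
move=> h; rewrite /line_integral.
transitivity (\int[lebesgue_measure]_(t in `[0%R, 1%R]%classic) k).
  by apply: eq_Rintegral => t; rewrite inE /= in_itv /= => ht; exact: h.
by rewrite Rintegral_cst// /= lebesgue_measure_itv /= lte_fin ltr01 -EFinD /= subr0 mulr1.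
Qed.

Lemma hull_end a b : hull [fset a; b]%fset a.
Proof.
exists (fun p => (p == a)%:R); split => [p _||]; first exact: ler0n.
  rewrite (bigD1_seq a) ?fset_uniq//= ?inE ?eqxx// big1 ?addr0// => p /negbTE ->//.
rewrite (bigD1_seq a) ?fset_uniq//= ?inE ?eqxx// scale1r big1 ?addr0// => p /negbTE ->.
by rewrite scale0r.
Qed.

Lemma zg_Zh0 C : Cok Omega Th C -> Zh0 Omega Th (zg C).
Proof.
move=> okC; exists (zT C).
  split.
  - by split; apply: pwz_L2 => T hT; exact: aff_zc.
  - by move=> T hT x xT; exact: zgE.
  - move=> T hT; split.
    + by apply: (poly_on_aff (g := zc Omega Th C T true)) => //; exact: aff_zc.
    + by apply: (poly_on_aff (g := zc Omega Th C T false)) => //; exact: aff_zc.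
    + have tT := tri_ hT.
      (* With this identity the quadratic terms of a Whitney form multiplied by x cancel, so z . x
         is affine. *)
      have dx s x : dot (dlam T s) x = lam T s x - lam T s 0 by rewrite (lamB tT) subr0.
      rewrite /zT /zc /cell3; case: (lab _ _ T) => [[[p q] r] bd]; case: bd.
        apply: (poly_on_aff (g := fun x => C p q * (lam T q x - lam T q 0) + C p r * (lam T r x - lam T r 0))).
          by move=> x _; rewrite -!dx; move: (dlam T q) (dlam T r) => u v; rewrite /dot /pr /=; ring.
        by apply: affD; apply: affZ; apply: affB; [exact: aff_lam|exact: aff_cst|exact: aff_lam|exact: aff_cst].
      pose Z s t x := lam T t 0 * - lam T s x + lam T s 0 * lam T t x.
      have aZ s t : aff (Z s t).
        apply: affD; apply: affZ; last exact: aff_lam.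
        by under eq_fun do rewrite -mulN1r; apply: affZ; exact: aff_lam.
      apply: (poly_on_aff (g := fun x => C p q * Z p q x + C q r * Z q r x + C r p * Z r p x)).
        move=> x _; rewrite /zphi /Z.
        have k s t : lam T t 0 * - lam T s x + lam T s 0 * lam T t x =
          lam T s x * dot (dlam T t) x - lam T t x * dot (dlam T s) x by rewrite !dx; ring.
        by rewrite !k; move: (dlam T p) (dlam T q) (dlam T r) => u v w; rewrite /dot /pr /=; ring.
      by apply: affD; [apply: affD|]; apply: affZ.
  - move=> T T' a b hT hT' /fsubsetP sub x xe.
    have := sub a; rewrite !inE eqxx => /(_ isT) /andP[aT aT'].
    have := sub b; rewrite !inE eqxx orbT => /(_ isT) /andP[bT bT'].
    have [->|ab] := eqVneq a b; first by rewrite subrr /dot /= !mulr0.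
    case: (edge_or Omega hT aT bT ab) => ie.
      by rewrite !zT_tangent.
    by rewrite (bdry_edge_uniq hOm hTh ab ie hT hT' aT bT aT' bT').
move=> a b c bc /=; set T := [fset a; b; c]%fset.
have hT : T \in Th by case: bc.
have [v hv] : exists v, forall x, zT C T x = v.
  rewrite /zT /zc; case lE : (lab Omega Th T) => [[[p q] r] bd].
  have -> : bd by apply/(lab_bdry hTh h1e hT lE).
  by eexists.
have li p q : line_integral (zT C T) p q = dot v (q - p) by apply: line_integral_cst => t _; rewrite hv.
rewrite !li /dot !planeE; ring.
Qed.

(** For z and z . x both affine along ab, comparing z . x at the midpoint with the mean of its end
    values forces the tangential component to agree at both ends. *)
Lemma midpoint_tangent (A1 A2 B1 B2 a1 a2 b1 b2 : R) :
  (A1 + B1) / 2 * ((a1 + b1) / 2) + (A2 + B2) / 2 * ((a2 + b2) / 2) =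
  ((A1 * a1 + A2 * a2) + (B1 * b1 + B2 * b2)) / 2 ->
  A1 * (b1 - a1) + A2 * (b2 - a2) = B1 * (b1 - a1) + B2 * (b2 - a2).
Proof. by move=> h; lra. Qed.

Lemma aff_mid f a b : aff f -> f (2^-1 *: (a + b)) = (f a + f b) / 2.
Proof. by move=> [al [be [ga h]]]; rewrite !h !planeE; field. Qed.

Lemma aff_seg f a b (t : R) : aff f -> f (a + t *: (b - a)) = (1 - t) * f a + t * f b.
Proof. by move=> [al [be [ga h]]]; rewrite !h !planeE; ring. Qed.

Lemma vec_eq T (u v : plane R) a b c : T \in Th -> T = [fset a; b; c]%fset -> a != b -> a != c -> b != c ->
  dot u (b - a) = dot v (b - a) -> dot u (c - a) = dot v (c - a) -> u = v.
Proof.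
move=> hT TE ab ac bc h1 h2.
have [bT cT] : b \in T /\ c \in T by rewrite TE !inE !eqxx !orbT.
have [a' [a'T a'b a'c _ d]] := tri_labels (tri_ hT) bT cT bc.
have ea : a' = a by move: a'T; rewrite TE !inE (negbTE a'b) (negbTE a'c) !orbF => /eqP.
rewrite ea in d.
have d0 : cross (b - a) (c - a) != 0 by apply/eqP => z; move/eqP: d; rewrite z mulr0 eq_sym oner_eq0.
have k (s t s1 s2 t1 t2 : R) : s * s1 + t * s2 = 0 -> s * t1 + t * t2 = 0 -> s * (s1 * t2 - s2 * t1) = 0 /\ t * (s1 * t2 - s2 * t1) = 0.
  move=> e1 e2; split.
    transitivity ((s * s1 + t * s2) * t2 - (s * t1 + t * t2) * s2); first by ring.
    by rewrite e1 e2; ring.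
  transitivity ((s * t1 + t * t2) * s1 - (s * s1 + t * s2) * t1); first by ring.
  by rewrite e1 e2; ring.
have e1 : (u - v).1 * (b - a).1 + (u - v).2 * (b - a).2 = 0.
  transitivity (dot u (b - a) - dot v (b - a)); last by rewrite h1 subrr.
  by rewrite /dot !planeE; ring.
have e2 : (u - v).1 * (c - a).1 + (u - v).2 * (c - a).2 = 0.
  transitivity (dot u (c - a) - dot v (c - a)); last by rewrite h2 subrr.
  by rewrite /dot !planeE; ring.
have [k1 k2] := k _ _ _ _ _ _ e1 e2.
move/eqP: k1; rewrite mulf_eq0 -/(cross _ _) (negbTE d0) orbF => /eqP k1.
move/eqP: k2; rewrite mulf_eq0 -/(cross _ _) (negbTE d0) orbF => /eqP k2.
apply/eqP; rewrite -subr_eq0; apply/eqP.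
by rewrite [u - v]surjective_pairing k1 k2.
Qed.

End Fields.

(** * Tangential components in Z_h^0 *)

Section Completeness.
Variable R : realType.
Implicit Types (x y p q a b c : plane R) (T : {fset plane R}) (z w : plane R -> plane R).
Variables (Omega : set (plane R)) (Th : {fset {fset plane R}}).
Hypotheses (hOm : polygonal_lipschitz_domain Omega) (hTh : triangulation Omega Th)
  (h1e : at_most_one_bdry_edge Omega Th).
Implicit Types C : plane R -> plane R -> R.

Let tri_ T (hT : T \in Th) : tri T := mesh_tri hTh hT.
Let labS T (hT : T \in Th) := labP hTh h1e hT.

Section Field.
Variables (zt : {fset plane R} -> plane R -> plane R) (z : plane R -> plane R).
Hypothesis hz : nedelec Omega Th zt z.

Lemma nedelec_aff T y : T \in Th -> exists2 g, aff g & forall x, hull T x -> dot (zt T x) y = g x.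
Proof.
move=> hT; have [_ _ /(_ T hT)[/aff_poly_on[g1 ag1 e1] /aff_poly_on[g2 ag2 e2] _] _] := hz.
exists (fun x => y.1 * g1 x + y.2 * g2 x); first by apply: affD; apply: affZ.
by move=> x xT; rewrite -e1// -e2// /dot /= mulrC [in X in _ + X]mulrC.
Qed.

Definition tang T a b : R := dot (zt T a) (b - a).

Lemma hull_seg T a b (t : R) : T \in Th -> a \in T -> b \in T -> 0 <= t <= 1 -> hull T (a + t *: (b - a)).
Proof.
move=> hT aT bT /andP[t0 t1]; apply/(hull_lamT (tri_ hT)) => p pT.
rewrite (aff_seg _ _ _ (aff_lam (tri_ hT) p)) !(lam_vertex (tri_ hT))//.
by rewrite addr_ge0// mulr_ge0// ?subr_ge0// ler0n.
Qed.

Lemma tang_const T a b : T \in Th -> a \in T -> b \in T -> dot (zt T b) (b - a) = tang T a b.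
Proof.
move=> hT aT bT; have [_ _ /(_ T hT)[/aff_poly_on[g1 ag1 e1] /aff_poly_on[g2 ag2 e2] /aff_poly_on[G aG eG]] _] := hz.
have aH := hull_vertex (tri_ hT) aT; have bH := hull_vertex (tri_ hT) bT.
have mH : hull T (2^-1 *: (a + b)).
  have -> : 2^-1 *: (a + b) = a + 2^-1 *: (b - a).
    by rewrite [RHS]surjective_pairing [LHS]surjective_pairing !planeE; congr pair; field.
  by apply: hull_seg => //; rewrite invr_ge0 ler0n /= invf_le1// ler1n.
have := eG _ mH; rewrite (aff_mid _ _ aG) -!eG// /dot.
have f1 x : hull T x -> (zt T x).1 = g1 x by exact: e1.
have f2 x : hull T x -> (zt T x).2 = g2 x by exact: e2.
rewrite (f1 _ mH) (f2 _ mH) (aff_mid _ _ ag1) (aff_mid _ _ ag2) -!f1// -!f2//.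
have -> : (2^-1 *: (a + b)).1 = (a.1 + b.1) / 2 by rewrite !planeE mulrC.
have -> : (2^-1 *: (a + b)).2 = (a.2 + b.2) / 2 by rewrite !planeE mulrC.
move=> /midpoint_tangent h; rewrite /tang /dot !planeE; exact/esym.
Qed.

Lemma tang_anti T a b : T \in Th -> a \in T -> b \in T -> tang T b a = - tang T a b.
Proof. by move=> hT aT bT; rewrite -(tang_const hT aT bT) /tang /dot !planeE; ring. Qed.

Lemma tang_cell T T' a b : T \in Th -> T' \in Th -> a \in T -> b \in T -> a \in T' -> b \in T' ->
  tang T a b = tang T' a b.
Proof.
move=> hT hT' aT bT aT' bT'; have [_ _ _ h4] := hz; apply: (h4 T T' a b hT hT'); last exact: hull_end.
by apply/fsubsetP => p; rewrite !inE => /orP[] /eqP ->; rewrite ?aT ?bT ?aT' ?bT'.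
Qed.

(** At r the component along pq is a difference of the tangential numbers of the two edges at r; so
    the three edge numbers determine the field on the cell. *)
Lemma zt_dot T p q r x : T \in Th -> T = [fset p; q; r]%fset -> p != q -> p != r -> q != r -> hull T x ->
  dot (zt T x) (q - p) = tang T p q * (lam T p x + lam T q x) - lam T r x * (tang T q r + tang T r p).
Proof.
move=> hT TE pq pr' qr xT; have [g ag ge] := nedelec_aff (q - p) hT.
have [pT qT rT] : [/\ p \in T, q \in T & r \in T] by rewrite TE !inE !eqxx !orbT.
rewrite (ge _ xT).
have -> : g x = lam T p x * g p + lam T q x * g q + lam T r x * g r.
  by rewrite (aff_lamE (tri_ hT) x ag) [in LHS]TE big_fset3// -TE.
rewrite -!ge; try exact: hull_vertex (tri_ hT) _.
have -> : dot (zt T r) (q - p) = tang T r q - tang T r p by rewrite /tang /dot !planeE; ring.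
rewrite tang_const// (tang_anti hT qT rT) -/(tang T p q); ring.
Qed.

Lemma tang_line T a b : T \in Th -> a \in T -> b \in T -> line_integral (zt T) a b = tang T a b.
Proof.
move=> hT aT bT; apply: line_integral_cst => t ht; have [g ag ge] := nedelec_aff (b - a) hT.
rewrite (ge _ (hull_seg hT aT bT ht)) (aff_seg _ _ _ ag) -!ge; try exact: hull_vertex (tri_ hT) _.
by rewrite tang_const// -/(tang T a b); ring.
Qed.

(** Read off from any cell that contains the edge; tangential continuity makes the choice
    immaterial. *)
Definition tcoef a b : R :=
  if `[< int_edge Omega Th [fset a; b]%fset >] then
    tang (xget fset0 [set T | T \in Th /\ ([fset a; b] `<=` T)%fset]) a b
  else 0.

Lemma tcoefE T a b : T \in Th -> a \in T -> b \in T -> int_edge Omega Th [fset a; b]%fset -> tcoef a b = tang T a b.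
Proof.
move=> hT aT bT ie; rewrite /tcoef asboolT//; case: xgetP => [T' _ [hT' /fsubsetP sub]|/(_ T)[]].
  by apply: tang_cell => //; apply: sub; rewrite !inE eqxx ?orbT.
by split => //; apply/fsubsetP => p; rewrite !inE => /orP[] /eqP ->.
Qed.

Lemma tcoef_ok : Cok Omega Th tcoef.
Proof.
split => a b; last first.
  by move=> be; rewrite /tcoef asboolF// => ie; exact: int_not_bdry ie be.
have [ie|nie] := pselect (int_edge Omega Th [fset a; b]%fset); last first.
  by rewrite /tcoef !asboolF ?oppr0// fset2C.
have [[_ [T hT /fsubsetP sub]] _] := ie.
have aT : a \in T by apply: sub; rewrite !inE eqxx.
have bT : b \in T by apply: sub; rewrite !inE eqxx orbT.
rewrite (tcoefE hT aT bT ie) (tcoefE hT bT aT); last by rewrite fset2C.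
by rewrite (tang_anti hT aT bT) opprK.
Qed.

End Field.

(** On a boundary cell zero circulation expresses the number of the boundary edge by those of the
    two interior edges; both fields then have the same products with two independent edge
    vectors. *)
Lemma Zh0_rep z : Zh0 Omega Th z -> exists2 C, Cok Omega Th C &
  forall T x, T \in Th -> (hull T)° x -> z x = zT Omega Th C T x.
Proof.
move=> [zt hz circ]; exists (tcoef zt); first exact: tcoef_ok hz.
move=> T x hT xi; have xT := interior_subset xi; have [_ zE _ _] := hz; rewrite (zE T hT x xi).
have s1 := sum_lam (tri_ hT) x.
have := labS hT; case lE : (lab Omega Th T) => [[[p q] r] bd] [TE [pq pr' qr] i1 i2 i3].
have [pT qT rT] : [/\ p \in T, q \in T & r \in T] by rewrite TE !inE !eqxx !orbT.
have qp : q != p by rewrite eq_sym.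
have rp : r != p by rewrite eq_sym.
have rq : r != q by rewrite eq_sym.
have {}s1 : lam T p x + lam T q x + lam T r x = 1 by rewrite -s1 [in RHS]TE big_fset3// -TE.
have C1 : tcoef zt p q = tang zt T p q := tcoefE hz hT pT qT i1.
have C2 : tcoef zt r p = tang zt T r p := tcoefE hz hT rT pT i2.
have C2' : tcoef zt p r = - tang zt T r p by rewrite (tcoef_ok hz).1 C2.
have TE' : T = [fset r; p; q]%fset.
  by apply/fsetP => s; rewrite TE !inE; case: (s == p); case: (s == q); case: (s == r).
have D1 := zt_dot hz hT TE pq pr' qr xT.
have D2 : dot (zt T x) (r - p) = - (tang zt T r p * (lam T r x + lam T p x) - lam T q x * (tang zt T p q + tang zt T q r)).
  by rewrite -(zt_dot hz hT TE' rp rq pq xT) /dot !planeE; ring.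
apply: (vec_eq hTh hT TE pq pr' qr).
  rewrite D1 zT_dot// lE !eqxx (negbTE pq) (negbTE qp) (negbTE rp) (negbTE rq) /= ?mulr0n ?mulr1n C1 C2 C2'.
  case: bd lE i3 => lE i3.
    have bc : bdry_cell Omega Th T by apply/(lab_bdry hTh h1e hT lE).
    have := circ p q r; rewrite -TE => /(_ bc) /=; rewrite !(tang_line hz)// => t0.
    have -> : tang zt T q r + tang zt T r p = - tang zt T p q.
      by apply/eqP; rewrite -subr_eq0 opprK addrC addrA t0.
    rewrite (_ : _ - _ = tang zt T p q * (lam T p x + lam T q x + lam T r x)); last by ring.
    by rewrite s1; ring.
  by rewrite (tcoefE hz hT qT rT i3); ring.
rewrite D2 zT_dot// lE !eqxx (negbTE pr') (negbTE qr) (negbTE qp) (negbTE rp) /= ?mulr0n ?mulr1n C1 C2 C2'.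
case: bd lE i3 => lE i3.
  have bc : bdry_cell Omega Th T by apply/(lab_bdry hTh h1e hT lE).
  have := circ p q r; rewrite -TE => /(_ bc) /=; rewrite !(tang_line hz)// => t0.
  have -> : tang zt T p q + tang zt T q r = - tang zt T r p.
    by apply/eqP; rewrite -subr_eq0 opprK t0.
  rewrite [LHS](_ : _ = - tang zt T r p * (lam T p x + lam T q x + lam T r x)); last by ring.
  by rewrite s1; ring.
by rewrite (tcoefE hz hT qT rT i3); ring.
Qed.

End Completeness.

(** * The projection onto V_h^b *)

Section Projection.
Variable R : realType.
Implicit Types (x y p q a b c : plane R) (T : {fset plane R}) (u z w : plane R -> plane R).
Variables (Omega : set (plane R)) (Th : {fset {fset plane R}}).
Hypotheses (hOm : polygonal_lipschitz_domain Omega) (hTh : triangulation Omega Th)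
  (h1e : at_most_one_bdry_edge Omega Th).
Implicit Types C : plane R -> plane R -> R.

Let oO : open Omega := dom_open hOm.
Let mO : pmeas Omega := dom_meas hOm.
Let mi T : pmeas (hull T)° := pmeas_int (hull T).

Lemma L2v_pr D u i : L2v D u -> L2 D (fun x => pr i (u x)).
Proof. by move=> [h1 h2]; case: i. Qed.

Lemma L2v_pintg u z : L2v Omega u -> L2v Omega z -> forall i, pintg Omega (fun x => pr i (u x) * pr i (z x)).
Proof. by move=> Lu Lz i; apply: L2_pintgM => //; exact: L2v_pr. Qed.

Lemma innervE u z : innerv Omega u z = I2 Omega (fun x => pr true (u x) * pr true (z x) + pr false (u x) * pr false (z x)).
Proof. by []. Qed.

Lemma innervE2 u z : L2v Omega u -> L2v Omega z -> innerv Omega u z =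
  I2 Omega (fun x => pr true (u x) * pr true (z x)) + I2 Omega (fun x => pr false (u x) * pr false (z x)).
Proof. by move=> Lu Lz; rewrite innervE I2D//; exact: L2v_pintg. Qed.

Lemma innerv_cells u z : L2v Omega u -> L2v Omega z -> innerv Omega u z =
  \sum_(T <- Th) I2 (hull T)° (fun x => pr true (u x) * pr true (z x) + pr false (u x) * pr false (z x)).
Proof.
move=> Lu Lz; rewrite innervE (I2_mesh hOm hTh)//.
by apply: pintgD => //; exact: L2v_pintg.
Qed.

Lemma innerv_eq_cells u z z' : L2v Omega u -> L2v Omega z -> L2v Omega z' ->
  (forall T x, T \in Th -> (hull T)° x -> z x = z' x) -> innerv Omega u z = innerv Omega u z'.
Proof.
move=> Lu Lz Lz' e; rewrite !innerv_cells//; rewrite !big_seq; apply: eq_bigr => T hT.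
by apply: I2_eq => x xT; rewrite (e T x hT xT).
Qed.

Lemma innerv_sum I (s : seq I) u (c : I -> R) (z : I -> plane R -> plane R) : L2v Omega u -> (forall i, L2v Omega (z i)) ->
  innerv Omega u (fun x => \sum_(i <- s) c i *: z i x) = \sum_(i <- s) c i * innerv Omega u (z i).
Proof.
move=> Lu Lz.
transitivity (I2 Omega (fun x => \sum_(i <- s) c i * (pr true (u x) * pr true (z i x) + pr false (u x) * pr false (z i x)))).
  rewrite innervE; apply: I2_eq => x _; rewrite !pr_sum !mulr_sumr -big_split.
  apply: eq_bigr => i _.
  transitivity (pr true (u x) * (c i * pr true (z i x)) + pr false (u x) * (c i * pr false (z i x))).
    by rewrite -!prZ.
  by ring.
have ii i : pintg Omega (fun x => pr true (u x) * pr true (z i x) + pr false (u x) * pr false (z i x)).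
  by apply: pintgD => //; exact: L2v_pintg.
rewrite I2_sum//; last by move=> i _; exact: pintgZ.
by apply: eq_bigr => i _; rewrite I2Z.
Qed.

Lemma innervC u z : innerv Omega u z = innerv Omega z u.
Proof. by rewrite !innervE; apply: I2_eq => x _; congr (_ + _); rewrite mulrC. Qed.

Lemma L2v_zg C : L2v Omega (zg Omega Th C).
Proof. by split; apply: (pwz_L2 hOm hTh) => T hT; exact: aff_zc. Qed.

Lemma L2v_Vhb w : Vhb Omega Th w -> L2v Omega w.
Proof.
by move=> /(Vhb_rep hOm hTh h1e)[C [_ _ h _]]; split; [have [[]] := h true|have [[]] := h false].
Qed.

Lemma sqn_cells f (c : {fset plane R} -> R) : L2 Omega f -> (forall T x, T \in Th -> (hull T)° x -> f x ^+ 2 <= c T) ->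
  (forall T, 0 <= c T) -> sqn Omega f <= \sum_(T <- Th) c T * area T.
Proof.
move=> Lf h c0; have fi := L2_pintg_sq mO Lf.
rewrite sqnE// (I2_mesh hOm hTh)// !big_seq; apply: ler_sum => T hT.
have tT := mesh_tri hTh hT; have lt := int_lty tT.
have le : (mu2 R (hull T)° <= mu2 R (hull T))%E.
  by apply: le_measure; rewrite ?inE; [exact: mi|exact: pmeas_closed (closed_hull tT)|exact: interior_subset].
apply: (@le_trans _ _ (I2 (hull T)° (fun=> c T))).
  apply: I2_le => //; [exact: (pintg_cell hOm hTh hT fi)| |by move=> x xT; exact: h].
  by apply: (pintg_bounded (c := c T)) => //; [exact: measf_cst|move=> x _; rewrite ger0_norm].
rewrite I2_cst// ler_wpM2l// /area fine_le//.
- by rewrite ge0_fin_numE.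
- by rewrite ge0_fin_numE//; exact: hull_lty.
Qed.

Section Size.
Variables (h ka : R).
Hypotheses (h0 : 0 < h) (k0 : 0 < ka) (hA : forall T, T \in Th -> ka * h ^+ 2 <= area T)
  (hD : forall T, T \in Th -> diam T <= h).

Definition Stot C : R := \sum_(T <- Th) area T * Qf Omega Th C T.

Lemma area_ge0 T : T \in Th -> 0 <= area T.
Proof. by move=> hT; apply/ltW/(area_gt0 h0 k0 hA hT). Qed.

Lemma coercive C w : Cok Omega Th C -> L2v Omega w ->
  (forall T x i, T \in Th -> hull T x -> pr i (w x) = wc Omega Th C T i x) ->
  Stot C / 5 <= innerv Omega w (zg Omega Th C).
Proof.
move=> okC Lw wE; rewrite innerv_cells//; last exact: L2v_zg.
rewrite /Stot mulr_suml !big_seq; apply: ler_sum => T hT.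
rewrite mulrAC; apply: le_trans (local_coercive hTh h1e hT okC (area_ge0 hT)) _.
rewrite le_eqVlt; apply/orP; left; apply/eqP; apply: I2_eq => x xT.
by rewrite !(wE T)//; try exact: interior_subset; rewrite (zgE hTh C hT xT).
Qed.

Lemma Stot_eq0 C : Stot C <= 0 -> Cok Omega Th C -> forall T x, T \in Th -> (hull T)° x -> zg Omega Th C x = 0.
Proof.
move=> S0 okC T x hT xT; rewrite (zgE hTh C hT xT).
have pos S : S \in enum_fset Th -> 0 <= area S * Qf Omega Th C S.
  by move=> hS; rewrite mulr_ge0 ?Qf_ge0 ?area_ge0.
have : Stot C == 0.
  by rewrite eq_le S0 /Stot big_seq sumr_ge0.
rewrite /Stot big_seq psumr_eq0// => /allP/(_ T hT); rewrite hT /= mulf_eq0.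
rewrite (gt_eqF (area_gt0 h0 k0 hA hT)) /= => /eqP Q0.
have z0 i : zc Omega Th C T i x = 0.
  apply/eqP; rewrite -sqrf_eq0 eq_le sqr_ge0 andbT.
  by have := zc_bnd hTh h1e h0 k0 hA hD i okC.1 hT (interior_subset xT); rewrite Q0 mulr0.
by rewrite /zT !z0.
Qed.

(** Testing with the field z that has the coefficients of w gives [Stot C <= 50 * K * U], since
    coercivity carries the factor 1/5 and z itself is bounded by [Stot C]. The cellwise bounds on w
    and its derivatives then supply 108 h^2 and 6912 / ka^2. *)
Lemma Vhb_stable u w : L2v Omega u -> Vhb Omega Th w ->
  (forall z, Zh0 Omega Th z -> innerv Omega w z = innerv Omega u z) ->
  let U := sqn Omega (fun x => pr true (u x)) + sqn Omega (fun x => pr false (u x)) in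
  forall i, H1_0 Omega (fun x => pr i (w x)) /\ sqn Omega (fun x => pr i (w x)) <= (108 * 50 * 192 / ka ^+ 2) * U /\
   hsq Omega (fun x => pr i (w x)) <= ((108 * 50 * 192 / ka ^+ 2) + 2 * (6912 * 50 * 192 / (ka ^+ 4 * h ^+ 2))) * U.
Proof.
move=> Lu hw eqs U i; have [C [okC wE wH wG]] := Vhb_rep hOm hTh h1e hw.
have Lw := L2v_Vhb hw; have Lz := L2v_zg C.
have K0 : 0 < 192 / (ka * h) ^+ 2 by apply: divr_gt0; [rewrite ltr0n|rewrite exprn_gt0// mulr_gt0].
set K := 192 / (ka * h) ^+ 2 in K0.
have Q0 T : 0 <= Qf Omega Th C T by exact: Qf_ge0.
have zb j : sqn Omega (fun x => pr j (zg Omega Th C x)) <= K * Stot C.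
  rewrite /Stot mulr_sumr; apply: le_trans (sqn_cells (c := fun T => K * Qf Omega Th C T) (L2v_pr j Lz) _ _) _.
  - move=> T x hT xT; rewrite (zgE hTh C hT xT).
    have -> : pr j (zT Omega Th C T x) = zc Omega Th C T j x by case: j.
    exact: (zc_bnd hTh h1e h0 k0 hA hD j okC.1 hT (interior_subset xT)).
  - by move=> T; rewrite mulr_ge0// ltW.
  - by rewrite le_eqVlt; apply/orP; left; apply/eqP; apply: eq_bigr => T _; ring.
(* Weight for Young's inequality: each component of the test field then costs at most [Stot C / 20],
   together half of the left side. *)
have t0 : 0 < 10 * K by rewrite mulr_gt0.
have co : Stot C / 5 <= innerv Omega u (zg Omega Th C).
  by rewrite -eqs; [exact: coercive|exact: zg_Zh0].
have yo j := le_trans (ler_norm _) (sqn_young t0 mO (L2v_pr j Lu) (L2v_pr j Lz)).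
have S1 : Stot C <= 50 * K * U.
  move: co; rewrite innervE2// => co.
  have e1 := le_trans co (lerD (yo true) (yo false)).
  have z1 : (2 * (10 * K))^-1 * sqn Omega (fun x => pr true (zg Omega Th C x)) <= Stot C / 20.
    have -> : Stot C / 20 = (2 * (10 * K))^-1 * (K * Stot C) by field; rewrite gt_eqF.
    by rewrite ler_pM2l// invr_gt0 mulr_gt0.
  have z2 : (2 * (10 * K))^-1 * sqn Omega (fun x => pr false (zg Omega Th C x)) <= Stot C / 20.
    have -> : Stot C / 20 = (2 * (10 * K))^-1 * (K * Stot C) by field; rewrite gt_eqF.
    by rewrite ler_pM2l// invr_gt0 mulr_gt0.
  have {}e1 := le_trans e1 (lerD (lerD (lexx _) z1) (lerD (lexx _) z2)).
  have e2 : Stot C / 10 <= 5 * K * U.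
    have -> : Stot C / 10 = Stot C / 5 - (Stot C / 20 + Stot C / 20) by field.
    rewrite lerBlDr; apply: le_trans e1 _; rewrite le_eqVlt; apply/orP; left; apply/eqP.
    by rewrite /U; field.
  have -> : Stot C = 10 * (Stot C / 10) by field.
  have -> : 50 * K * U = 10 * (5 * K * U) by ring.
  by rewrite ler_pM2l.
have S0 : 0 <= Stot C.
  by rewrite /Stot big_seq sumr_ge0// => T hT; rewrite mulr_ge0 ?area_ge0.
have fin f (B : R) : 0 <= B -> L2 Omega f ->
    (forall T x, T \in Th -> (hull T)° x -> f x ^+ 2 <= B * Qf Omega Th C T) -> sqn Omega f <= B * (50 * K * U).
  move=> B0 Lf fb; apply: (@le_trans _ _ (B * Stot C)); last by rewrite ler_wpM2l.
  rewrite /Stot mulr_sumr; apply: le_trans (sqn_cells (c := fun T => B * Qf Omega Th C T) Lf fb _) _.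
    by move=> T; rewrite mulr_ge0.
  by rewrite le_eqVlt; apply/orP; left; apply/eqP; apply: eq_bigr => T _; ring.
have s1 : sqn Omega (fun x => pr i (w x)) <= (108 * 50 * 192 / ka ^+ 2) * U.
  have -> : (108 * 50 * 192 / ka ^+ 2) * U = 108 * h ^+ 2 * (50 * K * U) by rewrite /K; field; rewrite !gt_eqF.
  have B0 : 0 <= 108 * h ^+ 2 by rewrite mulr_ge0// sqr_ge0.
  apply: (fin _ _ B0 (L2v_pr i Lw)).
  move=> T x hT /interior_subset xT; rewrite (wE T x i hT xT).
  exact: (wc_bnd hTh h1e h0 hD C i hT xT).
split; first exact: wH; split; first exact: s1.
have [g gP] := wG i; have [[Lt wt gt] [Lf wf gf]] := (gP true, gP false).
have gb e : sqn Omega (g e) <= 6912 * 50 * 192 / (ka ^+ 4 * h ^+ 2) * U.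
  have [Lg _ gE] := gP e.
  have -> : 6912 * 50 * 192 / (ka ^+ 4 * h ^+ 2) * U = 6912 / ka ^+ 2 * (50 * K * U) by rewrite /K; field; rewrite !gt_eqF.
  have B0 : 0 <= 6912 / ka ^+ 2 by apply: divr_ge0; [exact: ler0n|exact: sqr_ge0].
  apply: (fin (g e) _ B0 Lg).
  move=> T x hT xT; rewrite (gE T x hT xT).
  exact: (dc_bnd hTh h1e h0 k0 hA hD C e i hT (interior_subset xT)).
rewrite (hsq_weak oO (L2v_pr i Lw) Lt Lf wt wf).
rewrite mulrDl -addrA; apply: lerD => //.
rewrite -mulrA mulr_natl mulr2n; exact: lerD (gb true) (gb false).
Qed.

(** Every interior edge is listed in both orientations. The spanning families are thus doubled,
    whence the halves in [ecoef_sum] and an argument by cokernels, since the matrix is singular in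
    general. *)
Definition iedges : seq (plane R * plane R) :=
  let V := flatten [seq enum_fset T | T <- enum_fset Th] in
  undup [seq e <- [seq (p, q) | p <- V, q <- V] | `[< int_edge Omega Th [fset e.1; e.2]%fset >]].

Lemma iedgesP e : e \in iedges <-> int_edge Omega Th [fset e.1; e.2]%fset.
Proof.
rewrite mem_undup mem_filter; split => [/andP[/asboolP]//|ie].
rewrite asboolT//=; have [[_ [T hT /fsubsetP sub]] _] := ie.
have inV p : p \in T -> p \in flatten [seq enum_fset T | T <- enum_fset Th].
  by move=> pT; apply/flattenP; exists (enum_fset T) => //; apply/mapP; exists T.
apply/allpairsP; exists e; split; last by case: e {ie sub}.
- by apply: inV; apply: sub; rewrite !inE eqxx.
- by apply: inV; apply: sub; rewrite !inE eqxx orbT.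
Qed.

Lemma sum_delta (F : plane R * plane R -> R) (y : plane R * plane R) : y \in iedges ->
  \sum_(e <- iedges) F e * (y == e)%:R = F y.
Proof.
move=> hy; rewrite (bigD1_seq y) ?undup_uniq//= eqxx mulr1 big1 ?addr0// => e ey.
by rewrite eq_sym (negbTE ey) mulr0.
Qed.

Lemma ecoef_sum C a b : C a b = - C b a -> int_edge Omega Th [fset a; b]%fset ->
  \sum_(e <- iedges) (C e.1 e.2 / 2) * ecoef e a b = C a b.
Proof.
move=> anti ie.
have m1 : (a, b) \in iedges by apply/iedgesP.
have m2 : (b, a) \in iedges by apply/iedgesP; rewrite fset2C.
transitivity (\sum_(e <- iedges) ((C e.1 e.2 / 2) * ((a, b) == e)%:R - (C e.1 e.2 / 2) * ((b, a) == e)%:R)).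
  apply: eq_bigr => -[p q] _; rewrite /ecoef /= !xpair_eqE mulrBr; congr (_ - _ * _%:R).
  by rewrite andbC.
rewrite sumrB !sum_delta//= [in RHS](_ : C a b = C a b / 2 + C a b / 2); last by field.
by rewrite {2}anti; field.
Qed.

Lemma zc_int_eq C C' T i x : Cok Omega Th C -> Cok Omega Th C' -> T \in Th ->
  (forall a b, int_edge Omega Th [fset a; b]%fset -> C a b = C' a b) ->
  zc Omega Th C T i x = zc Omega Th C' T i x.
Proof.
move=> okC okC' hT e; have := labP hTh h1e hT; rewrite /zc /cell3.
case: (lab _ _ T) => [[[p q] r] bd] [_ _ i1 i2 i3].
have e1 := e _ _ i1; have e2 := e _ _ i2.
have e2' : C p r = C' p r by rewrite okC.1 okC'.1 e2.
by case: bd i3 => i3; rewrite e1 ?e2 ?e2'// (e _ _ i3).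
Qed.

(** The system is solvable when its right side is killed by the cokernel of the matrix. The
    equations are then extended from the fields [Z i] to all of Z_h^0, which these fields span up to
    null sets. *)
Lemma Pib_ex u : L2v Omega u -> exists w, Vhb Omega Th w /\
    forall z, Zh0 Omega Th z -> innerv Omega w z = innerv Omega u z.
Proof.
move=> Lu; pose n := size iedges; pose e (i : 'I_n) := nth (0, 0) iedges i.
have ie i : int_edge Omega Th [fset (e i).1; (e i).2]%fset by apply/iedgesP; exact: mem_nth.
pose P j := psi Omega Th (e j).1 (e j).2; pose Z i := zg Omega Th (ecoef (e i)).
have LZ i : L2v Omega (Z i) by exact: L2v_zg.
have VP (c : 'I_n -> R) : Vhb Omega Th (\sum_j c j *: P j).
  exists n, c, P; split => // j; exists (e j).1, (e j).2; split => //; exact: ie.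
have LP j : L2v Omega (P j).
  have := L2v_Vhb (VP (fun i => (i == j)%:R)); rewrite (bigD1 j)//= eqxx scale1r big1 ?addr0// => i /negbTE ->.
  by rewrite scale0r.
have sumE (c : 'I_n -> R) : \sum_j c j *: P j = (fun x => \sum_(j <- index_enum 'I_n) c j *: P j x).
  by apply/funext => x; rewrite fct_sumE.
pose A := \matrix_(j < n, i < n) innerv Omega (P j) (Z i).
pose bb := \row_(i < n) innerv Omega u (Z i).
pose Zs (d : 'I_n -> R) x : plane R := \sum_(i <- index_enum 'I_n) d i *: Z i x.
have LZs d : L2v Omega (Zs d).
  have pE i : (fun x => pr i (Zs d x)) = (fun x => \sum_(j <- index_enum 'I_n) d j * pr i (Z j x)).
    by apply/funext => x; rewrite /Zs pr_sum; apply: eq_bigr => j _; rewrite prE.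
  have L i : L2 Omega (fun x => pr i (Zs d x)).
    by rewrite pE; apply: L2_sum => // j _; apply: L2Z => //; exact: L2v_pr.
  by split; [exact: (L true)|exact: (L false)].
have ZsE d T x : T \in Th -> (hull T)° x -> Zs d x = zg Omega Th (esum_coef d e) x.
  move=> hT xT; rewrite (zgE hTh _ hT xT) /zT.
  have k i : pr i (Zs d x) = zc Omega Th (esum_coef d e) T i x.
    rewrite /Zs pr_sum /esum_coef zc_sum; apply: eq_bigr => j _; rewrite prE /Z (zgE hTh _ hT xT).
    by case: i.
  by rewrite [LHS]surjective_pairing -!k.
have : (bb <= A)%MS.
  rewrite submxE; apply/eqP/matrixP => a k; rewrite ord1 {a} !mxE.
  pose d i := cokermx A i k.
  transitivity (innerv Omega u (Zs d)).
    by rewrite (innerv_sum _ _ Lu LZ); apply: eq_bigr => i _; rewrite mxE mulrC.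
  have okd : Cok Omega Th (esum_coef d e) by apply: Cok_sum => j; exact: Cok_ecoef.
  (* Coercivity bounds the energy of a cokernel vector by a combination of the entries that it
     annihilates. *)
  have S0 : Stot (esum_coef d e) <= 0.
    rewrite -(@pmulr_lle0 _ 5^-1) ?invr_gt0//.
    apply: le_trans (coercive okd (L2v_Vhb (VP d)) (fun T x i hT xT => psi_sum_wc hTh h1e d i ie hT xT)) _.
    rewrite -(innerv_eq_cells (L2v_Vhb (VP d)) (LZs d) (L2v_zg _) (ZsE d)).
    rewrite innervC sumE innerv_sum// big1// => j _.
    rewrite innervC innerv_sum//.
    have -> : \sum_(i <- index_enum 'I_n) d i * innerv Omega (P j) (Z i) = (A *m cokermx A) j k.
      by rewrite mxE; apply: eq_bigr => i _; rewrite mxE mulrC.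
    by rewrite mulmx_coker mxE mulr0.
  rewrite innervE; transitivity (I2 Omega (fun=> 0)); last exact: I20.
  rewrite -innervE (innerv_eq_cells Lu (LZs d) (z' := fun=> 0)).
  - by apply: I2_eq => x _; rewrite /dot /= !mulr0 addr0.
  - by split; exact: L20.
  - by move=> T x hT xT; rewrite (ZsE d T x hT xT); exact: (Stot_eq0 S0 okd hT xT).
move=> /submxP[D bE]; pose c j := D 0 j.
exists (\sum_j c j *: P j); split; first exact: VP.
have eqZ i : innerv Omega (\sum_j c j *: P j) (Z i) = innerv Omega u (Z i).
  rewrite innervC sumE innerv_sum//.
  have -> : innerv Omega u (Z i) = bb 0 i by rewrite mxE.
  by rewrite bE mxE; apply: eq_bigr => j _; rewrite mxE innervC.
move=> z hz; have [C okC zE] := Zh0_rep hTh h1e hz.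
have Lz : L2v Omega z by case: hz => zt [].
pose d i := C (e i).1 (e i).2 / 2.
have zZ T x : T \in Th -> (hull T)° x -> z x = Zs d x.
  move=> hT xT; rewrite (ZsE d T x hT xT) (zE T x hT xT) (zgE hTh _ hT xT).
  have okd : Cok Omega Th (esum_coef d e) by apply: Cok_sum => j; exact: Cok_ecoef.
  have ee a b : int_edge Omega Th [fset a; b]%fset -> C a b = esum_coef d e a b.
    move=> iab; rewrite -[LHS](ecoef_sum (okC.1 a b) iab) /esum_coef.
    by rewrite (big_nth (0, 0)) big_mkord.
  by rewrite /zT !(zc_int_eq _ _ okC okd hT ee).
rewrite (innerv_eq_cells (L2v_Vhb (VP c)) Lz (LZs d) zZ) (innerv_eq_cells Lu Lz (LZs d) zZ).
by rewrite !innerv_sum//; [apply: eq_bigr => i _; rewrite eqZ|exact: L2v_Vhb (VP c)].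
Qed.

Lemma PibP u : L2v Omega u -> Vhb Omega Th (Pib Omega Th u) /\
    forall z, Zh0 Omega Th z -> innerv Omega (Pib Omega Th u) z = innerv Omega u z.
Proof. by move=> /Pib_ex[w hw]; rewrite /Pib; case: xgetP => [w' _ //|/(_ w)]. Qed.

End Size.
End Projection.

(** * Overlap of macroelements *)

Section Overlap.
Variable R : realType.
Implicit Types (x y p q a b c : plane R) (T : {fset plane R}) (u z w v : plane R -> plane R).
Variables (Omega : set (plane R)) (Th : {fset {fset plane R}}).
Hypotheses (hOm : polygonal_lipschitz_domain Omega) (hTh : triangulation Omega Th).

Let oO : open Omega := dom_open hOm.
Let mO : pmeas Omega := dom_meas hOm.
Let mi T : pmeas (hull T)° := pmeas_int (hull T).
Let tri_ T (hT : T \in Th) : tri T := mesh_tri hTh hT.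

Lemma I2_area T : tri T -> I2 (hull T)° (fun=> 1) = area T.
Proof.
move=> tT; have [a [b [c [TE _ _ bc _]]]] := tri_abc tT.
have bT : b \in T by rewrite TE !inE eqxx orbT.
have cT : c \in T by rewrite TE !inE eqxx orbT.
have [d [_ _ <- e]] := tri_affm tT bT cT bc.
rewrite (e (fun=> 1)); last first.
- by apply: (pintg_bounded (c := 1)); [exact: pmeas_rtri|exact: rtri_lty|exact: measf_cst|move=> x _; rewrite normr1].
- exact: measf_cst.
- by rewrite mom00 I2_cst ?mul1r//; exact: pmeas_rtri.
Qed.

Lemma mesh_size_ge T : T \in Th -> diam T <= mesh_size Th.
Proof. by move=> hT; apply: (le_bigmax_seq 0 T). Qed.

Lemma macro_size_bnd T : 0 <= macro_size Th T <= mesh_size Th.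
Proof.
rewrite /macro_size bigmax_ge_id /= big_seq_cond; apply: bigmax_le; first exact: bigmax_ge_id.
by move=> T' /andP[hT' _]; exact: mesh_size_ge.
Qed.

Lemma macro_dom T : (macro Th T)° `<=` Omega.
Proof.
rewrite -[X in _ `<=` X](dom_clint hOm); apply: interiorS => x [T' [hT' _] xT'].
exact: hull_cl hTh T' hT' x xT'.
Qed.

Lemma mesh_size_gt0 : 0 < mesh_size Th.
Proof.
have [[_ _ [x Ox]] _ _ _] := hOm.
have [T hT _] := cl_hull hTh (subset_closure Ox).
have [a [b [c [TE ab _ _ _]]]] := tri_abc (tri_ hT).
have aT : a \in T by rewrite TE !inE eqxx.
have bT : b \in T by rewrite TE !inE eqxx orbT.
apply: lt_le_trans (mesh_size_ge hT).
have d0 : 0 <= diam T.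
  apply: le_trans (eucl_diam (tri_ hT) (hull_vertex (tri_ hT) aT) (hull_vertex (tri_ hT) aT)); exact: sqrtr_ge0.
rewrite lt_neqAle d0 andbT; apply/eqP => e.
have := edge_le (tri_ hT) aT bT; rewrite -e expr0n /= /dot -!expr2 => h.
have s1 := sqr_ge0 (b - a).1; have s2 := sqr_ge0 (b - a).2.
have z1 : (b - a).1 == 0.
  by rewrite -sqrf_eq0 eq_le s1 andbT; apply: le_trans h; rewrite lerDl.
have z2 : (b - a).2 == 0.
  by rewrite -sqrf_eq0 eq_le s2 andbT; apply: le_trans h; rewrite lerDr.
move/eqP: ab; apply; apply/esym/eqP; rewrite -subr_eq0; apply/eqP.
by rewrite [b - a]surjective_pairing (eqP z1) (eqP z2).
Qed.

Definition adj T T' : bool := `[< hull T `&` hull T' !=set0 >].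

Section Size.
Variables (h ka : R).
Hypotheses (h0 : 0 < h) (k0 : 0 < ka) (hA : forall T, T \in Th -> ka * h ^+ 2 <= area T)
  (hD : forall T, T \in Th -> diam T <= h).

Lemma overlap T : T \in Th -> \sum_(T' <- Th | adj T' T) 1 <= 16 / ka :> R.
Proof.
move=> hT; pose s := [seq T' <- enum_fset Th | adj T' T].
have [p [q [r [TE _ _ _ _]]]] := tri_abc (tri_ hT).
have pT : hull T p by apply: hull_vertex (tri_ hT) _; rewrite TE !inE eqxx.
have hs : {subset s <= Th} by move=> T'; rewrite mem_filter => /andP[].
pose D := \bigcup_(T' in [set` s]) (hull T')°.
have mD : pmeas D by apply: pmeas_bigcup_seq => T' _; exact: mi.
have near_ T' x y : T' \in Th -> hull T' x -> hull T' y -> `|x - y| <= h.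
  move=> hT' xT yT; apply: le_trans (eucl_norm _ _) _.
  exact: le_trans (eucl_diam (tri_ hT') xT yT) (hD hT').
have Dbox : D `<=` pbox p (2 * h).
  move=> x [T' hT' xT']; rewrite /= mem_filter in hT'; have /andP[/asboolP[y [yT' yT]] hT'2] := hT'.
  rewrite /pbox /=; have -> : x - p = (x - y) + (y - p) by rewrite addrA subrK.
  apply: le_trans (ler_normD _ _) _; rewrite mulr_natl mulr2n; apply: lerD.
    exact: near_ hT'2 (interior_subset xT') yT'.
  exact: near_ hT yT pT.
have h20 : 0 <= 2 * h by rewrite mulr_ge0// ltW.
have i1 E : pmeas E -> E `<=` pbox p (2 * h) -> pintg E (fun=> 1).
  move=> mE EB; apply: (pintg_bounded (c := 1)) => //; [exact: mu2_lty mE EB|exact: measf_cst|].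
  by move=> x _; rewrite normr1.
have le16 : I2 D (fun=> 1) <= 16 * h ^+ 2.
  apply: le_trans (I2_sub mD (@pmeas_pbox _ p (2 * h)) Dbox _ _) _ => //.
    by apply: i1 => //; exact: pmeas_pbox.
  rewrite I2_cst ?mul1r; last exact: pmeas_pbox.
  rewrite mu2_pbox//= exprMn mulrA; have -> : 4 * 2 ^+ 2 = 16 :> R by ring.
  exact: lexx.
have su : uniq s by rewrite filter_uniq// fset_uniq.
have sumE := I2_cells hTh su hs (i1 _ mD Dbox).
have kh : 0 < ka * h ^+ 2 by rewrite mulr_gt0// exprn_gt0.
rewrite -(ler_pM2r kh) mulr_suml.
have -> : 16 / ka * (ka * h ^+ 2) = 16 * h ^+ 2 by field; rewrite gt_eqF.
apply: le_trans le16; rewrite /D sumE -big_filter -/s !big_seq; apply: ler_sum => T' hT'.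
by rewrite mul1r I2_area ?hA//; [exact: hs|exact: tri_ (hs _ hT')].
Qed.

(** After exchanging the two sums, each cell is counted once for every cell it touches. *)
Lemma clement_sum (E G : plane R -> R) (K : R) : 0 <= K -> pintg Omega E -> pintg Omega G ->
  (forall x, 0 <= G x) ->
  (forall T, T \in Th -> I2 (hull T)° E <= K * I2 (macro Th T)° G) ->
  I2 Omega E <= K * (16 / ka) * I2 Omega G.
Proof.
move=> K0 Ei Gi G0 loc; rewrite (I2_mesh hOm hTh Ei) (I2_mesh hOm hTh Gi).
have g0 T : 0 <= I2 (hull T)° G by apply: I2_ge0 => x _; exact: G0.
have mm T : pmeas (macro Th T)° by exact: pmeas_int.
apply: (@le_trans _ _ (\sum_(T <- Th) K * \sum_(T' <- Th | adj T T') I2 (hull T')° G)).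
  rewrite !big_seq; apply: ler_sum => T hT; apply: le_trans (loc T hT) _; rewrite ler_wpM2l//.
  apply: (I2_cover hOm hTh (mm T) (@macro_dom T) Gi) => [x _|x /interior_subset [T' [hT' a] xT']]; first exact: G0.
  by exists T'; split => //; exact/asboolP.
rewrite -mulr_sumr -mulrA ler_wpM2l//.
have -> : \sum_(T <- Th) \sum_(T' <- Th | adj T T') I2 (hull T')° G =
  \sum_(T' <- Th) (\sum_(T <- Th | adj T T') 1) * I2 (hull T')° G.
  under eq_bigr do rewrite big_mkcond; rewrite exchange_big /=; apply: eq_bigr => T' _.
  rewrite -big_mkcond mulr_suml /=.
  by apply: eq_bigr => T _; rewrite mul1r.
rewrite mulr_sumr !big_seq; apply: ler_sum => T hT.
by rewrite ler_wpM2r//; exact: overlap.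
Qed.

End Size.

Definition sqv D v : R := sqn D (fun x => pr true (v x)) + sqn D (fun x => pr false (v x)).
Definition hqv D v : R := hsq D (fun x => pr true (v x)) + hsq D (fun x => pr false (v x)).

Lemma sqv_ge0 D v : 0 <= sqv D v. Proof. by rewrite addr_ge0 ?sqn_ge0. Qed.
Lemma hqv_ge0 D v : 0 <= hqv D v. Proof. by rewrite addr_ge0 ?hsq_ge0. Qed.

Lemma L2normvE D v : L2normv D v = Num.sqrt (sqv D v).
Proof. by rewrite /L2normv /sqv sqn.unlock. Qed.
Lemma H1normvE D v : H1normv D v = Num.sqrt (hqv D v).
Proof. by rewrite /H1normv /hqv hsq.unlock. Qed.

(** A squared norm, seen as a function of the subdomain, is the integral of one fixed density. Open
    subdomains suffice for cells and macroelements, and weak derivatives restrict to them. *)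
Definition energy (D0 : set (plane R)) (Q : set (plane R) -> R) (E : plane R -> R) : Prop :=
  [/\ pintg D0 E, forall x, 0 <= E x & forall D, open D -> D `<=` D0 -> Q D = I2 D E].

Lemma energyD D0 Q Q' E E' : pmeas D0 -> energy D0 Q E -> energy D0 Q' E' ->
  energy D0 (fun D => Q D + Q' D) (fun x => E x + E' x).
Proof.
move=> m0 [i p e] [i' p' e']; split; first exact: pintgD.
  by move=> x; rewrite addr_ge0.
move=> D oD s; have mD := pmeas_open oD; rewrite e// e'// I2D//.
- exact: pintgS mD m0 s i.
- exact: pintgS mD m0 s i'.
Qed.

Lemma sqn_energy f : L2 Omega f -> energy Omega (fun D => sqn D f) (fun x => f x ^+ 2).
Proof.
move=> Lf; split; [exact: L2_pintg_sq|by move=> x; exact: sqr_ge0|].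
by move=> D oD s; rewrite sqnE//; [exact: pmeas_open|exact: L2S (pmeas_open oD) mO s Lf].
Qed.

Lemma hsq_energy f : H1 Omega f -> exists E, energy Omega (fun D => hsq D f) E.
Proof.
move=> hf; have [g1 [g2 [L1 L2' w1 w2 _]]] := H1_ex oO hf; have L0 : L2 Omega f by case: hf.
have [i p e] := energyD mO (energyD mO (sqn_energy L0) (sqn_energy L1)) (sqn_energy L2').
exists (fun x => f x ^+ 2 + g1 x ^+ 2 + g2 x ^+ 2); split => // D oD s.
have mD := pmeas_open oD; rewrite -(e D oD s).
apply: hsq_weak => //; try exact: L2S mD mO s _.
- exact: weak_derivS mD mO s w1.
- exact: weak_derivS mD mO s w2.
Qed.

Lemma sqv_energy v : L2v Omega v -> exists E, energy Omega (fun D => sqv D v) E.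
Proof.
move=> Lv; eexists; apply: energyD mO (sqn_energy _) (sqn_energy _).
  exact: (L2v_pr true Lv).
exact: (L2v_pr false Lv).
Qed.

Lemma hqv_energy v : (forall i, H1 Omega (fun x => pr i (v x))) -> exists E, energy Omega (fun D => hqv D v) E.
Proof.
move=> hv; have [E1 e1] := hsq_energy (hv true); have [E2 e2] := hsq_energy (hv false).
by exists (fun x => E1 x + E2 x); exact: energyD.
Qed.

Lemma sqrt_le_sq (s t k : R) : 0 <= s -> 0 <= t -> Num.sqrt s <= k * Num.sqrt t -> s <= k ^+ 2 * t.
Proof.
move=> s0 t0 le; have := sqrtr_ge0 s => z.
rewrite -(sqr_sqrtr s0) -[in leRHS](sqr_sqrtr t0) -exprMn ler_pXn2r// nnegrE//.
exact: le_trans le.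
Qed.

(** The factor k' may depend on the cell, because the first-order estimate carries the size of the
    macroelement. *)
Lemma clement_energy (Q Q' : set (plane R) -> R) E G (h ka k : R) : 0 < h -> 0 < ka ->
  (forall T, T \in Th -> ka * h ^+ 2 <= area T) -> (forall T, T \in Th -> diam T <= h) ->
  energy Omega Q E -> energy Omega Q' G ->
  (forall T, T \in Th -> exists2 k', k' ^+ 2 <= k ^+ 2 &
     Num.sqrt (Q (hull T)°) <= k' * Num.sqrt (Q' (macro Th T)°)) ->
  Q Omega <= k ^+ 2 * (16 / ka) * Q' Omega.
Proof.
move=> h0 k0 hA hD [Ei E0 QE] [Gi G0 QG] loc.
rewrite QE// QG//; apply: (clement_sum h0 k0 hA hD) => //; first exact: sqr_ge0.
move=> T hT; have sT := int_dom hOm hTh hT; have sM := @macro_dom T.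
have [k' kk le] := loc T hT.
have e1 := QE _ (@open_interior _ (hull T)) sT; have e2 := QG _ (@open_interior _ (macro Th T)) sM.
have n2 : 0 <= I2 (macro Th T)° G by apply: I2_ge0 => x _; exact: G0.
apply: (@le_trans _ _ (k' ^+ 2 * I2 (macro Th T)° G)); last by rewrite ler_wpM2r.
by apply: sqrt_le_sq; rewrite -?e1 -?e2//; [rewrite e1; apply: I2_ge0|rewrite e2].
Qed.

End Overlap.

(** * Stability and commutation of Pi_h *)

Section Assembly.
Variable R : realType.
Implicit Types (q : plane R -> R) (x y p a b c : plane R) (T : {fset plane R}) (u z w v : plane R -> plane R).
Variables (Omega : set (plane R)) (Th : {fset {fset plane R}}).
Hypotheses (hOm : polygonal_lipschitz_domain Omega) (hTh : triangulation Omega Th)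
  (h1e : at_most_one_bdry_edge Omega Th).

Let oO : open Omega := dom_open hOm.
Let mO : pmeas Omega := dom_meas hOm.
Let tri_ T (hT : T \in Th) : tri T := mesh_tri hTh hT.

Lemma cont_affM f g (k : R) : aff f -> aff g -> continuous (fun x : plane R => k * (f x * g x)).
Proof. by move=> /aff_cont cf /aff_cont cg x; apply: cvgM; [exact: cvg_cst|apply: cvgM; [exact: cf|exact: cg]]. Qed.

Lemma Vhb_Lagrange w i : Vhb Omega Th w -> Lagrange 2 Omega Th (fun x => pr i (w x)).
Proof.
move=> /(Vhb_rep hOm hTh h1e)[C [_ wE _ _]].
have tl T p (hT : T \in Th) : aff (lam T p) by exact: aff_lam (tri_ hT) p.
have wcE T : wc Omega Th C T i = let: (a, b, c, _) := lab Omega Th T in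
  fun x => (C a b * 6 * pr i (b - a)) * (lam T a x * lam T b x) + (C b c * 6 * pr i (c - b)) * (lam T b x * lam T c x) +
    (C c a * 6 * pr i (a - c)) * (lam T c x * lam T a x).
  by rewrite /wc /cell3 /wphi; case: (lab _ _ T) => [[[a b] c] bd]; apply/funext => x; ring.
split.
  apply: (cont_pieces hTh (F := fun T => wc Omega Th C T i)) => [T x hT xT|T hT]; first exact: wE.
  rewrite wcE; case: (lab _ _ T) => [[[a b] c] bd] x.
  by apply: cvgD; [apply: cvgD|]; apply: cont_affM; exact: tl.
move=> T hT; apply: (poly_on_eq (f := wc Omega Th C T i)) => [x xT|]; first by rewrite (wE T x i hT xT).
rewrite wcE; case: (lab _ _ T) => [[[a b] c] bd].
by apply: poly_onD; [apply: poly_onD|]; apply: poly_onZ; apply: poly_on_mul; exact: tl.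
Qed.

Lemma Vhb_bdry w x : Vhb Omega Th w -> bdry Omega x -> w x = 0.
Proof.
move=> [n [c [s [hs ->]]]] bx; rewrite fct_sumE big1// => i _.
have [a [b [ie ->]]] := hs i.
have h0 := hh_bdry hOm hTh ie bx.
have -> : (c i *: psi Omega Th a b) x = c i *: ((6 * hh Omega Th a b x) *: (b - a)) by rewrite /psi /hh mulrA.
by rewrite h0 mulr0 scale0r scaler0.
Qed.

Lemma Vh1_pr w i : Vh1 Omega Th w -> Lagrange 1 Omega Th (fun x => pr i (w x)) /\
  forall x, bdry Omega x -> pr i (w x) = 0.
Proof. by move=> [h1 h2 h3]; split; [case: i|move=> x /h3 ->; case: i]. Qed.

Lemma Vh1_pr_H10 w i : Vh1 Omega Th w -> H1_0 Omega (fun x => pr i (w x)).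
Proof. by move=> /(Vh1_pr i)[h1 h2]; exact: (Vh1_H10 hOm hTh h1 h2). Qed.

Lemma LagrangeD k f g : Lagrange k Omega Th f -> Lagrange k Omega Th g -> Lagrange k Omega Th (fun x => f x + g x).
Proof.
move=> [c1 p1] [c2 p2]; split; last by move=> T hT; apply: poly_onD; [exact: p1|exact: p2].
by move=> x; apply: cvgD; [exact: c1|exact: c2].
Qed.

Lemma Vh_add w v : Vhb Omega Th w -> Vh1 Omega Th v -> Vh Omega Th (w + v).
Proof.
move=> hw hv; have L i : Lagrange 2 Omega Th (fun x => pr i (w x) + pr i (v x)).
  apply: LagrangeD; first exact: Vhb_Lagrange.
  have [[c p] _] := Vh1_pr i hv; split => // T hT; exact: poly_on12 (p T hT).
split; [exact: (L true)|exact: (L false)|].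
move=> x bx; have [_ _ v0] := hv.
have -> : (w + v) x = w x + v x by [].
by rewrite (Vhb_bdry hw bx) v0// addr0.
Qed.

Lemma sqnB f g : L2 Omega f -> L2 Omega g -> sqn Omega (fun x => f x - g x) <= 2 * sqn Omega f + 2 * sqn Omega g.
Proof.
move=> Lf Lg; have Lg' : L2 Omega (fun x => -1 * g x) by exact: L2Z.
have := sqnD mO Lf Lg'; rewrite (sqnZ _ mO Lg) sqrrN expr1n mul1r.
by rewrite (sqn_eq (f := fun x => f x + -1 * g x) (g := fun x => f x - g x))// => x _; rewrite mulN1r.
Qed.

Lemma hsqB f g : H1 Omega f -> H1 Omega g -> hsq Omega (fun x => f x - g x) <= 2 * hsq Omega f + 2 * hsq Omega g.
Proof.
move=> Lf Lg; have Lg' : H1 Omega (fun x => -1 * g x) by exact: H1_scale.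
have := hsqD oO Lf Lg'; rewrite (hsqZ oO _ Lg) sqrrN expr1n mul1r.
by rewrite (hsq_eq (f := fun x => f x + -1 * g x) (f' := fun x => f x - g x))// => x _; rewrite mulN1r.
Qed.

Lemma H10_H1 f : H1_0 Omega f -> H1 Omega f. Proof. by case. Qed.
Lemma H10_L2 f : H1_0 Omega f -> L2 Omega f. Proof. by case=> [[]]. Qed.
Lemma H10v_L2v v : H1_0v Omega v -> L2v Omega v.
Proof. by move=> [h1 h2]; split; exact: H10_L2. Qed.
Lemma H10v_pr v i : H1_0v Omega v -> H1_0 Omega (fun x => pr i (v x)).
Proof. by move=> [h1 h2]; case: i; [exact: h1|exact: h2]. Qed.

Lemma prB i u v x : pr i ((u - v) x) = pr i (u x) - pr i (v x).
Proof. by case: i. Qed.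

Lemma H10_sub f g : H1_0 Omega f -> H1_0 Omega g -> H1_0 Omega (fun x => f x - g x).
Proof.
move=> hf hg; have := H1_0_add oO hf (H1_0_scale oO (-1) hg).
by apply: (H1_0_eq mO) => x _; rewrite mulN1r.
Qed.

(** Arithmetic of squared norms: p stands for Pi_h v, w for Pi_h^b (v - R_h v), r for R_h v, U for v
    - R_h v and V for v, with one index per component. *)
Lemma stab_L2 (c1 K U V p1 p2 w1 w2 r1 r2 : R) : 0 <= c1 ->
  p1 <= 2 * w1 + 2 * r1 -> p2 <= 2 * w2 + 2 * r2 -> w1 <= c1 * U -> w2 <= c1 * U ->
  r1 + r2 <= 2 * V + 2 * U -> U <= K * V -> p1 + p2 <= ((4 * c1 + 4) * K + 4) * V.
Proof.
move=> c0 h1 h2 h3 h4 h5 h6.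
have h7 : (4 * c1 + 4) * U <= (4 * c1 + 4) * (K * V).
  by rewrite ler_wpM2l// addr_ge0// mulr_ge0.
have -> : ((4 * c1 + 4) * K + 4) * V = (4 * c1 + 4) * (K * V) + 4 * V by ring.
apply: le_trans (lerD h7 (lexx _)).
have h8 : p1 + p2 <= 2 * (w1 + w2) + 2 * (r1 + r2) by clear - h1 h2; lra.
apply: le_trans h8 _.
have -> : (4 * c1 + 4) * U + 4 * V = 2 * (c1 * U + c1 * U) + 2 * (2 * V + 2 * U) by ring.
by apply: lerD; rewrite ler_pM2l// lerD.
Qed.

(** U enters twice: the plain bound serves c1, and the bound with h^2 compensates the h^-2 that
    accompanies c2. *)
Lemma stab_H1 (c1 c2 K U V e p1 p2 w1 w2 r1 r2 h : R) : 0 <= c1 -> 0 <= c2 -> 0 < h ->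
  p1 <= 2 * w1 + 2 * r1 -> p2 <= 2 * w2 + 2 * r2 ->
  w1 <= (c1 + c2 / h ^+ 2) * U -> w2 <= (c1 + c2 / h ^+ 2) * U ->
  r1 + r2 <= 2 * V + 2 * e -> U <= K * V -> U <= K * h ^+ 2 * V -> e <= K * V ->
  p1 + p2 <= ((4 * (c1 + c2) + 4) * K + 4) * V.
Proof.
move=> c10 c20 h0 h1 h2 h3 h4 h5 h6 h7 h8.
have k : (c1 + c2 / h ^+ 2) * U <= (c1 + c2) * (K * V).
  rewrite !mulrDl; apply: lerD; first by rewrite ler_wpM2l.
  have -> : c2 * (K * V) = c2 / h ^+ 2 * (K * h ^+ 2 * V) by field; rewrite gt_eqF.
  by rewrite ler_wpM2l// divr_ge0// sqr_ge0.
have h9 : p1 + p2 <= 2 * (w1 + w2) + 2 * (r1 + r2) by clear - h1 h2; lra.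
apply: le_trans h9 _.
have -> : ((4 * (c1 + c2) + 4) * K + 4) * V = 2 * ((c1 + c2) * (K * V) + (c1 + c2) * (K * V)) + 2 * (2 * V + 2 * (K * V)) by ring.
apply: lerD; rewrite ler_pM2l//.
  by apply: lerD; [exact: le_trans h3 k|exact: le_trans h4 k].
by apply: le_trans h5 _; rewrite lerD2l ler_pM2l.
Qed.

Definition gradq (q : plane R -> R) x : plane R :=
  (pwz Th (fun T _ => (pgrad q T).1) x, pwz Th (fun T _ => (pgrad q T).2) x).

Lemma gradq_L2v q : L2v Omega (gradq q).
Proof. by have [h1 h2] := pgrad_L2 hOm hTh q. Qed.

Lemma gradq_Zh0 q : Lagrange 1 Omega Th q -> Zh0 Omega Th (gradq q).
Proof.
move=> Lq; exists (fun T _ => pgrad q T); last first.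
  move=> a b c _ /=; move: (pgrad q _) => g.
  have li p r : line_integral (fun=> g) p r = dot g (r - p) by apply: line_integral_cst.
  by rewrite !li /dot !planeE; ring.
split.
- exact: gradq_L2v.
- by move=> T hT x xT; rewrite /gradq !(pwzE hTh _ hT xT) -surjective_pairing.
- move=> T hT; split.
  + by apply: (poly_on_aff (g := fun=> (pgrad q T).1)) => //; exact: aff_cst.
  + by apply: (poly_on_aff (g := fun=> (pgrad q T).2)) => //; exact: aff_cst.
  + apply: (poly_on_aff (g := fun x => dot (pgrad q T) x)) => //.
    by exists (pgrad q T).1, (pgrad q T).2, 0 => x; rewrite /dot addr0.
- move=> T T' a b hT hT' /fsubsetP sub x _.
  have := sub a; rewrite !inE eqxx => /(_ isT) /andP[aT aT'].
  have := sub b; rewrite !inE eqxx orbT => /(_ isT) /andP[bT bT'].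
  rewrite -!(daffB _ _ (aff_interp _ (tri_ _)))//.
  rewrite -!(Lagrange1_interp hTh Lq)//; exact: hull_vertex (tri_ _) _.
Qed.

Lemma wdiv_grad v q : H1_0v Omega v -> Lagrange 1 Omega Th q ->
  inner Omega (wdiv Omega v) q = - innerv Omega v (gradq q).
Proof.
move=> hv Lq; have H1v := H10v_pr true hv; have H2v := H10v_pr false hv.
have [La Lb Lc wa wb] := H1_wD oO (H10_H1 H1v).
have [Ld Le Lf wd we] := H1_wD oO (H10_H1 H2v).
have Lq2 : L2 Omega q by exact: (Lagrange1_L2 hOm hTh Lq).
have i1 := H10_parts hOm hTh true Lq H1v Lb Lc wa wb.
have i2 := H10_parts hOm hTh false Lq H2v Le Lf wd we.
rewrite (innervE2 hOm (H10v_L2v hv) (gradq_L2v q)) opprD.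
rewrite innerE in i1; rewrite innerE in i2; rewrite -[X in _ = X + _]i1 -[X in _ = _ + X]i2.
rewrite innerE -I2D//; [|exact: L2_pintgM|exact: L2_pintgM].
by apply: I2_eq => x _; rewrite /wdiv mulrDl.
Qed.

(** The constant of [stab_H1] with the values from [Vhb_stable], where 2 counts the partial
    derivatives, and with K the Clement constant squared times the overlap 16 / ka. *)
Definition stab_const (ka cc : R) : R :=
  (4 * (108 * 50 * 192 / ka ^+ 2 + 2 * (6912 * 50 * 192 / ka ^+ 4)) + 4) * (cc ^+ 2 * (16 / ka)) + 4.

(** * Estimates and commutation on a single mesh *)

Section Bounds.
Variables (h ka cc : R) (v rv : plane R -> plane R).
Hypotheses (h0 : 0 < h) (k0 : 0 < ka) (hA : forall T, T \in Th -> ka * h ^+ 2 <= area T)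
  (hD : forall T, T \in Th -> diam T <= h).
Hypotheses (Lv : L2v Omega v) (hR : Vh1 Omega Th rv).
Let K : R := cc ^+ 2 * (16 / ka).
Let c1 : R := 108 * 50 * 192 / ka ^+ 2.
Let c2 : R := 2 * (6912 * 50 * 192 / ka ^+ 4).
Let w := Pib Omega Th (v - rv).
Hypothesis c00 : forall T, T \in Th -> L2normv (hull T)° (v - rv) <= cc * L2normv (macro Th T)° v.

Lemma L2v_rv : L2v Omega rv.
Proof. by split; [exact: H10_L2 (Vh1_pr_H10 true hR)|exact: H10_L2 (Vh1_pr_H10 false hR)]. Qed.

Lemma L2v_res : L2v Omega (v - rv).
Proof.
have L i : L2 Omega (fun x => pr i (v x) - pr i (rv x)) by apply: L2B => //; [exact: L2v_pr Lv|exact: L2v_pr L2v_rv].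
by split; [exact: (L true)|exact: (L false)].
Qed.

Lemma w_spec : Vhb Omega Th w /\ forall z, Zh0 Omega Th z -> innerv Omega w z = innerv Omega (v - rv) z.
Proof. exact: (PibP hOm hTh h1e h0 k0 hA hD L2v_res). Qed.

Lemma res_L2 : sqv Omega (v - rv) <= K * sqv Omega v.
Proof.
have [E eE] := sqv_energy hOm L2v_res; have [G eG] := sqv_energy hOm Lv.
apply: (clement_energy hOm hTh h0 k0 hA hD eE eG) => T hT; exists cc => //.
by have := c00 hT; rewrite !L2normvE.
Qed.

Let c10 : 0 <= c1.
Proof. by rewrite /c1; apply: divr_ge0; [rewrite -!natrM ler0n|exact: exprn_ge0 (ltW k0)]. Qed.
Let c20 : 0 <= c2.
Proof. by rewrite /c2; apply: mulr_ge0; [exact: ler0n|apply: divr_ge0]; [rewrite -!natrM ler0n|exact: exprn_ge0 (ltW k0)]. Qed.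

Let M : R := stab_const ka cc.
Lemma stab_const_ge4 : 4 <= stab_const ka cc.
Proof.
rewrite /stab_const -/c1 -/c2 lerDr; apply: mulr_ge0; last by apply: mulr_ge0; [exact: sqr_ge0|apply: divr_ge0; [exact: ler0n|exact: ltW]].
apply: addr_ge0; last exact: ler0n.
by apply: mulr_ge0; [exact: ler0n|exact: addr_ge0].
Qed.
Let K0 : 0 <= K. Proof. by rewrite mulr_ge0 ?sqr_ge0// divr_ge0// ltW. Qed.

Lemma rvE i x : pr i (rv x) = pr i (v x) - pr i ((v - rv) x).
Proof. by rewrite prB opprB addrC subrK. Qed.

Lemma Pi_L2 : L2v Omega (w + rv) /\ sqv Omega (w + rv) <= M * sqv Omega v.
Proof.
have [hw eqs] := w_spec; have Lw := L2v_Vhb hOm hTh h1e hw.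
have L i : L2 Omega (fun x => pr i (w x) + pr i (rv x)) by apply: L2D => //; [exact: L2v_pr Lw|exact: L2v_pr L2v_rv].
split; first by split; [exact: (L true)|exact: (L false)].
have st := Vhb_stable hOm hTh h1e h0 k0 hA hD L2v_res hw eqs.
(* The L^2 argument gives a smaller constant; it is enlarged so that one constant serves both
   norms. *)
apply: (@le_trans _ _ (((4 * c1 + 4) * K + 4) * sqv Omega v)); last first.
  rewrite ler_wpM2r ?sqv_ge0// /M /stab_const -/c1 -/c2 -/K lerD2r ler_wpM2r// lerD2r ler_pM2l// lerDl //.
have pb i : sqn Omega (fun x => pr i ((w + rv) x)) <= 2 * sqn Omega (fun x => pr i (w x)) + 2 * sqn Omega (fun x => pr i (rv x)).
  have := sqnD mO (L2v_pr i Lw) (L2v_pr i L2v_rv).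
  by rewrite (sqn_eq (f := fun x => pr i (w x) + pr i (rv x)) (g := fun x => pr i ((w + rv) x)))// => x _; rewrite -prD.
have rb i : sqn Omega (fun x => pr i (rv x)) <= 2 * sqn Omega (fun x => pr i (v x)) + 2 * sqn Omega (fun x => pr i ((v - rv) x)).
  have := sqnB (L2v_pr i Lv) (L2v_pr i L2v_res).
  by rewrite (sqn_eq (g := fun x => pr i (rv x)))// => x _; rewrite -rvE.
apply: (stab_L2 c10 (pb true) (pb false) (st true).2.1 (st false).2.1 _ res_L2).
apply: le_trans (lerD (rb true) (rb false)) _; rewrite le_eqVlt; apply/orP; left; apply/eqP.
by rewrite /sqv; ring.
Qed.

Lemma Pi_H1 : H1_0v Omega v ->
  (forall T, T \in Th -> L2normv (hull T)° (v - rv) <= cc * macro_size Th T * H1normv (macro Th T)° v) ->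
  (forall T, T \in Th -> H1normv (hull T)° (v - rv) <= cc * H1normv (macro Th T)° v) ->
  mesh_size Th = h ->
  H1_0v Omega (w + rv) /\ hqv Omega (w + rv) <= M * hqv Omega v.
Proof.
move=> hv c01 c11 hh; have [hw eqs] := w_spec.
have st := Vhb_stable hOm hTh h1e h0 k0 hA hD L2v_res hw eqs.
have Hw i : H1_0 Omega (fun x => pr i (w x)) by have [] := st i.
have Hr i := Vh1_pr_H10 i hR; have Hv i := H10v_pr i hv.
have He i : H1_0 Omega (fun x => pr i ((v - rv) x)).
  by apply: (H1_0_eq mO _ (H10_sub (Hv i) (Hr i))) => x _; rewrite prB.
have HP i : H1_0 Omega (fun x => pr i (w x) + pr i (rv x)) by exact: H1_0_add.
split; first by split; [exact: (HP true)|exact: (HP false)].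
have [EL eEL] := sqv_energy hOm L2v_res.
have [EH eEH] := hqv_energy hOm (fun i => H10_H1 (He i)).
have [GH eGH] := hqv_energy hOm (fun i => H10_H1 (Hv i)).
have b1 : sqv Omega (v - rv) <= K * hqv Omega v.
  apply: le_trans res_L2 _; rewrite ler_wpM2l// /sqv /hqv.
  by apply: lerD; apply: (sqn_hsq oO); exact: H10_H1.
(* The first-order Clement estimate: this h^2 cancels against the inverse estimate. *)
have b2 : sqv Omega (v - rv) <= K * h ^+ 2 * hqv Omega v.
  have -> : K * h ^+ 2 * hqv Omega v = (cc * h) ^+ 2 * (16 / ka) * hqv Omega v by rewrite /K; ring.
  apply: (clement_energy hOm hTh h0 k0 hA hD eEL eGH) => T hT; exists (cc * macro_size Th T).
    have /andP[m0 m1] := macro_size_bnd Th T; rewrite hh in m1.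
    by rewrite !exprMn ler_wpM2l ?sqr_ge0// ler_pXn2r ?nnegrE ?(ltW h0).
  by have := c01 T hT; rewrite L2normvE H1normvE.
have b3 : hqv Omega (v - rv) <= K * hqv Omega v.
  apply: (clement_energy hOm hTh h0 k0 hA hD eEH eGH) => T hT; exists cc => //.
  by have := c11 T hT; rewrite !H1normvE.
have pb i : hsq Omega (fun x => pr i ((w + rv) x)) <= 2 * hsq Omega (fun x => pr i (w x)) + 2 * hsq Omega (fun x => pr i (rv x)).
  have := hsqD oO (H10_H1 (Hw i)) (H10_H1 (Hr i)).
  by rewrite (hsq_eq (f := fun x => pr i (w x) + pr i (rv x)) (f' := fun x => pr i ((w + rv) x)))// => x _; rewrite -prD.
have rb i : hsq Omega (fun x => pr i (rv x)) <= 2 * hsq Omega (fun x => pr i (v x)) + 2 * hsq Omega (fun x => pr i ((v - rv) x)).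
  have := hsqB (H10_H1 (Hv i)) (H10_H1 (He i)).
  by rewrite (hsq_eq (f' := fun x => pr i (rv x)))// => x _; rewrite -rvE.
have wb i : hsq Omega (fun x => pr i (w x)) <= (c1 + c2 / h ^+ 2) * sqv Omega (v - rv).
  have -> : c1 + c2 / h ^+ 2 = 108 * 50 * 192 / ka ^+ 2 + 2 * (6912 * 50 * 192 / (ka ^+ 4 * h ^+ 2)).
    by congr (_ + _); rewrite /c2 -[LHS]mulrA; congr (_ * _); rewrite -[LHS]mulrA -invfM.
  exact: (st i).2.2.
rewrite /M /stab_const -/c1 -/c2 -/K.
apply: (stab_H1 c10 c20 h0 (pb true) (pb false) (wb true) (wb false) _ b1 b2 b3).
apply: le_trans (lerD (rb true) (rb false)) _; rewrite le_eqVlt; apply/orP; left; apply/eqP.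
by rewrite /hqv; ring.
Qed.

Lemma Pi_Vh : Vh Omega Th (w + rv).
Proof. by apply: Vh_add => //; have [] := w_spec. Qed.

(** Both sides become pairings with the gradient of q, a field of Z_h^0, against which w has the
    same product as v - R_h v. *)
Lemma Pi_div q : H1_0v Omega v -> Lagrange 1 Omega Th q ->
  H1_0v Omega (w + rv) -> inner Omega (wdiv Omega (w + rv)) q = inner Omega (wdiv Omega v) q.
Proof.
move=> hv Lq hP; have [hw eqs] := w_spec; rewrite !wdiv_grad//; congr (- _).
have Lg := gradq_L2v q; have Lw := L2v_Vhb hOm hTh h1e hw.
have ii u : L2v Omega u -> pintg Omega (fun x => dot (u x) (gradq q x)).
  by move=> Lu; apply: pintgD => //; [exact: (L2v_pintg hOm Lu Lg true)|exact: (L2v_pintg hOm Lu Lg false)].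
have addE u u' : L2v Omega u -> L2v Omega u' -> innerv Omega (u + u') (gradq q) = innerv Omega u (gradq q) + innerv Omega u' (gradq q).
  move=> Lu Lu'; transitivity (I2 Omega (fun x => dot (u x) (gradq q x) + dot (u' x) (gradq q x))).
    by apply: I2_eq => x _; rewrite /dot !mulrDl addrACA.
  by rewrite I2D//; exact: ii.
rewrite addE//; last exact: L2v_rv.
rewrite eqs; last exact: gradq_Zh0.
rewrite -addE ?subrK//; [exact: L2v_res|exact: L2v_rv].
Qed.

End Bounds.
End Assembly.

(** * Uniform bounds for the family of meshes *)

Section NormBounds.
Variable R : realType.
Implicit Types (Omega : set (plane R)) (v w : plane R -> plane R).

Lemma sqrt_mul_le (s t M : R) : 0 <= M -> s <= M * t -> Num.sqrt s <= Num.sqrt M * Num.sqrt t.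
Proof. by move=> M0 le; rewrite -sqrtrM// ler_wsqrtr. Qed.

Lemma L2epsH1normE Omega eps v : L2epsH1norm Omega eps v = Num.sqrt (sqv Omega v + eps ^+ 2 * hqv Omega v).
Proof. by rewrite /L2epsH1norm L2normvE H1normvE !sqr_sqrtr ?sqv_ge0 ?hqv_ge0. Qed.

End NormBounds.

Theorem theorem4p4 (R : realType) (Omega : set (plane R)) (H : set R)
    (Th : R -> {fset {fset plane R}})
    (Rh : R -> (plane R -> plane R) -> plane R -> plane R) :
  polygonal_lipschitz_domain Omega ->
  mesh_family Omega H Th ->
  shape_regular H Th ->
  quasi_uniform H Th ->
  (forall h, H h -> at_most_one_bdry_edge Omega (Th h)) ->
  clement Omega H Th Rh ->
  let Pi h := Pi_h Omega (Th h) (Rh h) in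
  [/\ forall h v, H h -> L2v Omega v -> Vh Omega (Th h) (Pi h v),
      exists2 C : R, 0 < C & forall h, H h ->
        [/\ forall (eps : R) v, 0 < eps <= 1 -> H1_0v Omega v ->
              L2epsH1norm Omega eps (Pi h v) <= C * L2epsH1norm Omega eps v,
            forall v, L2v Omega v ->
              L2v Omega (Pi h v) /\
              L2normv Omega (Pi h v) <= C * L2normv Omega v &
            forall v, H1_0v Omega v ->
              H1_0v Omega (Pi h v) /\
              H1normv Omega (Pi h v) <= C * H1normv Omega v] &
      forall h v q, H h -> H1_0v Omega v -> Qh Omega (Th h) q ->
        inner Omega (wdiv Omega (Pi h v)) q = inner Omega (wdiv Omega v) q].
Proof.
move=> hOm hF [g0 g0p sr] [g1 g1p qu] one [cl1 _ _ [cc clm]] Pi.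
(* Both mesh conditions combined: gamma1^2 h^2 <= diam^2 <= gamma0 |T|. *)
pose ka := g1 ^+ 2 / g0.
have k0 : 0 < ka by rewrite divr_gt0// exprn_gt0.
have tr h : H h -> triangulation Omega (Th h) by move=> /hF[].
have ms h : H h -> mesh_size (Th h) = h by move=> /hF[].
have h0 h (hh : H h) : 0 < h by rewrite -(ms h hh); exact: mesh_size_gt0 hOm (tr h hh).
have hD h (hh : H h) T : T \in Th h -> diam T <= h by move=> hT; rewrite -(ms h hh); exact: mesh_size_ge.
have hA h (hh : H h) T : T \in Th h -> ka * h ^+ 2 <= area T.
  move=> hT; rewrite /ka mulrAC ler_pdivrMr// [leRHS]mulrC -exprMn.
  apply: le_trans (sr h T hh hT); have q1 := qu h T hh hT.
  have p1 : 0 <= g1 * h by rewrite mulr_ge0// ltW// h0.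
  by rewrite ler_pXn2r// nnegrE//; exact: le_trans q1.
have c00 h v (hh : H h) (Lv : L2v Omega v) T : T \in Th h ->
    L2normv (hull T)° (v - Rh h v) <= cc * L2normv (macro (Th h) T)° v.
  by move=> hT; have := clm h T 0%N 0%N v hh hT isT Lv; rewrite /= expr0 mulr1.
have c01 h v (hh : H h) (Lv : H1_0v Omega v) T : T \in Th h ->
    L2normv (hull T)° (v - Rh h v) <= cc * macro_size (Th h) T * H1normv (macro (Th h) T)° v.
  by move=> hT; have := clm h T 0%N 1%N v hh hT isT Lv; rewrite /= expr1.
have c11 h v (hh : H h) (Lv : H1_0v Omega v) T : T \in Th h ->
    H1normv (hull T)° (v - Rh h v) <= cc * H1normv (macro (Th h) T)° v.
  by move=> hT; have := clm h T 1%N 1%N v hh hT isT Lv; rewrite /= subnn expr0 mulr1.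
pose M := stab_const ka cc.
have M4 : 4 <= M := stab_const_ge4 cc k0.
have M0 : 0 < M by apply: lt_le_trans M4.
have P2 h v (hh : H h) (Lv : L2v Omega v) : L2v Omega (Pi h v) /\ sqv Omega (Pi h v) <= M * sqv Omega v.
  exact: (Pi_L2 hOm (tr h hh) (one h hh) (h0 h hh) k0 (hA h hh) (hD h hh) Lv (cl1 h v hh Lv) (c00 h v hh Lv)).
have P1 h v (hh : H h) (hv : H1_0v Omega v) : H1_0v Omega (Pi h v) /\ hqv Omega (Pi h v) <= M * hqv Omega v.
  have Lv := H10v_L2v hv.
  exact: (Pi_H1 hOm (tr h hh) (one h hh) (h0 h hh) k0 (hA h hh) (hD h hh) Lv (cl1 h v hh Lv)
    (c00 h v hh Lv) hv (c01 h v hh hv) (c11 h v hh hv) (ms h hh)).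
split.
- move=> h v hh Lv.
  exact: (Pi_Vh hOm (tr h hh) (one h hh) (h0 h hh) k0 (hA h hh) (hD h hh) Lv (cl1 h v hh Lv)).
- exists (Num.sqrt M); first by rewrite sqrtr_gt0.
  move=> h hh; split.
  (* The squared L^2 and H^1 bounds share the constant M, so adding them with weight eps^2 on the
     second leaves no dependence on eps. *)
  + move=> eps v _ hv; rewrite !L2epsH1normE; apply: sqrt_mul_le; first exact: ltW.
    have [_ b2] := P2 h v hh (H10v_L2v hv); have [_ b1] := P1 h v hh hv.
    have -> : M * (sqv Omega v + eps ^+ 2 * hqv Omega v) = M * sqv Omega v + eps ^+ 2 * (M * hqv Omega v) by ring.
    by rewrite lerD// ler_wpM2l// sqr_ge0.
  + move=> v Lv; have [L b] := P2 h v hh Lv; split => //.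
    by rewrite !L2normvE; apply: sqrt_mul_le => //; exact: ltW.
  + move=> v Lv; have [L b] := P1 h v hh Lv; split => //.
    by rewrite !H1normvE; apply: sqrt_mul_le => //; exact: ltW.
- move=> h v q hh hv [Lq _]; have Lv := H10v_L2v hv; have [hP _] := P1 h v hh hv.
  exact: (Pi_div hOm (tr h hh) (one h hh) (h0 h hh) k0 (hA h hh) (hD h hh) Lv (cl1 h v hh Lv) hv Lq hP).
Qed.
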